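(* Let $1<p<\infty$, $p\ne2$, and let $X$ be a closed infinite-dimensional subspace of $c_p$. Then the following conditions are equivalent: (i) The closed unit ball $B_X$ is compact for the topology $\tau$. (ii) $X$ has property $(m_p)$. (iii) For any $\varepsilon>0$ there is a subspace $X_0$ of $\ell_p(c_p^n)$ such that $d(X,X_0)<1+\varepsilon$.
   Context: $\mathcal{H}$ is a separable (infinite-dimensional) Hilbert space and $c_p$ is the Schatten class of compact operators on $\mathcal{H}$ with $p$-summable singular values, normed by the $\ell_p$-norm of the singular values. $\tau$ is the topology on $c_p$ given by the seminorms $x\mapsto\|x(\xi)\|$ and $x\mapsto\|x^*(\xi)\|$, $\xi\in\mathcal{H}$, where $x^*$ is the Hilbert space adjoint of $x$. $c_p^n$ is the space of $n\times n$-matrices with the $c_p$-norm, and $\ell_p(c_p^n)$ is the $\ell_p$-direct sum of the sequence $(c_p^n)_{n\ge1}$. A separable Banach space $X$ has property $(m_p)$ if $\limsup_n\|x+x_n\|=\left(\|x\|^p+\limsup_n\|x_n\|^p\right)^{1/p}$ whenever $x\in X$ and $x_n\to0$ weakly in $X$. $d(X,Y)=\inf\|T\|\,\|T^{-1}\|$, over all surjective isomorphisms $T:X\to Y$, is the Banach–Mazur distance. *)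

(* Defs.v *)
From HB Require Import structures.
From mathcomp Require Import all_boot all_order all_algebra.
From mathcomp Require Import complex.
From mathcomp Require Import all_classical all_reals all_analysis.

Set Implicit Arguments.
Unset Strict Implicit.
Unset Printing Implicit Defensive.
Import Order.TTheory GRing.Theory Num.Theory.
Import numFieldNormedType.Exports.

Local Open Scope classical_set_scope.
Local Open Scope ring_scope.

(* Hilbert and Banach spaces are taken over the real or over the complex
   numbers; a value of [scalar_kind] selects which.  Norms in MathComp-Analysis
   take values in the scalar field, and [sre] brings them back to [R]. *)
Variant scalar_kind := RealScalars | ComplexScalars.

Definition scalar_field (R : realType) (k : scalar_kind) : numFieldType :=
  match k with
  | RealScalars => R
  | ComplexScalars => R[i]
  end.

Definition sre (R : realType) (k : scalar_kind) : scalar_field R k -> R :=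
  match k with
  | RealScalars => id
  | ComplexScalars => @complex.Re R
  end.

Definition sconj (R : realType) (k : scalar_kind) : scalar_field R k -> scalar_field R k :=
  match k with
  | RealScalars => id
  | ComplexScalars => @conjc R
  end.

(* A normed space is given by a set [X] of vectors of an ambient [V : lmodType]
   together with a norm [N : V -> R] which is only meaningful on [X].  Thus a
   functional or an operator on [X] is a function on [V] of which only the
   restriction to [X] matters. *)
Section NormedSpaces.
Context {R : realType} {k : scalar_kind}.
Local Notation K := (scalar_field R k).
Implicit Types V W : lmodType K.

Definition closed_subspace V (E : set V) (N : V -> R) (X : set V) : Prop :=
  [/\ X `<=` E, X 0,
      forall (a : K) x y, X x -> X y -> X (a *: x + y) &
      forall (u : nat -> V) (x : V), (forall n, X (u n)) -> E x ->
        N (u n - x) @[n --> \oo] --> (0 : R) -> X x].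

Definition finite_dimensional V (X : set V) : Prop :=
  exists (n : nat) (e : 'I_n -> V), forall x, X x ->
    exists c : 'I_n -> K, x = \sum_(i < n) c i *: e i.

Definition infinite_dimensional V (X : set V) : Prop :=
  ~ finite_dimensional X.

Definition closed_unit_ball V (N : V -> R) (X : set V) : set V :=
  [set x | X x /\ N x <= 1].

Definition linear_on V W (X : set V) (T : V -> W) : Prop :=
  forall (a : K) x y, X x -> X y -> T (a *: x + y) = a *: T x + T y.

Definition dual_functional V (N : V -> R) (X : set V) (f : V -> K^o) : Prop :=
  linear_on X f /\ exists C : R, forall x, X x -> sre `|f x| <= C * N x.

Definition weakly_null V (N : V -> R) (X : set V) (u : nat -> V) : Prop :=
  (forall n, X (u n)) /\
  forall f, dual_functional N X f -> f (u n) @[n --> \oo] --> (0 : K^o).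

Definition property_mp V (p : R) (N : V -> R) (X : set V) : Prop :=
  forall (x : V) (u : nat -> V), X x -> weakly_null N X u ->
    (limn_esup (fun n => (N (x + u n))%:E) =
     ((N x)%:E `^ p + limn_esup (fun n => (N (u n))%:E) `^ p) `^ p^-1)%E.

Definition operator_norm V W (N : V -> R) (M : W -> R) (X : set V) (T : V -> W)
    : \bar R :=
  ereal_sup [set (M (T x))%:E | x in closed_unit_ball N X].

(* [T] is an isomorphism of [X] onto [Y], and [S] is its inverse. *)
Definition isomorphism V W (N : V -> R) (M : W -> R) (X : set V) (Y : set W)
    (T : V -> W) (S : W -> V) : Prop :=
  [/\ linear_on X T /\ linear_on Y S,
      (forall x, X x -> Y (T x)) /\ (forall y, Y y -> X (S y)),
      (forall x, X x -> S (T x) = x) /\ (forall y, Y y -> T (S y) = y) &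
      (operator_norm N M X T < +oo)%E /\ (operator_norm M N Y S < +oo)%E].

(* equal to +oo when [X] and [Y] are not isomorphic *)
Definition banach_mazur V W (N : V -> R) (M : W -> R) (X : set V) (Y : set W)
    : \bar R :=
  ereal_inf [set d | exists (T : V -> W) (S : W -> V),
    isomorphism N M X Y T S /\
    d = (operator_norm N M X T * operator_norm M N Y S)%E].

End NormedSpaces.

Section SchattenNorm.
Context {R : realType} {k : scalar_kind}.
Local Notation K := (scalar_field R k).
Context {V : lmodType K}.
Variable dot : V -> V -> K.

Definition adjoint (f : V -> V) : V -> V :=
  xget (fun=> 0) [set g : V -> V | forall u v, dot (f u) v = dot u (g v)].

Definition orthonormal_family n (e : 'I_n -> V) : Prop :=
  forall i j, dot (e i) (e j) = (i == j)%:R.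

(* For a positive compact operator [g] (or a positive operator in finite
   dimension), the [n]-th largest eigenvalue, counted with multiplicity and
   starting from [n = 0].  It is 0 beyond the last positive eigenvalue, since
   the supremum of the empty set is 0. *)
Definition eigenvalue_seq (g : V -> V) (n : nat) : R :=
  sup [set t : R | 0 <= t /\
    exists e : 'I_n.+1 -> V, orthonormal_family e /\
      forall i, exists2 l : K, g (e i) = l *: e i & t <= sre l].

Definition singular_value (f : V -> V) (n : nat) : R :=
  Num.sqrt (eigenvalue_seq (adjoint f \o f) n).

Definition schatten_norm (p : R) (f : V -> V) : \bar R :=
  'N[counting]_(p%:E)[EFin \o singular_value f].

End SchattenNorm.

Section SchattenClass.
Context {R : realType} {k : scalar_kind}.
Local Notation K := (scalar_field R k).
Context {H : completeNormedModType K}.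
Variable dot : {dot H for @sconj R k}.

Definition compact_operator (f : H -> H) : Prop :=
  linear f /\ precompact (f @` [set x | `|x| <= 1]).

Definition schatten_class (p : R) : set (H -> H) :=
  [set f | compact_operator f /\ (schatten_norm dot p f < +oo)%E].

Definition cp_norm (p : R) (f : H -> H) : R := fine (schatten_norm dot p f).

(* The topology generated by the seminorms [x |-> `|x xi|] and
   [x |-> `|x^* xi|]: pointwise convergence of [x] and of its adjoint. *)
Definition tau_topology : topologicalType :=
  initial_topology (fun x : H -> H =>
    ((x, adjoint dot x) : {ptws H -> H} * {ptws H -> H})).

Definition tau_compact (A : set (H -> H)) : Prop :=
  compact (A : set tau_topology).

End SchattenClass.

Section MatrixSequences.
Context (R : realType) (k : scalar_kind).
Local Notation K := (scalar_field R k).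

(* The [n]-th term is a square matrix of size [n.+1], so that the sizes run
   through 1, 2, 3, and so on. *)
Definition mx_seq : Type := forall n : nat, 'M[K]_n.+1.

HB.instance Definition _ := gen_eqMixin mx_seq.
HB.instance Definition _ := gen_choiceMixin mx_seq.

Let zero : mx_seq := fun n => 0.
Let opp (a : mx_seq) : mx_seq := fun n => - a n.
Let add (a b : mx_seq) : mx_seq := fun n => a n + b n.
Let scale (c : K) (a : mx_seq) : mx_seq := fun n => c *: a n.

Let addA : associative add.
Proof. by move=> a b c; apply: functional_extensionality_dep => n; exact: addrA. Qed.
Let addC : commutative add.
Proof. by move=> a b; apply: functional_extensionality_dep => n; exact: addrC. Qed.
Let add0 : left_id zero add.
Proof. by move=> a; apply: functional_extensionality_dep => n; exact: add0r. Qed.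
Let addN : left_inverse zero opp add.
Proof. by move=> a; apply: functional_extensionality_dep => n; exact: addNr. Qed.

HB.instance Definition _ := GRing.isZmodule.Build mx_seq addA addC add0 addN.

Let scaleA c d a : scale c (scale d a) = scale (c * d) a.
Proof. by apply: functional_extensionality_dep => n; exact: scalerA. Qed.
Let scale1 : left_id 1 scale.
Proof. by move=> a; apply: functional_extensionality_dep => n; exact: scale1r. Qed.
Let scaleDr : right_distributive scale +%R.
Proof. by move=> c a b; apply: functional_extensionality_dep => n; exact: scalerDr. Qed.
Let scaleDl a : {morph scale^~ a : c d / c + d}.
Proof. by move=> c d; apply: functional_extensionality_dep => n; exact: scalerDl. Qed.

HB.instance Definition _ :=
  GRing.Zmodule_isLmodule.Build K mx_seq scaleA scale1 scaleDr scaleDl.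

Definition mx_dot n (u v : 'cV[K]_n) : K := \sum_(i < n) u i 0 * sconj (v i 0).

Definition mx_cp_norm (p : R) n (A : 'M[K]_n) : R :=
  fine (schatten_norm (@mx_dot n) p (mulmx A)).

Definition lp_sum_norm (p : R) (a : mx_seq) : \bar R :=
  'N[counting]_(p%:E)[EFin \o (fun n => mx_cp_norm p (a n))].

Definition lp_cpn (p : R) : set mx_seq := [set a | (lp_sum_norm p a < +oo)%E].

Definition lp_cpn_norm (p : R) (a : mx_seq) : R := fine (lp_sum_norm p a).

End MatrixSequences.

(* Main.v *)
Require Import Defs.
From HB Require Import structures.
From mathcomp Require Import all_boot all_order all_algebra.
From mathcomp Require Import complex.
From mathcomp Require Import all_classical all_reals all_analysis.
From mathcomp Require Import ring lra zify.

(** The Schatten norm of [f] is handled variationally, as the least [C] such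
    that [\sum_i |<f e_i, g_i>|^p <= C^p] for all finite Bessel families [e]
    and [g]; pinching inequalities are then direct.

    (i) => (iii).  Let [P_n] be the coordinate projections of an orthonormal
    basis.  Compactness of the unit ball of [X] yields cut points
    [q_0 < q_1 < ...] such that [P_(q_j) x (1 - P_(q_(j+1)))] and its mirror
    image are as small as desired, uniformly on the ball: up to a small error
    every [x] in [X] is block tridiagonal.  Let [W_m] be the projection on the
    window formed by [L] consecutive blocks ending at the [m]-th, and map [x] to
    [L^(-1/p) (W_m x W_m)_m].  Windows with equal [m] modulo [L] are disjoint,
    hence this map is a contraction; averaging over the residues modulo [L], an
    entry of a block tridiagonal matrix is missed for few residues only, so
    that the norm is almost preserved for large [L].

    (iii) => (ii).  In [l_p(c_p^n)] one has
    [N(x + u_n)^p - N(x)^p - N(u_n)^p --> 0] for bounded coordinatewise null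
    [u_n], and a space which is almost isometric, for every [eps], to subspaces
    with this property inherits it.

    (ii) => (i).  A bounded sequence [y_n] of [X] converging to [0] in the weak
    operator topology is weakly null by a Banach-Saks argument, so [(m_p)]
    describes [N(x + t y_n)] and [N(x - t y_n)].  Splitting along a singular
    vector [u] of [x] bounds their [p]-th powers by quantities with a term of
    order [t^2 |y_n u|^2], whereas [(m_p)] gives a term of order [t^p]; as
    [p <> 2] this forces [y_n u --> 0].  Hence [y_n --> 0] strongly, likewise
    for the adjoints, and limits of ultrafilters for the weak operator topology
    are limits for [tau]. *)

Set Implicit Arguments.
Unset Strict Implicit.
Unset Printing Implicit Defensive.
Import Order.TTheory GRing.Theory Num.Theory.
Import numFieldNormedType.Exports.

Local Open Scope classical_set_scope.
Local Open Scope ring_scope.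

(** * Scalars, powers and null sequences *)

(** The exponent 2 is excluded because t^2 and t^p are then the same scale. Everything else is
    organised around t^(p/2), convex for p >= 2 and concave for p <= 2: Jensen's inequality with
    weights coming from Bessel families turns this into opposite inequalities between N(z)^p and the
    sums of |z e_i|^p. Weak convergence in X is reached through means rather than through a
    description of the dual of c_p. Splitting an operator by a projection adds at most r-th powers
    of norms, with r = min(p, 2) > 1, so the sum of m well chosen terms of a bounded sequence with
    vanishing entries grows like m^(1/r). A single partition into diagonal blocks would lose the
    entries next to the block boundaries, whose norm need not be small. With windows taken along all
    residues modulo L, a pair of neighbouring blocks is separated for exactly one residue. Pinching
    then bounds the p-th powers of all these losses together by 2 N(x)^p, against a total weight
    L. *)

Section Scalars.
Variables (R : realType) (k : scalar_kind).
Local Notation K := (scalar_field R k).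

(** With [sre] and [smod], this makes the proof uniform in the two scalar fields: all estimates take
    place in [R], and [sinj] carries real coefficients back to the scalars. *)
Definition sinj : R -> K :=
  match k with
  | RealScalars => id
  | ComplexScalars => fun x => x%:C%C
  end.

Definition smod (z : K) : R := sre `|z|.

Lemma sinj_is_zmod : zmod_morphism sinj.
Proof. by rewrite /sinj; case: (k) => // x y; rewrite rmorphB. Qed.
Lemma sinj_is_monoid : monoid_morphism sinj.
Proof.
rewrite /sinj; case: (k); split => //= x y; exact: rmorphM.
Qed.
HB.instance Definition _ := GRing.isZmodMorphism.Build R K sinj sinj_is_zmod.
HB.instance Definition _ := GRing.isMonoidMorphism.Build R K sinj sinj_is_monoid.

Lemma sre_is_zmod : zmod_morphism (@sre R k).
Proof. by rewrite /sre; case: (k) => //= -[a b] [c d]. Qed.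
HB.instance Definition _ := GRing.isZmodMorphism.Build K R (@sre R k) sre_is_zmod.

Lemma sconj_is_zmod : zmod_morphism (@sconj R k).
Proof. by rewrite /sconj; case: (k) => // x y; rewrite rmorphB. Qed.
Lemma sconj_is_monoid : monoid_morphism (@sconj R k).
Proof.
rewrite /sconj; case: (k); split => //= [|x y]; last by rewrite rmorphM.
by rewrite oppr0.
Qed.
HB.instance Definition _ := GRing.isZmodMorphism.Build K K (@sconj R k) sconj_is_zmod.
HB.instance Definition _ := GRing.isMonoidMorphism.Build K K (@sconj R k) sconj_is_monoid.

Lemma sreZ (a : R) (z : K) : sre (sinj a * z) = a * sre z.
Proof.
by rewrite /sre /sinj; case: (k) z => //= -[x y]; rewrite /real_complex_def; simpc.
Qed.

Lemma sinjK (a : R) : sre (sinj a) = a.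
Proof. by rewrite /sre /sinj; case: (k). Qed.

Lemma sinj_inj : injective sinj. Proof. exact: can_inj sinjK. Qed.

Lemma sconjK : involutive (@sconj R k).
Proof. by rewrite /sconj; case: (k) => // x; rewrite conjcK. Qed.

Lemma sconj_sinj (a : R) : sconj (sinj a) = sinj a.
Proof. by rewrite /sconj /sinj; case: (k) => //=; rewrite oppr0. Qed.

Lemma sre_conj (z : K) : sre (sconj z) = sre z.
Proof. by rewrite /sconj /sre; case: (k) z => //= -[x y]. Qed.

Lemma sinj_ge0 (a : R) : (0 <= sinj a) = (0 <= a).
Proof. by rewrite /sinj; case: (k) => //; rewrite ler0c. Qed.

Lemma sinj_le (a b : R) : (sinj a <= sinj b) = (a <= b).
Proof. by rewrite -subr_ge0 -rmorphB sinj_ge0 subr_ge0. Qed.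

Lemma sinj_lt (a b : R) : (sinj a < sinj b) = (a < b).
Proof. by rewrite !lt_neqAle sinj_le (inj_eq sinj_inj). Qed.

Lemma ge0_sinj (z : K) : 0 <= z -> z = sinj (sre z).
Proof.
rewrite /sre /sinj; case: (k) z => //= -[x y].
by rewrite lecE /= => /andP[/eqP -> _].
Qed.

Lemma normE (z : K) : `|z| = sinj (smod z).
Proof. exact: ge0_sinj. Qed.

Lemma smod_ge0 (z : K) : 0 <= smod z.
Proof. by rewrite -sinj_ge0 -normE. Qed.
Hint Resolve smod_ge0 : core.

Lemma smodM (z w : K) : smod (z * w) = smod z * smod w.
Proof. by apply: sinj_inj; rewrite -normE normrM !normE rmorphM. Qed.

Lemma smodD (z w : K) : smod (z + w) <= smod z + smod w.
Proof. rewrite -sinj_le rmorphD/= -!normE. by apply: ler_normD. Qed.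

Lemma smodN (z : K) : smod (- z) = smod z.
Proof. by apply: sinj_inj; rewrite -!normE normrN. Qed.

Lemma smodB (z w : K) : smod (z - w) <= smod z + smod w.
Proof. by rewrite -(smodN w) smodD. Qed.

Lemma smod0 : smod 0 = 0.
Proof. by apply: sinj_inj; rewrite -normE normr0 rmorph0. Qed.

Lemma smod1 : smod 1 = 1.
Proof. by apply: sinj_inj; rewrite -normE normr1 rmorph1. Qed.

Lemma smod_eq0 (z : K) : (smod z == 0) = (z == 0).
Proof. by rewrite -(inj_eq sinj_inj) -normE rmorph0 normr_eq0. Qed.

Lemma smod_conj (z : K) : smod (sconj z) = smod z.
Proof.
rewrite /smod /sconj /sre; case: (k) z => //= -[x y].
by rewrite /Normc.normc /= sqrrN.
Qed.

Lemma smod_sinj (a : R) : smod (sinj a) = `|a|.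
Proof.
rewrite /smod /sinj /sre; case: (k) => //=.
by rewrite /Normc.normc /= expr0n /= addr0 sqrtr_sqr.
Qed.

Lemma mul_conj (z : K) : z * sconj z = sinj (smod z ^+ 2).
Proof.
rewrite /smod /sconj /sinj /sre; case: (k) z => /= [z|z].
  by rewrite real_normK ?num_real // expr2.
rewrite -sqr_normc normc_def /= rmorphXn //=.
by case: z.
Qed.

Lemma sre_le_smod (z : K) : `|sre z| <= smod z.
Proof.
rewrite /smod /sre; case: (k) z => //= z.
have := normc_ge_Re z; rewrite normc_def lecR /=.
by case: z.
Qed.

Lemma smod_sum I (r : seq I) (P : pred I) (F : I -> K) :
  smod (\sum_(i <- r | P i) F i) <= \sum_(i <- r | P i) smod (F i).
Proof.
elim/big_rec2: _ => [|i y x _ IH]; first by rewrite smod0.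
by apply: le_trans (smodD _ _) _; rewrite lerD2l.
Qed.

(** Rotates the values of a functional to nonnegative reals, after which they cannot cancel in a
    sum. *)
Lemma ex_phase (z : K) : exists c : K, smod c = 1 /\ c * z = sinj (smod z).
Proof.
have [->|z0] := eqVneq z 0.
  by exists 1; rewrite smod1 mulr0 smod0 rmorph0.
have m0 : smod z != 0 by rewrite smod_eq0.
exists (sconj z * sinj (smod z)^-1); split.
  by rewrite smodM smod_conj smod_sinj ger0_norm ?invr_ge0 // divff.
rewrite mulrAC mulrC [sconj z * z]mulrC mul_conj -rmorphM.
by rewrite expr2 mulrA mulVf // mul1r.
Qed.

End Scalars.
#[global] Hint Extern 0 (is_true (0 <= smod _)) => exact: smod_ge0 : core.

Section Powers.
Variable R : realType.
Implicit Types (p q t x y : R).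

Lemma ler_pow p x y : 0 <= p -> 0 <= x -> x <= y -> x `^ p <= y `^ p.
Proof.
move=> p0 x0 xy; apply: ge0_ler_powR => //; rewrite nnegrE //.
exact: le_trans xy.
Qed.

Lemma ltr_pow p x y : 0 < p -> 0 <= x -> x < y -> x `^ p < y `^ p.
Proof.
move=> p0 x0 xy; apply: gt0_ltr_powR => //; rewrite nnegrE //.
exact: le_trans (ltW xy).
Qed.

Lemma pow_le p x y : 0 < p -> 0 <= x -> 0 <= y -> (x `^ p <= y `^ p) = (x <= y).
Proof.
move=> p0 x0 y0; apply/idP/idP => [|xy]; last by apply: ler_pow => //; exact: ltW.
by apply: contraTT; rewrite -!ltNge => yx; apply: ltr_pow.
Qed.

Lemma powK p x : p != 0 -> 0 <= x -> (x `^ p) `^ p^-1 = x.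
Proof. by move=> p0 x0; rewrite -powRrM divff // powRr1. Qed.

Lemma powVK p x : p != 0 -> 0 <= x -> (x `^ p^-1) `^ p = x.
Proof. by move=> p0 x0; rewrite -powRrM mulVf // powRr1. Qed.

Lemma sqr_pow p x : 0 <= x -> (x ^+ 2) `^ (p / 2) = x `^ p.
Proof.
by move=> x0; rewrite -powR_mulrn // -powRrM mulrC divfK.
Qed.

(** Young's inequality for the product of t and 1, with the conjugate exponents q and q / (q -
    1). *)
Lemma bernoulli_ge1 q t : 1 <= q -> 0 <= t -> 1 + q * (t - 1) <= t `^ q.
Proof.
rewrite le_eqVlt => /predU1P[<- t0|q1 t0]; first by rewrite powRr1 // mul1r subrKC.
have q0 : 0 < q by lra.
have q10 : 0 < q - 1 by lra.
have := @conjugate_powR R t 1 q (q / (q - 1)) t0 ler01 q0.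
rewrite powR1 mulr1 => H.
have /H {}H : 0 < q / (q - 1) by rewrite divr_gt0.
have {H} : t <= t `^ q / q + 1 / (q / (q - 1)).
  by apply: H; rewrite invf_div; field; lra.
rewrite -(ler_pM2l q0) mulrDr mulrCA divff ?gt_eqF // mulr1 invf_div mul1r.
by rewrite mulrCA divff ?gt_eqF //; lra.
Qed.

(** Convexity in tangent form: Bernoulli's inequality for t / m, rescaled by m^q. *)
Lemma pow_tangent q (m : R) t : 1 <= q -> 0 < m -> 0 <= t ->
  m `^ q + q * m `^ (q - 1) * (t - m) <= t `^ q.
Proof.
move=> q1 m0 t0.
have mq : m `^ (q - 1) * m = m `^ q by rewrite mulrC mulr_powRB1 ?ltW //; lra.
have -> : t `^ q = m `^ q * (t / m) `^ q.
  by rewrite -powRM ?divr_ge0 ?(ltW m0) // mulrCA divff ?gt_eqF // mulr1.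
have := bernoulli_ge1 q1 (divr_ge0 t0 (ltW m0)).
have mq0 := powR_gt0 q m0.
rewrite -(ler_pM2l mq0); apply: le_trans; rewrite le_eqVlt; apply/orP; left.
by rewrite -mq; apply/eqP; field; rewrite gt_eqF.
Qed.

(** The convex case for the exponent 1 / q, evaluated at t^q. *)
Lemma bernoulli_le1 q t : 0 < q -> q <= 1 -> 0 <= t -> t `^ q <= 1 + q * (t - 1).
Proof.
move=> q0 q1 t0.
have q'1 : 1 <= q^-1 by rewrite invf_ge1.
have := bernoulli_ge1 q'1 (powR_ge0 t q).
rewrite powK ?gt_eqF // -(ler_pM2l q0) mulrDr mulr1 mulrA divff ?gt_eqF //.
by rewrite mul1r; lra.
Qed.

Lemma pow_tangent_le q (m : R) t : 0 < q -> q <= 1 -> 0 < m -> 0 <= t ->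
  t `^ q <= m `^ q + q * m `^ (q - 1) * (t - m).
Proof.
move=> q0 q1 m0 t0.
have mq : m `^ (q - 1) * m = m `^ q by rewrite mulrC mulr_powRB1 ?ltW.
have -> : t `^ q = m `^ q * (t / m) `^ q.
  by rewrite -powRM ?divr_ge0 ?(ltW m0) // mulrCA divff ?gt_eqF // mulr1.
have := bernoulli_le1 q0 q1 (divr_ge0 t0 (ltW m0)).
have mq0 := powR_gt0 q m0.
rewrite -(ler_pM2l mq0) => /le_trans; apply; rewrite le_eqVlt; apply/orP; left.
by rewrite -mq; apply/eqP; field; rewrite gt_eqF.
Qed.

Lemma pow_lip p C x y : 1 <= p -> 0 <= x -> x <= C -> 0 <= y -> y <= C ->
  `|x `^ p - y `^ p| <= p * C `^ (p - 1) * `|x - y|.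
Proof.
move=> p1; wlog xy : x y / x <= y => [H|] x0 xC y0 yC.
  have [xy|/ltW yx] := leP x y; first exact: H.
  by rewrite distrC [X in _ * X]distrC; apply: H.
have p10 : 0 <= p - 1 by lra.
rewrite ler0_norm ?subr_le0 ?ler_pow //; last by lra.
rewrite [X in _ * X]ler0_norm ?subr_le0 // !opprB.
have [y00|yn0] := eqVneq y 0.
  rewrite y00 in xy *.
  have -> : x = 0 by apply/eqP; rewrite eq_le xy.
  by rewrite !subrr mulr0.
have yp : 0 < y by rewrite lt_neqAle eq_sym yn0.
have := pow_tangent p1 yp x0.
have h1 : y `^ (p - 1) <= C `^ (p - 1) by apply: ler_pow.
have : p * y `^ (p - 1) * (y - x) <= p * C `^ (p - 1) * (y - x).
  by rewrite ler_wpM2r ?subr_ge0 // ler_wpM2l //; lra.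
lra.
Qed.

(** The weights may sum to less than 1, since the missing mass can be put at 0, where t^q vanishes.
    Bessel families produce exactly such weights. *)
Lemma jensen_ge1 q I (r : seq I) (w a : I -> R) :
  1 <= q -> (forall i, 0 <= w i) -> (forall i, 0 <= a i) ->
  \sum_(i <- r) w i <= 1 ->
  (\sum_(i <- r) w i * a i) `^ q <= \sum_(i <- r) w i * a i `^ q.
Proof.
move=> q1 w0 a0 w1; set m := \sum_(i <- r) w i * a i.
have S0 : 0 <= \sum_(i <- r) w i * a i `^ q.
  by apply: sumr_ge0 => i _; rewrite mulr_ge0 ?powR_ge0.
have m0 : 0 <= m by apply: sumr_ge0 => i _; rewrite mulr_ge0.
move: m0; rewrite le_eqVlt => /predU1P[<-|m0].
  by rewrite powR0 //; apply/eqP; lra.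
set W := \sum_(i <- r) w i in w1.
have W0 : 0 <= W by apply: sumr_ge0.
(* Each a_i^q is compared with the tangent at the weighted mean [m]. *)
apply: (@le_trans _ _ (\sum_(i <- r) w i * (m `^ q + q * m `^ (q - 1) * (a i - m)))).
  have -> : \sum_(i <- r) w i * (m `^ q + q * m `^ (q - 1) * (a i - m)) =
     W * (m `^ q - q * m `^ (q - 1) * m) + q * m `^ (q - 1) * m.
    transitivity (\sum_(i <- r) (w i * (m `^ q - q * m `^ (q - 1) * m)
      + q * m `^ (q - 1) * (w i * a i))).
      by apply: eq_bigr => i _; ring.
    by rewrite big_split /= -mulr_suml -mulr_sumr.
  have mq : m `^ (q - 1) * m = m `^ q by rewrite mulrC mulr_powRB1 ?ltW //; lra.
  rewrite -!mulrA !mq; have mq0 := powR_gt0 q m0.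
  have : 0 <= (1 - W) * (q - 1) * m `^ q.
    by rewrite !mulr_ge0 ?subr_ge0 // ltW.
  by lra.
by apply: ler_sum => i _; rewrite ler_wpM2l // pow_tangent.
Qed.

Lemma jensen_le1 q I (r : seq I) (w a : I -> R) :
  0 < q -> q <= 1 -> (forall i, 0 <= w i) -> (forall i, 0 <= a i) ->
  \sum_(i <- r) w i <= 1 ->
  \sum_(i <- r) w i * a i `^ q <= (\sum_(i <- r) w i * a i) `^ q.
Proof.
move=> q0 q1 w0 a0 w1.
have S0 : 0 <= \sum_(i <- r) w i * a i `^ q.
  by apply: sumr_ge0 => i _; rewrite mulr_ge0 ?powR_ge0.
have q'1 : 1 <= q^-1 by rewrite invf_ge1.
have := @jensen_ge1 q^-1 I r w (fun i => a i `^ q) q'1 w0 (fun i => powR_ge0 _ _) w1.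
under [X in _ <= X]eq_bigr do rewrite powK ?gt_eqF //.
move=> H; rewrite -[leLHS](@powVK q) ?gt_eqF //.
by apply: ler_pow => //; [exact: ltW | exact: powR_ge0].
Qed.

Lemma pow_mean_ge1 q x y : 1 <= q -> 0 <= x -> 0 <= y ->
  2 * ((x + y) / 2) `^ q <= x `^ q + y `^ q.
Proof.
move=> q1 x0 y0.
have := @jensen_ge1 q _ [:: x; y] (fun=> 2^-1) (fun i : R => `|i|) q1.
rewrite !big_cons !big_nil !addr0 !ger0_norm // => H.
have : (2^-1 * x + 2^-1 * y) `^ q <= 2^-1 * x `^ q + 2^-1 * y `^ q.
  by apply: H => // *; clear; lra.
have -> : 2^-1 * x + 2^-1 * y = (x + y) / 2 by field.
by clear H; lra.
Qed.

Lemma pow_mean_le1 q x y : 0 < q -> q <= 1 -> 0 <= x -> 0 <= y ->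
  x `^ q + y `^ q <= 2 * ((x + y) / 2) `^ q.
Proof.
move=> q0 q1 x0 y0.
have := @jensen_le1 q _ [:: x; y] (fun=> 2^-1) (fun i : R => `|i|) q0 q1.
rewrite !big_cons !big_nil !addr0 !ger0_norm // => H.
have : 2^-1 * x `^ q + 2^-1 * y `^ q <= (2^-1 * x + 2^-1 * y) `^ q.
  by apply: H => // *; clear; lra.
have -> : 2^-1 * x + 2^-1 * y = (x + y) / 2 by field.
by clear H; lra.
Qed.

(** Minkowski's inequality with upper bounds [A] and [B] in place of the norms, so that applications
    can be chained. *)
Lemma sum_pow_mink p I (r : seq I) (a b : I -> R) (A B : R) :
  1 <= p -> (forall i, 0 <= a i) -> (forall i, 0 <= b i) -> 0 <= A -> 0 <= B ->
  \sum_(i <- r) a i `^ p <= A `^ p -> \sum_(i <- r) b i `^ p <= B `^ p ->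
  \sum_(i <- r) (a i + b i) `^ p <= (A + B) `^ p.
Proof.
move=> p1 a0 b0 A0 B0 hA hB.
have pn : p != 0 by apply/eqP; lra.
have p0 : 0 < p by lra.
(* the zero cases are reached by enlarging [A] and [B] *)
suff pos : forall A B : R, 0 < A -> 0 < B ->
    \sum_(i <- r) a i `^ p <= A `^ p -> \sum_(i <- r) b i `^ p <= B `^ p ->
    \sum_(i <- r) (a i + b i) `^ p <= (A + B) `^ p.
  set S := leLHS; have S0 : 0 <= S by apply: sumr_ge0 => i _; exact: powR_ge0.
  rewrite -[S](@powVK p) // pow_le ?powR_ge0 ?addr_ge0 //.
  apply/ler_addgt0Pr => e e0; have e2 : 0 < e / 2 by rewrite divr_gt0.
  have : S <= ((A + e / 2) + (B + e / 2)) `^ p.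
    apply: pos; [lra|lra| |].
    - by apply: (le_trans hA); apply: ler_pow; lra.
    - by apply: (le_trans hB); apply: ler_pow; lra.
  rewrite -[X in X <= _](@powVK p) // pow_le ?powR_ge0 //; last by lra.
  move/le_trans; apply; lra.
move=> {}A {}B {A0 B0 hA hB} A0 B0 hA hB.
have AB : 0 < A + B by lra.
(* (a_i + b_i) / (A + B) is the convex combination of a_i / A and b_i / B with weights t and 1 -
   t. *)
pose t := A / (A + B).
have t0 : 0 <= t by rewrite divr_ge0 // ltW.
have t1 : 1 - t = B / (A + B) by rewrite /t; field; lra.
have t10 : 0 <= 1 - t by rewrite t1 divr_ge0 // ltW.
apply: (@le_trans _ _ (\sum_(i <- r) (A + B) `^ p *
   (t * (a i / A) `^ p + (1 - t) * (b i / B) `^ p))).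
  apply: ler_sum => i _.
  have -> : a i + b i = (A + B) * (t * (a i / A) + (1 - t) * (b i / B)).
    by rewrite t1 /t; field; lra.
  have hA' : 0 <= a i / A by rewrite divr_ge0 // ltW.
  have hB' : 0 <= b i / B by rewrite divr_ge0 // ltW.
  have hs : 0 <= t * (a i / A) + (1 - t) * (b i / B).
    by apply: addr_ge0; apply: mulr_ge0.
  rewrite powRM ?(ltW AB) //.
  rewrite ler_wpM2l ?powR_ge0 //.
  have := @jensen_ge1 p _ [:: true; false] (fun c => if c then t else 1 - t)
     (fun c => if c then a i / A else b i / B) p1.
  rewrite !big_cons !big_nil !addr0; apply => //; [by case|by case|lra].
rewrite -mulr_sumr -[leRHS]mulr1 ler_wpM2l ?powR_ge0 //.
rewrite big_split /= -!mulr_sumr.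
have hs (c : I -> R) (C : R) : (forall i, 0 <= c i) -> 0 < C ->
    \sum_(i <- r) c i `^ p <= C `^ p -> \sum_(i <- r) (c i / C) `^ p <= 1.
  move=> c0 C0 h; have Cp : 0 < C `^ p by exact: powR_gt0.
  rewrite -(ler_pM2l Cp) mulr1 mulr_sumr; apply: le_trans h.
  apply: ler_sum => i _; rewrite -powRM ?divr_ge0 ?(ltW C0) //.
  by rewrite mulrCA divff ?gt_eqF // mulr1.
have := ler_wpM2l t0 (hs _ _ a0 A0 hA); have := ler_wpM2l t10 (hs _ _ b0 B0 hB).
lra.
Qed.

Lemma sum_inj_le (F : nat -> R) (nu : nat -> nat) M n0 :
  (forall i, 0 <= F i) -> injective nu -> (forall m, (m < M)%N -> (nu m < n0)%N) ->
  \sum_(m < M) F (nu m) <= \sum_(n < n0) F n.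
Proof.
move=> F0 nui nub.
have : \sum_(n <- [seq nu m | m <- index_iota 0 M]) F n <= \sum_(0 <= n < n0) F n.
  rewrite [leRHS](bigID (fun n => n \in [seq nu m | m <- index_iota 0 M])) /=.
  have -> : \sum_(n <- [seq nu m | m <- index_iota 0 M]) F n =
            \sum_(0 <= n < n0 | n \in [seq nu m | m <- index_iota 0 M]) F n.
    rewrite -[RHS]big_filter; apply: perm_big; apply: uniq_perm.
    - by rewrite map_inj_uniq // iota_uniq.
    - by rewrite filter_uniq // iota_uniq.
    move=> n; rewrite mem_filter mem_index_iota /=.
    case: (boolP (n \in _)) => //= /mapP[m]; rewrite mem_index_iota /= => mM ->.
    by rewrite nub.
  by rewrite lerDl; apply: sumr_ge0.
by rewrite big_map !big_mkord.
Qed.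

End Powers.

Section Null.
Variable R : realType.
Implicit Types (a b : nat -> R) (p : R).

Definition null a := forall e : R, 0 < e -> exists N, forall n, (N <= n)%N -> `|a n| <= e.

Lemma null_cvg a : null a <-> a n @[n --> \oo] --> (0 : R).
Proof.
split=> [h|/cvgr0Pnorm_le h e e0].
  apply/cvgr0Pnorm_le => e e0; have [N hN] := h e e0.
  by exists N => // n /= /hN.
by have [N _ hN] := h e e0; exists N => n /hN.
Qed.

Lemma null_le a b : (exists N, forall n, (N <= n)%N -> `|a n| <= b n) -> null b -> null a.
Proof.
move=> [N hN] hb e e0; have [M hM] := hb e e0; exists (maxn N M) => n.
rewrite geq_max => /andP[/hN h1 /hM h2].
exact: le_trans h1 (le_trans (ler_norm _) h2).
Qed.

Lemma null_squeeze a b : (forall n, `|a n| <= b n) -> null b -> null a.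
Proof. by move=> h; apply: null_le; exists 0%N. Qed.

Lemma nullD a b : null a -> null b -> null (fun n => a n + b n).
Proof.
move=> ha hb e e0; have e2 : 0 < e / 2 by rewrite divr_gt0.
have [N hN] := ha _ e2; have [M hM] := hb _ e2; exists (maxn N M) => n.
rewrite geq_max => /andP[/hN h1 /hM h2].
by apply: le_trans (ler_normD _ _) _; lra.
Qed.

Lemma nullZ (c : R) a : null a -> null (fun n => c * a n).
Proof.
move=> ha e e0; have c0 : 0 < `|c| + 1 by rewrite ltr_wpDl.
have [N hN] := ha _ (divr_gt0 e0 c0); exists N => n /hN h.
rewrite normrM; apply: (@le_trans _ _ ((`|c| + 1) * `|a n|)).
  by rewrite ler_wpM2r // lerDl.
by rewrite mulrC -ler_pdivlMr.
Qed.

Lemma nullN a : null a -> null (fun n => - a n).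
Proof. by move=> ha e e0; have [N hN] := ha e e0; exists N => n /hN; rewrite normrN. Qed.

Lemma nullB a b : null a -> null b -> null (fun n => a n - b n).
Proof. by move=> ha /nullN; apply: nullD. Qed.

Lemma null0 : null (fun=> 0).
Proof. by move=> e e0; exists 0%N => n _; rewrite normr0 ltW. Qed.

Lemma null_sum I (r : seq I) (P : pred I) (F : I -> nat -> R) :
  (forall i, P i -> null (F i)) -> null (fun n => \sum_(i <- r | P i) F i n).
Proof.
move=> h; elim: r => [|i r IH].
  by under eq_fun do rewrite big_nil; exact: null0.
under eq_fun do rewrite big_cons.
by have [/h hi|_] := boolP (P i); [exact: nullD|exact: IH].
Qed.

Lemma null_sub a (phi : nat -> nat) : (forall n, (n <= phi n)%N) -> null a ->
  null (a \o phi).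
Proof.
move=> hp ha e e0; have [N hN] := ha e e0; exists N => n Nn /=.
by apply: hN; apply: leq_trans Nn _.
Qed.

Lemma null_const (c : R) : null (fun=> c) -> c = 0.
Proof.
move=> h; apply/eqP; rewrite -normr_le0; apply/ler_addgt0Pr => e e0.
by have [N /(_ N (leqnn N))] := h e e0; rewrite add0r.
Qed.

Lemma null_ext a b : a =1 b -> null a -> null b.
Proof. by move=> h ha e /ha[N hN]; exists N => n /hN; rewrite h. Qed.

Lemma null_sqr a : null (fun n => a n ^+ 2) -> null a.
Proof.
move=> h e e0; have [N hN] := h _ (exprn_gt0 2 e0); exists N => n /hN.
by rewrite normrX ler_sqr ?nnegrE // ltW.
Qed.

Lemma null_pow p a : 0 < p -> (forall n, 0 <= a n) -> null a -> null (fun n => a n `^ p).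
Proof.
move=> p0 a0 h e e0; have ep : 0 < e `^ p^-1 by exact: powR_gt0.
have [N hN] := h _ ep; exists N => n /hN; rewrite !ger0_norm ?powR_ge0 // => h1.
rewrite -[e](@powVK _ p) ?gt_eqF ?(ltW e0) //.
by apply: ler_pow => //; exact: ltW.
Qed.

(** The extracted [phi] need not be increasing: [n <= phi n] is what [null_sub] asks for, and it is
    stable under composition. *)
Lemma not_null a : ~ null a -> exists2 e : R, 0 < e &
  exists2 phi : nat -> nat, (forall n, (n <= phi n)%N) & forall n, e < `|a (phi n)|.
Proof.
move=> /existsNP[e /not_implyP[e0 he]]; exists e => //.
have H n : {m : nat | (n <= m)%N /\ e < `|a m|}.
  apply: cid; apply: contrapT => hn; apply: he; exists n => m nm.
  by rewrite leNgt; apply/negP => h; apply: hn; exists m.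
by exists (fun n => sval (H n)) => n; case: (H n) => m [].
Qed.

Lemma le_null_lim (c d : R) a : null a -> (forall n, c <= d + a n) -> c <= d.
Proof.
move=> h hc; apply/ler_addgt0Pr => e /h[N /(_ N (leqnn N))] h1.
have := hc N; have := ler_norm (a N); lra.
Qed.

Lemma null_harmonic : null (fun n : nat => n.+1%:R^-1 : R).
Proof.
move=> e e0; exists (Num.Def.truncn e^-1).+1 => n hn.
rewrite ger0_norm ?invr_ge0 // invf_ple ?posrE //.
apply: le_trans (_ : (Num.Def.truncn e^-1).+1%:R <= _).
  exact: ltW (truncnS_gt _).
by rewrite ler_nat; apply: leq_trans hn _.
Qed.

(** By Minkowski's inequality a uniform error b_n changes the l_p norm of a family indexed by [I] by
    at most |I|^(1/p) b_n. *)
Lemma sum_pow_lim p (I : finType) (a : I -> R) (C : R) (b : nat -> R) :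
  1 <= p -> 0 <= C -> (forall i, 0 <= a i) -> (forall n, 0 <= b n) -> null b ->
  (forall n, exists c : I -> R, [/\ forall i, 0 <= c i, \sum_i c i `^ p <= C `^ p &
     forall i, a i <= c i + b n]) ->
  \sum_i a i `^ p <= C `^ p.
Proof.
move=> p1 C0 a0 b0 nb h; have p0 : 0 < p by lra.
set S := \sum_i _.
have S0 : 0 <= S by apply: sumr_ge0 => i _; exact: powR_ge0.
rewrite -[S](@powVK _ p) ?gt_eqF // pow_le ?powR_ge0 //.
apply: (@le_null_lim _ _ (fun n => (\sum_(i : I) b n `^ p) `^ p^-1)).
  apply: null_pow; rewrite ?invr_gt0 //.
    by move=> n; apply: sumr_ge0 => i _; exact: powR_ge0.
  by apply: null_sum => i _; apply: null_pow.
move=> n; have [c [c0 hc hd]] := h n.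
pose D := (\sum_(i : I) b n `^ p) `^ p^-1; rewrite -/D.
have D0 : 0 <= D by exact: powR_ge0.
suff SD : S <= (C + D) `^ p.
  apply: le_trans (_ : ((C + D) `^ p) `^ p^-1 <= _).
    by apply: ler_pow => //; rewrite invr_ge0 ltW.
  by rewrite powK ?gt_eqF ?addr_ge0.
apply: (@le_trans _ _ (\sum_i (c i + b n) `^ p)).
  by apply: ler_sum => i _; apply: ler_pow => //; exact: ltW.
apply: sum_pow_mink => //.
by rewrite /D powVK ?gt_eqF //; apply: sumr_ge0 => i _; exact: powR_ge0.
Qed.

End Null.

(** * Norms of l_p type through partial sums *)

Section CountingNorm.
Variable R : realType.

Lemma nneseries_leP (u : nat -> R) (C : R) : (forall n, 0 <= u n) ->
  (\sum_(k <oo) (u k)%:E <= C%:E)%E <-> forall n, \sum_(i < n) u i <= C.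
Proof.
move=> u0; split=> [h n|h].
  rewrite -lee_fin; apply: le_trans h.
  rewrite -(big_mkord xpredT) -sumEFin.
  by apply: nneseries_lim_ge => i _ _; rewrite lee_fin.
apply: lime_le; first by apply: is_cvg_nneseries => n _ _; rewrite lee_fin.
by apply: nearW => n; rewrite sumEFin lee_fin big_mkord.
Qed.

Lemma Lnorm_leP (p : R) (s : nat -> R) (C : R) : 0 < p -> 0 <= C ->
  (forall n, 0 <= s n) ->
  ('N[counting]_(p%:E)[EFin \o s] <= C%:E)%E <->
  forall n, \sum_(i < n) s i `^ p <= C `^ p.
Proof.
move=> p0 C0 s0; rewrite Lnorm_counting //.
have E : (\sum_(k <oo) (`|(EFin \o s) k| `^ p) =
          \sum_(k <oo) (s k `^ p)%:E)%E.
  by apply: eq_eseriesr => k _; rewrite /= ger0_norm.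
rewrite E; have X := @nneseries_leP (fun k => s k `^ p) (C `^ p) (fun n => powR_ge0 _ _).
apply: iff_trans X; set S := (\sum_(k <oo) _)%E.
have S0 : (0 <= S)%E by apply: nneseries_ge0 => n _ _; rewrite lee_fin powR_ge0.
have pV : 0 <= p^-1 by rewrite invr_ge0 ltW.
have -> : C%:E = ((C `^ p)%:E `^ p^-1)%E.
  by rewrite poweR_EFin powK ?gt_eqF.
split=> [h|h]; last first.
  by apply: gt0_ler_poweR => //; rewrite in_itv /= leey andbT ?lee_fin ?powR_ge0.
have := @gt0_ler_poweR R p (ltW p0) (S `^ p^-1)%E ((C `^ p)%:E `^ p^-1)%E.
rewrite -!poweRrM mulVf ?gt_eqF // !poweRe1 ?lee_fin ?powR_ge0 //.
move=> Y; apply: Y.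
- by rewrite in_itv /= leey andbT poweR_ge0.
- by rewrite in_itv /= leey andbT lee_fin powR_ge0.
- exact: h.
Qed.

End CountingNorm.

Section LinearFacts.
Variables (K : nzRingType) (V W : lmodType K) (f : V -> W) (lf : linear f).
Lemma lin0 : f 0 = 0.
Proof.
have := lf 1 0 0; rewrite !scale1r addr0 => /eqP.
by rewrite -subr_eq subrr eq_sym => /eqP.
Qed.
Lemma linD x y : f (x + y) = f x + f y.
Proof. by have := lf 1 x y; rewrite !scale1r. Qed.
Lemma linZ a x : f (a *: x) = a *: f x.
Proof. by have := lf a x 0; rewrite lin0 !addr0. Qed.
Lemma linN x : f (- x) = - f x.
Proof. by rewrite -scaleN1r linZ scaleN1r. Qed.
Lemma linB x y : f (x - y) = f x - f y.
Proof. by rewrite linD linN. Qed.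
Lemma lin_sum I (r : seq I) (P : pred I) (F : I -> V) :
  f (\sum_(i <- r | P i) F i) = \sum_(i <- r | P i) f (F i).
Proof.
by elim/big_rec2: _ => [|i y x _ <-]; [exact: lin0|rewrite linD].
Qed.
End LinearFacts.

(** * Hilbert spaces *)

Section Hilbert.
Variables (R : realType) (k : scalar_kind).
Local Notation K := (scalar_field R k).
Variables (H : completeNormedModType K) (dot : {dot H for @sconj R k}).
Hypothesis Hdot : forall x : H, `|x| ^+ 2 = dot x x.
Implicit Types (x y z u v w : H) (a c : K).

Lemma sre_conj_scale (s : R) (z : K) :
  sre (sconj (sinj k s * z) * z) = s * smod z ^+ 2.
Proof.
by rewrite rmorphM /= sconj_sinj -mulrA sreZ (mulrC (sconj z)) mul_conj sinjK.
Qed.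

Definition nm (x : H) : R := sre `|x|.

Lemma normH x : `|x| = sinj k (nm x).
Proof. exact: ge0_sinj. Qed.

Lemma nm_ge0 x : 0 <= nm x.
Proof. by rewrite -(sinj_ge0 k) -normH. Qed.
Hint Resolve nm_ge0 : core.

Lemma nmZ a x : nm (a *: x) = smod a * nm x.
Proof. by apply: (@sinj_inj R k); rewrite -normH normrZ normE normH rmorphM. Qed.

Lemma nmD x y : nm (x + y) <= nm x + nm y.
Proof. rewrite -(sinj_le k) rmorphD /= -!normH; exact: ler_normD. Qed.

Lemma nmN x : nm (- x) = nm x.
Proof. by rewrite /nm normrN. Qed.

Lemma nmB x y : nm (x - y) <= nm x + nm y.
Proof. by rewrite -(nmN y) nmD. Qed.

Lemma nm_distC x y : nm (x - y) = nm (y - x).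
Proof. by rewrite -nmN opprB. Qed.

Lemma nm_tri y x z : nm (x - z) <= nm (x - y) + nm (y - z).
Proof. by rewrite -(subrKA y); exact: nmD. Qed.

Lemma nm_sub y x : nm x <= nm y + nm (x - y).
Proof. by rewrite -{1}(subrKC y x); exact: nmD. Qed.

Lemma nm0 : nm 0 = 0.
Proof. by rewrite /nm normr0 raddf0. Qed.

Lemma nm_eq0 x : nm x = 0 -> x = 0.
Proof. by move=> h; apply/eqP; rewrite -normr_eq0 normH h rmorph0. Qed.

Lemma nm_sum I (r : seq I) (P : pred I) (F : I -> H) :
  nm (\sum_(i <- r | P i) F i) <= \sum_(i <- r | P i) nm (F i).
Proof.
elim/big_rec2: _ => [|i y x _ IH]; first by rewrite nm0.
by apply: le_trans (nmD _ _) _; rewrite lerD2l.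
Qed.

Lemma ip0l y : dot 0 y = 0. Proof. exact: linear0l. Qed.
Lemma ip0r x : dot x 0 = 0. Proof. exact: linear0r. Qed.
Lemma ipDl x y z : dot (x + y) z = dot x z + dot y z. Proof. exact: linearDl. Qed.
Lemma ipDr x y z : dot x (y + z) = dot x y + dot x z. Proof. exact: linearDr. Qed.
Lemma ipBl x y z : dot (x - y) z = dot x z - dot y z. Proof. exact: linearBl. Qed.
Lemma ipBr x y z : dot x (y - z) = dot x y - dot x z. Proof. exact: linearBr. Qed.
Lemma ipNr x y : dot x (- y) = - dot x y. Proof. exact: linearNr. Qed.
Lemma ipZl a x y : dot (a *: x) y = a * dot x y. Proof. exact: linearZl_LR. Qed.
Lemma ipZr a x y : dot x (a *: y) = sconj a * dot x y. Proof. exact: linearZr_LR. Qed.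
Lemma ip_suml I (r : seq I) (P : pred I) (F : I -> H) y :
  dot (\sum_(i <- r | P i) F i) y = \sum_(i <- r | P i) dot (F i) y.
Proof. exact: linear_sumlz. Qed.
Lemma ip_sumr I (r : seq I) (P : pred I) (F : I -> H) x :
  dot x (\sum_(i <- r | P i) F i) = \sum_(i <- r | P i) dot x (F i).
Proof. exact: linear_sumr. Qed.
Lemma ipC x y : dot x y = sconj (dot y x).
Proof. by have := @hermitian_subproof _ _ _ _ dot x y; rewrite expr0 mul1r. Qed.

Lemma ipxx x : dot x x = sinj k (nm x ^+ 2).
Proof. by rewrite -Hdot normH rmorphXn. Qed.

Lemma nm_sqr x : nm x ^+ 2 = sre (dot x x).
Proof. by rewrite ipxx sinjK. Qed.

Lemma sre_ipC x y : sre (dot x y) = sre (dot y x).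
Proof. by rewrite ipC sre_conj. Qed.

Lemma smod_ipC x y : smod (dot x y) = smod (dot y x).
Proof. by rewrite ipC smod_conj. Qed.

Lemma nmD_sqr x y : nm (x + y) ^+ 2 = nm x ^+ 2 + nm y ^+ 2 + 2 * sre (dot x y).
Proof.
rewrite nm_sqr ipDl !ipDr !raddfD /= -!nm_sqr (sre_ipC y x).
by ring.
Qed.

Lemma nmB_sqr x y : nm (x - y) ^+ 2 = nm x ^+ 2 + nm y ^+ 2 - 2 * sre (dot x y).
Proof. by rewrite nmD_sqr nmN ipNr raddfN mulrN. Qed.

Lemma parallelogram x y : nm (x + y) ^+ 2 + nm (x - y) ^+ 2 = 2 * (nm x ^+ 2 + nm y ^+ 2).
Proof. by rewrite nmD_sqr nmB_sqr; ring. Qed.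

Lemma pythagoras x y : dot x y = 0 -> nm (x + y) ^+ 2 = nm x ^+ 2 + nm y ^+ 2.
Proof. by move=> h; rewrite nmD_sqr h raddf0 mulr0 addr0. Qed.

Lemma sqr_le (a b : R) : 0 <= a -> 0 <= b -> (a ^+ 2 <= b ^+ 2) = (a <= b).
Proof. by move=> a0 b0; rewrite ler_sqr. Qed.

Lemma cauchy_schwarz x y : smod (dot x y) <= nm x * nm y.
Proof.
have [->|y0] := eqVneq y 0; first by rewrite ip0r smod0 nm0 mulr0.
have ny : 0 < nm y.
  by rewrite lt_neqAle nm_ge0 andbT eq_sym; apply: contraNneq y0 => /nm_eq0 ->.
have n2 : 0 < nm y ^+ 2 by rewrite exprn_gt0.
rewrite -sqr_le // ?mulr_ge0 // exprMn.
set z := dot x y.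
have := exprn_ge0 2 (nm_ge0 (x - (z * sinj k (nm y ^+ 2)^-1) *: y)).
rewrite nmB_sqr nmZ smodM smod_sinj ger0_norm ?invr_ge0 ?sqr_ge0 // ipZr.
rewrite -/z (mulrC z) sre_conj_scale.
set s := smod z ^+ 2; set n := nm y ^+ 2 in n2 *.
have -> : (smod z * n^-1 * nm y) ^+ 2 = s / n.
  by rewrite /s /n; field; rewrite gt_eqF.
have -> : n^-1 * s = s / n by rewrite mulrC.
move=> h; have : 0 <= nm x ^+ 2 - s / n by lra.
by rewrite subr_ge0 ler_pdivrMr.
Qed.

Lemma nm_le_dual x (C : R) : 0 <= C ->
  (forall y, smod (dot x y) <= C * nm y) -> nm x <= C.
Proof.
move=> C0 h; have := h x; rewrite ipxx smod_sinj ger0_norm ?sqr_ge0 // expr2.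
have [->//|n0] := eqVneq (nm x) 0.
by rewrite ler_pM2r // lt_neqAle nm_ge0 eq_sym n0.
Qed.

Lemma ip_ext x y : (forall z, dot x z = dot y z) -> x = y.
Proof.
move=> h; apply/eqP; rewrite -subr_eq0; apply/eqP/nm_eq0.
have : nm (x - y) ^+ 2 = 0 by rewrite nm_sqr ipBl h subrr raddf0.
by move=> /eqP; rewrite sqrf_eq0 => /eqP.
Qed.

Lemma ip_extr x y : (forall z, dot z x = dot z y) -> x = y.
Proof. by move=> h; apply: ip_ext => z; rewrite ipC h -ipC. Qed.

(** Used in place of orthonormality because it survives contractions and unions along orthogonal
    projections, and admits zero vectors. *)
Definition bessel (I : finType) (e : I -> H) :=
  forall x, \sum_i smod (dot x (e i)) ^+ 2 <= nm x ^+ 2.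

Lemma orthogonal_bessel (I : finType) (e : I -> H) :
  (forall i j, i != j -> dot (e i) (e j) = 0) -> (forall i, nm (e i) <= 1) ->
  bessel e.
Proof.
move=> eo e1 x; set S := \sum_i _; pose y := \sum_i dot x (e i) *: e i.
have xy : sre (dot x y) = S.
  rewrite ip_sumr raddf_sum /=; apply: eq_bigr => i _.
  by rewrite ipZr mulrC mul_conj sinjK.
have yy : nm y ^+ 2 <= S.
  rewrite nm_sqr {1}/y ip_suml raddf_sum /=; apply: ler_sum => i _.
  rewrite ipZl ip_sumr (bigD1 i) //= big1 ?addr0; last first.
    by move=> j ji; rewrite ipZr eo 1?eq_sym ?mulr0.
  rewrite ipZr mulrA mul_conj ipxx sreZ sinjK ler_piMr ?sqr_ge0 //.
  by rewrite expr_le1.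
have := exprn_ge0 2 (nm_ge0 (x - y)); rewrite nmB_sqr xy.
lra.
Qed.

(** The Bessel inequality tested at e_i itself gives |e_i|^4 <= |e_i|^2. *)
Lemma bessel_le1 (I : finType) (e : I -> H) i : bessel e -> nm (e i) <= 1.
Proof.
move=> /(_ (e i)); rewrite (bigD1 i) //= ipxx smod_sinj ger0_norm ?sqr_ge0 // => h.
have {}h : (nm (e i) ^+ 2) ^+ 2 <= nm (e i) ^+ 2.
  by apply: le_trans h; rewrite lerDl; apply: sumr_ge0 => j _; rewrite sqr_ge0.
have [|n1] := leP (nm (e i)) 1; first by [].
have : 1 < nm (e i) ^+ 2 by rewrite exprn_egt1.
nra.
Qed.

Lemma bessel_comp (I : finType) (e : I -> H) (b b' : H -> H) : bessel e ->
  (forall x y, dot x (b y) = dot (b' x) y) -> (forall x, nm (b' x) <= nm x) ->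
  bessel (b \o e).
Proof.
move=> be ab b1 x /=; under eq_bigr do rewrite ab.
by apply: le_trans (be _) _; rewrite sqr_le.
Qed.

Lemma hilbert_complete (u : nat -> H) :
  (forall e : R, 0 < e -> exists N, forall n m, (N <= n)%N -> (N <= m)%N ->
     nm (u n - u m) <= e) ->
  exists l, null (fun n => nm (u n - l)).
Proof.
move=> hc; have : cvg (u @ \oo).
  apply/cauchy_cvgP/cauchy_exP => /= e e0.
  have e0' : 0 < sre e.
    by rewrite -(sinj_lt k) rmorph0 -ge0_sinj // ltW.
  have [N hN] := hc _ (divr_gt0 e0' (ltr0n _ 2)).
  exists (u N); exists N => // n /= Nn; rewrite -ball_normE /ball_ /=.
  rewrite normH (ge0_sinj (ltW e0)) sinj_lt.
  by apply: le_lt_trans (hN _ _ (leqnn _) Nn) _; lra.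
move=> /cvg_ex[l /cvgrPdist_le hl]; exists l => e e0.
have := hl (sinj k e); rewrite -(rmorph0 (sinj k)) sinj_lt => /(_ e0)[N _ hN].
exists N => n /hN; rewrite normH sinj_le ger0_norm // => h.
by rewrite nm_distC.
Qed.

Definition closed_linear (G : H -> Prop) :=
  [/\ G 0, forall a x y, G x -> G y -> G (a *: x + y) &
      forall x, (forall e : R, 0 < e -> exists2 y, G y & nm (x - y) <= e) -> G x].

Lemma projection_exists (G : H -> Prop) x : closed_linear G ->
  exists2 g, G g & forall h, G h -> dot (x - g) h = 0.
Proof.
move=> [G0 Glin Gcl].
pose A := [set r : R | exists2 g, G g & r = nm (x - g) ^+ 2].
have Ah : has_inf A.
  split; first by exists (nm (x - 0) ^+ 2); exists 0.
  by exists 0 => _ [g _ ->]; rewrite sqr_ge0.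
pose d := inf A.
have dA g : G g -> d <= nm (x - g) ^+ 2.
  by move=> Gg; apply: ge_inf; [exact: Ah.2|exists g].
have ex n : {g | G g /\ nm (x - g) ^+ 2 <= d + n.+1%:R^-1}.
  apply: cid.
  have n0 : 0 < n.+1%:R^-1 :> R by rewrite invr_gt0.
  have [_ [g Gg ->] hg] := inf_adherent n0 Ah.
  by exists g; split => //; exact: ltW.
pose u n := sval (ex n).
have Gu n : G (u n) by rewrite /u; case: (ex n) => g [].
have du n : nm (x - u n) ^+ 2 <= d + n.+1%:R^-1 by rewrite /u; case: (ex n) => g [].
have [g hg] : exists l, null (fun n => nm (u n - l)).
  apply: hilbert_complete => e e0.
  have [N hN] := null_harmonic (divr_gt0 (exprn_gt0 2 e0) (ltr0n _ 4)).
  exists N => n m /hN hn /hN hm; rewrite -sqr_le ?(ltW e0) //.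
  rewrite !ger0_norm ?invr_ge0 // in hn hm.
  have mid : G ((sinj k 2^-1) *: (u n + u m)).
    have -> : (sinj k 2^-1) *: (u n + u m) = (sinj k 2^-1) *: (1 *: u n + u m) + 0.
      by rewrite scale1r addr0.
    exact: (Glin _ _ _ (Glin _ _ _ (Gu n) (Gu m)) G0).
  have := parallelogram (x - u n) (x - u m).
  have -> : x - u n - (x - u m) = - (u n - u m) by rewrite !opprB addrC subrKA.
  have -> : x - u n + (x - u m) = sinj k 2 *: (x - (sinj k 2^-1) *: (u n + u m)).
    rewrite scalerBr scalerA -rmorphM mulfV // rmorph1 scale1r addrACA -opprD.
    by congr (_ - _); rewrite rmorph_nat scaler_nat mulr2n.
  rewrite nmN nmZ smod_sinj ger0_norm // exprMn.
  have h1 : nm (x - u n) ^+ 2 <= d + e ^+ 2 / 4.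
    by apply: le_trans (du n) _; rewrite lerD2l.
  have h2 : nm (x - u m) ^+ 2 <= d + e ^+ 2 / 4.
    by apply: le_trans (du m) _; rewrite lerD2l.
  by have h3 := dA _ mid; clear -h1 h2 h3; lra.
exists g.
  apply: Gcl => e /hg[N /(_ N (leqnn N))]; rewrite ger0_norm // => h.
  by exists (u N) => //; rewrite nm_distC.
have dg : nm (x - g) ^+ 2 <= d.
  have hb : nm (x - g) <= Num.sqrt d.
    have d0 : 0 <= d by apply: lb_le_inf; [exact: Ah.1|move=> _ [? _ ->]; rewrite sqr_ge0].
    apply: (@le_null_lim _ _ _ (fun n => Num.sqrt n.+1%:R^-1 + nm (u n - g))).
      apply: nullD => //; apply: null_sqr; apply: null_ext (@null_harmonic R) => n.
      by rewrite sqr_sqrtr ?invr_ge0.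
    move=> n; have -> : x - g = (x - u n) + (u n - g) by rewrite addrA subrK.
    apply: le_trans (nmD _ _) _; rewrite addrA lerD2r.
    rewrite -sqr_le ?addr_ge0 ?sqrtr_ge0 //; apply: le_trans (du n) _.
    by rewrite sqrrD !sqr_sqrtr ?invr_ge0 // -addrA lerD2l lerDr mulrn_wge0.
  have d0 : 0 <= d by apply: lb_le_inf; [exact: Ah.1|move=> _ [? _ ->]; rewrite sqr_ge0].
  by rewrite -(sqr_sqrtr d0) sqr_le ?sqrtr_ge0.
move=> h Gh; set z := dot (x - g) h.
apply/eqP; rewrite -smod_eq0; apply/eqP.
have Gg : G g.
  apply: Gcl => e /hg[N /(_ N (leqnn N))]; rewrite ger0_norm // => h'.
  by exists (u N) => //; rewrite nm_distC.
(* Comparison of g with g + s z h gives 2 s |z|^2 <= s |z|^2 (s |h|^2); adding 1 in [s] makes the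
   last factor at most 1 and covers h = 0. *)
pose s := (nm h ^+ 2 + 1)^-1.
have h1 : 0 < nm h ^+ 2 + 1 by rewrite ltr_wpDl ?sqr_ge0.
have s0 : 0 < s by rewrite invr_gt0.
have sh : s * (nm h ^+ 2 + 1) = 1 by rewrite mulVf // gt_eqF.
have := dA _ (Glin (sinj k s * z) _ _ Gh Gg).
rewrite opprD addrCA addrC [x + _]addrC addrC [- g + x]addrC addrC.
rewrite nmB_sqr nmZ smodM smod_sinj ger0_norm ?(ltW s0) // ipZr -/z sre_conj_scale => hh.
have hm : 2 * (s * smod z ^+ 2) <= (s * smod z * nm h) ^+ 2 by lra.
have hm2 : (s * smod z * nm h) ^+ 2 = s * smod z ^+ 2 * (s * nm h ^+ 2) by ring.
have q0 := sqr_ge0 (smod z).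
have : s * smod z ^+ 2 <= 0.
  rewrite hm2 in hm; have : 0 <= s * smod z ^+ 2 by rewrite mulr_ge0 // ltW.
  have : s * nm h ^+ 2 <= 1 by lra.
  nra.
rewrite pmulr_rle0 // => q1.
have /eqP : smod z ^+ 2 = 0 by lra.
by rewrite sqrf_eq0 => /eqP.
Qed.

Definition bop (f : H -> H) :=
  linear f /\ exists C : R, forall x, nm (f x) <= C * nm x.

Lemma riesz (phi : H -> K) (C : R) :
  (forall a x y, phi (a *: x + y) = a * phi x + phi y) ->
  (forall x, smod (phi x) <= C * nm x) ->
  exists w, forall x, phi x = dot x w.
Proof.
move=> phil phib.
have phi0 : phi 0 = 0.
  have := phil 1 0 0; rewrite scale1r addr0 mul1r => /eqP.
  by rewrite -subr_eq subrr eq_sym => /eqP.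
have phiB x y : phi (x - y) = phi x - phi y.
  by rewrite addrC -scaleN1r phil mulN1r addrC.
have cl : closed_linear (fun x => phi x = 0).
  split=> [//|a x y hx hy|x hx]; first by rewrite phil hx hy mulr0 addr0.
  apply/eqP; rewrite -smod_eq0 eq_le smod_ge0 andbT.
  apply/ler_addgt0Pr => e e0; rewrite add0r.
  have C1 : 0 < `|C| + 1 by rewrite ltr_wpDl.
  have [y hy hxy] := hx _ (divr_gt0 e0 C1).
  rewrite -[phi x]subr0 -hy -phiB; apply: le_trans (phib _) _.
  apply: (@le_trans _ _ ((`|C| + 1) * nm (x - y))).
    by rewrite ler_wpM2r // (le_trans (ler_norm _)) // lerDl.
  by rewrite mulrC -ler_pdivlMr.
have [h|/existsNP[x0 hx0]] := pselect (forall x, phi x = 0).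
  by exists 0 => x; rewrite ip0r h.
have [g hg og] := projection_exists x0 cl.
set q := x0 - g in og.
have pq : phi q != 0 by rewrite phiB hg subr0; apply/eqP.
have q0 : sinj k (nm q ^+ 2) != 0.
  rewrite -(rmorph0 (sinj k)) (inj_eq (@sinj_inj R k)) sqrf_eq0.
  by apply: contraNneq pq => /nm_eq0 ->; rewrite phi0.
exists ((sconj (phi q) / sinj k (nm q ^+ 2)) *: q) => x.
have : dot q (x - (phi x / phi q) *: q) = 0.
  by apply: og; rewrite phiB -[_ *: q]addr0 phil phi0 addr0 divfK // subrr.
rewrite ipC ipBl ipZl ipxx rmorphB /= -rmorphB => h.
have {}h : dot x q - phi x / phi q * sinj k (nm q ^+ 2) = 0.
  by rewrite -[LHS](@sconjK R k) h rmorph0.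
rewrite ipZr rmorphM /= sconjK fmorphV /= sconj_sinj.
move/eqP: h; rewrite subr_eq0 => /eqP ->.
by rewrite (mulrC (phi x / _)) mulrA divfK // mulrCA divff // mulr1.
Qed.

Lemma bop_bound f : bop f -> exists2 C : R, 0 < C & forall x, nm (f x) <= C * nm x.
Proof.
move=> [_ [C hC]]; exists (`|C| + 1) => [|x]; first by rewrite ltr_wpDl.
apply: le_trans (hC x) _; rewrite ler_wpM2r // (le_trans (ler_norm _)) // lerDl.
by [].
Qed.

Local Notation adj := (adjoint dot).

(** [adjoint] is a choice with default value 0; Riesz representation shows that for a bounded
    operator there is something to choose. *)
Lemma adjP f : bop f -> forall u v, dot (f u) v = dot u (adj f v).
Proof.
move=> bf; have [C C0 hC] := bop_bound bf.
have H1 v : exists w, forall u, dot (f u) v = dot u w.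
  apply: (@riesz (fun u => dot (f u) v) (C * nm v)) => [a x y|x].
    by rewrite bf.1 ipDl ipZl.
  apply: le_trans (cauchy_schwarz _ _) _.
  by rewrite mulrAC ler_wpM2r.
have [g hg] := choice H1.
rewrite /adjoint; case: xgetP => [g' _ hg'|] // /(_ g); case=> u v.
exact: hg.
Qed.

Lemma adj_uniq f g : (forall u v, dot (f u) v = dot u (g v)) -> adj f = g.
Proof.
move=> hg; apply/funext => v; rewrite /adjoint.
case: xgetP => [g' _ hg'|/(_ g)/(_ hg)//].
by apply: ip_extr => u; rewrite -hg' hg.
Qed.

Lemma adj_lin f : bop f -> linear (adj f).
Proof.
move=> bf a x y; apply: ip_extr => u.
by rewrite -adjP // !ipDr !ipZr -!adjP.
Qed.

Lemma adj_le f (C : R) : bop f -> 0 <= C -> (forall x, nm (f x) <= C * nm x) ->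
  forall x, nm (adj f x) <= C * nm x.
Proof.
move=> bf C0 hC x; apply: nm_le_dual => [|y]; first by rewrite mulr_ge0.
rewrite smod_ipC -adjP //; apply: le_trans (cauchy_schwarz _ _) _.
by rewrite mulrAC ler_wpM2r.
Qed.

Lemma adj_bop f : bop f -> bop (adj f).
Proof.
move=> bf; split; first exact: adj_lin.
have [C C0 hC] := bop_bound bf; exists C; apply: adj_le => //; exact: ltW.
Qed.

Lemma adjP' f : bop f -> forall u v, dot (adj f u) v = dot u (f v).
Proof. by move=> bf u v; rewrite ipC -adjP // -ipC. Qed.

Lemma adjK f : bop f -> adj (adj f) = f.
Proof. by move=> bf; apply: adj_uniq => u v; rewrite adjP'. Qed.

Lemma bop_lin a f g : bop f -> bop g -> bop (a *: f + g).
Proof.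
move=> bf bg; have [C C0 hC] := bop_bound bf; have [D D0 hD] := bop_bound bg.
split=> [c x y|].
  rewrite /= !fctE bf.1 bg.1 !scalerDr !scalerA addrACA.
  by congr (_ + _ + _); rewrite mulrC.
exists (smod a * C + D) => x; apply: le_trans (nmD _ _) _.
by rewrite nmZ mulrDl -mulrA lerD // ler_wpM2l.
Qed.

Lemma adj_comb a f g : bop f -> bop g -> adj (a *: f + g) = sconj a *: adj f + adj g.
Proof.
move=> bf bg; apply: adj_uniq => u v.
by rewrite /= !fctE ipDl ipZl ipDr ipZr sconjK !adjP.
Qed.

Lemma bop0 : bop (0 : H -> H).
Proof.
split=> [a x y|]; first by rewrite /= scaler0 addr0.
by exists 0 => x; rewrite /= nm0 mul0r.
Qed.

Lemma bop_comp f g : bop f -> bop g -> bop (f \o g).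
Proof.
move=> bf bg; have [C C0 hC] := bop_bound bf; have [D D0 hD] := bop_bound bg.
split=> [a x y|]; first by rewrite /= bg.1 bf.1.
exists (C * D) => x /=; apply: le_trans (hC _) _.
by rewrite -mulrA ler_wpM2l // ltW.
Qed.

Lemma adj_comp f g : bop f -> bop g -> adj (f \o g) = adj g \o adj f.
Proof. by move=> bf bg; apply: adj_uniq => u v /=; rewrite !adjP. Qed.

End Hilbert.
#[global] Hint Extern 0 (is_true (0 <= nm _)) => exact: nm_ge0 : core.

(** * Compact operators and singular values *)

Section Spectral.
Variables (R : realType) (k : scalar_kind).
Local Notation K := (scalar_field R k).
Variables (H : completeNormedModType K) (dot : {dot H for @sconj R k}).
Hypothesis Hdot : forall x : H, `|x| ^+ 2 = dot x x.
Local Notation adj := (adjoint dot).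
Local Notation bessel := (bessel dot).
Implicit Types (x y z u v w : H) (a c : K).

Definition seq_compact (T : H -> H) := forall w : nat -> H,
  (forall n, nm (w n) <= 1) -> exists2 phi : nat -> nat, (forall n, (n <= phi n)%N) &
    exists v, null (fun n => nm (T (w (phi n)) - v)).

Definition positive_op (T : H -> H) :=
  (forall x y, dot (T x) y = dot x (T y)) /\ forall x, 0 <= sre (dot (T x) x).

Lemma null_nmZ a (f : nat -> H) l : null (fun n => nm (f n - l)) ->
  null (fun n => nm (a *: f n - a *: l)).
Proof.
move=> h; apply: null_ext (nullZ (smod a) h) => n /=.
by rewrite -scalerBr nmZ.
Qed.

Lemma null_nm_uniq (f : nat -> H) l l' : null (fun n => nm (f n - l)) ->
  null (fun n => nm (f n - l')) -> l = l'.
Proof.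
move=> h1 h2; apply/eqP; rewrite -subr_eq0; apply/eqP/nm_eq0.
apply: null_const; apply: null_squeeze (nullD h1 h2) => n.
by rewrite ger0_norm // (nm_distC (f n) l); exact: nm_tri.
Qed.

Lemma null_nm_bop (f : nat -> H) (T : H -> H) l : bop T -> null (fun n => nm (f n - l)) ->
  null (fun n => nm (T (f n) - T l)).
Proof.
move=> bT h; have [C C0 hC] := bop_bound bT.
apply: null_squeeze (nullZ C h) => n; rewrite ger0_norm //.
by rewrite -(linB bT.1) hC.
Qed.

Lemma null_nm_shift (f g : nat -> H) l : null (fun n => nm (f n - g n)) ->
  null (fun n => nm (f n - l)) -> null (fun n => nm (g n - l)).
Proof.
move=> h1 h2; apply: null_squeeze (nullD h1 h2) => n; rewrite ger0_norm //.
by rewrite (nm_distC (f n) (g n)); exact: nm_tri.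
Qed.

(** A maximizing sequence for the quadratic form consists of approximate eigenvectors, and
    compactness provides a limit. If the supremum is 0, the zero vector stands in for an
    eigenvector, so that spectral lists can always be continued. *)
Lemma maximizer (T : H -> H) (W : H -> Prop) :
  bop T -> positive_op T -> seq_compact T ->
  closed_linear W -> (forall x, W x -> W (T x)) ->
  exists (s : R) (u : H), [/\ 0 <= s, W u, (0 < s -> nm u = 1), (s = 0 -> u = 0) &
    T u = sinj k s *: u /\ forall x, W x -> sre (dot (T x) x) <= s * nm x ^+ 2].
Proof.
move=> bT [sT pT] cT [W0 Wlin Wcl] Winv.
have [C C0 hC] := bop_bound bT.
pose q x := sre (dot (T x) x).
have qle x : q x <= C * nm x ^+ 2.
  apply: le_trans (ler_norm _) _; apply: le_trans (sre_le_smod _) _.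
  apply: le_trans (cauchy_schwarz Hdot _ _) _.
  by rewrite expr2 mulrA ler_wpM2r.
pose A := [set r : R | exists2 x, W x /\ nm x <= 1 & r = q x].
have Ah : has_sup A.
  split; first by exists (q 0); exists 0 => //; rewrite nm0.
  exists C => _ [x [_ x1] ->]; apply: le_trans (qle x) _.
  by rewrite ler_piMr ?expr_le1 // ltW.
pose s := sup A.
have qs0 x : W x -> nm x <= 1 -> q x <= s.
  by move=> Wx x1; apply: sup_upper_bound => //; exists x.
have s0 : 0 <= s by apply: le_trans (pT 0) (qs0 _ W0 _); rewrite nm0.
have WZ a x : W x -> W (a *: x).
  by move=> Wx; rewrite -[_ *: x]addr0; apply: Wlin.
have qZ (r : R) x : q (sinj k r *: x) = r ^+ 2 * q x.
  by rewrite /q (linZ bT.1) ipZl ipZr sconj_sinj !sreZ expr2 mulrA.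
have qs x : W x -> q x <= s * nm x ^+ 2.
  move=> Wx; have [x0|x0] := eqVneq (nm x) 0.
    by rewrite (nm_eq0 x0) /q ip0r raddf0 nm0 expr0n /= mulr0.
  have xp : 0 < nm x by rewrite lt_neqAle eq_sym x0 /=.
  have := qs0 _ (WZ (sinj k (nm x)^-1) _ Wx).
  rewrite nmZ smod_sinj ger0_norm ?invr_ge0 // mulVf // => /(_ (lexx _)).
  by rewrite qZ exprVn mulrC ler_pdivrMr ?exprn_gt0.
have [s00|sn0] := eqVneq s 0.
  exists 0, 0; split=> //; first by rewrite ltxx.
  by split=> [|x /qs]; rewrite ?s00 // (lin0 bT.1) scaler0.
have sp : 0 < s by rewrite lt_neqAle eq_sym sn0.
(* Positivity of the form at x - T x / s, together with its bound by s at T x. *)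
have nTq x : W x -> nm (T x) ^+ 2 <= s * q x.
  move=> Wx; have := pT (x - sinj k s^-1 *: T x).
  rewrite (linB bT.1) ipBl !ipBr (linZ bT.1) !ipZl !ipZr sconj_sinj.
  rewrite !raddfB /= !sreZ -!(nm_sqr Hdot) (sT (T x)) -(nm_sqr Hdot).
  have := qs _ (Winv _ Wx); rewrite /q.
  set N := nm (T x) ^+ 2; set Q := sre (dot (T (T x)) (T x)).
  move=> h1 h2.
  have h3 : s * (s^-1 * (s^-1 * Q)) <= N.
    by rewrite mulVKf ?gt_eqF // mulrC ler_pdivrMr // mulrC.
  have := mulr_ge0 (ltW sp) h2; set Q0 := sre (dot (T x) x).
  have -> : s * (Q0 - s^-1 * N + (- (s^-1 * N) - - (s^-1 * (s^-1 * Q)))) =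
    s * Q0 - 2 * N + s * (s^-1 * (s^-1 * Q)) by field.
  lra.
have ex n : {w | (W w /\ nm w <= 1) /\ s - n.+1%:R^-1 <= q w}.
  apply: cid; have n0 : 0 < n.+1%:R^-1 :> R by rewrite invr_gt0.
  have [_ [w hw ->] hq] := sup_adherent n0 Ah.
  by exists w; split => //; exact: ltW.
pose w n := sval (ex n).
have Ww n : W (w n) by rewrite /w; case: (ex n) => g [[]].
have w1 n : nm (w n) <= 1 by rewrite /w; case: (ex n) => g [[]].
have qw n : s - n.+1%:R^-1 <= q (w n) by rewrite /w; case: (ex n) => g [].
(* By [nTq], |T w - s w|^2 <= s^2 - s q(w), which tends to 0 along a maximizing sequence. *)
have nearly : null (fun n => nm (T (w n) - sinj k s *: w n)).
  apply: null_sqr; apply: null_squeeze (nullZ s (@null_harmonic R)) => n.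
  rewrite ger0_norm ?sqr_ge0 // (nmB_sqr Hdot) nmZ smod_sinj ger0_norm // ipZr sconj_sinj sreZ.
  rewrite -/(q _).
  have h1 := nTq _ (Ww n); have h2 := qw n.
  have h3 : (s * nm (w n)) ^+ 2 <= s * s.
    by rewrite exprMn expr2 ler_piMr ?mulr_ge0 ?expr_le1.
  by have := ler_wpM2l s0 h2; rewrite mulrBr; move: (s / _) => t h4; lra.
have [phi hphi [v hv]] := cT w w1.
have nearly' := null_sub hphi nearly.
have sv : null (fun n => nm (sinj k s *: w (phi n) - v)).
  exact: null_nm_shift nearly' hv.
pose u := sinj k s^-1 *: v.
have vu : v = sinj k s *: u by rewrite scalerA -rmorphM mulfV // rmorph1 scale1r.
have wu : null (fun n => nm (w (phi n) - u)).
  have := null_nmZ (sinj k s^-1) sv; apply: null_ext => n.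
  by rewrite scalerA -rmorphM mulVf // rmorph1 scale1r.
have Tu : T u = v by apply: null_nm_uniq hv; apply: null_nm_bop.
have Wu : W u.
  apply: Wcl => e /wu[N /(_ N (leqnn N))]; rewrite ger0_norm // => h.
  by exists (w (phi N)) => //; rewrite nm_distC.
exists s, u; split => //; last 2 first.
- by move=> s00; rewrite s00 eqxx in sn0.
- by split; rewrite ?Tu.
move=> _; apply/eqP; rewrite eq_le; apply/andP; split.
  apply: (le_null_lim wu) => n; apply: le_trans (nm_sub (w (phi n)) u) _.
  by rewrite nm_distC lerD2r.
rewrite -(ler_pM2l sp) mulr1.
have -> : s * nm u = nm v by rewrite vu nmZ smod_sinj ger0_norm.
apply: (@le_null_lim _ _ _ (fun n => nm (T (w (phi n)) - v) + (phi n).+1%:R^-1)).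
  by apply: nullD => //; apply: null_sub hphi (@null_harmonic R).
move=> n; have h1 := qw (phi n).
have h2 : q (w (phi n)) <= nm (T (w (phi n))).
  apply: le_trans (ler_norm _) _; apply: le_trans (sre_le_smod _) _.
  apply: le_trans (cauchy_schwarz Hdot _ _) _.
  by rewrite ler_piMr.
have h3 : nm (T (w (phi n))) <= nm (T (w (phi n)) - v) + nm v.
  by rewrite -[in leLHS](subrK v (T (w (phi n)))) nmD.
by move: _^-1 h1 => t h1; lra.
Qed.

(** Lists are infinite: after the last positive eigenvalue both values and vectors are 0. The
    vectors are thus orthogonal of norm 0 or 1, which still gives Bessel families. *)
Record eigsys (T : H -> H) (s : nat -> R) (u : nat -> H) := EigSys {
  eig_ge0 : forall n, 0 <= s n;
  eig_dec : forall n, s n.+1 <= s n;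
  eig_orth : forall i j, i != j -> dot (u i) (u j) = 0;
  eig_unit : forall i, 0 < s i -> nm (u i) = 1;
  eig_null : forall i, s i = 0 -> u i = 0;
  eig_eq : forall i, T (u i) = sinj k (s i) *: u i;
  eig_max : forall n x, (forall i, (i < n)%N -> dot x (u i) = 0) ->
    sre (dot (T x) x) <= s n * nm x ^+ 2 }.

Lemma eigsys_exists (T : H -> H) :
  bop T -> positive_op T -> seq_compact T ->
  exists (s : nat -> R) (u : nat -> H), eigsys T s u.
Proof.
move=> bT pT cT.
pose W (l : seq H) x := forall w, w \in l -> dot x w = 0.
(* The premise on [l] stays inside the statement so that [choice] gives a function on all lists;
   [Leig] discharges it along the recursion. *)
have next (l : seq H) : exists su : R * H,
    (forall w, w \in l -> exists r : R, T w = sinj k r *: w) ->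
    [/\ 0 <= su.1, W l su.2, (0 < su.1 -> nm su.2 = 1), (su.1 = 0 -> su.2 = 0) &
    T su.2 = sinj k su.1 *: su.2 /\ forall x, W l x -> sre (dot (T x) x) <= su.1 * nm x ^+ 2].
  have [hl|hl] := pselect (forall w, w \in l -> exists r : R, T w = sinj k r *: w); last first.
    by exists (0, 0) => h; case: hl.
  have Wcl : closed_linear (W l).
    split=> [w _|a x y Wx Wy w wl|x hx w wl]; first by rewrite ip0l.
      by rewrite ipDl ipZl Wx // Wy // mulr0 addr0.
    apply/eqP; rewrite -smod_eq0 eq_le smod_ge0 andbT.
    apply/ler_addgt0Pr => e e0; rewrite add0r.
    have C1 : 0 < nm w + 1 by rewrite ltr_wpDl.
    have [y hy hxy] := hx _ (divr_gt0 e0 C1).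
    have -> : dot x w = dot (x - y) w by rewrite ipBl hy // subr0.
    apply: le_trans (cauchy_schwarz Hdot _ _) _.
    apply: (@le_trans _ _ (nm (x - y) * (nm w + 1))); first by rewrite ler_wpM2l // lerDl.
    by rewrite -ler_pdivlMr.
  have Winv x : W l x -> W l (T x).
    move=> Wx w wl; rewrite pT.1; have [r ->] := hl w wl.
    by rewrite ipZr Wx // mulr0.
  have [s [u h]] := maximizer bT pT cT Wcl Winv.
  by exists (s, u).
have [f hf] := choice next.
pose L := fix L n : seq H := if n is m.+1 then (f (L m)).2 :: L m else [::].
have Leig n : forall w, w \in L n -> exists r : R, T w = sinj k r *: w.
  elim: n => [//|n IH] w; rewrite inE => /predU1P[->|]; last exact: IH.
  by exists (f (L n)).1; have [_ _ _ _ []] := hf _ IH.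
have Lin i n : (i < n)%N -> (f (L i)).2 \in L n.
  elim: n => [//|n IH]; rewrite ltnS leq_eqVlt => /predU1P[->|/IH h] /=.
    by rewrite inE eqxx.
  by rewrite inE h orbT.
have Lin' n w : w \in L n -> exists2 i, (i < n)%N & w = (f (L i)).2.
  elim: n => [//|n IH] /=; rewrite inE => /predU1P[->|/IH[i ni ->]]; first by exists n.
  by exists i => //; exact: ltnW.
pose s n := (f (L n)).1; pose u n := (f (L n)).2.
have hn n := hf _ (Leig n).
have orth i j : (i < j)%N -> dot (u j) (u i) = 0.
  by move=> ij; have [_ h _ _ _] := hn j; apply/h/Lin.
exists s, u; split.
- by move=> n; have [] := hn n.
- move=> n; have [s0 hW h1 h2 [h3 h4]] := hn n.+1.
  have [s0' _ _ _ [_ hmax]] := hn n.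
  have [->//|sn0] := eqVneq (s n.+1) 0.
  have sp : 0 < s n.+1 by rewrite lt_neqAle eq_sym sn0.
  have /hmax : W (L n) (u n.+1) by move=> w wl; apply: hW; rewrite /= inE wl orbT.
  rewrite h3 ipZl (ipxx Hdot) sreZ sinjK (h1 sp) expr1n !mulr1; exact.
- move=> i j; rewrite neq_ltn => /orP[ij|ij]; last exact: orth.
  by rewrite ipC orth // rmorph0.
- by move=> i; have [] := hn i.
- by move=> i; have [] := hn i.
- by move=> i; have [_ _ _ _ []] := hn i.
move=> n x hx; have [_ _ _ _ [_ hmax]] := hn n.
by apply: hmax => w /Lin'[i ni ->]; apply: hx.
Qed.

End Spectral.

(** * Singular systems and the variational form of the norm *)

Section Singular.
Variables (R : realType) (k : scalar_kind).
Local Notation K := (scalar_field R k).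
Variables (H : completeNormedModType K) (dot : {dot H for @sconj R k}).
Hypothesis Hdot : forall x : H, `|x| ^+ 2 = dot x x.
Local Notation adj := (adjoint dot).
Local Notation bessel := (bessel dot).
Implicit Types (x y z : H) (a c : K).

(** [sing_eq] is the eigenvalue equation of [adj f \o f] tested against y, and [sing_max] its
    min-max bound, both freed from the adjoint. *)
Record singsys (f : H -> H) (s : nat -> R) (u : nat -> H) := SingSys {
  sing_ge0 : forall n, 0 <= s n;
  sing_dec : forall n, s n.+1 <= s n;
  sing_orth : forall i j, i != j -> dot (u i) (u j) = 0;
  sing_unit : forall i, 0 < s i -> nm (u i) = 1;
  sing_null : forall i, s i = 0 -> u i = 0;
  sing_eq : forall i y, dot (f (u i)) (f y) = sinj k (s i ^+ 2) * dot (u i) y;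
  sing_max : forall n x, (forall i, (i < n)%N -> dot x (u i) = 0) -> nm (f x) <= s n * nm x }.

Lemma adj_comp_self (f : H -> H) : bop f -> forall x y,
  dot ((adj f \o f) x) y = dot (f x) (f y).
Proof. by move=> bf x y /=; rewrite adjP'. Qed.

Lemma adj_comp_positive (f : H -> H) : bop f -> positive_op dot (adj f \o f).
Proof.
move=> bf; split=> [x y|x]; last by rewrite adj_comp_self // -(nm_sqr Hdot) sqr_ge0.
by rewrite adj_comp_self //= -adjP.
Qed.

Lemma seq_compact_comp (f g : H -> H) : bop g -> seq_compact f -> seq_compact (g \o f).
Proof.
move=> bg cf w w1; have [phi hphi [v hv]] := cf w w1.
exists phi => //; exists (g v).
exact: (null_nm_bop (f := fun n => f (w (phi n))) bg hv).
Qed.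

Lemma singsys_exists (f : H -> H) : bop f -> seq_compact f ->
  exists (s : nat -> R) (u : nat -> H), singsys f s u.
Proof.
move=> bf cf; have bT : bop (adj f \o f) by apply: bop_comp => //; exact: adj_bop.
have cT : seq_compact (adj f \o f) by apply: seq_compact_comp => //; exact: adj_bop.
have [s [u [s0 sd uo u1 un ue um]]] := eigsys_exists Hdot bT (adj_comp_positive bf) cT.
exists (fun n => Num.sqrt (s n)), u; split => //.
- by move=> n; rewrite ler_sqrt.
- by move=> i; rewrite sqrtr_gt0; exact: u1.
- move=> i /eqP; rewrite sqrtr_eq0 => h; apply: un; apply/eqP.
  by rewrite eq_le h s0.
- by move=> i y; rewrite -adj_comp_self // ue ipZl sqr_sqrtr.
move=> n x hx; rewrite -sqr_le ?mulr_ge0 ?sqrtr_ge0 // exprMn sqr_sqrtr //.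
by rewrite (nm_sqr Hdot) -adj_comp_self //; exact: um.
Qed.

Lemma sing_mono f s u : singsys f s u -> forall i j, (i <= j)%N -> s j <= s i.
Proof.
move=> hs i j; elim: j => [|j IH]; first by rewrite leqn0 => /eqP ->.
rewrite leq_eqVlt => /predU1P[->//|]; rewrite ltnS => /IH; apply: le_trans.
exact: sing_dec hs j.
Qed.

Lemma sing_le1 f s u : singsys f s u -> forall i, nm (u i) <= 1.
Proof.
move=> hs i; have [s0|s0] := eqVneq (s i) 0; first by rewrite (sing_null hs s0) nm0.
by rewrite (sing_unit hs) // lt_neqAle eq_sym s0 (sing_ge0 hs).
Qed.

Lemma sing_nm f s u : singsys f s u -> forall i, nm (f (u i)) = s i.
Proof.
move=> hs i; apply/eqP; rewrite -(eqrXn2 (n:=2)) ?(sing_ge0 hs) //; apply/eqP.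
rewrite (nm_sqr Hdot) (sing_eq hs) (ipxx Hdot) sreZ sinjK.
have [s0|s0] := eqVneq (s i) 0; first by rewrite s0 expr0n /= mul0r.
by rewrite (sing_unit hs) ?expr1n ?mulr1 // lt_neqAle eq_sym s0 (sing_ge0 hs).
Qed.

Lemma sing_dot f s u : singsys f s u -> forall i j, i != j -> dot (f (u i)) (f (u j)) = 0.
Proof. by move=> hs i j ij; rewrite (sing_eq hs) (sing_orth hs) // mulr0. Qed.

(** Courant-Fischer: among n + 1 orthonormal eigenvectors with eigenvalues at least t, some nonzero
    combination is orthogonal to the first n singular vectors, so t <= s_n^2. *)
Lemma singular_valueE f s u n : bop f -> singsys f s u -> singular_value dot f n = s n.
Proof.
move=> bf hs; have s0 := sing_ge0 hs.
rewrite /singular_value -[in RHS](ger0_norm (s0 n)) -sqrtr_sqr.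
congr Num.sqrt; rewrite /eigenvalue_seq; set E := [set t : R | _].
have ub : ubound E (s n ^+ 2).
  move=> t [t0 [e [eo he]]].
  (* With more rows than columns, [M] has a nonzero left kernel vector; it holds the coefficients of
     the combination. *)
  pose M : 'M[K]_(n.+1, n) := \matrix_(i, j) dot (e i) (u j).
  have kM : kermx M != 0.
    rewrite -mxrank_eq0 mxrank_ker subn_eq0 -ltnNge.
    by rewrite ltnS; exact: rank_leq_col.
  have [i ri] : exists i, row i (kermx M) != 0.
    apply: contrapT => h; move/negP: kM; apply; apply/eqP/row_matrixP => i.
    rewrite row0; apply/eqP; apply: contrapT => /negP hi; apply: h; by exists i.
  pose c j := row i (kermx M) 0 j.
  have cM j : (j < n)%N -> \sum_l c l * dot (e l) (u j) = 0.
    move=> jn; have := sub_kermxP (row_sub i (kermx M)).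
    move=> /matrixP/(_ 0 (Ordinal jn)); rewrite !mxE => h; rewrite -[RHS]h.
    by apply: eq_bigr => l _; rewrite /c !mxE.
  pose x := \sum_l c l *: e l.
  have xx : nm x ^+ 2 = \sum_l smod (c l) ^+ 2.
    rewrite (nm_sqr Hdot) /x ip_suml raddf_sum /=; apply: eq_bigr => l _.
    rewrite ipZl ip_sumr (bigD1 l) //= big1 ?addr0; last first.
      by move=> j jl; rewrite ipZr eo eq_sym (negbTE jl) mulr0.
    by rewrite ipZr eo eqxx mulr1 mul_conj sinjK.
  have xp : 0 < nm x ^+ 2.
    rewrite lt_neqAle sqr_ge0 andbT eq_sym xx; apply: contraNneq ri => h.
    apply/eqP/rowP => j; rewrite [RHS]mxE.
    have /psumr_eq0P : \sum_l smod (c l) ^+ 2 = 0 by [].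
    move=> /(_ (fun l _ => sqr_ge0 _) j isT)/eqP; rewrite sqrf_eq0 smod_eq0.
    by move=> /eqP <-.
  have xu j : (j < n)%N -> dot x (u j) = 0.
    move=> jn; rewrite -[RHS](cM j jn) ip_suml; apply: eq_bigr => l _.
    by rewrite ipZl.
  rewrite -(ler_pM2r xp); apply: (@le_trans _ _ (nm (f x) ^+ 2)); last first.
    by rewrite -exprMn sqr_le ?mulr_ge0 //; exact: (sing_max hs).
  rewrite [nm (f x) ^+ 2](nm_sqr Hdot) -adj_comp_self // xx mulr_sumr.
  have lT : linear (adj f \o f) by apply: (bop_comp (adj_bop Hdot bf) bf).1.
  rewrite {1}/x (lin_sum lT) ip_suml raddf_sum /=; apply: ler_sum => l _.
  have [ll el tl] := he l.
  rewrite -[adj f (f _)]/((adj f \o f) _) (linZ lT) el !ipZl ip_sumr (bigD1 l) //= big1 ?addr0; last first.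
    by move=> j jl; rewrite ipZr eo eq_sym (negbTE jl) mulr0.
  rewrite ipZr eo eqxx mulr1 (mulrCA (c l)) mul_conj (mulrC ll) sreZ mulrC.
  by rewrite ler_wpM2l ?sqr_ge0.
(* If s_n = 0 then u_n = 0 is no unit eigenvector; it is then enough that the supremum is
   nonnegative, the empty one being 0. *)
have En : s n ^+ 2 = 0 \/ E (s n ^+ 2).
  have [sn0|sn0] := eqVneq (s n) 0; first by left; rewrite sn0 expr0n.
  right; split; first by rewrite sqr_ge0.
  have sp i : (i <= n)%N -> 0 < s i.
    move=> ni; apply: lt_le_trans (sing_mono hs ni).
    by rewrite lt_neqAle eq_sym sn0 s0.
  exists (fun i => u i); split=> [i j|i].
    have [->|ij] := eqVneq i j.
      by rewrite (ipxx Hdot) (sing_unit hs) ?expr1n ?rmorph1 // sp // -ltnS.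
    by rewrite (sing_orth hs).
  exists (sinj k (s i ^+ 2)); last first.
    by rewrite sinjK sqr_le //; apply: (sing_mono hs); rewrite -ltnS.
  apply: (ip_ext Hdot) => y; rewrite adj_comp_self // (sing_eq hs).
  by rewrite ipZl.
apply/eqP; rewrite eq_le; apply/andP; split.
  have [[t Et]|E0] := pselect (E !=set0); first by apply: ge_sup => //; exists t.
  rewrite sup_out ?sqr_ge0 // => -[].
  by move=> /E0.
case: En => [->|Es].
  have [[t Et]|E0] := pselect (E !=set0).
    by apply: le_trans (Et.1) _; apply: sup_upper_bound => //; split; [exists t|exists (s n ^+ 2)].
  by rewrite sup_out // => -[/E0].
by apply: sup_upper_bound => //; split; [exists (s n ^+ 2)|exists (s n ^+ 2)].
Qed.

(* [cp_norm dot p f] is the least [C >= 0] satisfying this. *)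
Definition Qle (p : R) (f : H -> H) (C : R) :=
  forall (I : finType) (e g : I -> H), bessel e -> bessel g ->
    \sum_i smod (dot (f (e i)) (g i)) `^ p <= C `^ p.

(** The coefficients of s_j in <f e_i, g_i> are dominated by a matrix whose row and column sums are
    at most 1. Jensen's inequality along the rows and summation along the columns give the bound. *)
Lemma Qle_finrep (p : R) (J : finType) (s : J -> R) (a b : J -> H) (f : H -> H) (C : R) :
  1 <= p -> (forall j, 0 <= s j) -> bessel a -> bessel b ->
  (forall x, f x = \sum_j (sinj k (s j) * dot x (a j)) *: b j) ->
  \sum_j s j `^ p <= C `^ p -> Qle p f C.
Proof.
move=> p1 s0 ba bb hf hs I e g be bg; apply: le_trans hs.
(* The arithmetic-geometric mean bound of the product of the two moduli; Bessel's inequality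
   controls both marginals. *)
pose w i j := (smod (dot (e i) (a j)) ^+ 2 + smod (dot (b j) (g i)) ^+ 2) / 2.
have w0 i j : 0 <= w i j by rewrite divr_ge0 ?addr_ge0 ?sqr_ge0.
have w1 i : \sum_j w i j <= 1.
  rewrite -mulr_suml ler_pdivrMr // mul1r big_split /=.
  have h1 := ba (e i).
  have h2 : \sum_j smod (dot (b j) (g i)) ^+ 2 <= nm (g i) ^+ 2.
    by under eq_bigr do rewrite smod_ipC; exact: bb.
  have e1 : nm (e i) ^+ 2 <= 1 by rewrite expr_le1 //; exact: bessel_le1 be.
  have g1 : nm (g i) ^+ 2 <= 1 by rewrite expr_le1 //; exact: bessel_le1 bg.
  lra.
have w1' j : \sum_i w i j <= 1.
  rewrite -mulr_suml ler_pdivrMr // mul1r big_split /=.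
  have h2 := bg (b j).
  have h1 : \sum_i smod (dot (e i) (a j)) ^+ 2 <= nm (a j) ^+ 2.
    by under eq_bigr do rewrite smod_ipC; exact: be.
  have e1 : nm (a j) ^+ 2 <= 1 by rewrite expr_le1 //; exact: bessel_le1 ba.
  have g1 : nm (b j) ^+ 2 <= 1 by rewrite expr_le1 //; exact: bessel_le1 bb.
  lra.
apply: (@le_trans _ _ (\sum_i \sum_j w i j * s j `^ p)).
  apply: ler_sum => i _; apply: le_trans (jensen_ge1 p1 (w0 i) s0 (w1 i)).
  apply: ler_pow => //; first by lra.
  rewrite hf ip_suml; apply: le_trans (smod_sum _ _ _) _.
  apply: ler_sum => j _; rewrite ipZl !smodM smod_sinj ger0_norm // /w.
  rewrite mulrC [leRHS]mulrC mulrC -mulrA ler_wpM2l //.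
  have := sqr_ge0 (smod (dot (e i) (a j)) - smod (dot (b j) (g i))); lra.
rewrite exchange_big /=; apply: ler_sum => j _; rewrite -mulr_suml.
by rewrite ler_piMl ?powR_ge0.
Qed.

Lemma finite_null (I : finType) (F : I -> nat -> R) (e : R) : 0 < e ->
  (forall i, null (F i)) -> exists N, forall n i, (N <= n)%N -> `|F i n| <= e.
Proof.
move=> e0 h; have : null (fun n => \sum_i `|F i n|).
  by apply: null_sum => i _ d d0; have [N hN] := h i d d0; exists N => n /hN; rewrite normr_id.
move=> /(_ e e0)[N hN]; exists N => n i /hN; rewrite ger0_norm; last first.
  by apply: sumr_ge0.
apply: le_trans; rewrite (bigD1 i) //= lerDl.
by apply: sumr_ge0.
Qed.

(** [Qle] involves finitely many matrix entries at a time, so it is closed for the weak operator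
    topology, along filters as well as sequences. *)
Lemma Qle_approx (p : R) (f : H -> H) (C : R) : 1 <= p -> 0 <= C ->
  (forall (I : finType) (e g : I -> H) (d : R), 0 < d ->
     exists2 f', Qle p f' C & forall i, smod (dot (f' (e i)) (g i) - dot (f (e i)) (g i)) <= d) ->
  Qle p f C.
Proof.
move=> p1 C0 h I e g be bg.
apply: (@sum_pow_lim _ _ _ _ _ (fun n => n.+1%:R^-1)) => //; first exact: null_harmonic.
move=> n; have n0 : 0 < n.+1%:R^-1 :> R by rewrite invr_gt0.
have [f' hf' hd] := h I e g _ n0.
exists (fun i => smod (dot (f' (e i)) (g i))); split=> // [|i]; first exact: hf'.
rewrite -lerBlDl; apply: le_trans (hd i); rewrite lerBlDl -(smodN (_ - _)) opprB.
by rewrite -{1}(subrKC (dot (f' (e i)) (g i)) (dot (f (e i)) (g i))) smodD.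
Qed.

Lemma Qle_lim (p : R) (f : H -> H) (f_ : nat -> H -> H) (C : R) : 1 <= p -> 0 <= C ->
  (forall x y, null (fun n => smod (dot (f_ n x) y - dot (f x) y))) ->
  (forall n, Qle p (f_ n) C) -> Qle p f C.
Proof.
move=> p1 C0 h hQ; apply: Qle_approx => // I e g d d0.
have [N hN] := finite_null d0 (fun i => h (e i) (g i)).
by exists (f_ N) => // i; have := hN N i (leqnn _); rewrite ger0_norm.
Qed.

(** By monotonicity (n + 1) s_n^p is at most the sum of the first n + 1 powers. *)
Lemma sing_null_lim (p : R) f s u (C : R) : 0 < p -> singsys f s u ->
  (forall n, \sum_(i < n) s i `^ p <= C `^ p) -> null s.
Proof.
move=> p0 hs hC; have s0 := sing_ge0 hs.
have h n : s n `^ p <= C `^ p * n.+1%:R^-1.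
  rewrite ler_pdivlMr // mulrC; apply: le_trans (hC n.+1).
  rewrite -[n.+1 in leLHS]card_ord mulr_natl -sumr_const; apply: ler_sum => i _.
  by apply: ler_pow; rewrite ?(ltW p0) //; apply: (sing_mono hs); rewrite -ltnS.
have : null (fun n => s n `^ p).
  apply: null_squeeze (nullZ (C `^ p) (@null_harmonic R)) => n.
  by rewrite ger0_norm ?powR_ge0.
have pV : 0 < p^-1 by rewrite invr_gt0.
move=> /(null_pow pV (fun n => powR_ge0 _ _)); apply: null_ext => n.
by rewrite powK // gt_eqF.
Qed.

(* Vanishes when [s n = 0], because [0^-1 = 0]. *)
Definition left_sing (f : H -> H) (s : nat -> R) (u : nat -> H) n := sinj k (s n)^-1 *: f (u n).

Lemma left_singE f s u : singsys f s u -> forall n, f (u n) = sinj k (s n) *: left_sing f s u n.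
Proof.
move=> hs n; have [s0|s0] := eqVneq (s n) 0.
  by rewrite s0 rmorph0 scale0r; apply: nm_eq0; rewrite (sing_nm hs).
by rewrite /left_sing scalerA -rmorphM mulfV // rmorph1 scale1r.
Qed.

Lemma sing_bessel f s u n : singsys f s u -> bessel (fun i : 'I_n => u i).
Proof.
move=> hs; apply: (orthogonal_bessel Hdot) => [i j ij|i]; last exact: (sing_le1 hs).
exact: (sing_orth hs).
Qed.

Lemma left_sing_orth f s u : singsys f s u -> forall i j, i != j ->
  dot (left_sing f s u i) (left_sing f s u j) = 0.
Proof. by move=> hs i j ij; rewrite ipZl ipZr (sing_dot hs) // !mulr0. Qed.

Lemma left_sing_le1 f s u : singsys f s u -> forall i, nm (left_sing f s u i) <= 1.
Proof.
move=> hs i; rewrite nmZ (sing_nm hs) smod_sinj ger0_norm ?invr_ge0 ?(sing_ge0 hs) //.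
have [->|s0] := eqVneq (s i) 0; first by rewrite mulr0.
by rewrite mulVf.
Qed.

Lemma left_sing_bessel f s u n : singsys f s u -> bessel (fun i : 'I_n => left_sing f s u i).
Proof.
move=> hs; apply: (orthogonal_bessel Hdot) => [i j ij|i]; last exact: (left_sing_le1 hs).
exact: (left_sing_orth hs).
Qed.

Lemma sing_tail f s u n x : linear f -> singsys f s u ->
  nm (f x - \sum_(i < n) dot x (u i) *: f (u i)) <= s n * nm x.
Proof.
move=> lf hs; have bu := sing_bessel n hs; set y := \sum_(i < n) dot x (u i) *: u i.
have -> : \sum_(i < n) dot x (u i) *: f (u i) = f y.
  by rewrite (lin_sum lf); apply: eq_bigr => i _; rewrite (linZ lf).
have xy j : (j < n)%N -> dot (x - y) (u j) = 0.
  move=> jn; rewrite ipBl ip_suml (bigD1 (Ordinal jn)) //= big1 ?addr0; last first.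
    by move=> i ij; rewrite ipZl (sing_orth hs) ?mulr0 //; apply: contraNneq ij => h; apply/eqP/val_inj.
  rewrite ipZl (ipxx Hdot).
  have [s0|s0] := eqVneq (s j) 0; first by rewrite (sing_null hs s0) ip0r mul0r subrr.
  by rewrite (sing_unit hs) ?expr1n ?rmorph1 ?mulr1 ?subrr // lt_neqAle eq_sym s0 (sing_ge0 hs).
rewrite -(linB lf); apply: le_trans (sing_max hs xy) _.
rewrite ler_wpM2l ?(sing_ge0 hs) // -sqr_le //.
have h : dot (x - y) y = 0.
  by rewrite ip_sumr big1 // => i _; rewrite ipZr xy // mulr0.
by rewrite -[in leRHS](subrK y x) (pythagoras Hdot h) lerDl sqr_ge0.
Qed.

(** Truncated singular series are covered by [Qle_finrep] and converge by [sing_tail]. *)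
Lemma singsys_Qle (p : R) f s u (C : R) : 1 <= p -> 0 <= C -> linear f -> singsys f s u ->
  (forall n, \sum_(i < n) s i `^ p <= C `^ p) -> Qle p f C.
Proof.
move=> p1 C0 lf hs hC; have p0 : 0 < p by lra.
pose f_ n x := \sum_(i < n) (sinj k (s i) * dot x (u i)) *: left_sing f s u i.
apply: (@Qle_lim _ _ f_) => // [x y|n].
  have := nullZ (nm x * nm y) (sing_null_lim p0 hs hC); apply: null_squeeze => n.
  rewrite ger0_norm // -ipBl; apply: le_trans (cauchy_schwarz Hdot _ _) _.
  rewrite nm_distC mulrAC ler_wpM2r // mulrC.
  have := sing_tail n x lf hs; congr (nm (_ - _) <= _).
  by apply: eq_bigr => i _; rewrite (left_singE hs) scalerA mulrC.
apply: (@Qle_finrep _ _ (fun i : 'I_n => s i) (fun i => u i) (fun i => left_sing f s u i)) => //.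
- by move=> j; exact: (sing_ge0 hs).
- exact: (sing_bessel n hs).
- exact: (left_sing_bessel n hs).
Qed.

Lemma dot_left_sing f s u i : singsys f s u ->
  dot (f (u i)) (left_sing f s u i) = sinj k (s i).
Proof.
move=> hs; rewrite ipZr (ipxx Hdot) (sing_nm hs) sconj_sinj -rmorphM expr2.
by have [->|s0] := eqVneq (s i) 0; [rewrite !mulr0|rewrite mulKf].
Qed.

(** The variational bound is attained on the right and left singular vectors themselves. *)
Lemma Qle_singsys (p : R) f s u (C : R) n : singsys f s u -> Qle p f C ->
  \sum_(i < n) s i `^ p <= C `^ p.
Proof.
move=> hs hQ; have := hQ _ _ _ (sing_bessel n hs) (left_sing_bessel n hs).
apply: le_trans; apply: ler_sum => i _.
by rewrite (dot_left_sing _ hs) smod_sinj ger0_norm // (sing_ge0 hs).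
Qed.

End Singular.

(** * Finite nets for bounded sets of scalars *)

Section Nets.
Variables (R : realType) (k : scalar_kind).
Local Notation K := (scalar_field R k).

Lemma real_net (M d : R) : 0 < d -> exists s : seq R, forall x : R, `|x| <= M ->
  exists2 y, y \in s & `|x - y| <= d.
Proof.
move=> d0; pose s := [seq - M + i%:R * d | i <- iota 0 (Num.truncn (2 * M / d)).+1].
exists s => x xM; have xM0 : 0 <= (x + M) / d.
  by rewrite divr_ge0 ?(ltW d0) //; have := ler_norm (- x); rewrite normrN; lra.
pose i := Num.truncn ((x + M) / d).
have /andP[i1 i2] : i%:R <= (x + M) / d < i.+1%:R.
  exact: truncn_itv.
exists (- M + i%:R * d).
  apply/mapP; exists i => //; rewrite mem_iota /= add0n ltnS.
  apply: le_truncn; rewrite ler_pM2r ?invr_gt0 //.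
  by have := ler_norm x; lra.
rewrite ler_pdivlMr // in i1; rewrite ltr_pdivrMr // -natr1 mulrDl mul1r in i2.
by rewrite ler_norml; apply/andP; split; lra.
Qed.

(** [j] is 0 or the imaginary unit, so that nets for both kinds of scalars come from real ones. *)
Lemma scalar_split : exists j : K, smod j <= 1 /\ forall z : K, exists a b : R,
  [/\ `|a| <= smod z, `|b| <= smod z & z = sinj k a + j * sinj k b].
Proof.
rewrite /smod /sinj /sre; case: (k) => /=.
  exists 0; split=> [|z]; first by rewrite normr0.
  by exists z, 0; rewrite normr0 mul0r addr0.
exists 'i%C; split=> [|[a b]]; first by rewrite /= expr0n /= add0r expr1n sqrtr1.
exists a, b; split => /=.
- by rewrite -sqrtr_sqr ler_sqrt ?addr_ge0 ?sqr_ge0 // lerDl sqr_ge0.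
- by rewrite -sqrtr_sqr ler_sqrt ?addr_ge0 ?sqr_ge0 // lerDr sqr_ge0.
by rewrite [LHS]complexE.
Qed.

Lemma scalar_net (M d : R) : 0 < d -> exists s : seq K, forall z, smod z <= M ->
  exists2 y, y \in s & smod (z - y) <= d.
Proof.
move=> d0; have [j [j1 hj]] := scalar_split.
have [s hs] := real_net M (divr_gt0 d0 (ltr0n R 2)).
exists [seq sinj k a + j * sinj k b | a <- s, b <- s] => z zM.
have [a [b [aM bM ->]]] := hj z.
have [a' as' ha] := hs a (le_trans aM zM); have [b' bs' hb] := hs b (le_trans bM zM).
exists (sinj k a' + j * sinj k b'); first by apply/allpairsP; exists (a', b').
rewrite opprD addrACA -mulrBr -!rmorphB; apply: le_trans (smodD _ _) _.
rewrite smodM !smod_sinj.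
have : smod j * `|b - b'| <= `|b - b'| by rewrite ler_piMl.
lra.
Qed.

End Nets.

(** * Compact operators, total boundedness and membership in c_p *)

Section Compactness.
Variables (R : realType) (k : scalar_kind).
Local Notation K := (scalar_field R k).
Variables (H : completeNormedModType K) (dot : {dot H for @sconj R k}).
Hypothesis Hdot : forall x : H, `|x| ^+ 2 = dot x x.
Local Notation adj := (adjoint dot).
Local Notation bessel := (bessel dot).
Implicit Types (x y z : H) (a c : K).

Lemma comb_net (b : nat -> H) (n : nat) (M d : R) : 0 < d -> exists ys : seq H,
  forall c : nat -> K, (forall i, smod (c i) <= M) ->
  exists2 y, y \in ys & nm (\sum_(i < n) c i *: b i - y) <= d.
Proof.
elim: n d => [|n IH] d d0.
  by exists [:: 0] => c _; exists 0; rewrite ?inE // big_ord0 subrr nm0 ltW.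
have d2 : 0 < d / 2 by rewrite divr_gt0.
have [ys hys] := IH _ d2.
have b1 : 0 < nm (b n) + 1 by rewrite ltr_wpDl.
have [s hs] := scalar_net k M (divr_gt0 d2 b1).
exists [seq y + a *: b n | y <- ys, a <- s] => c hc.
have [y yys hy] := hys c hc; have [z zs hz] := hs (c n) (hc n).
exists (y + z *: b n); first by apply/allpairsP; exists (y, z).
rewrite big_ord_recr /= opprD addrACA -scalerBl; apply: le_trans (nmD _ _) _.
rewrite nmZ; have : smod (c n - z) * nm (b n) <= d / 2.
  apply: (@le_trans _ _ (smod (c n - z) * (nm (b n) + 1))).
    by rewrite ler_wpM2l // lerDl.
  by rewrite -ler_pdivlMr.
lra.
Qed.

Lemma nm_le1 x : `|x| <= 1 <-> nm x <= 1.
Proof. by rewrite normH -(rmorph1 (sinj k)) sinj_le. Qed.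

Lemma seq_compact_bop (f : H -> H) : linear f -> seq_compact f -> bop f.
Proof.
move=> lf cf; split => //; apply: contrapT => hC.
have ex n : {w : H | nm w <= 1 /\ n%:R < nm (f w)}.
  apply: cid; apply: contrapT => hn; apply: hC; exists n%:R => x.
  have [->|x0] := eqVneq x 0; first by rewrite (lin0 lf) nm0 mulr0.
  have xp : 0 < nm x.
    by rewrite lt_neqAle nm_ge0 andbT eq_sym; apply: contraNneq x0 => /nm_eq0 ->.
  rewrite leNgt; apply/negP => h; apply: hn; exists (sinj k (nm x)^-1 *: x).
  rewrite (linZ lf) !nmZ smod_sinj ger0_norm ?invr_ge0 // mulVf ?gt_eqF //; split=> //.
  by rewrite mulrC ltr_pdivlMr.
have [phi hphi [v hv]] := cf _ (fun n => (svalP (ex n)).1).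
have [N hN] := hv 1 ltr01.
pose m := maxn N (Num.truncn (nm v + 1)).+1.
have := hN m (leq_maxl _ _); rewrite ger0_norm // => h1.
have := (svalP (ex (phi m))).2 => h2.
have h3 := nm_sub v (f (sval (ex (phi m)))).
have h4 : nm v + 1 < m%:R.
  by apply: lt_le_trans (truncnS_gt _) _; rewrite ler_nat leq_maxr.
have h5 : m%:R <= (phi m)%:R :> R by rewrite ler_nat.
by have h6 := lt_trans h4 (le_lt_trans h5 h2); clear -h1 h3 h6; lra.
Qed.

Lemma compact_operator_seq (f : H -> H) : compact_operator f -> seq_compact f.
Proof.
move=> [lf [A fA [cA _]]] w w1.
have [v Av hv] : exists2 v, A v & cluster (f \o w @ \oo) v.
  have FA : (f \o w @ \oo) A.
    by exists 0%N => // n _; apply: fA; exists (w n) => //; exact/nm_le1.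
  by have [v [Av hv]] := cA _ _ FA; exists v.
have ex n : {m | (n <= m)%N /\ nm (f (w m) - v) <= n.+1%:R^-1}.
  apply: cid.
  have h1 : (f \o w @ \oo) ((f \o w) @` [set m | (n <= m)%N]).
    by exists n => // m nm /=; exists m.
  have h2 : nbhs v (ball v (sinj k n.+1%:R^-1)).
    by apply: nbhsx_ballx; rewrite -(rmorph0 (sinj k)) sinj_lt invr_gt0.
  have [_ [[m nm <-] hm]] := hv _ _ h1 h2; exists m; split=> //.
  move: hm; rewrite -ball_normE /ball_ /= normH sinj_lt nm_distC; exact: ltW.
exists (fun n => sval (ex n)); first by move=> n; case: (svalP (ex n)).
exists v; apply: null_squeeze (@null_harmonic R) => n; rewrite ger0_norm //.
by case: (svalP (ex n)).
Qed.

Lemma proper_almost_const_cvg (F : set_system H) : ProperFilter F ->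
  (forall e : R, 0 < e -> exists y, F [set x | nm (x - y) <= e]) -> exists l : H, F --> l.
Proof.
move=> uF hF; apply/cvg_ex/cauchy_cvgP/cauchy_exP => e e0.
have e0' : 0 < sre e by rewrite -(sinj_lt k) rmorph0 -ge0_sinj // ltW.
have [y hy] := hF _ (divr_gt0 e0' (ltr0n _ 2)).
exists y; apply: filterS hy => x /= hx.
rewrite -ball_normE /ball_ /= normH (ge0_sinj (ltW e0)) sinj_lt nm_distC.
by apply: le_lt_trans hx _; lra.
Qed.

(** An ultrafilter containing a finite union contains one of its members; finite nets thus yield a
    single approximating point. *)
Lemma ultra_seq (T : Type) (I : eqType) (F : set_system T) (s : seq I) (B : I -> set T) :
  UltraFilter F -> F [set x | exists2 i, i \in s & B i x] -> exists i, F (B i).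
Proof.
move=> uF; elim: s => [|i s IH].
  move=> h; suff : F set0 by move=> /filter_not_empty.
  by apply: filterS h => x [].
move=> h; have [Bi|nBi] := in_ultra_setVsetC (B i) uF; first by exists i.
apply: IH; apply: filterS (filterI h nBi) => x [[j]]; rewrite inE => /predU1P[->//|js Bj _].
by exists j.
Qed.

Lemma totally_bounded_compact (f : H -> H) : linear f ->
  (forall d : R, 0 < d -> exists ys : seq H, forall x, nm x <= 1 ->
     exists2 y, y \in ys & nm (f x - y) <= d) -> compact_operator f.
Proof.
move=> lf hf; split => //; rewrite precompactE compact_ultra => F uF hF.
have [l hl] : exists l : H, F --> l.
  apply: proper_almost_const_cvg => e e0.
  have e2 : 0 < e / 2 by rewrite divr_gt0.
  have [ys hys] := hf _ e2.
  apply: (@ultra_seq _ _ _ ys) => //.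
  apply: filterS hF => x hx.
  have h2 : nbhs x (ball x (sinj k (e / 2))).
    by apply: nbhsx_ballx; rewrite -(rmorph0 (sinj k)) sinj_lt.
  have [_ [[z z1 <-] hz]] := hx _ h2.
  move: hz; rewrite -ball_normE /ball_ /= normH sinj_lt => hz.
  have [y yys hy] := hys z (iffLR (nm_le1 _) z1); exists y => //=.
  by have := nm_tri (f z) x y; lra.
exists l; split=> //; apply: closed_closure => B lB.
have FB : F B by apply: hl.
by have [x hx] := filter_ex (filterI hF FB); exists x.
Qed.

Definition orthosys (I : finType) (e : I -> H) :=
  (forall i j, i != j -> dot (e i) (e j) = 0) /\ forall i, e i = 0 \/ nm (e i) = 1.

Definition proj (I : finType) (e : I -> H) x := \sum_i dot x (e i) *: e i.

Section Proj.
Variables (I : finType) (e : I -> H) (oe : orthosys e).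

Lemma orthosys_bessel : bessel e.
Proof.
apply: (orthogonal_bessel Hdot) => [|i]; first exact: oe.1.
by case: (oe.2 i) => ->; rewrite ?nm0.
Qed.

Lemma proj_dot x i : dot (proj e x) (e i) = dot x (e i).
Proof.
rewrite ip_suml (bigD1 i) //= big1 ?addr0; last first.
  by move=> j ji; rewrite ipZl oe.1 // mulr0.
rewrite ipZl (ipxx Hdot); case: (oe.2 i) => ->; first by rewrite ip0r mul0r.
by rewrite expr1n rmorph1 mulr1.
Qed.

Lemma proj_lin : linear (proj e).
Proof.
move=> a x y; rewrite /proj scaler_sumr -big_split /=.
by apply: eq_bigr => i _; rewrite ipDl ipZl scalerDl scalerA.
Qed.

Lemma proj_sym x y : dot (proj e x) y = dot x (proj e y).
Proof.
rewrite ip_suml ip_sumr; apply: eq_bigr => i _.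
by rewrite ipZl ipZr mulrC -ipC.
Qed.

Lemma proj_res x i : dot (x - proj e x) (e i) = 0.
Proof. by rewrite ipBl proj_dot subrr. Qed.

Lemma proj_orth x y : (forall i, dot x (e i) = 0) -> dot x (proj e y) = 0.
Proof.
by move=> h; rewrite ip_sumr big1 // => i _; rewrite ipZr h mulr0.
Qed.

Lemma proj_idem x : proj e (proj e x) = proj e x.
Proof. by apply: eq_bigr => i _; rewrite proj_dot. Qed.

Lemma proj_pyth x : nm x ^+ 2 = nm (proj e x) ^+ 2 + nm (x - proj e x) ^+ 2.
Proof.
rewrite addrC -(pythagoras Hdot) ?subrK //.
by apply: proj_orth => i; exact: proj_res.
Qed.

Lemma proj_sqr x : nm (proj e x) ^+ 2 = \sum_i smod (dot x (e i)) ^+ 2.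
Proof.
rewrite (nm_sqr Hdot) -proj_sym proj_idem ip_suml raddf_sum /=.
by apply: eq_bigr => i _; rewrite ipZl (ipC dot (e i)) mul_conj sinjK.
Qed.

Lemma proj_res_le x : nm (x - proj e x) <= nm x.
Proof. by rewrite -sqr_le // [leRHS](proj_pyth x) lerDr sqr_ge0. Qed.

End Proj.

Definition ext (T : Type) (e : nat -> T) n (x : T) i := if i == n then x else e i.

Lemma orthosys_ext (e : nat -> H) n x : orthosys (fun i : 'I_n => e i) ->
  (forall i : 'I_n, dot x (e i) = 0) -> nm x = 1 ->
  orthosys (fun i : 'I_n.+1 => ext e n x i).
Proof.
move=> oe xe x1; have lt (i : 'I_n.+1) : i != n :> nat -> (i < n)%N.
  by move=> h; rewrite ltn_neqAle h -ltnS /=.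
split=> [i j ij|i]; rewrite /ext; last first.
  by case: eqVneq => [_|/lt h]; [right|exact: (oe.2 (Ordinal h))].
case: eqVneq => [i0|/lt i0]; case: eqVneq => [j0|/lt j0].
- by case/eqP: ij; apply: val_inj; rewrite /= i0 j0.
- exact: (xe (Ordinal j0)).
- by rewrite ipC (xe (Ordinal i0)) rmorph0.
- by apply: (oe.1 (Ordinal i0) (Ordinal j0)); apply: contraNneq ij => -[h]; apply/eqP/val_inj.
Qed.

(** Take [e] and [g] of maximal length with all |<f e_i, g_i>| >= d; the length is at most C^p /
    d^p. A pair of vectors orthogonal to them that violated the estimate could be normalised and
    appended. *)
Lemma Qle_approx_finrank (p : R) (f : H -> H) (C d : R) : 1 <= p -> linear f ->
  Qle dot p f C -> 0 < d ->
  exists (n : nat) (e g : nat -> H),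
    [/\ orthosys (fun i : 'I_n => e i), orthosys (fun i : 'I_n => g i) &
    forall x y, (forall i : 'I_n, dot x (e i) = 0) -> (forall i : 'I_n, dot y (g i) = 0) ->
      smod (dot (f x) y) <= d * (nm x * nm y)].
Proof.
move=> p1 lf hQ d0; have p0 : 0 < p by lra.
pose P n := exists e g : nat -> H,
    [/\ orthosys (fun i : 'I_n => e i), orthosys (fun i : 'I_n => g i) &
     forall i : 'I_n, d <= smod (dot (f (e i)) (g i))].
have P0 : exists n, `[< P n >].
  exists 0%N; apply/asboolP; exists (fun=> 0), (fun=> 0).
  by split; [split=> -[]|split=> -[]|case].
have Pb n : `[< P n >] -> (n <= Num.truncn (C `^ p / d `^ p))%N.
  move=> /asboolP[e [g [oe og h]]].
  have := hQ _ _ _ (orthosys_bessel oe) (orthosys_bessel og) => hs.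
  have dp : 0 < d `^ p by exact: powR_gt0.
  have : n%:R * d `^ p <= C `^ p.
    apply: le_trans hs; rewrite -[n in leLHS]card_ord mulr_natl -sumr_const.
    by apply: ler_sum => i _; apply: ler_pow => //; exact: ltW.
  by rewrite -ler_pdivlMr // => /le_truncn; rewrite natrK.
have [n Pn nmax] := ex_maxnP P0 Pb.
move: Pn => /asboolP[e [g [oe og h]]]; exists n, e, g; split=> // x y hx hy.
have [x0|xn0] := eqVneq (nm x) 0.
  by rewrite (nm_eq0 x0) (lin0 lf) ip0l smod0 nm0 mul0r mulr0.
have [y0|yn0] := eqVneq (nm y) 0.
  by rewrite (nm_eq0 y0) ip0r smod0 nm0 !mulr0.
have xp : 0 < nm x by rewrite lt_neqAle eq_sym xn0 nm_ge0.
have yp : 0 < nm y by rewrite lt_neqAle eq_sym yn0 nm_ge0.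
rewrite leNgt; apply/negP => hlt.
suff /nmax : `[< P n.+1 >] by rewrite ltnn.
have unit z : 0 < nm z -> nm (sinj k (nm z)^-1 *: z) = 1.
  by move=> z0; rewrite nmZ smod_sinj ger0_norm ?invr_ge0 // mulVf // gt_eqF.
apply/asboolP; exists (ext e n (sinj k (nm x)^-1 *: x)), (ext g n (sinj k (nm y)^-1 *: y)).
split.
- by apply: orthosys_ext => //; [move=> i; rewrite ipZl hx mulr0|exact: unit].
- by apply: orthosys_ext => //; [move=> i; rewrite ipZl hy mulr0|exact: unit].
move=> i; rewrite /ext; case: eqVneq => [_|ni]; last first.
  have lt : (i < n)%N by rewrite ltn_neqAle ni -ltnS /=.
  exact: (h (Ordinal lt)).
rewrite (linZ lf) ipZl ipZr sconj_sinj !smodM !smod_sinj !ger0_norm ?invr_ge0 //.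
rewrite mulrA -invfM ler_pdivlMl ?mulr_gt0 // mulrC.
exact: ltW.
Qed.

Lemma Qle_compact (p : R) (f : H -> H) (C : R) : 1 <= p -> bop f -> Qle dot p f C ->
  compact_operator f.
Proof.
move=> p1 bf hQ; apply: totally_bounded_compact; first exact: bf.1.
move=> d d0; have d2 : 0 < d / 2 by rewrite divr_gt0.
have [n [e [g [oe og h]]]] := Qle_approx_finrank p1 bf.1 hQ d2.
have [D D0 hD] := bop_bound bf.
pose E := proj (fun i : 'I_n => e i); pose G := proj (fun i : 'I_n => g i).
have [ys1 h1] := comb_net g n (D + 1) (divr_gt0 d2 (ltr0n _ 2)).
have [ys2 h2] := comb_net (fun i => f (e i) - G (f (e i))) n (D + 1) (divr_gt0 d2 (ltr0n _ 2)).
exists [seq y1 + y2 | y1 <- ys1, y2 <- ys2] => x x1.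
have fx : nm (f x) <= D.
  by apply: le_trans (hD x) _; rewrite ler_piMr // ltW.
have smod_le (u v : H) : nm v <= 1 -> smod (dot u v) <= nm u.
  by move=> v1; apply: le_trans (cauchy_schwarz Hdot _ _) _; rewrite ler_piMr.
have le1 (u : nat -> H) : orthosys (fun i : 'I_n => u i) -> forall i, (i < n)%N -> nm (u i) <= 1.
  by move=> ou i ni; exact: (bessel_le1 Hdot (Ordinal ni) (orthosys_bessel ou)).
pose c1 i := if (i < n)%N then dot (f x) (g i) else 0.
pose c2 i := if (i < n)%N then dot x (e i) else 0.
have [y1 ys1y hy1] : exists2 y, y \in ys1 & nm (\sum_(i < n) c1 i *: g i - y) <= d / 2 / 2.
  apply: h1 => i; rewrite /c1; case: ifPn => ni; last by rewrite smod0; lra.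
  by apply: le_trans (smod_le _ _ (le1 _ og _ ni)) _; lra.
have [y2 ys2y hy2] : exists2 y, y \in ys2 &
    nm (\sum_(i < n) c2 i *: (f (e i) - G (f (e i))) - y) <= d / 2 / 2.
  apply: h2 => i; rewrite /c2; case: ifPn => ni; last by rewrite smod0; lra.
  by apply: le_trans (smod_le _ _ (le1 _ oe _ ni)) _; lra.
exists (y1 + y2); first by apply/allpairsP; exists (y1, y2).
have e1 : \sum_(i < n) c1 i *: g i = G (f x).
  by apply: eq_bigr => i _; rewrite /c1 ltn_ord.
have lG : linear G by exact: proj_lin.
have e2 : \sum_(i < n) c2 i *: (f (e i) - G (f (e i))) = f (E x) - G (f (E x)).
  rewrite /E /proj (lin_sum bf.1) (lin_sum lG) -sumrB; apply: eq_bigr => i _.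
  by rewrite /c2 ltn_ord scalerBr (linZ bf.1) (linZ lG).
rewrite e1 in hy1; rewrite e2 in hy2.
set z := f x - E x in |- *.
have h3 : nm (f (x - E x) - G (f (x - E x))) <= d / 2.
  apply: (nm_le_dual Hdot) => [|y]; first exact: ltW.
  rewrite ipBl (proj_sym _ (f _)) -ipBr; apply: le_trans (h _ _ _ _) _.
  - by move=> i; exact: proj_res.
  - by move=> i; exact: (proj_res og).
  rewrite ler_wpM2l ?(ltW d2) //; apply: (@le_trans _ _ (1 * nm y)); last by rewrite mul1r.
  apply: ler_pM => //; last exact: proj_res_le.
  by apply: le_trans x1; exact: proj_res_le.
(* f = G f + (1 - G) f E + (1 - G) f (1 - E): the first two terms have finite rank and are covered
   by the nets, the last is small by the choice of [E] and [G]. *)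
have -> : f x - (y1 + y2) = (G (f x) - y1) + ((f (E x) - G (f (E x)) - y2) +
    (f (x - E x) - G (f (x - E x)))).
  rewrite (linB bf.1) (linB lG).
  move: (f x) (G (f x)) (f (E x)) (G (f (E x))) => a b c q.
  have -> : a - c - (b - q) = (a - b) - (c - q).
    by rewrite opprB (addrC q) addrACA (addrC (- c)) opprB.
  by rewrite (addrC (c - q - y2)) subrKA addrACA subrKC -opprD.
apply: le_trans (nmD _ _) _; have := nmD (f (E x) - G (f (E x)) - y2) (f (x - E x) - G (f (x - E x))).
lra.
Qed.

Section CP.
Variables (p : R) (p_gt1 : 1 < p).

Local Notation cp := (schatten_class dot p).
Local Notation N := (cp_norm dot p).
Let p1 : 1 <= p := ltW p_gt1.
Let p0 : 0 < p. Proof. exact: lt_trans p_gt1. Qed.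

Lemma cp_bop f : cp f -> bop f.
Proof.
by move=> [cf _]; apply: seq_compact_bop; [exact: cf.1|exact: compact_operator_seq].
Qed.

Lemma cp_norm_ge0 f : 0 <= N f.
Proof. by apply: fine_ge0; exact: Lnorm_ge0. Qed.

Lemma cp_normE f : cp f -> schatten_norm dot p f = (N f)%:E.
Proof.
move=> [_ h]; rewrite /cp_norm fineK // ge0_fin_numE //; exact: Lnorm_ge0.
Qed.

Lemma cp_sing f : cp f -> exists (s : nat -> R) (u : nat -> H), [/\ singsys dot f s u,
  (forall n, \sum_(i < n) s i `^ p <= N f `^ p) &
  forall C, 0 <= C -> (forall n, \sum_(i < n) s i `^ p <= C `^ p) -> N f <= C].
Proof.
move=> cf; have bf := cp_bop cf.
have [s [u hs]] := singsys_exists Hdot bf (compact_operator_seq cf.1).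
have sE : singular_value dot f = s.
  by apply/funext => n; exact: (singular_valueE Hdot _ bf hs).
have hN C : 0 <= C -> (N f <= C) <-> (forall n, \sum_(i < n) s i `^ p <= C `^ p).
  move=> C0; rewrite -lee_fin -cp_normE // /schatten_norm sE.
  by apply: Lnorm_leP => // n; exact: (sing_ge0 hs).
exists s, u; split=> //; first exact/(hN _ (cp_norm_ge0 f)).
by move=> C C0; exact: (hN C C0).2.
Qed.

Lemma cp_Qle f : cp f -> Qle dot p f (N f).
Proof.
move=> cf; have [s [u [hs h1 _]]] := cp_sing cf.
by apply: (singsys_Qle Hdot p1 (cp_norm_ge0 f) (cp_bop cf).1 hs h1).
Qed.

Lemma cp_intro f C : bop f -> 0 <= C -> Qle dot p f C -> cp f.
Proof.
move=> bf C0 hQ; have cf := Qle_compact p1 bf hQ.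
have [s [u hs]] := singsys_exists Hdot bf (compact_operator_seq cf).
have sE : singular_value dot f = s.
  by apply/funext => n; exact: (singular_valueE Hdot _ bf hs).
split=> //; apply: (@le_lt_trans _ _ C%:E); last exact: ltry.
rewrite /schatten_norm sE; apply/(Lnorm_leP p0 C0); first exact: (sing_ge0 hs).
by move=> n; exact: (Qle_singsys Hdot n hs hQ).
Qed.

Lemma cp_norm_le f C : cp f -> 0 <= C -> Qle dot p f C -> N f <= C.
Proof.
move=> cf C0 hQ; have [s [u [hs _ h1]]] := cp_sing cf.
by apply: h1 => // n; exact: (Qle_singsys Hdot n hs hQ).
Qed.

End CP.

End Compactness.

(** * Norm inequalities in the Schatten classes *)

Section NormAlgebra.
Variables (R : realType) (k : scalar_kind).
Local Notation K := (scalar_field R k).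
Variables (H : completeNormedModType K) (dot : {dot H for @sconj R k}).
Hypothesis Hdot : forall x : H, `|x| ^+ 2 = dot x x.
Local Notation adj := (adjoint dot).
Local Notation bessel := (bessel dot).
Implicit Types (x y z : H) (a c : K).

Variables (p : R) (p_gt1 : 1 < p).
Local Notation cp := (schatten_class dot p).
Local Notation N := (cp_norm dot p).
Let p1 : 1 <= p := ltW p_gt1.
Let p0 : 0 < p. Proof. exact: lt_trans p_gt1. Qed.
Let pn0 : p != 0. Proof. by rewrite gt_eqF. Qed.

Lemma cp_le f (C : R) : bop f -> 0 <= C -> Qle dot p f C -> cp f /\ N f <= C.
Proof.
move=> bf C0 hQ; have cf := cp_intro Hdot p_gt1 bf C0 hQ; split=> //.
exact: (cp_norm_le Hdot p_gt1 cf C0 hQ).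
Qed.

Lemma smod_le_cp f x y : cp f -> smod (dot (f x) y) <= N f * (nm x * nm y).
Proof.
move=> cf; have bf := cp_bop cf.
have [x0|xn0] := eqVneq (nm x) 0.
  by rewrite (nm_eq0 x0) (lin0 bf.1) ip0l smod0 nm0 mul0r mulr0.
have [y0|yn0] := eqVneq (nm y) 0.
  by rewrite (nm_eq0 y0) ip0r smod0 nm0 !mulr0.
have xp : 0 < nm x by rewrite lt_neqAle eq_sym xn0 nm_ge0.
have yp : 0 < nm y by rewrite lt_neqAle eq_sym yn0 nm_ge0.
have unit z : 0 < nm z -> bessel (fun _ : unit => sinj k (nm z)^-1 *: z).
  move=> z0; apply: (orthogonal_bessel Hdot) => [[] []//|_].
  by rewrite nmZ smod_sinj ger0_norm ?invr_ge0 // mulVf // gt_eqF.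
have := cp_Qle Hdot p_gt1 cf (unit x xp) (unit y yp).
rewrite (big_pred1 tt) /=; last by case.
rewrite pow_le ?cp_norm_ge0 //.
rewrite (linZ bf.1) ipZl ipZr sconj_sinj !smodM !smod_sinj !ger0_norm ?invr_ge0 //.
by rewrite mulrA -invfM ler_pdivrMl ?mulr_gt0 // mulrC.
Qed.

Lemma nm_le_cp f x : cp f -> nm (f x) <= N f * nm x.
Proof.
move=> cf; apply: (nm_le_dual Hdot) => [|y]; first by rewrite mulr_ge0 ?cp_norm_ge0.
by rewrite -mulrA; exact: smod_le_cp.
Qed.

Lemma cp_norm_eq0 f : cp f -> N f = 0 -> f = 0.
Proof.
move=> cf h; apply/funext => x; apply: nm_eq0; apply/eqP.
by rewrite eq_le nm_ge0 andbT; have := nm_le_cp x cf; rewrite h mul0r.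
Qed.

Lemma Qle0 : Qle dot p 0 0.
Proof.
move=> I e g _ _; rewrite big1 ?powR_ge0 // => i _.
by rewrite /= ip0l smod0 powR0.
Qed.

Lemma cp0 : cp 0 /\ N 0 = 0.
Proof.
have [c h] := cp_le (bop0 H) (lexx 0) Qle0; split=> //.
by apply/eqP; rewrite eq_le h cp_norm_ge0.
Qed.

Lemma Qle_comb a f g (C D : R) : 0 <= C -> 0 <= D -> Qle dot p f C -> Qle dot p g D ->
  Qle dot p (a *: f + g) (smod a * C + D).
Proof.
move=> C0 D0 hf hg I e h be bh.
apply: (@le_trans _ _ (\sum_i (smod a * smod (dot (f (e i)) (h i)) +
   smod (dot (g (e i)) (h i))) `^ p)).
  apply: ler_sum => i _; apply: ler_pow => //; first exact: ltW.
  by rewrite /= ipDl ipZl; apply: le_trans (smodD _ _) _; rewrite smodM.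
apply: sum_pow_mink => //; rewrite ?mulr_ge0 //; last exact: hg.
  by move=> i; rewrite mulr_ge0.
under eq_bigr do rewrite powRM //.
by rewrite -mulr_sumr powRM // ler_wpM2l ?powR_ge0 //; exact: hf.
Qed.

Lemma cp_comb a f g : cp f -> cp g -> cp (a *: f + g) /\ N (a *: f + g) <= smod a * N f + N g.
Proof.
move=> cf cg; apply: cp_le.
- exact: (bop_lin a (cp_bop cf) (cp_bop cg)).
- by rewrite addr_ge0 ?mulr_ge0 ?cp_norm_ge0.
by apply: Qle_comb; rewrite ?cp_norm_ge0 //; exact: (cp_Qle Hdot p_gt1).
Qed.

Lemma cpD f g : cp f -> cp g -> cp (f + g).
Proof. by move=> cf cg; have [] := cp_comb 1 cf cg; rewrite scale1r. Qed.

Lemma cp_normD f g : cp f -> cp g -> N (f + g) <= N f + N g.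
Proof. by move=> cf cg; have [_] := cp_comb 1 cf cg; rewrite scale1r smod1 mul1r. Qed.

Lemma cpZ a f : cp f -> cp (a *: f).
Proof. by move=> cf; have [] := cp_comb a cf cp0.1; rewrite addr0. Qed.

Lemma cp_normZ a f : cp f -> N (a *: f) = smod a * N f.
Proof.
have le b g : cp g -> N (b *: g) <= smod b * N g.
  by move=> cg; have [_] := cp_comb b cg cp0.1; rewrite cp0.2 !addr0.
move=> cf; have [->|a0] := eqVneq a 0; first by rewrite scale0r cp0.2 smod0 mul0r.
apply/eqP; rewrite eq_le le //=.
have m0 : 0 < smod a by rewrite lt_neqAle smod_ge0 andbT eq_sym smod_eq0.
have := le a^-1 _ (cpZ a cf); rewrite scalerA mulVf // scale1r => h.
have e : smod a * smod a^-1 = 1 by rewrite -smodM divff // smod1.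
by have := ler_wpM2l (ltW m0) h; rewrite mulrA e mul1r.
Qed.

Lemma cpN f : cp f -> cp (- f).
Proof. by move=> cf; rewrite -scaleN1r; exact: cpZ. Qed.

Lemma cp_normN f : cp f -> N (- f) = N f.
Proof. by move=> cf; rewrite -scaleN1r cp_normZ // smodN smod1 mul1r. Qed.

Lemma cpB f g : cp f -> cp g -> cp (f - g).
Proof. by move=> cf /cpN; exact: cpD. Qed.

Lemma cp_normB f g : cp f -> cp g -> N (f - g) <= N f + N g.
Proof. by move=> cf cg; rewrite -(cp_normN cg); apply: cp_normD => //; exact: cpN. Qed.

Lemma cp_norm_sub f g : cp f -> cp g -> N f <= N g + N (f - g).
Proof. by move=> cf cg; rewrite -{1}(subrKC g f); apply: cp_normD => //; exact: cpB. Qed.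

Lemma cp_sum I (r : seq I) (P : pred I) (F : I -> H -> H) : (forall i, P i -> cp (F i)) ->
  cp (\sum_(i <- r | P i) F i) /\ N (\sum_(i <- r | P i) F i) <= \sum_(i <- r | P i) N (F i).
Proof.
move=> h; elim: r => [|i r [IH1 IH2]]; first by rewrite !big_nil cp0.2; split=> //; exact: cp0.1.
rewrite !big_cons; case: ifPn => // Pi; split; first by apply: cpD => //; exact: h.
by apply: le_trans (cp_normD (h i Pi) IH1) _; rewrite lerD2l.
Qed.

Lemma cp_adj f : cp f -> cp (adj f) /\ N (adj f) = N f.
Proof.
have le g : cp g -> cp (adj g) /\ N (adj g) <= N g.
  move=> cg; have bg := cp_bop cg.
  apply: cp_le; [exact: adj_bop|exact: cp_norm_ge0|].
  move=> I e h be bh; have := cp_Qle Hdot p_gt1 cg bh be.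
  by under eq_bigr do rewrite adjP // smod_ipC.
move=> cf; have [c1 n1] := le f cf; split=> //.
apply/eqP; rewrite eq_le n1 /=; have [_] := le _ c1.
by rewrite adjK //; exact: cp_bop cf.
Qed.

Definition contraction (a : H -> H) := linear a /\ forall x, nm (a x) <= nm x.

Lemma contraction_bop (a : H -> H) : contraction a -> bop a.
Proof. by move=> [la ha]; split=> //; exists 1 => x; rewrite mul1r. Qed.

Lemma contraction_bessel (I : finType) (e : I -> H) (a : H -> H) : contraction a -> bessel e -> bessel (a \o e).
Proof.
move=> ca be; have ba := contraction_bop ca.
apply: (bessel_comp be (b' := adj a)) => [x y|x]; first by rewrite adjP'.
have := adj_le Hdot ba ler01 _ x; rewrite mul1r; apply=> y.
by rewrite mul1r; exact: ca.2.
Qed.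

Lemma contraction_adj (a : H -> H) : contraction a -> contraction (adj a).
Proof.
move=> ca; have ba := contraction_bop ca; split; first exact: (adj_bop Hdot ba).1.
move=> x; have := adj_le Hdot ba ler01 _ x; rewrite mul1r; apply=> y.
by rewrite mul1r; exact: ca.2.
Qed.

Lemma cp_ideal (a f b : H -> H) : contraction a -> cp f -> contraction b ->
  cp (a \o f \o b) /\ N (a \o f \o b) <= N f.
Proof.
move=> ca cf cb; have bf := cp_bop cf; have ba := contraction_bop ca.
apply: cp_le.
- by apply: bop_comp (contraction_bop cb); exact: bop_comp.
- exact: cp_norm_ge0.
move=> I e g be bg; have := cp_Qle Hdot p_gt1 cf (contraction_bessel cb be)
  (contraction_bessel (contraction_adj ca) bg).
by under [X in _ -> X <= _]eq_bigr => i _ do rewrite /= adjP //.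
Qed.

Lemma contraction_id : contraction id.
Proof. by []. Qed.

Lemma cp_compl (a f : H -> H) : contraction a -> cp f -> cp (a \o f) /\ N (a \o f) <= N f.
Proof. by move=> ca cf; exact: (cp_ideal ca cf contraction_id). Qed.

Lemma cp_compr f b : cp f -> contraction b -> cp (f \o b) /\ N (f \o b) <= N f.
Proof. by move=> cf cb; exact: (cp_ideal contraction_id cf cb). Qed.

Definition rank1 (v w : H) (x : H) := dot x v *: w.

Lemma rank1_lin v w : linear (rank1 v w).
Proof. by move=> a x y; rewrite /rank1 ipDl ipZl scalerDl scalerA. Qed.

Lemma cp_rank1 v w : cp (rank1 v w) /\ N (rank1 v w) <= nm v * nm w.
Proof.
apply: cp_le; last 1 first.
- pose un z := sinj k (nm z)^-1 *: z.
  have unE z : z = sinj k (nm z) *: un z.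
    have [z0|z0] := eqVneq (nm z) 0; first by rewrite z0 rmorph0 scale0r (nm_eq0 z0).
    by rewrite scalerA -rmorphM mulfV // rmorph1 scale1r.
  have bun z : bessel (fun _ : unit => un z).
    apply: (orthogonal_bessel Hdot) => [[] []//|_].
    rewrite nmZ smod_sinj ger0_norm ?invr_ge0 //.
    by have [->|z0] := eqVneq (nm z) 0; [rewrite mulr0|rewrite mulVf].
  apply: (@Qle_finrep _ _ _ _ Hdot _ _ (fun=> nm v * nm w) (fun=> un v) (fun=> un w)) => //.
  + by move=> _; rewrite mulr_ge0.
  + move=> x; rewrite (big_pred1 tt); last by case.
    rewrite /rank1 {1}(unE v) {1}(unE w) ipZr sconj_sinj scalerA rmorphM.
    by congr (_ *: _); rewrite mulrAC.
  by rewrite (big_pred1 tt) //; case.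
- split; first exact: rank1_lin.
  exists (nm v * nm w) => x; rewrite nmZ mulrAC ler_wpM2r // mulrC.
  exact: cauchy_schwarz.
by rewrite mulr_ge0.
Qed.

(** The last premise makes [M] the least bound, as [cp_sing] provides it; the increasing partial
    sums then converge to M^p. *)
Lemma sum_pow_sup (s : nat -> R) (M : R) : 0 <= M -> (forall n, 0 <= s n) ->
  (forall n, \sum_(i < n) s i `^ p <= M `^ p) ->
  (forall C, 0 <= C -> (forall n, \sum_(i < n) s i `^ p <= C `^ p) -> M <= C) ->
  null (fun n => M `^ p - \sum_(i < n) s i `^ p).
Proof.
move=> M0 s0 h1 h2 e e0.
have mono n m : (n <= m)%N -> \sum_(i < n) s i `^ p <= \sum_(i < m) s i `^ p.
  move=> le; rewrite -!(big_mkord xpredT (fun i => s i `^ p)).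
  rewrite [leRHS](@big_cat_nat _ _ _ n) //= lerDl.
  by apply: sumr_ge0 => i _; exact: powR_ge0.
suff [n hn] : exists n, M `^ p - e <= \sum_(i < n) s i `^ p.
  exists n => m nm; rewrite ger0_norm ?subr_ge0 // lerBlDr addrC -lerBlDr.
  exact: le_trans hn (mono _ _ nm).
apply: contrapT => hn.
have hlt n : \sum_(i < n) s i `^ p <= M `^ p - e.
  by rewrite leNgt; apply/negP => h; apply: hn; exists n; exact: ltW.
have Me : 0 <= M `^ p - e by have := hlt 0%N; rewrite big_ord0.
have := h2 ((M `^ p - e) `^ p^-1) (powR_ge0 _ _).
rewrite powVK // => /(_ hlt).
rewrite -(pow_le p0 M0 (powR_ge0 _ _)) powVK //; lra.
Qed.

(** The model is a family of mutually orthogonal projections; only what pinching uses is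
    recorded. *)
Definition pfam (J : finType) (A : J -> H -> H) := forall j,
  [/\ linear (A j), (forall x y, dot (A j x) y = dot x (A j y)) &
      forall x, \sum_j nm (A j x) ^+ 2 <= nm x ^+ 2].

Lemma pfam_bessel (I J : finType) (A : J -> H -> H) (e : J -> I -> H) : pfam A ->
  (forall j, bessel (e j)) -> bessel (fun ij : J * I => A ij.1 (e ij.1 ij.2)).
Proof.
move=> pA be x; rewrite -(pair_bigA _ (fun j i => smod (dot x (A j (e j i))) ^+ 2)) /=.
have [/card0_eq J0|/card_gt0P[j0 _]] := posnP #|J|.
  by rewrite big1 ?sqr_ge0 // => j; have := J0 j.
have [_ _ h] := pA j0; apply: le_trans (h x); apply: ler_sum => j _.
have [_ sA _] := pA j; under eq_bigr do rewrite -sA.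
exact: be.
Qed.

Lemma pfam_contraction (J : finType) (A : J -> H -> H) : pfam A -> forall j, contraction (A j).
Proof.
move=> pA j; have [lA _ h] := pA j; split=> // x; rewrite -sqr_le //.
by apply: le_trans (h x); rewrite (bigD1 j) //= lerDl; apply: sumr_ge0 => i _; rewrite sqr_ge0.
Qed.

(** Singular vectors of all the f_j, moved by [A] and [B], form Bessel families that represent the
    sum, so [Qle_finrep] applies to the joint list of singular values. *)
Lemma cp_block_sum (J : finType) (A B : J -> H -> H) (f : J -> H -> H) (C : R) :
  pfam A -> pfam B -> (forall j, cp (f j)) -> (forall j x, f j x = A j (f j (B j x))) ->
  0 <= C -> \sum_j N (f j) `^ p <= C `^ p ->
  cp (\sum_j f j) /\ N (\sum_j f j) <= C.
Proof.
move=> pA pB cf hf C0 hC.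
have [s hs] := choice (fun j => cp_sing Hdot p_gt1 (cf j)).
have {hs}[u hs] := choice hs.
have [cs _] := cp_sum (index_enum J) (fun j (_ : true) => cf j).
split=> //; apply: cp_norm_le => //.
pose g n x := \sum_(jm : J * 'I_n) (sinj k (s jm.1 jm.2) * dot x (B jm.1 (u jm.1 jm.2))) *:
   A jm.1 (left_sing (f jm.1) (s jm.1) (u jm.1) jm.2).
apply: (@Qle_lim _ _ _ _ _ _ g) => // [x y|n].
  have sn : null (fun n => \sum_j (nm x * nm y) * s j n).
    apply: null_sum => j _; apply: nullZ; have [h1 h2 _] := hs j.
    exact: (sing_null_lim p0 h1 h2).
  apply: null_squeeze sn => n; rewrite ger0_norm // -ipBl.
  apply: le_trans (cauchy_schwarz Hdot _ _) _.
  have gE : g n x = \sum_j A j (\sum_(i < n) dot (B j x) (u j i) *: f j (u j i)).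
    rewrite /g -(pair_bigA _ (fun j (i : 'I_n) => (sinj k (s j i) * dot x (B j (u j i))) *:
      A j (left_sing (f j) (s j) (u j) i))) /=; apply: eq_bigr => j _.
    have [lA _ _] := pA j; have [_ sB _] := pB j; have [h1 _ _] := hs j.
    rewrite (lin_sum lA); apply: eq_bigr => i _.
    by rewrite [in RHS](linZ lA) [in RHS](left_singE Hdot h1) [A j (sinj k _ *: _)](linZ lA) scalerA sB mulrC.
  have sE : (\sum_j f j) x = \sum_j f j x.
    by elim/big_rec2: _ => //= j y1 y2 _ <-.
  rewrite nm_distC sE gE -sumrB.
  apply: (@le_trans _ _ ((\sum_j nm x * s j n) * nm y)).
    rewrite ler_wpM2r //; apply: le_trans (nm_sum _ _ _) _; apply: ler_sum => j _.
    have [lA _ _] := pA j; have [h1 _ _] := hs j.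
    rewrite hf -(linB lA); apply: le_trans ((pfam_contraction pA j).2 _) _.
    apply: le_trans (sing_tail Hdot n (B j x) (cp_bop (cf j)).1 h1) _.
    rewrite mulrC ler_wpM2r ?(sing_ge0 h1) //.
    exact: (pfam_contraction pB j).2.
  by rewrite mulr_suml; apply: ler_sum => j _; rewrite mulrAC.
apply: (@Qle_finrep _ _ _ _ Hdot _ _ (fun jm : J * 'I_n => s jm.1 jm.2)
  (fun jm => B jm.1 (u jm.1 jm.2)) (fun jm => A jm.1 (left_sing (f jm.1) (s jm.1) (u jm.1) jm.2))) => //.
- by move=> [j i]; have [h1 _ _] := hs j; exact: (sing_ge0 h1).
- apply: (pfam_bessel (e := fun j (i : 'I_n) => u j i)) => // j.
  by have [h1 _ _] := hs j; exact: (sing_bessel Hdot n h1).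
- apply: (pfam_bessel (e := fun j (i : 'I_n) => left_sing (f j) (s j) (u j) i)) => // j.
  by have [h1 _ _] := hs j; exact: (left_sing_bessel Hdot n h1).
rewrite -(pair_bigA _ (fun j (i : 'I_n) => s j i `^ p)) /=.
apply: le_trans hC; apply: ler_sum => j _.
by have [_ h2 _] := hs j; exact: h2.
Qed.

(** Conversely, the joint list of singular vectors of the blocks is an admissible pair of test
    families for [f]. *)
Lemma cp_pinch (J : finType) (A B : J -> H -> H) f : pfam A -> pfam B -> cp f ->
  \sum_j N (A j \o f \o B j) `^ p <= N f `^ p.
Proof.
move=> pA pB cf.
have cj j : cp (A j \o f \o B j).
  by have [] := cp_ideal (pfam_contraction pA j) cf (pfam_contraction pB j).
have [s hs] := choice (fun j => cp_sing Hdot p_gt1 (cj j)).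
have {hs}[u hs] := choice hs.
pose S j n := \sum_(i < n) s j i `^ p.
have hS n : \sum_j S j n <= N f `^ p.
  have := cp_Qle Hdot p_gt1 cf
    (pfam_bessel pB (fun j => sing_bessel Hdot n (let: And3 h _ _ := hs j in h)))
    (pfam_bessel pA (fun j => left_sing_bessel Hdot n (let: And3 h _ _ := hs j in h))).
  rewrite -(pair_bigA _ (fun j (i : 'I_n) => smod (dot (f (B j (u j i)))
     (A j (left_sing (A j \o f \o B j) (s j) (u j) i))) `^ p)) /=.
  apply: le_trans; apply: ler_sum => j _; apply: ler_sum => i _.
  have [_ sA _] := pA j; have [h1 _ _] := hs j.
  by rewrite -sA -[A j _]/((A j \o f \o B j) _) (dot_left_sing Hdot _ h1) smod_sinj ger0_norm ?(sing_ge0 h1).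
have lim j : null (fun n => N (A j \o f \o B j) `^ p - S j n).
  have [h1 h2 h3] := hs j.
  by apply: sum_pow_sup => //; [exact: cp_norm_ge0|exact: (sing_ge0 h1)].
apply: (le_null_lim (null_sum (index_enum J) (fun j (_ : true) => lim j))) => n.
by rewrite sumrB -lerBlDr opprB subrKC; exact: hS.
Qed.

End NormAlgebra.

(** * Splitting inequalities on the two sides of p = 2 *)

Section Inequalities.
Variables (R : realType) (k : scalar_kind).
Local Notation K := (scalar_field R k).
Variables (H : completeNormedModType K) (dot : {dot H for @sconj R k}).
Hypothesis Hdot : forall x : H, `|x| ^+ 2 = dot x x.
Local Notation adj := (adjoint dot).
Local Notation bessel := (bessel dot).
Implicit Types (x y : H) (a c : K) (f g z : H -> H).

Variables (p : R) (p_gt1 : 1 < p).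
Local Notation cp := (schatten_class dot p).
Local Notation N := (cp_norm dot p).
Let p1 : 1 <= p := ltW p_gt1.
Let p0 : 0 < p. Proof. exact: lt_trans p_gt1. Qed.
Let pn0 : p != 0. Proof. by rewrite gt_eqF. Qed.

Lemma sing_sum_sqr f s (u : nat -> H) n x : singsys dot f s u ->
  nm (\sum_(i < n) dot x (u i) *: f (u i)) ^+ 2 =
  \sum_(i < n) s i ^+ 2 * smod (dot x (u i)) ^+ 2.
Proof.
move=> hs; rewrite (nm_sqr Hdot) ip_suml raddf_sum /=; apply: eq_bigr => i _.
rewrite ipZl ip_sumr (bigD1 i) //= big1 ?addr0; last first.
  by move=> j ji; rewrite ipZr (sing_dot hs) 1?eq_sym ?mulr0.
by rewrite ipZr (ipxx Hdot) (sing_nm Hdot hs) mulrA mul_conj mulrC sreZ sinjK.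
Qed.

Lemma sing_lower f s (u : nat -> H) n x : linear f -> singsys dot f s u ->
  \sum_(i < n) s i ^+ 2 * smod (dot x (u i)) ^+ 2 <= nm (f x) ^+ 2.
Proof.
move=> lf hs; rewrite -(sing_sum_sqr _ _ hs); set y := \sum_(i < n) _.
have h j : (j < n)%N -> dot (f x - y) (f (u j)) = 0.
  move=> jn; rewrite ipBl ip_suml (bigD1 (Ordinal jn)) //= big1 ?addr0; last first.
    by move=> i ij; rewrite ipZl (sing_dot hs) ?mulr0.
  rewrite ipZl (ipxx Hdot) (sing_nm Hdot hs) (ipC dot (f x)) (sing_eq hs) rmorphM /= sconj_sinj -ipC mulrC.
  by rewrite subrr.
have o : dot (f x - y) y = 0.
  by rewrite ip_sumr big1 // => i _; rewrite ipZr h // mulr0.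
by rewrite -[f x](subrK y) (pythagoras Hdot o) lerDr sqr_ge0.
Qed.

Lemma sing_orthosys f s (u : nat -> H) n : singsys dot f s u ->
  orthosys dot (fun i : 'I_n => u i).
Proof.
move=> hs; split=> [i j ij|i]; first exact: (sing_orth hs).
have [s0|s0] := eqVneq (s i) 0; first by left; exact: (sing_null hs).
by right; apply: (sing_unit hs); rewrite lt_neqAle eq_sym s0 (sing_ge0 hs).
Qed.

Lemma sing_range_tail f s (u : nat -> H) n (z : H) : bop f -> singsys dot f s u ->
  nm (adj f z - proj dot (fun i : 'I_n => u i) (adj f z)) <= s n * nm z.
Proof.
move=> bf hs; have ou := sing_orthosys n hs; set w := adj f z.
set r := w - _.
have ru i : (i < n)%N -> dot r (u i) = 0 by move=> ni; exact: (proj_res Hdot ou w (Ordinal ni)).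
have h : nm r ^+ 2 <= s n * nm z * nm r.
  rewrite (nm_sqr Hdot) {1}/r ipBl (ipC dot (proj _ _ _)) (proj_orth _ (fun i : 'I_n => ru i (ltn_ord i))).
  rewrite rmorph0 subr0 adjP' //.
  apply: le_trans (ler_norm _) _; apply: le_trans (sre_le_smod _) _.
  apply: le_trans (cauchy_schwarz Hdot _ _) _; rewrite (mulrC (s n)) -mulrA ler_wpM2l //.
  exact: (sing_max hs).
have [->|r0] := eqVneq (nm r) 0; first by rewrite mulr_ge0 ?(sing_ge0 hs).
by move: h; rewrite expr2 ler_pM2r // lt_neqAle eq_sym r0 nm_ge0.
Qed.

(** Parseval's identity: the right singular vectors are complete in the closure of the range of
    [adj f]. *)
Lemma sing_range f s (u : nat -> H) (z : H) : bop f -> singsys dot f s u -> null s ->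
  null (fun n => nm (adj f z) ^+ 2 - \sum_(i < n) smod (dot (adj f z) (u i)) ^+ 2).
Proof.
move=> bf hs s0.
apply: null_squeeze (nullZ (nm z ^+ 2 * s 0%N) s0) => n.
have ou := sing_orthosys n hs.
rewrite -(proj_sqr Hdot ou) (proj_pyth Hdot ou (adj f z)) addrAC subrr add0r ger0_norm ?sqr_ge0 //.
apply: le_trans (_ : (s n * nm z) ^+ 2 <= _).
  by rewrite sqr_le ?mulr_ge0 ?(sing_ge0 hs) //; exact: sing_range_tail.
rewrite exprMn mulrC -mulrA ler_wpM2l ?sqr_ge0 // expr2 ler_wpM2r ?(sing_ge0 hs) //.
exact: (sing_mono hs).
Qed.

Lemma cp_sing_null f s (u : nat -> H) : singsys dot f s u ->
  (forall n, \sum_(i < n) s i `^ p <= N f `^ p) -> null s.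
Proof. by move=> hs; exact: (sing_null_lim p0 hs). Qed.

(** |z e_i|^2 is a sum of s_j^2 with weights |<e_i, u_j>|^2; Jensen's inequality for the convex
    t^(p/2), then summation over i. *)
Lemma sum_pow_nm_le (I : finType) (e : I -> H) z : 2 <= p -> cp z -> bessel e ->
  \sum_i nm (z (e i)) `^ p <= N z `^ p.
Proof.
move=> p2 cz be; have [s [u [hs h1 _]]] := cp_sing Hdot p_gt1 cz.
have s0 := sing_ge0 hs; have lz := (cp_bop cz).1.
apply: (@sum_pow_lim _ _ _ _ _ s) => //; [exact: cp_norm_ge0|exact: (cp_sing_null hs h1)|].
move=> n; exists (fun i => nm (\sum_(j < n) dot (e i) (u j) *: z (u j))); split=> // [|i]; last first.
  apply: le_trans (nm_sub (\sum_(j < n) dot (e i) (u j) *: z (u j)) _) _; rewrite lerD2l.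
  apply: le_trans (sing_tail Hdot n (e i) lz hs) _.
  by rewrite ler_piMr //; exact: (bessel_le1 Hdot i be).
apply: le_trans (h1 n).
apply: (@le_trans _ _ (\sum_i \sum_(j < n) smod (dot (e i) (u j)) ^+ 2 * s j `^ p)).
  apply: ler_sum => i _; rewrite -sqr_pow // (sing_sum_sqr _ _ hs).
  have q1 : 1 <= p / 2 by lra.
  have w1 : \sum_(j < n) smod (dot (e i) (u j)) ^+ 2 <= 1.
    apply: le_trans (sing_bessel Hdot n hs (e i)) _.
    by rewrite expr_le1 //; exact: (bessel_le1 Hdot i be).
  under eq_bigr do rewrite mulrC.
  apply: le_trans (jensen_ge1 q1 _ _ w1) _.
  - by move=> j; rewrite sqr_ge0.
  - by move=> j; rewrite sqr_ge0.
  by under eq_bigr do rewrite sqr_pow //.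
rewrite exchange_big /=; apply: ler_sum => j _; rewrite -mulr_suml ler_piMl ?powR_ge0 //.
under eq_bigr do rewrite smod_ipC.
by apply: le_trans (be (u j)) _; rewrite expr_le1 //; exact: (sing_le1 hs).
Qed.

(** The reverse of [sum_pow_nm_le], from concavity of t^(p/2). Now the weights must exhaust the mass
    of each u_j, hence the completeness premise on the range of [adj z]. *)
Lemma cp_norm_le_sum z (I : nat -> finType) (e : forall n, I n -> H) (C : R) (d : nat -> R) :
  p <= 2 -> cp z -> 0 <= C -> null d -> (forall n, bessel (e n)) ->
  (forall n, \sum_i nm (z (e n i)) `^ p <= C `^ p + d n) ->
  (forall w, null (fun n => nm (adj z w) ^+ 2 - \sum_i smod (dot (adj z w) (e n i)) ^+ 2)) ->
  N z <= C.
Proof.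
move=> p2 cz C0 d0 be he hc; have [s [u [hs _ h2]]] := cp_sing Hdot p_gt1 cz.
have s0 := sing_ge0 hs; have bz := cp_bop cz; have lz := bz.1.
apply: h2 => // m.
(* A singular vector with positive singular value lies in the range of [adj z], where completeness
   is assumed. *)
have uE j : 0 < s j -> u j = adj z (sinj k (s j ^+ 2)^-1 *: z (u j)).
  move=> sj; apply: (ip_extr Hdot) => y; rewrite -adjP // ipZr (ipC dot (z y)) (sing_eq hs) rmorphM /=.
  by rewrite -ipC !sconj_sinj mulrA -rmorphM mulVf ?rmorph1 ?mul1r // gt_eqF // exprn_gt0.
have h n : \sum_(j < m) s j `^ p * \sum_(i : I n) smod (dot (u j) (e n i)) ^+ 2 <= C `^ p + d n.
  apply: le_trans (he n); under eq_bigr do rewrite mulr_sumr.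
  rewrite exchange_big /=; apply: ler_sum => i _.
  rewrite -sqr_pow //.
  apply: le_trans (_ : (\sum_(j < m) smod (dot (e n i) (u j)) ^+ 2 * s j ^+ 2) `^ (p / 2) <= _); last first.
    apply: ler_pow; first by rewrite divr_ge0 // ltW.
      by apply: sumr_ge0 => j _; rewrite mulr_ge0 ?sqr_ge0.
    by apply: le_trans (sing_lower m (e n i) lz hs); under eq_bigr do rewrite mulrC.
  have q0 : 0 < p / 2 by rewrite divr_gt0.
  have q1 : p / 2 <= 1 by lra.
  apply: le_trans (jensen_le1 q0 q1 _ _ _).
  - under eq_bigr do rewrite mulrC smod_ipC.
    by under [X in _ <= X]eq_bigr do rewrite sqr_pow //.
  - by move=> j; rewrite sqr_ge0.
  - by move=> j; rewrite sqr_ge0.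
  apply: le_trans (sing_bessel Hdot m hs (e n i)) _.
  by rewrite expr_le1 //; exact: (bessel_le1 Hdot i (be n)).
have lim : null (fun n => d n + \sum_(j < m)
    s j `^ p * (1 - \sum_(i : I n) smod (dot (u j) (e n i)) ^+ 2)).
  apply: nullD => //; apply: null_sum => j _.
  have [sj0|sj0] := eqVneq (s j) 0.
    by apply: null_ext (@null0 R) => n; rewrite sj0 powR0 // mul0r.
  have sj : 0 < s j by rewrite lt_neqAle eq_sym sj0 s0.
  apply: nullZ; have := hc (sinj k (s j ^+ 2)^-1 *: z (u j)).
  by rewrite -uE // (sing_unit hs) // expr1n.
apply: (le_null_lim lim) => n; rewrite addrA.
under [X in _ <= _ + X]eq_bigr do rewrite mulrBr mulr1.
by rewrite sumrB addrCA lerDl subr_ge0; exact: h.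
Qed.

Definition projection (E : H -> H) :=
  [/\ linear E, (forall x y, dot (E x) y = dot x (E y)) & forall x, E (E x) = E x].

Definition compl (E : H -> H) x := x - E x.

Lemma compl_projection E : projection E -> projection (compl E).
Proof.
move=> [lE sE iE]; split=> [a x y|x y|x]; rewrite /compl.
- by rewrite lE opprD addrACA scalerBr.
- by rewrite ipBl ipBr sE.
by rewrite (linB lE) iE subrr subr0.
Qed.

Lemma projection_pyth E x : projection E -> nm x ^+ 2 = nm (E x) ^+ 2 + nm (compl E x) ^+ 2.
Proof.
move=> [lE sE iE]; rewrite -(pythagoras Hdot) ?subrKC //.
by rewrite ipBr -sE iE subrr.
Qed.

Lemma projection_contraction E : projection E -> contraction E.
Proof.
move=> pE; split=> [|x]; first by case: pE.
by rewrite -sqr_le // (projection_pyth x pE) lerDl sqr_ge0.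
Qed.

Lemma projection_adj E : projection E -> adj E = E.
Proof. by move=> [_ sE _]; apply: (adj_uniq Hdot) => x y; rewrite sE. Qed.

Lemma bessel_union (I J : finType) (e : I -> H) (g : J -> H) E : projection E ->
  bessel e -> bessel g ->
  bessel (fun ij : I + J => match ij with inl i => E (e i) | inr j => compl E (g j) end).
Proof.
move=> pE be bg x; have [_ sE _] := pE; have [_ sF _] := compl_projection pE.
rewrite big_sumType /= (projection_pyth x pE).
under eq_bigr do rewrite -sE; under [X in _ + X <= _]eq_bigr do rewrite -sF.
by apply: lerD.
Qed.

(** Test with the singular vectors of [z \o E] and [z \o compl E], cut by [E] and its complement:
    together they are complete for the range of [adj z]. *)
Lemma split_le2 z E : p <= 2 -> cp z -> projection E ->
  N z `^ p <= N (z \o E) `^ p + N (z \o compl E) `^ p.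
Proof.
move=> p2 cz pE; have pF := compl_projection pE.
have [cz1 _] := cp_compr Hdot p_gt1 cz (projection_contraction pE).
have [cz2 _] := cp_compr Hdot p_gt1 cz (projection_contraction pF).
have [s1 [u1 [h1 l1 _]]] := cp_sing Hdot p_gt1 cz1.
have [s2 [u2 [h2 l2 _]]] := cp_sing Hdot p_gt1 cz2.
set D := _ + _; have D0 : 0 <= D by rewrite addr_ge0 ?powR_ge0.
rewrite -[D](powVK pn0) //; apply: ler_pow; rewrite ?cp_norm_ge0 ?(ltW p0) //.
pose e n (ij : 'I_n + 'I_n) := match ij with inl i => E (u1 i) | inr j => compl E (u2 j) end.
apply: (@cp_norm_le_sum z (fun n => ('I_n + 'I_n)%type) e _ (fun=> 0)) => //.
- exact: powR_ge0.
- exact: null0.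
- by move=> n; apply: bessel_union => //; [exact: (sing_bessel Hdot n h1)|exact: (sing_bessel Hdot n h2)].
- move=> n; rewrite addr0 powVK // big_sumType /=.
  apply: lerD; [apply: le_trans (l1 n)|apply: le_trans (l2 n)]; apply: ler_sum => i _.
    by rewrite -[z _]/((z \o E) _) (sing_nm Hdot h1).
  by rewrite -[z _]/((z \o compl E) _) (sing_nm Hdot h2).
move=> w; have bz := cp_bop cz.
have a1 : adj (z \o E) w = E (adj z w).
  by rewrite (adj_comp Hdot bz (contraction_bop (projection_contraction pE))) (projection_adj pE).
have a2 : adj (z \o compl E) w = compl E (adj z w).
  by rewrite (adj_comp Hdot bz (contraction_bop (projection_contraction pF))) (projection_adj pF).
have r1 := sing_range w (cp_bop cz1) h1 (cp_sing_null h1 l1).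
have r2 := sing_range w (cp_bop cz2) h2 (cp_sing_null h2 l2).
rewrite a1 in r1; rewrite a2 in r2.
apply: null_ext (nullD r1 r2) => n.
rewrite (projection_pyth (adj z w) pE) big_sumType /= addrACA -opprD.
have [_ sE _] := pE; have [_ sF _] := pF.
congr (_ - (_ + _)); apply: eq_bigr => i _; [by rewrite sE|by rewrite sF].
Qed.

(** For the adjoint, s_i^2 is the sum of the squared norms of two orthogonal components; Minkowski's
    inequality with exponent p / 2 separates them. *)
Lemma split_ge2 z E : 2 <= p -> cp z -> projection E ->
  N z ^+ 2 <= N (z \o E) ^+ 2 + N (z \o compl E) ^+ 2.
Proof.
move=> p2 cz pE; have pF := compl_projection pE.
have cE := projection_contraction pE; have cF := projection_contraction pF.
have [cz' nz'] := cp_adj Hdot p_gt1 cz.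
have [cz1 _] := cp_compr Hdot p_gt1 cz cE; have [cz1' nz1'] := cp_adj Hdot p_gt1 cz1.
have [cz2 _] := cp_compr Hdot p_gt1 cz cF; have [cz2' nz2'] := cp_adj Hdot p_gt1 cz2.
rewrite -nz' -nz1' -nz2'.
have aE : adj (z \o E) = E \o adj z.
  by rewrite (adj_comp Hdot (cp_bop cz) (contraction_bop cE)) (projection_adj pE).
have aF : adj (z \o compl E) = compl E \o adj z.
  by rewrite (adj_comp Hdot (cp_bop cz) (contraction_bop cF)) (projection_adj pF).
rewrite aE in cz1' *; rewrite aF in cz2' *.
have [s [v [hs _ h2]]] := cp_sing Hdot p_gt1 cz'.
set D := _ + _; have D0 : 0 <= D by rewrite addr_ge0 ?sqr_ge0.
suff : N (adj z) <= Num.sqrt D.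
  by move=> h; rewrite -(sqr_sqrtr D0) sqr_le ?cp_norm_ge0 ?sqrtr_ge0.
apply: h2 => [|n]; first exact: sqrtr_ge0.
rewrite -sqr_pow ?sqrtr_ge0 // sqr_sqrtr //.
under eq_bigr => i _ do rewrite -(sing_nm Hdot hs) -sqr_pow // (projection_pyth _ pE).
apply: sum_pow_mink; rewrite ?sqr_ge0 //; first by lra.
- by move=> i; rewrite sqr_ge0.
- by move=> i; rewrite sqr_ge0.
- rewrite sqr_pow ?cp_norm_ge0 //; under eq_bigr do rewrite sqr_pow //.
  exact: (sum_pow_nm_le p2 cz1' (sing_bessel Hdot n hs)).
rewrite sqr_pow ?cp_norm_ge0 //; under eq_bigr do rewrite sqr_pow //.
exact: (sum_pow_nm_le p2 cz2' (sing_bessel Hdot n hs)).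
Qed.

(** The exponent for which splitting along a projection holds on both sides of 2; that it exceeds 1
    is what makes means decay. *)
Definition rexp := Num.min p 2.

Lemma rexp_gt1 : 1 < rexp.
Proof. by rewrite lt_min p_gt1 /= ltr1n. Qed.

Lemma split_r z E : cp z -> projection E ->
  N z `^ rexp <= N (z \o E) `^ rexp + N (z \o compl E) `^ rexp.
Proof.
move=> cz pE; rewrite /rexp /Num.min; case: ifPn => [/ltW h|]; first exact: split_le2.
by rewrite -leNgt => h; rewrite !powR_mulrn ?cp_norm_ge0 //; exact: split_ge2.
Qed.

Lemma line_projection (u : H) : nm u = 1 -> projection (rank1 dot u u).
Proof.
move=> u1; split=> [|x y|x]; first exact: rank1_lin.
- by rewrite ipZl ipZr mulrC -ipC.
by rewrite /rank1 ipZl (ipxx Hdot) u1 expr1n rmorph1 mulr1.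
Qed.

Lemma line_split_le2 z (u : H) : p <= 2 -> cp z -> nm u = 1 ->
  N z `^ p <= nm (z u) `^ p + N (z \o compl (rank1 dot u u)) `^ p.
Proof.
move=> p2 cz u1; apply: le_trans (split_le2 p2 cz (line_projection u1)) _.
rewrite lerD2r; apply: ler_pow; rewrite ?cp_norm_ge0 ?(ltW p0) //.
have -> : z \o rank1 dot u u = rank1 dot u (z u).
  by apply/funext => x /=; rewrite /rank1 (linZ (cp_bop cz).1).
by apply: le_trans (cp_rank1 Hdot p_gt1 u (z u)).2 _; rewrite u1 mul1r.
Qed.

(** The vector u together with the singular vectors of the remainder, projected off u, is a test
    family for [sum_pow_nm_le]. *)
Lemma line_split_ge2 z (u : H) : 2 <= p -> cp z -> nm u = 1 ->
  nm (z u) `^ p + N (z \o compl (rank1 dot u u)) `^ p <= N z `^ p.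
Proof.
move=> p2 cz u1; have pE := line_projection u1; have pF := compl_projection pE.
have [cz2 _] := cp_compr Hdot p_gt1 cz (projection_contraction pF).
have [s [v [hs h1 h2]]] := cp_sing Hdot p_gt1 cz2.
apply: (le_null_lim (sum_pow_sup p_gt1 (cp_norm_ge0 _ _ _) (sing_ge0 hs) h1 h2)) => n.
have bu : bessel (fun _ : unit => u).
  by apply: (orthogonal_bessel Hdot) => [[] []//|_]; rewrite u1.
have := sum_pow_nm_le p2 cz (bessel_union pE bu (sing_bessel Hdot n hs)).
rewrite big_sumType /= (big_pred1 tt); last by case.
have -> : rank1 dot u u u = u by rewrite /rank1 (ipxx Hdot) u1 expr1n rmorph1 scale1r.
have -> : \sum_(i < n) nm (z (compl (rank1 dot u u) (v i))) `^ p = \sum_(i < n) s i `^ p.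
  by apply: eq_bigr => i _; rewrite -[z _]/((z \o compl (rank1 dot u u)) _) (sing_nm Hdot hs).
by move: (nm _ `^ p) (N z `^ p) (N _ `^ p) (\sum_(i < n) _) => a b c d h; clear -h; lra.
Qed.

End Inequalities.

Lemma bessel_arith (R : realType) (A B C : R) : 0 <= A + C - 2 * B -> C <= B -> B <= A.
Proof. by move=> *; lra. Qed.

(** * Clarkson's inequality and a strict splitting for p <= 2 *)

Section Clarkson.
Variables (R : realType) (k : scalar_kind).
Local Notation K := (scalar_field R k).
Variables (H : completeNormedModType K) (dot : {dot H for @sconj R k}).
Hypothesis Hdot : forall x : H, `|x| ^+ 2 = dot x x.
Local Notation adj := (adjoint dot).
Local Notation bessel := (bessel dot).
Implicit Types (x y : H) (f g z : H -> H).

Variables (p : R) (p_gt1 : 1 < p).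
Local Notation cp := (schatten_class dot p).
Local Notation N := (cp_norm dot p).
Let p1 : 1 <= p := ltW p_gt1.
Let p0 : 0 < p. Proof. exact: lt_trans p_gt1. Qed.
Let pn0 : p != 0. Proof. by rewrite gt_eqF. Qed.

Lemma seq_compactD f g : seq_compact f -> seq_compact g -> seq_compact (fun x => f x + g x).
Proof.
move=> cf cg w w1; have [phi hphi [v hv]] := cf w w1.
have [psi hpsi [v' hv']] := cg (w \o phi) (fun n => w1 _).
exists (phi \o psi); first by move=> n /=; exact: leq_trans (hpsi n) (hphi _).
exists (v + v'); have hv2 := null_sub hpsi hv.
apply: null_squeeze (nullD hv2 hv') => n; rewrite ger0_norm //=.
by rewrite opprD addrACA nmD.
Qed.

Lemma eig_orthosys (T : H -> H) (l : nat -> R) (e : nat -> H) n : eigsys dot T l e ->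
  orthosys dot (fun i : 'I_n => e i).
Proof.
move=> he; split=> [i j ij|i]; first exact: (eig_orth he).
have [l0|l0] := eqVneq (l i) 0; first by left; exact: (eig_null he).
by right; apply: (eig_unit he); rewrite lt_neqAle eq_sym l0 (eig_ge0 he).
Qed.

Section Pair.
Variables (a b : H -> H) (ca : cp a) (cb : cp b) (p_le2 : p <= 2).
Let ba := cp_bop ca.
Let bb := cp_bop cb.

Definition gram x := adj a (a x) + adj b (b x).

Lemma gram_dot x y : dot (gram x) y = dot (a x) (a y) + dot (b x) (b y).
Proof. by rewrite ipDl !adjP'. Qed.

Lemma gram_sqr x : sre (dot (gram x) x) = nm (a x) ^+ 2 + nm (b x) ^+ 2.
Proof. by rewrite gram_dot raddfD /= -!(nm_sqr Hdot). Qed.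

Lemma gram_eigsys : exists (l : nat -> R) (e : nat -> H), eigsys dot gram l e.
Proof.
have sc f : cp f -> seq_compact (adj f \o f).
  move=> cf; apply: seq_compact_comp; last exact: (compact_operator_seq cf.1).
  by apply: adj_bop => //; exact: cp_bop cf.
have bs f : bop f -> bop (adj f \o f) by move=> bf; apply: bop_comp => //; exact: adj_bop.
apply: (eigsys_exists Hdot).
- have := bop_lin 1 (bs _ ba) (bs _ bb); rewrite scale1r; exact.
- split=> [x y|x]; last by rewrite gram_sqr addr_ge0 ?sqr_ge0.
  by rewrite gram_dot ipDr -!adjP.
exact: (seq_compactD (sc _ ca) (sc _ cb)).
Qed.

Variables (l : nat -> R) (e : nat -> H).
Hypothesis he : eigsys dot gram l e.

Lemma gram_nm0 i : l i = 0 -> nm (a (e i)) = 0.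
Proof. by move=> /(eig_null he) ->; rewrite (lin0 ba.1) nm0. Qed.

(** The vectors a e_i / sqrt(l_i) form a Bessel family, because |a x|^2 is dominated by the
    quadratic form of [gram]. *)
Lemma gram_bessel n w :
  \sum_(i < n) smod (dot w (a (e i))) ^+ 2 * (l i)^-1 <= nm w ^+ 2.
Proof.
set S := \sum_(i < n) _.
pose c (i : 'I_n) := sinj k (l i)^-1 * dot w (a (e i)).
pose x := \sum_(i < n) c i *: e i.
have oe := eig_orthosys n he.
have wx : sre (dot w (a x)) = S.
  rewrite /x (lin_sum ba.1) ip_sumr raddf_sum /=; apply: eq_bigr => i _.
  by rewrite (linZ ba.1) ipZr sre_conj_scale mulrC.
have xx : nm (a x) ^+ 2 <= S.
  apply: (@le_trans _ _ (nm (a x) ^+ 2 + nm (b x) ^+ 2)); first by rewrite lerDl sqr_ge0.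
  rewrite -gram_sqr /x.
  have lg : linear gram.
    by have := (bop_lin 1 (bop_comp (adj_bop Hdot ba) ba) (bop_comp (adj_bop Hdot bb) bb)).1; rewrite scale1r.
  rewrite (lin_sum lg) ip_suml raddf_sum /=; apply: ler_sum => i _.
  rewrite (linZ lg) (eig_eq he) !ipZl ip_sumr (bigD1 i) //= big1 ?addr0; last first.
    by move=> j ji; rewrite ipZr (eig_orth he) 1?eq_sym ?mulr0.
  rewrite ipZr (ipxx Hdot) (mulrCA (c i)) [c i * (_ * _)]mulrA mul_conj -!rmorphM sinjK.
  have [l0|l0] := eqVneq (l i) 0; first by rewrite l0 mul0r invr0 mulr0.
  have lp : 0 < l i by rewrite lt_neqAle eq_sym l0 (eig_ge0 he).
  rewrite (eig_unit he lp) expr1n mulr1 smodM smod_sinj ger0_norm ?invr_ge0 ?(ltW lp) //.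
  rewrite le_eqVlt; apply/orP; left; apply/eqP; field.
  by rewrite gt_eqF.
have := sqr_ge0 (nm (w - a x)); rewrite (nmB_sqr Hdot) wx.
by move=> h; exact: (bessel_arith h xx).
Qed.

(** Formally the trace of gram^(p/2 - 1) a^* a. With |a e_i|^2 expanded in the left singular vectors
    of [a], concavity for the weights of [gram_bessel] bounds the part along w_j by s_j^p. *)
Lemma gram_half n :
  \sum_(i < n) l i `^ (p / 2 - 1) * nm (a (e i)) ^+ 2 <= N a `^ p.
Proof.
have l0 := eig_ge0 he.
have [ca' na'] := cp_adj Hdot p_gt1 ca; have ba' := cp_bop ca'.
have [s [w [hs h1 _]]] := cp_sing Hdot p_gt1 ca'.
have q0 : 0 < p / 2 by rewrite divr_gt0.
have q1 : p / 2 <= 1 by rewrite ler_pdivrMr // mul1r.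
have key m : \sum_(i < n) l i `^ (p / 2 - 1) * \sum_(j < m) smod (dot (a (e i)) (w j)) ^+ 2 <= N a `^ p.
  rewrite -na'; apply: le_trans (h1 m).
  under eq_bigr do rewrite mulr_sumr.
  rewrite exchange_big /=; apply: ler_sum => j _.
  pose mm (i : 'I_n) := smod (dot (w j) (a (e i))) ^+ 2 * (l i)^-1.
  have mm0 i : 0 <= mm i by rewrite mulr_ge0 ?sqr_ge0 ?invr_ge0.
  have mm1 : \sum_i mm i <= 1.
    by apply: le_trans (gram_bessel n (w j)) _; rewrite expr_le1 //; exact: (sing_le1 hs).
  rewrite -(sing_nm Hdot hs) -sqr_pow //.
  apply: (@le_trans _ _ ((\sum_i mm i * l i) `^ (p / 2))); last first.
    apply: ler_pow; first exact: ltW.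
      by apply: sumr_ge0 => i _; rewrite mulr_ge0.
    apply: le_trans (orthosys_bessel Hdot (eig_orthosys n he) (adj a (w j))).
    apply: ler_sum => i _; rewrite adjP' // /mm -mulrA.
    have [li|li] := eqVneq (l i) 0; first by rewrite li mulr0 mulr0 sqr_ge0.
    by rewrite mulVf // mulr1.
  apply: le_trans (jensen_le1 q0 q1 mm0 (fun i : 'I_n => l0 i) mm1).
  apply: ler_sum => i _; rewrite /mm smod_ipC.
  have [li|li] := eqVneq (l i) 0.
    rewrite (_ : dot _ _ = 0) ?smod0 ?expr0n /= ?mulr0 ?mul0r //.
    by rewrite (nm_eq0 (gram_nm0 li)) ip0r.
  have lp : 0 < l i by rewrite lt_neqAle eq_sym li l0.
  by rewrite -(mulr_powRB1 (ltW lp) q0) mulrA divfK // mulrC.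
have lim : null (fun m => \sum_(i < n) l i `^ (p / 2 - 1) * (nm (a (e i)) ^+ 2 -
    \sum_(j < m) smod (dot (a (e i)) (w j)) ^+ 2)).
  apply: null_sum => i _; apply: nullZ.
  have := sing_range Hdot (e i) ba' hs (cp_sing_null p_gt1 hs h1).
  by rewrite adjK.
apply: (le_null_lim lim) => m.
under [X in _ <= _ + X]eq_bigr do rewrite mulrBr.
by rewrite sumrB addrCA lerDl subr_ge0; exact: key.
Qed.

End Pair.

Lemma gramC a b : gram b a = gram a b.
Proof. by apply/funext => x; rewrite /gram addrC. Qed.

Lemma gram_trace a b (l : nat -> R) (e : nat -> H) n : cp a -> cp b -> p <= 2 ->
  eigsys dot (gram a b) l e ->
  \sum_(i < n) l i `^ (p / 2) <= N a `^ p + N b `^ p.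
Proof.
move=> ca cb p2 he.
have he' : eigsys dot (gram b a) l e by rewrite gramC.
apply: le_trans (lerD (gram_half ca cb p2 he n) (gram_half cb ca p2 he' n)).
rewrite -big_split /=; apply: ler_sum => i _; rewrite -mulrDr -gram_sqr; [|exact: ca|exact: cb].
have [li|li] := eqVneq (l i) 0.
  rewrite li powR0 ?gt_eqF ?divr_gt0 // mulr_ge0 ?powR_ge0 // gram_sqr //.
  by rewrite addr_ge0 ?sqr_ge0.
have lp : 0 < l i by rewrite lt_neqAle eq_sym li (eig_ge0 he).
rewrite (eig_eq he) ipZl (ipxx Hdot) (eig_unit he lp) sreZ sinjK expr1n mulr1.
by rewrite [leRHS]mulrC mulr_powRB1 ?(ltW lp) // divr_gt0.
Qed.

Lemma gram_lim a b (l : nat -> R) (e : nat -> H) : cp a -> cp b -> p <= 2 ->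
  eigsys dot (gram a b) l e -> null l.
Proof.
move=> ca cb p2 he; have l0 := eig_ge0 he.
have q0 : 0 < p / 2 by rewrite divr_gt0.
have mono i j : (i <= j)%N -> l j <= l i.
  elim: j => [|j IH]; first by rewrite leqn0 => /eqP ->.
  rewrite leq_eqVlt => /predU1P[->//|]; rewrite ltnS => /IH; apply: le_trans.
  exact: eig_dec he j.
pose D := N a `^ p + N b `^ p.
have h n : l n `^ (p / 2) <= D * n.+1%:R^-1.
  rewrite ler_pdivlMr // mulrC; apply: le_trans (gram_trace n.+1 ca cb p2 he).
  rewrite -[n.+1 in leLHS]card_ord mulr_natl -sumr_const; apply: ler_sum => i _.
  by apply: ler_pow; rewrite ?(ltW q0) //; apply: mono; rewrite -ltnS.
have : null (fun n => l n `^ (p / 2)).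
  apply: null_squeeze (nullZ D (@null_harmonic R)) => n.
  by rewrite ger0_norm ?powR_ge0.
have pV : 0 < (p / 2)^-1 by rewrite invr_gt0.
move=> /(null_pow pV (fun n => powR_ge0 _ _)); apply: null_ext => n.
by rewrite powK // gt_eqF.
Qed.

(** The residual r of [adj z w] off the first n eigenvectors satisfies |r|^2 = <w, z r>, and |z r|^2
    <= 2 l_n |r|^2 by the min-max bound. *)
Lemma gram_complete a b (l : nat -> R) (e : nat -> H) z w : cp a -> cp b -> cp z -> p <= 2 ->
  eigsys dot (gram a b) l e ->
  (forall x, nm (z x) ^+ 2 <= 2 * (nm (a x) ^+ 2 + nm (b x) ^+ 2)) ->
  null (fun n => nm (adj z w) ^+ 2 - \sum_(i < n) smod (dot (adj z w) (e i)) ^+ 2).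
Proof.
move=> ca cb cz p2 he hz; have l0 := eig_ge0 he.
apply: null_squeeze (nullZ (2 * nm w ^+ 2) (gram_lim ca cb p2 he)) => n.
have oe := eig_orthosys n he; set v := adj z w.
rewrite -(proj_sqr Hdot oe) (proj_pyth Hdot oe v) addrAC subrr add0r ger0_norm ?sqr_ge0 //.
set r := v - _.
have re (i : 'I_n) : dot r (e i) = 0 by exact: (proj_res Hdot oe v i).
have h1 : nm r ^+ 2 <= nm w * nm (z r).
  rewrite (nm_sqr Hdot) {1}/r ipBl (ipC dot (proj _ _ _)) (proj_orth _ re).
  rewrite rmorph0 subr0 adjP'; [|exact: Hdot|exact: cp_bop cz].
  apply: le_trans (ler_norm _) _; apply: le_trans (sre_le_smod _) _.
  exact: cauchy_schwarz.
have h2 : nm (z r) ^+ 2 <= 2 * (l n * nm r ^+ 2).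
  apply: le_trans (hz r) _; rewrite ler_pM2l // -gram_sqr //.
  by apply: (eig_max he) => i ni; exact: (re (Ordinal ni)).
have [r0|r0] := eqVneq (nm r) 0.
  by rewrite r0 expr0n /= !mulr_ge0 ?sqr_ge0.
have rp : 0 < nm r ^+ 2 by rewrite exprn_gt0 // lt_neqAle eq_sym r0 nm_ge0.
rewrite -(ler_pM2r rp) -expr2.
apply: le_trans (_ : (nm w * nm (z r)) ^+ 2 <= _).
  by rewrite sqr_le ?sqr_ge0 ?mulr_ge0.
rewrite exprMn; apply: le_trans (ler_wpM2l (sqr_ge0 (nm w)) h2) _.
by rewrite le_eqVlt; apply/orP; left; apply/eqP; ring.
Qed.

(* On an orthonormal eigensystem of [a^* a + b^* b] the inequality reduces to
   the parallelogram law and the concavity of [t^(p/2)]. *)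
Lemma clarkson_le2 a b : cp a -> cp b -> p <= 2 ->
  N (a + b) `^ p + N (a - b) `^ p <= 2 * (N a `^ p + N b `^ p).
Proof.
move=> ca cb p2; have [l [e he]] := gram_eigsys ca cb.
have l0 := eig_ge0 he; have q0 : 0 < p / 2 by rewrite divr_gt0.
have q1 : p / 2 <= 1 by rewrite ler_pdivrMr // mul1r.
pose A n := \sum_(i < n) nm ((a + b) (e i)) `^ p.
pose B n := \sum_(i < n) nm ((a - b) (e i)) `^ p.
set D := 2 * _.
have hAB n : A n + B n <= D.
  rewrite -big_split /=; apply: le_trans (_ : 2 * \sum_(i < n) l i `^ (p / 2) <= D); last first.
    by rewrite ler_pM2l //; exact: gram_trace he.
  rewrite mulr_sumr; apply: ler_sum => i _.
  rewrite -!(@sqr_pow R p) //; apply: le_trans (pow_mean_le1 q0 q1 (sqr_ge0 _) (sqr_ge0 _)) _.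
  rewrite ler_pM2l //.
  have -> : (nm ((a + b) (e i)) ^+ 2 + nm ((a - b) (e i)) ^+ 2) / 2 =
      nm (a (e i)) ^+ 2 + nm (b (e i)) ^+ 2.
    by rewrite /= (parallelogram Hdot) mulrAC divff // mul1r.
  rewrite -gram_sqr // (eig_eq he) ipZl (ipxx Hdot) sreZ sinjK.
  apply: ler_pow; rewrite ?(ltW q0) ?mulr_ge0 ?sqr_ge0 //.
  rewrite ler_piMr // expr_le1 //.
  have [li|li] := eqVneq (l i) 0; first by rewrite (eig_null he li) nm0.
  by rewrite (eig_unit he) // lt_neqAle eq_sym li l0.
have mono (c : nat -> R) : (forall i, 0 <= c i) -> forall n m, (n <= m)%N ->
    \sum_(i < n) c i <= \sum_(i < m) c i.
  move=> c0 n m le; rewrite -!(big_mkord xpredT c).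
  by rewrite [leRHS](@big_cat_nat _ _ _ n) //= lerDl; apply: sumr_ge0.
have Am : forall n m, (n <= m)%N -> A n <= A m := mono (fun i => nm ((a + b) (e i)) `^ p) (fun i => powR_ge0 _ _).
have Bm : forall n m, (n <= m)%N -> B n <= B m := mono (fun i => nm ((a - b) (e i)) `^ p) (fun i => powR_ge0 _ _).
have A0 n : 0 <= A n by apply: sumr_ge0 => i _; exact: powR_ge0.
have B0 n : 0 <= B n by apply: sumr_ge0 => i _; exact: powR_ge0.
have AB n m : A n + B m <= D.
  by apply: le_trans (hAB (maxn n m)); apply: lerD; [apply: Am|apply: Bm]; rewrite ?leq_maxl ?leq_maxr.
have be n : bessel (fun i : 'I_n => e i) by apply: (orthosys_bessel Hdot); exact: eig_orthosys he.
have fin z (F : R) : cp z -> 0 <= F ->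
    (forall x, nm (z x) ^+ 2 <= 2 * (nm (a x) ^+ 2 + nm (b x) ^+ 2)) ->
    (forall n, \sum_(i < n) nm (z (e i)) `^ p <= F) -> N z `^ p <= F.
  move=> cz F0 hz hF; rewrite -[F](powVK pn0) //.
  apply: ler_pow; rewrite ?(ltW p0) ?cp_norm_ge0 //.
  apply: (cp_norm_le_sum Hdot p_gt1 (I := fun n => 'I_n) (e := fun n i => e i)
    p2 cz (powR_ge0 _ _) (@null0 R) be) => [n|w].
    by rewrite addr0 powVK // hF.
  exact: (gram_complete w ca cb cz p2 he hz).
(* The two norms are recovered one after the other: the partial sum [B m] is frozen while the sums
   for a + b pass to the limit. *)
have hA m : N (a + b) `^ p <= D - B m.
  apply: fin => [| |x|n].
  - exact: cpD.
  - by rewrite subr_ge0; apply: le_trans (AB 0%N m); rewrite lerDr.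
  - by rewrite -(parallelogram Hdot) lerDl sqr_ge0.
  by rewrite lerBrDr; exact: AB.
rewrite -lerBrDl; apply: fin => [| |x|n].
- exact: cpB.
- by rewrite subr_ge0; apply: le_trans (hA 0%N) _; rewrite gerBl.
- by rewrite -(parallelogram Hdot) lerDr sqr_ge0.
by rewrite lerBrDl -lerBrDr; exact: hA.
Qed.

(** Removing the component along u from [adj y v_i] lowers s_i^2 by |<y u, v_i>|^2. The tangent of
    t^(p/2) at s_i^2 has slope (p/2) s_i^(p-2), at least (p/2) M^(p-2) as p <= 2, and the losses add
    up to |y u|^2. *)
Lemma line_strict_le2 (y : H -> H) (u : H) (M : R) : p <= 2 -> cp y -> nm u = 1 -> 0 < M -> N y <= M ->
  N (y \o compl (rank1 dot u u)) `^ p + p / 2 * M `^ (p - 2) * nm (y u) ^+ 2 <= N y `^ p.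
Proof.
move=> p2 cy u1 M0 yM; have pE := line_projection Hdot u1; have pF := compl_projection pE.
have by_ := cp_bop cy; have cF := projection_contraction Hdot pF.
have [cY nY] := cp_adj Hdot p_gt1 cy; have bY := cp_bop cY.
have [s [v [hs h1 h2]]] := cp_sing Hdot p_gt1 cY.
have s0 := sing_ge0 hs.
set E := rank1 dot u u in pE pF cF *.
have [cz _] := cp_compr Hdot p_gt1 cy cF; have [cz' nz'] := cp_adj Hdot p_gt1 cz.
have zE : adj (y \o compl E) = compl E \o adj y.
  by rewrite (adj_comp Hdot by_ (contraction_bop cF)) (projection_adj Hdot pF).
pose kp := p / 2 * M `^ (p - 2).
have kp0 : 0 <= kp by rewrite mulr_ge0 ?powR_ge0 // divr_ge0 // ltW.
have q0 : 0 < p / 2 by rewrite divr_gt0.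
have q1 : p / 2 <= 1 by rewrite ler_pdivrMr // mul1r.
have term i : nm (compl E (adj y (v i))) `^ p <= s i `^ p - kp * smod (dot (y u) (v i)) ^+ 2.
  have sM : s i <= M.
    apply: le_trans yM; rewrite -nY -(sing_nm Hdot hs).
    apply: le_trans (nm_le_cp Hdot p_gt1 _ cY) _.
    by rewrite ler_piMr ?cp_norm_ge0 //; exact: (sing_le1 hs).
  have dE : smod (dot (y u) (v i)) ^+ 2 = nm (E (adj y (v i))) ^+ 2.
    by rewrite /E nmZ u1 mulr1 adjP' // smod_ipC.
  rewrite dE -(sing_nm Hdot hs).
  have := projection_pyth Hdot (adj y (v i)) pE.
  rewrite -!(@sqr_pow R p) // (sing_nm Hdot hs).
  set al := nm (compl E _) ^+ 2; set bt := nm (E _) ^+ 2 => sab.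
  have al0 : 0 <= al by exact: sqr_ge0.
  have bt0 : 0 <= bt by exact: sqr_ge0.
  have [si|si] := eqVneq (s i) 0.
    have : al = 0 /\ bt = 0 by move: sab; rewrite si expr0n /=; clear -al0 bt0; split; lra.
    by move=> [-> ->]; rewrite si expr0n /= mulr0 subr0.
  have sp : 0 < s i by rewrite lt_neqAle eq_sym si s0.
  have := pow_tangent_le q0 q1 (exprn_gt0 2 sp) al0.
  rewrite {3}sab opprD addrCA subrr addr0 mulrN => /le_trans; apply.
  rewrite lerD2l lerN2 ler_wpM2r // ler_wpM2l ?(ltW q0) //.
  have -> : (s i ^+ 2) `^ (p / 2 - 1) = s i `^ (p - 2).
    by rewrite -powR_mulrn // -powRrM; congr (_ `^ _); field.
  rewrite -[p - 2]opprB !powRN lef_pV2 ?posrE ?powR_gt0 //.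
  by apply: ler_pow; rewrite ?subr_ge0.
have lim := nullZ kp (sing_range Hdot u bY hs (cp_sing_null p_gt1 hs h1)).
rewrite adjK // in lim.
have hsum n : \sum_(i < n) nm (compl E (adj y (v i))) `^ p <=
    N y `^ p - kp * nm (y u) ^+ 2 + kp * (nm (y u) ^+ 2 - \sum_(i < n) smod (dot (y u) (v i)) ^+ 2).
  apply: (@le_trans _ _ (\sum_(i < n) (s i `^ p - kp * smod (dot (y u) (v i)) ^+ 2))).
    by apply: ler_sum => i _; exact: term.
  rewrite sumrB -mulr_sumr (mulrBr kp (nm _ ^+ 2)) addrA subrK lerD2r -nY; exact: h1.
have D0 : 0 <= N y `^ p - kp * nm (y u) ^+ 2.
  apply: (le_null_lim lim) => n; apply: le_trans (hsum n).
  by apply: sumr_ge0 => i _; exact: powR_ge0.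
rewrite -/kp -lerBrDr -nz' -[leRHS](powVK pn0) //.
apply: ler_pow; rewrite ?(ltW p0) ?cp_norm_ge0 //.
apply: (cp_norm_le_sum Hdot p_gt1 (I := fun n => 'I_n) (e := fun n i => v i)
    p2 cz' (powR_ge0 _ _) lim) => [n|n|w].
- exact: sing_bessel hs.
- by rewrite powVK // zE; exact: hsum.
rewrite adjK; [|exact: Hdot|exact: cp_bop cz].
have := sing_range Hdot (compl E w) bY hs (cp_sing_null p_gt1 hs h1).
by rewrite adjK.
Qed.

End Clarkson.

(** * Orthonormal bases and weakly null sequences *)

Section Basis.
Variables (R : realType) (k : scalar_kind).
Local Notation K := (scalar_field R k).
Variables (H : completeNormedModType K) (dot : {dot H for @sconj R k}).
Hypothesis Hdot : forall x : H, `|x| ^+ 2 = dot x x.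
Local Notation adj := (adjoint dot).
Local Notation bessel := (bessel dot).
Implicit Types (x y : H) (f g z : H -> H).

Definition orthobasis (h : nat -> H) :=
  (forall i j, dot (h i) (h j) = (i == j)%:R) /\
  forall x, null (fun n => nm (x - proj dot (fun i : 'I_n => h i) x)).

Lemma orthonormal_orthosys (h : nat -> H) n :
  (forall i j, (i < n)%N -> (j < n)%N -> dot (h i) (h j) = (i == j)%:R) ->
  orthosys dot (fun i : 'I_n => h i).
Proof.
move=> hh; split=> [i j ij|i]; first by rewrite hh // val_eqE (negbTE ij).
right; apply/eqP; rewrite -(eqrXn2 (n:=2)) //.
by rewrite (nm_sqr Hdot) hh // eqxx -(rmorph1 (sinj k)) sinjK expr1n.
Qed.

Lemma orthonormal_nm (h : nat -> H) : (forall i j, dot (h i) (h j) = (i == j)%:R) ->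
  forall i, nm (h i) = 1.
Proof.
move=> ho i; apply/eqP; rewrite -(eqrXn2 (n := 2)) // (nm_sqr Hdot) ho eqxx.
by rewrite -(rmorph1 (sinj k)) sinjK expr1n.
Qed.

Lemma basis_exists : (exists2 D : set H, countable D & dense D) ->
  infinite_dimensional [set: H] -> exists h, orthobasis h.
Proof.
move=> [D /countable_injP[f finj] dD] Hinf.
(* Enumeration of [D] by inverting its injection into the integers, with 0 at integers that are not
   values. *)
pose d n := xget 0 [set x | D x /\ f x = n].
have dd x (e : R) : 0 < e -> exists n, nm (x - d n) <= e.
  move=> e0; have o : open (ball x (sinj k e)) by apply: ball_open; rewrite -(rmorph0 (sinj k)) sinj_lt.
  have [|y [xy Dy]] := dD _ _ o.
    by exists x; apply: ballxx; rewrite -(rmorph0 (sinj k)) sinj_lt.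
  exists (f y); rewrite (_ : d (f y) = y).
    by move: xy; rewrite -ball_normE /ball_ /= normH sinj_lt; exact: ltW.
  rewrite /d; case: xgetP => [z _ [Dz fz]|/(_ y)[]//].
  by apply: finj => //; rewrite inE.
pose P n (g : nat -> H) := proj dot (fun i : 'I_n => g i).
pose on n (g : nat -> H) := forall i j, (i < n)%N -> (j < n)%N -> dot (g i) (g j) = (i == j)%:R.
(* Existence is stated before the premise so that [choice] applies to arbitrary sequences; [Gon]
   supplies the premise later. *)
have next n (g : nat -> H) : exists v, on n g ->
    [/\ nm v = 1, (forall i, (i < n)%N -> dot v (g i) = 0) &
     exists m, [/\ forall j, (j < m)%N -> d j = P n g (d j),
       d m = P n g (d m) + dot (d m) v *: v & d m != P n g (d m)]].
  have [og|nog] := pselect (on n g); last by exists 0.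
  have og' := orthonormal_orthosys og.
  have [m dm mmin] : exists2 m, d m != P n g (d m) & forall j, (j < m)%N -> d j = P n g (d j).
    have ex : exists m, d m != P n g (d m).
      apply: contrapT => hno; apply: Hinf; exists n, (fun i : 'I_n => g i) => x _.
      exists (fun i : 'I_n => dot x (g i)); apply/eqP; rewrite -subr_eq0; apply/eqP/nm_eq0/eqP.
      rewrite eq_le nm_ge0 andbT; apply/ler_addgt0Pr => e /(dd x)[j hj]; rewrite add0r.
      have dj : d j = P n g (d j).
        by apply/eqP; apply: contrapT => /negP hj'; apply: hno; exists j.
      apply: le_trans hj; apply: le_trans (proj_res_le Hdot og' (x - d j)).
      rewrite (linB (proj_lin dot _)) -[proj _ _ (d j)]/(P n g (d j)) -dj.
      by rewrite opprB addrA subrK.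
    exists (ex_minn ex); case: ex_minnP => // j _ hmin i ij.
    by apply/eqP; apply: contrapT => /negP /hmin; rewrite leqNgt ij.
  pose r := d m - P n g (d m).
  have r0 : 0 < nm r.
    rewrite lt_neqAle nm_ge0 andbT eq_sym; apply: contraNneq dm => /nm_eq0 /eqP.
    by rewrite subr_eq0.
  have rg i : (i < n)%N -> dot r (g i) = 0 by move=> ni; exact: (proj_res Hdot og' (d m) (Ordinal ni)).
  exists (sinj k (nm r)^-1 *: r) => _; split.
  - by rewrite nmZ smod_sinj ger0_norm ?invr_ge0 // mulVf // gt_eqF.
  - by move=> i ni; rewrite ipZl rg // mulr0.
  exists m; split=> //.
  have dr : dot (d m) r = sinj k (nm r ^+ 2).
    rewrite -(ipxx Hdot) {2}/r ipBl (ipC dot (P n g _)).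
    rewrite (proj_orth _ (fun i : 'I_n => rg i (ltn_ord i))) rmorph0 subr0 //.
  rewrite ipZr sconj_sinj dr scalerA -!rmorphM expr2 mulrA mulVf ?gt_eqF // mul1r divff ?gt_eqF //.
  by rewrite rmorph1 scale1r subrKC.
have [nx hnx] := choice (fun ng : nat * (nat -> H) => next ng.1 ng.2).
pose G := fix G n : nat -> H := if n is m.+1 then ext (G m) m (nx (m, G m)) else (fun=> 0).
pose h i := nx (i, G i).
have Gh n i : (i < n)%N -> G n i = h i.
  elim: n => [//|n IH]; rewrite ltnS leq_eqVlt => /predU1P[->|ni] /=; rewrite /ext.
    by rewrite eqxx.
  by rewrite (ltn_eqF ni); exact: IH.
have Gon n : on n (G n).
  elim: n => [//|n IH] i j; have [v1 vo _] := hnx (n, G n) IH.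
  rewrite !ltnS leq_eqVlt => /predU1P[->|ni]; rewrite leq_eqVlt => /predU1P[->|nj] /=; rewrite /ext ?eqxx.
  - by rewrite (ipxx Hdot) v1 expr1n rmorph1.
  - by rewrite (ltn_eqF nj) vo // (gtn_eqF nj).
  - by rewrite (ltn_eqF ni) ipC vo // rmorph0.
  by rewrite (ltn_eqF ni) (ltn_eqF nj); exact: IH.
have hon i j : dot (h i) (h j) = (i == j)%:R.
  have := Gon (maxn i j).+1 i j; rewrite !ltnS leq_maxl leq_maxr => /(_ isT isT).
  by rewrite !Gh // !ltnS ?leq_maxl ?leq_maxr.
have PG n x : P n (G n) x = P n h x.
  by apply: eq_bigr => i _; rewrite Gh.
exists h; split=> // x.
have Pd n : forall j, (j < n)%N -> d j = P n h (d j).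
  have PS n' y : P n'.+1 h y = P n' h y + dot y (h n') *: h n' by rewrite /P /proj big_ord_recr.
  elim: n => [//|n IH] j; have [v1 vo [m [mmin dm dmP]]] := hnx (n, G n) (Gon n).
  have stay y : y = P n h y -> y = P n.+1 h y.
    move=> hy; rewrite PS -hy hy ipC (proj_orth _ (fun i : 'I_n => _)) ?rmorph0 ?scale0r ?addr0 //.
    by move=> i; rewrite hon (gtn_eqF (ltn_ord i)).
  rewrite ltnS leq_eqVlt => /predU1P[->|nj]; last by apply: stay; exact: IH.
  have [mn|nm'|mn] := ltngtP m n.
  - by move: dmP; rewrite /= PG -IH // eqxx.
  - by apply: stay; rewrite -PG; exact: mmin.
  by move: dm; rewrite mn /= PG PS.
move=> e e0; have [j hj] := dd x _ e0; exists j.+1 => n jn; rewrite ger0_norm //.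
have oh : orthosys dot (fun i : 'I_n => h i) by apply: orthonormal_orthosys => *; exact: hon.
apply: le_trans hj; apply: le_trans (proj_res_le Hdot oh (x - d j)).
rewrite (linB (proj_lin dot _)) -[proj _ _ (d j)]/(P n h (d j)) -(Pd n j jn).
by rewrite opprB addrA subrK.
Qed.

End Basis.

Lemma half_lt (R : realType) (d : R) : 0 < d -> d / 2 < d.
Proof. by move=> d0; rewrite ltr_pdivrMr // ltr_pMr // ltr1n. Qed.

Lemma dual_zero (R : realType) (k : scalar_kind) (V W : lmodType (scalar_field R k)) (X : set V)
  (phi : V -> W) : X 0 -> linear_on X phi -> phi 0 = 0.
Proof.
move=> X0 /(_ 1 0 0 X0 X0); rewrite !scale1r addr0 => /eqP.
by rewrite -subr_eq subrr eq_sym => /eqP.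
Qed.

Lemma dual_comb (R : realType) (k : scalar_kind) (V : lmodType (scalar_field R k)) (X : set V)
  (phi : V -> (scalar_field R k)^o) n (x_ : nat -> V) (c : scalar_field R k) :
  X 0 -> (forall a x y, X x -> X y -> X (a *: x + y)) -> linear_on X phi ->
  (forall i, X (x_ i)) ->
  X (c *: \sum_(i < n) x_ i) /\ phi (c *: \sum_(i < n) x_ i) = c *: \sum_(i < n) phi (x_ i).
Proof.
move=> X0 Xl lphi Xx.
have phi0 := dual_zero X0 lphi.
have [XS pS] : X (\sum_(i < n) x_ i) /\ phi (\sum_(i < n) x_ i) = \sum_(i < n) phi (x_ i).
  elim: n => [|n [IH1 IH2]]; first by rewrite !big_ord0.
  rewrite !big_ord_recr /= -IH2; split.
    by have := Xl 1 _ _ IH1 (Xx n); rewrite scale1r.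
  by have := lphi 1 _ _ IH1 (Xx n); rewrite !scale1r.
split; first by have := Xl c _ _ XS X0; rewrite addr0.
by have := lphi c _ _ XS X0; rewrite addr0 phi0 addr0 pS.
Qed.

(** * Finite cuts, means of sequences with vanishing entries, and weak nullity *)

Section BanachSaks.
Variables (R : realType) (k : scalar_kind).
Local Notation K := (scalar_field R k).
Variables (H : completeNormedModType K) (dot : {dot H for @sconj R k}).
Hypothesis Hdot : forall x : H, `|x| ^+ 2 = dot x x.
Local Notation adj := (adjoint dot).
Local Notation bessel := (bessel dot).
Implicit Types (x y : H) (f g z : H -> H).

Variables (p : R) (p_gt1 : 1 < p).
Local Notation cp := (schatten_class dot p).
Local Notation N := (cp_norm dot p).
Let p1 : 1 <= p := ltW p_gt1.
Let p0 : 0 < p. Proof. exact: lt_trans p_gt1. Qed.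
Let pn0 : p != 0. Proof. by rewrite gt_eqF. Qed.

Lemma proj_projection (I : finType) (e : I -> H) : orthosys dot e -> projection dot (proj dot e).
Proof.
move=> oe; split; [exact: proj_lin|exact: proj_sym|].
by move=> x; exact: (proj_idem Hdot oe).
Qed.

Lemma sing_tail_sys z s (u : nat -> H) m : linear z -> singsys dot z s u ->
  singsys dot (z \o compl (proj dot (fun i : 'I_m => u i))) (fun n => s (m + n)%N)
    (fun n => u (m + n)%N).
Proof.
move=> lz hs; have ou := sing_orthosys m hs.
have pP := proj_projection ou; have pF := compl_projection pP.
have cu n : compl (proj dot (fun i : 'I_m => u i)) (u (m + n)%N) = u (m + n)%N.
  rewrite /compl /proj big1 ?subr0 // => i _.
  rewrite (sing_orth hs) ?scale0r //.
  by rewrite gtn_eqF // ltn_addr.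
split=> [n|n|i j ij|i|i|i y|n x hx] /=.
- exact: (sing_ge0 hs).
- by rewrite addnS; exact: (sing_dec hs).
- by apply: (sing_orth hs); rewrite eqn_add2l.
- exact: (sing_unit hs).
- exact: (sing_null hs).
- rewrite cu (sing_eq hs); congr (_ * _).
  by have [_ sF _] := pF; rewrite -sF cu.
apply: (@le_trans _ _ (s (m + n)%N * nm (compl (proj dot (fun i : 'I_m => u i)) x))).
  apply: (sing_max hs) => i imn.
  have [im|mi] := ltnP i m; first exact: (proj_res Hdot ou x (Ordinal im)).
  have [_ sF _] := pF; rewrite sF -(subnKC mi) cu; apply: hx.
  by rewrite ltn_subLR.
rewrite ler_wpM2l ?(sing_ge0 hs) //.
by apply: (projection_contraction Hdot pF).2.
Qed.

(** The remainder has the shifted list as singular system, so its norm is an l_p tail. *)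
Lemma sing_tail_norm z s (u : nat -> H) : cp z -> singsys dot z s u ->
  (forall n, \sum_(i < n) s i `^ p <= N z `^ p) ->
  (forall C, 0 <= C -> (forall n, \sum_(i < n) s i `^ p <= C `^ p) -> N z <= C) ->
  null (fun m => N (z \o compl (proj dot (fun i : 'I_m => u i)))).
Proof.
move=> cz hs h1 h2; have lz := (cp_bop cz).1.
have lim := sum_pow_sup p_gt1 (cp_norm_ge0 _ _ _) (sing_ge0 hs) h1 h2.
have T0 m : 0 <= N z `^ p - \sum_(i < m) s i `^ p by rewrite subr_ge0.
have pV : 0 < p^-1 by rewrite invr_gt0.
apply: null_squeeze (null_pow pV T0 lim) => m; rewrite ger0_norm ?cp_norm_ge0 //.
have ou := sing_orthosys m hs; have pF := compl_projection (proj_projection ou).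
have [cz' _] := cp_compr Hdot p_gt1 cz (projection_contraction Hdot pF).
apply: (cp_norm_le Hdot p_gt1 cz' (powR_ge0 _ _)).
apply: (singsys_Qle Hdot p1 (powR_ge0 _ _) (cp_bop cz').1 (sing_tail_sys m lz hs)) => n.
rewrite powVK // lerBrDl; apply: le_trans (h1 (m + n)%N).
by rewrite big_split_ord.
Qed.

Variables (h : nat -> H) (hb : orthobasis dot h).

Definition head_proj n := proj dot (fun i : 'I_n => h i).

Lemma basis_orthosys n : orthosys dot (fun i : 'I_n => h i).
Proof. by apply: (orthonormal_orthosys Hdot) => i j _ _; exact: hb.1. Qed.

Lemma head_proj_projection n : projection dot (head_proj n).
Proof. exact: (proj_projection (basis_orthosys n)). Qed.

Lemma head_proj_contraction n : contraction (head_proj n).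
Proof. exact: (projection_contraction Hdot (head_proj_projection n)). Qed.

Lemma head_proj_compl_contraction n : contraction (compl (head_proj n)).
Proof. exact: (projection_contraction Hdot (compl_projection (head_proj_projection n))). Qed.

Lemma cp_cut z n : cp z -> cp (head_proj n \o z \o head_proj n) /\ N (head_proj n \o z \o head_proj n) <= N z.
Proof. by move=> cz; apply: (cp_ideal Hdot p_gt1) => //; exact: head_proj_contraction. Qed.

Lemma rank1_cut n v w : head_proj n \o rank1 dot v w \o head_proj n = rank1 dot (head_proj n v) (head_proj n w).
Proof.
have [lP sP _] := head_proj_projection n.
by apply/funext => x /=; rewrite /rank1 (linZ lP) sP.
Qed.

Lemma rank1_cut_null v w : null (fun n => N (rank1 dot v w - (head_proj n \o rank1 dot v w \o head_proj n))).
Proof.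
have n1 := nullZ (nm w) (hb.2 v); have n2 := nullZ (nm v) (hb.2 w).
apply: null_squeeze (nullD n1 n2) => n; rewrite ger0_norm ?cp_norm_ge0 // rank1_cut.
have -> : rank1 dot v w - rank1 dot (head_proj n v) (head_proj n w) =
    rank1 dot (v - head_proj n v) w + rank1 dot (head_proj n v) (w - head_proj n w).
  apply/funext => x; rewrite /rank1 /= !fctE ipBr scalerBl scalerBr.
  by rewrite subrKA.
have [c1 l1] := cp_rank1 Hdot p_gt1 (v - head_proj n v) w.
have [c2 l2] := cp_rank1 Hdot p_gt1 (head_proj n v) (w - head_proj n w).
apply: le_trans (cp_normD Hdot p_gt1 c1 c2) _; apply: lerD.
  by rewrite mulrC; exact: l1.
by apply: le_trans l2 _; rewrite ler_wpM2r //; exact: (head_proj_contraction n).2.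
Qed.

(** True for rank one operators, hence for the truncated singular series; the remainder is small
    uniformly in n because cutting is contractive. *)
Lemma cp_cut_null z : cp z -> null (fun n => N (z - (head_proj n \o z \o head_proj n))).
Proof.
move=> cz; have [s [u [hs h1 h2]]] := cp_sing Hdot p_gt1 cz.
have lz := (cp_bop cz).1.
move=> e e0; have e4 : 0 < e / 4 by rewrite divr_gt0.
have [m /(_ m (leqnn m))] := sing_tail_norm cz hs h1 h2 e4.
rewrite ger0_norm ?cp_norm_ge0 // => hm.
pose zm := \sum_(i < m) rank1 dot (u i) (z (u i)).
have cr (i : 'I_m) : true -> cp (rank1 dot (u i) (z (u i))).
  by move=> _; have [] := cp_rank1 Hdot p_gt1 (u i) (z (u i)).
have [czm _] := cp_sum Hdot p_gt1 (index_enum 'I_m) cr.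
have zmE x : zm x = \sum_(i < m) dot x (u i) *: z (u i).
  by rewrite /zm; elim/big_rec2: _ => //= i y1 y2 _ <-.
have zzm : z - zm = z \o compl (proj dot (fun i : 'I_m => u i)).
  apply/funext => x /=; rewrite /compl (linB lz) /proj (lin_sum lz).
  rewrite !fctE zmE; congr (_ - _); apply: eq_bigr => i _.
  by rewrite (linZ lz).
have lim : null (fun n => \sum_(i < m) N (rank1 dot (u i) (z (u i)) -
    (head_proj n \o rank1 dot (u i) (z (u i)) \o head_proj n))).
  by apply: null_sum => i _; exact: rank1_cut_null.
have e2 : 0 < e / 2 by rewrite divr_gt0.
have [n0 hn] := lim _ e2; exists n0 => n /hn.
rewrite ger0_norm; last by apply: sumr_ge0 => i _; exact: cp_norm_ge0.
move=> hn'; rewrite ger0_norm ?cp_norm_ge0 //.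
have cd : cp (z - zm) by exact: cpB.
have [cc1 l1] := cp_cut n cd; have [cc2 _] := cp_cut n czm.
have [lP _ _] := head_proj_projection n.
have -> : z - (head_proj n \o z \o head_proj n) =
    (z - zm) - (head_proj n \o (z - zm) \o head_proj n) + (zm - (head_proj n \o zm \o head_proj n)).
  apply/funext => x; rewrite /= !fctE (linB lP).
  move: (z x) (zm x) (head_proj n (z (head_proj n x))) (head_proj n (zm (head_proj n x))) => a b c d.
  by rewrite addrAC subrKA opprB subrKA.
have h3 : N (zm - (head_proj n \o zm \o head_proj n)) <= e / 2.
  apply: le_trans hn'.
  have -> : zm - (head_proj n \o zm \o head_proj n) = \sum_(i < m) (rank1 dot (u i) (z (u i)) -
      (head_proj n \o rank1 dot (u i) (z (u i)) \o head_proj n)).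
    rewrite sumrB; congr (_ - _); apply/funext => x.
    rewrite /= zmE (lin_sum lP).
    by elim/big_rec2: _ => //= i y1 y2 _ ->.
  have [|//] := cp_sum Hdot p_gt1 (index_enum 'I_m) (P := xpredT) (F := fun i : 'I_m =>
    rank1 dot (u i) (z (u i)) - (head_proj n \o rank1 dot (u i) (z (u i)) \o head_proj n)).
  by move=> i _; apply: cpB => //; [exact: cr|have [] := cp_cut n (cr i isT)].
have cdd : cp ((z - zm) - (head_proj n \o (z - zm) \o head_proj n)) by exact: cpB.
have cdm : cp (zm - (head_proj n \o zm \o head_proj n)) by exact: cpB.
apply: le_trans (cp_normD Hdot p_gt1 cdd cdm) _.
have := cp_normB Hdot p_gt1 cd cc1; rewrite -zzm in hm.
move: (N (z - zm)) (N _) (N _) (N _) hm h3 l1 => a b c d; lra.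
Qed.

(** For bounded sequences this is convergence to 0 in the weak operator topology. *)
Definition wot_null (x_ : nat -> H -> H) :=
  forall i j, null (fun n => smod (dot (x_ n (h i)) (h j))).

Lemma wot_null_cut (x_ : nat -> H -> H) m : (forall n, cp (x_ n)) -> wot_null x_ ->
  null (fun n => N (head_proj m \o x_ n \o head_proj m)).
Proof.
move=> cx wx.
have lim : null (fun n => \sum_(i < m) \sum_(j < m) smod (dot (x_ n (h i)) (h j))).
  by apply: null_sum => i _; apply: null_sum => j _; exact: wx.
apply: null_squeeze lim => n; rewrite ger0_norm ?cp_norm_ge0 //.
have h1 i : nm (h i) = 1.
  apply/eqP; rewrite -(eqrXn2 (n:=2)) //.
  by rewrite (nm_sqr Hdot) hb.1 eqxx -(rmorph1 (sinj k)) sinjK expr1n.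
have E : head_proj m \o x_ n \o head_proj m =
    \sum_(i < m) \sum_(j < m) dot (x_ n (h i)) (h j) *: rank1 dot (h i) (h j).
  have lx := (cp_bop (cx n)).1; have [lP _ _] := head_proj_projection m.
  apply/funext => x; rewrite /= {2}/head_proj /proj (lin_sum lx) (lin_sum lP).
  elim/big_rec2: _ => //= i y1 y2 _ ->; congr (_ + _).
  rewrite (linZ lx) (linZ lP) /head_proj /proj scaler_sumr.
  elim/big_rec2: _ => //= j z1 z2 _ ->; congr (_ + _).
  by rewrite scalerA mulrC -scalerA.
have cr a b : cp (rank1 dot a b) by have [] := cp_rank1 Hdot p_gt1 a b.
have cs (i : 'I_m) : true -> cp (\sum_(j < m) dot (x_ n (h i)) (h j) *: rank1 dot (h i) (h j)).
  move=> _; have [|//] := cp_sum Hdot p_gt1 (index_enum 'I_m) (P := xpredT)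
    (F := fun j : 'I_m => dot (x_ n (h i)) (h j) *: rank1 dot (h i) (h j)).
  by move=> j _; apply: (cpZ Hdot).
rewrite E; apply: le_trans (cp_sum Hdot p_gt1 (index_enum 'I_m) cs).2 _.
apply: ler_sum => i _.
have ct (j : 'I_m) : true -> cp (dot (x_ n (h i)) (h j) *: rank1 dot (h i) (h j)).
  by move=> _; apply: (cpZ Hdot).
apply: le_trans (cp_sum Hdot p_gt1 (index_enum 'I_m) ct).2 _.
apply: ler_sum => j _; rewrite (cp_normZ Hdot) //.
rewrite ler_piMr //; apply: le_trans (cp_rank1 Hdot p_gt1 _ _).2 _.
by rewrite !h1 mulr1.
Qed.

Let r := rexp p.
Let r1 : 1 < r. Proof. exact: rexp_gt1. Qed.
Let r0 : 0 < r. Proof. exact: lt_trans r1. Qed.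

Lemma split_r_left z E : cp z -> projection dot E ->
  N z `^ r <= N (E \o z) `^ r + N (compl E \o z) `^ r.
Proof.
move=> cz pE; have pF := compl_projection pE; have bz := cp_bop cz.
have cE := projection_contraction Hdot pE; have cF := projection_contraction Hdot pF.
have [cz' nz'] := cp_adj Hdot p_gt1 cz.
have aE E' : projection dot E' -> contraction E' -> adj z \o E' = adj (E' \o z).
  move=> pE' cE'; rewrite (adj_comp Hdot) ?(projection_adj Hdot pE') //.
  exact: contraction_bop.
rewrite -nz'; apply: le_trans (split_r Hdot p_gt1 cz' pE) _.
have [c1 _] := cp_compl Hdot p_gt1 cE cz; have [c2 _] := cp_compl Hdot p_gt1 cF cz.
by rewrite (aE _ pE cE) (aE _ pF cF) (cp_adj Hdot p_gt1 c1).2 (cp_adj Hdot p_gt1 c2).2.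
Qed.

(** [S] is almost supported on a corner P S P, and x_n almost vanishes there for large n. The rest
    of x_n costs r-th powers only, with an increment that does not depend on [S]. *)
Lemma banach_saks_step (x_ : nat -> H -> H) (M : R) (S : H -> H) : 0 <= M ->
  (forall n, cp (x_ n)) -> (forall n, N (x_ n) <= M) -> wot_null x_ -> cp S ->
  exists n, N (S + x_ n) `^ r <= N S `^ r + (2 * M `^ r + 1).
Proof.
move=> M0 cx xM wx cS.
(* Bounds every norm whose r-th power is compared below. [L] exceeds the Lipschitz constant of t^r
   on [0, T], and [eta] makes each of the two replacements cost at most 1/2. *)
pose T := N S + M + 2.
have NS0 : 0 <= N S by exact: cp_norm_ge0.
have T0 : 0 < T by rewrite /T; lra.
have NST : N S + 1 <= T by rewrite /T; lra.
have NST' : N S <= T by apply: le_trans NST; rewrite lerDl.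
have NSMT : N S + M <= T by rewrite /T lerDl.
pose L := r * T `^ (r - 1) + 1.
have L0 : 0 < L by rewrite /L ltr_wpDl // mulr_ge0 ?powR_ge0 // ltW.
pose eta := Num.min 1 (2 * L)^-1.
have eta0 : 0 < eta by rewrite lt_min ltr01 invr_gt0 mulr_gt0.
have eta1 : eta <= 1 by rewrite ge_min lexx.
have Leta : L * eta <= 2^-1.
  apply: (@le_trans _ _ (L * (2 * L)^-1)); first by rewrite ler_wpM2l ?(ltW L0) // ge_min lexx orbT.
  by rewrite invfM mulrCA divff ?gt_eqF // mulr1.
have lip a b : 0 <= a -> a <= T -> 0 <= b -> b <= T -> a <= b + eta -> a `^ r <= b `^ r + 2^-1.
  move=> a0 aT b0 bT ab; have [|ba] := leP a b.
    by move=> ab'; apply: (@le_trans _ _ (b `^ r)); [apply: ler_pow => //; exact: ltW|rewrite lerDl].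
  have := pow_lip (ltW r1) a0 aT b0 bT; rewrite [`|a - b|]gtr0_norm ?subr_gt0 // => hl.
  have h1 : a `^ r - b `^ r <= L * eta.
    apply: le_trans (ler_norm _) _; apply: le_trans hl _.
    apply: ler_pM; rewrite ?mulr_ge0 ?powR_ge0 ?(ltW r0) ?subr_ge0 ?(ltW ba) //.
      by rewrite /L lerDl.
    by rewrite lerBlDl.
  by rewrite -lerBlDl; exact: le_trans h1 Leta.
have [m /(_ m (leqnn m))] := cp_cut_null cS eta0; rewrite ger0_norm ?cp_norm_ge0 // => hm.
have [n /(_ n (leqnn n))] := wot_null_cut m cx wx eta0; rewrite ger0_norm ?cp_norm_ge0 // => hn.
exists n; set P := head_proj m in hm hn *.
have [cPS lPS] := cp_cut m cS; rewrite -/P in cPS lPS.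
have pP := head_proj_projection m; rewrite -/P in pP; have [lP _ iP] := pP.
have cP := head_proj_contraction m; have cF := head_proj_compl_contraction m; rewrite -/P in cP cF.
pose z := (P \o S \o P) + x_ n.
have cz : cp z by exact: cpD.
have zS : N (S + x_ n) <= N z + eta.
  have -> : S + x_ n = z + (S - (P \o S \o P)) by rewrite /z addrAC subrKC.
  by apply: le_trans (cp_normD Hdot p_gt1 cz (cpB Hdot p_gt1 cS cPS)) _; rewrite lerD2l.
have NM : N (S + x_ n) <= T.
  by apply: le_trans (cp_normD Hdot p_gt1 cS (cx n)) (le_trans _ NSMT); rewrite lerD2l.
have NzM : N z <= T.
  by apply: le_trans (cp_normD Hdot p_gt1 cPS (cx n)) (le_trans _ NSMT); exact: lerD.
apply: le_trans (lip _ _ (cp_norm_ge0 _ _ _) NM (cp_norm_ge0 _ _ _) NzM zS) _.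
have Fz : compl P \o z = compl P \o x_ n.
  have [lF _ _] := compl_projection pP.
  apply/funext => x; rewrite /z /= !fctE (linD lF).
  by rewrite {1}/compl iP subrr add0r.
have [cPz _] := cp_compl Hdot p_gt1 cP cz.
have PzF : P \o z \o compl P = P \o x_ n \o compl P.
  have PF x : P (compl P x) = 0 by rewrite /compl (linB lP) iP subrr.
  apply/funext => x; rewrite /z /= !fctE (linD lP) PF.
  by rewrite (lin0 (cp_bop cS).1) !(lin0 lP) add0r.
have PzP : P \o z \o P = (P \o S \o P) + (P \o x_ n \o P).
  by apply/funext => x; rewrite /z /= !fctE (linD lP) !iP.
(* Splitting by P on the left, then on the right, leaves the corner and two pieces made of x_n
   alone. *)
have s1 := split_r_left cz pP; rewrite Fz in s1.
have s2 := split_r Hdot p_gt1 cPz pP; rewrite PzF PzP in s2.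
have t1 : N (compl P \o x_ n) `^ r <= M `^ r.
  apply: ler_pow; rewrite ?(ltW r0) ?cp_norm_ge0 //.
  exact: le_trans (cp_compl Hdot p_gt1 cF (cx n)).2 (xM n).
have t2 : N (P \o x_ n \o compl P) `^ r <= M `^ r.
  apply: ler_pow; rewrite ?(ltW r0) ?cp_norm_ge0 //.
  exact: le_trans (cp_ideal Hdot p_gt1 cP (cx n) cF).2 (xM n).
have [cPx _] := cp_cut n (cx n).
have [cPxP _] := cp_cut m (cx n); rewrite -/P in cPxP.
have u1 : N ((P \o S \o P) + (P \o x_ n \o P)) <= N S + eta.
  by apply: le_trans (cp_normD Hdot p_gt1 cPS cPxP) _; exact: lerD.
have t3 : N ((P \o S \o P) + (P \o x_ n \o P)) `^ r <= N S `^ r + 2^-1.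
  apply: (lip _ _ (cp_norm_ge0 _ _ _) _ NS0 NST' u1).
  by apply: le_trans u1 (le_trans _ NST); rewrite lerD2l.
apply: (@le_trans _ _ (N S `^ r + 2^-1 + M `^ r + M `^ r + 2^-1)).
  by rewrite lerD2r; apply: le_trans s1 _; exact: lerD (le_trans s2 (lerD t3 t2)) t1.
by rewrite le_eqVlt; apply/orP; left; apply/eqP; field.
Qed.

Lemma banach_saks (x_ : nat -> H -> H) (M e : R) : 0 <= M -> 0 < e ->
  (forall n, cp (x_ n)) -> (forall n, N (x_ n) <= M) -> wot_null x_ ->
  exists (m : nat) (phi : nat -> nat),
    N (sinj k m.+1%:R^-1 *: \sum_(i < m.+1) x_ (phi i)) <= e.
Proof.
move=> M0 e0 cx xM wx.
have ex (S : H -> H) : exists n, cp S -> N (S + x_ n) `^ r <= N S `^ r + (2 * M `^ r + 1).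
  have [cS|ncS] := pselect (cp S); last by exists 0%N => /ncS.
  by have [n hn] := banach_saks_step M0 cx xM wx cS; exists n.
have [nx hnx] := choice ex.
pose S := fix S n : H -> H := if n is m.+1 then S m + x_ (nx (S m)) else 0.
have cS n : cp (S n).
  elim: n => [|n IH] /=; first by have [] := cp0 Hdot p_gt1.
  exact: (cpD Hdot).
have SE n : S n = \sum_(i < n) x_ (nx (S i)).
  by elim: n => [|n IH]; rewrite ?big_ord0 // big_ord_recr -IH.
pose D := 2 * M `^ r + 1.
have D0 : 0 < D by rewrite /D ltr_wpDl // mulr_ge0 ?powR_ge0.
have NS n : N (S n) `^ r <= n%:R * D.
  elim: n => [|n IH] /=; first by rewrite (cp0 Hdot p_gt1).2 powR0 ?gt_eqF // mul0r.
  have -> : n.+1%:R * D = n%:R * D + D by rewrite -natr1 mulrDl mul1r.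
  by apply: le_trans (hnx _ (cS n)) _; rewrite lerD2r.
have r10 : 0 < r - 1 by rewrite subr_gt0.
(* The mean of m + 1 terms has norm at most ((m + 1) D)^(1/r) / (m + 1), which is at most e as soon
   as (m + 1)^(r-1) >= D / e^r. *)
pose m := Num.truncn ((D / e `^ r) `^ (r - 1)^-1).
exists m, (fun i => nx (S i)); rewrite -SE (cp_normZ Hdot) //.
rewrite smod_sinj ger0_norm ?invr_ge0 // ler_pdivrMl //.
rewrite -(pow_le r0) ?cp_norm_ge0 ?mulr_ge0 ?(ltW e0) //.
apply: le_trans (NS _) _; rewrite powRM ?(ltW e0) //.
have er : 0 < e `^ r by exact: powR_gt0.
have r1n : r - 1 != 0 by rewrite gt_eqF.
have h1 : D / e `^ r <= m.+1%:R `^ (r - 1).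
  have D1 : 0 <= D / e `^ r by rewrite divr_ge0 // ltW.
  rewrite -(powVK r1n D1); apply: ler_pow; rewrite ?powR_ge0 ?(ltW r10) //.
  exact: ltW (truncnS_gt _).
rewrite -(@mulr_powRB1 _ m.+1%:R r) // -mulrA ler_pM2l ?ltr0n //.
by rewrite -ler_pdivrMr.
Qed.

(** If a functional stayed away from 0 along a subsequence, rotating its values would keep it above
    d on all means, although some means have arbitrarily small norm. *)
Lemma wot_null_weakly_null (X : set (H -> H)) (x_ : nat -> H -> H) (M : R) :
  closed_subspace cp N X -> (forall n, X (x_ n)) -> (forall n, N (x_ n) <= M) ->
  wot_null x_ -> weakly_null N X x_.
Proof.
move=> [Xcp X0 Xl _] Xx xM wx; split=> // phi [lphi [C hC]].
have cx n : cp (x_ n) by exact: Xcp.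
have M0 : 0 <= M by apply: le_trans (xM 0%N); exact: cp_norm_ge0.
suff lim : null (fun n => smod (phi (x_ n))).
  apply/cvgr0Pnorm_le => e e0.
  have e0' : 0 < sre e by rewrite -(sinj_lt k) rmorph0 -ge0_sinj // ltW.
  have [m hm] := lim _ e0'; exists m => // n /hm; rewrite ger0_norm //= => h'.
  by rewrite normE (ge0_sinj (ltW e0)) sinj_le.
apply: contrapT => /not_null[d d0 [f hf hd]].
have [c hc] := choice (fun n => ex_phase (phi (x_ n))).
pose y_ n := c (f n) *: x_ (f n).
have Xy n : X (y_ n) by have := Xl (c (f n)) _ _ (Xx (f n)) X0; rewrite addr0.
have yM n : N (y_ n) <= M.
  by rewrite (cp_normZ Hdot) // (hc _).1 mul1r.
have wy : wot_null y_.
  move=> i j; apply: null_ext (null_sub hf (wx i j)) => n /=.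
  by rewrite ipZl smodM (hc _).1 mul1r.
have py n : sre (phi (y_ n)) > d.
  have phi0 := dual_zero X0 lphi.
  have := lphi (c (f n)) _ _ (Xx (f n)) X0; rewrite addr0 phi0 addr0 => ->.
  by rewrite -[_ *: _]/(c (f n) * phi (x_ (f n))) (hc _).2 sinjK; have := hd n; rewrite ger0_norm.
have C1 : 0 < `|C| + 1 by rewrite ltr_wpDl.
have dC : 0 < d / 2 / (`|C| + 1) by rewrite !divr_gt0.
have [m [g hg]] := banach_saks M0 dC (fun n => Xcp _ (Xy n)) yM wy.
have [Xz pz] := dual_comb m.+1 (sinj k m.+1%:R^-1) X0 Xl lphi (fun i => Xy (g i)).
have h1 := hC _ Xz; rewrite pz in h1.
have h2 : d <= sre (sinj k m.+1%:R^-1 * \sum_(i < m.+1) phi (y_ (g i))).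
  rewrite sreZ raddf_sum /= ler_pdivlMl ?ltr0n // -[m.+1 in leLHS]card_ord mulr_natl -sumr_const.
  by apply: ler_sum => i _; exact: ltW.
have h3 : d <= `|C| * (d / 2 / (`|C| + 1)).
  apply: le_trans h2 _; apply: le_trans (ler_norm _) _; apply: le_trans (sre_le_smod _) _.
  apply: le_trans h1 _; apply: (@le_trans _ _ (`|C| * N (sinj k m.+1%:R^-1 *: \sum_(i < m.+1) y_ (g i)))).
    by rewrite ler_wpM2r ?cp_norm_ge0 // ler_norm.
  exact: ler_wpM2l.
have h4 : `|C| * (d / 2 / (`|C| + 1)) <= d / 2.
  by rewrite mulrA ler_pdivrMr // mulrC ler_wpM2l ?lerDl // divr_ge0 // ltW.
by have := le_lt_trans (le_trans h3 h4) (half_lt d0); rewrite ltxx.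
Qed.

(** Means of the x_n converge to f in norm, and X is norm closed. *)
Lemma wot_closed (X : set (H -> H)) (x_ : nat -> H -> H) f (M : R) :
  closed_subspace cp N X -> (forall n, X (x_ n)) -> (forall n, N (x_ n) <= M) ->
  cp f -> wot_null (fun n => x_ n - f) -> X f.
Proof.
move=> [Xcp X0 Xl Xc] Xx xM cf wx.
have cx n : cp (x_ n) by exact: Xcp.
have M0 : 0 <= M + N f.
  by apply: addr_ge0; [apply: le_trans (xM 0%N)|]; exact: cp_norm_ge0.
have cy n : cp (x_ n - f) by exact: (cpB Hdot).
have yM n : N (x_ n - f) <= M + N f.
  by apply: le_trans (cp_normB Hdot p_gt1 (cx n) cf) _; rewrite lerD2r.
have ex (n : nat) : exists z, X z /\ N (z - f) <= n.+1%:R^-1.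
  have n0 : (0 : R) < n.+1%:R^-1 by rewrite invr_gt0.
  have [m [g hg]] := banach_saks M0 n0 cy yM wx.
  have lid : linear_on X (fun=> 0 : K^o) by move=> *; rewrite scaler0 addr0.
  have [Xz _] := dual_comb m.+1 (sinj k m.+1%:R^-1) X0 Xl lid (fun i => Xx (g i)).
  eexists; split; first exact: Xz.
  move: hg; rewrite sumrB sumr_const card_ord scalerBr -(@scaler_nat K _ m.+1 f) scalerA.
  have -> : sinj k (m.+1%:R^-1 : R) * m.+1%:R = 1.
    by rewrite -(rmorph_nat (sinj k)) -rmorphM mulVf ?rmorph1 // pnatr_eq0.
  by rewrite scale1r.
have [z hz] := choice ex.
apply: (Xc z) => //; first by move=> n; exact: (hz n).1.
apply/null_cvg; apply: null_le (@null_harmonic R); exists 0%N => n _.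
rewrite ger0_norm ?cp_norm_ge0 //; exact: (hz n).2.
Qed.

End BanachSaks.

(** * Property (m_p) and compactness of the unit ball *)

Section LimSup.
Variable R : realType.
Implicit Types a b : nat -> R.

Lemma pow_cont q (l e : R) : 0 < q -> 0 <= l -> 0 < e -> exists2 d, 0 < d &
  forall t, 0 <= t -> (t <= l + d -> t `^ q <= l `^ q + e) /\
                      (l - d <= t -> l `^ q - e <= t `^ q).
Proof.
move=> q0 l0 e0; have qn : q != 0 by rewrite gt_eqF.
have q0' : 0 < q^-1 by rewrite invr_gt0.
have lq : 0 <= l `^ q by exact: powR_ge0.
have up : exists2 d, 0 < d & forall t, 0 <= t -> t <= l + d -> t `^ q <= l `^ q + e.
  exists ((l `^ q + e) `^ q^-1 - l).
    rewrite subr_gt0 -{1}(powK qn l0); apply: ltr_pow; rewrite ?ltrDl //.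
  move=> t t0; rewrite addrC subrK => h.
  rewrite -[leRHS](powVK qn) ?addr_ge0 ?(ltW e0) //.
  by apply: ler_pow => //; exact: ltW.
have dn : exists2 d, 0 < d & forall t, 0 <= t -> l - d <= t -> l `^ q - e <= t `^ q.
  have [le|el] := leP (l `^ q) e.
    by exists 1 => // t t0 _; apply: le_trans (powR_ge0 _ _); rewrite subr_le0.
  have le0 : 0 <= l `^ q - e by rewrite subr_ge0 ltW.
  exists (l - (l `^ q - e) `^ q^-1).
    rewrite subr_gt0 -{2}(powK qn l0); apply: ltr_pow; rewrite ?ltrBlDr ?ltrDl //.
  move=> t t0; rewrite opprB addrC subrK => h.
  rewrite -[leLHS](powVK qn) //.
  by apply: ler_pow; rewrite ?powR_ge0 // ltW.
have [d1 d10 h1] := up; have [d2 d20 h2] := dn.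
exists (Num.min d1 d2); first by rewrite lt_min d10.
move=> t t0; split=> h.
  by apply: h1 => //; apply: le_trans h _; rewrite lerD2l ge_min lexx.
by apply: h2 => //; apply: le_trans h; rewrite lerD2l lerN2 ge_min lexx orbT.
Qed.

Lemma null_pow_sub q (l : R) a : 0 < q -> 0 <= l -> (forall n, 0 <= a n) ->
  null (fun n => a n - l) -> null (fun n => a n `^ q - l `^ q).
Proof.
move=> q0 l0 a0 h e e0; have [d d0 hd] := pow_cont q0 l0 e0.
have [N hN] := h _ d0; exists N => n /hN; rewrite !ler_norml => /andP[h1 h2].
have [hu hl] := hd _ (a0 n); have := hu; have := hl; lra.
Qed.

Definition lsup a (l : R) :=
  (forall e, 0 < e -> exists m, forall n, (m <= n)%N -> a n <= l + e) /\
  (forall e m, 0 < e -> exists2 n, (m <= n)%N & l - e <= a n).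

Lemma lsup_pow q a l : 0 < q -> 0 <= l -> (forall n, 0 <= a n) ->
  lsup a l -> lsup (fun n => a n `^ q) (l `^ q).
Proof.
move=> q0 l0 a0 [hu hl]; split=> [e|e m] e0; have [d d0 hd] := pow_cont q0 l0 e0.
  by have [m hm] := hu d d0; exists m => n /hm; apply: (hd _ (a0 n)).1.
by have [n mn hn] := hl d m d0; exists n => //; apply: (hd _ (a0 n)).2.
Qed.

Lemma lsup_null a b l : lsup a l -> null b -> lsup (fun n => a n + b n) l.
Proof.
move=> [hu hl] nb; split=> [e|e m] e0.
  have [m1 h1] := hu (e / 2) ltac:(by rewrite divr_gt0).
  have [m2 h2] := nb (e / 2) ltac:(by rewrite divr_gt0).
  exists (maxn m1 m2) => n; rewrite geq_max => /andP[/h1 + /h2].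
  rewrite ler_norml => ? /andP[]; lra.
have [m2 h2] := nb (e / 2) ltac:(by rewrite divr_gt0).
have [n + hn] := hl (e / 2) (maxn m m2) ltac:(by rewrite divr_gt0).
rewrite geq_max => /andP[mn /h2 hb]; exists n => //.
move: hb; rewrite ler_norml => /andP[]; lra.
Qed.

Lemma lsupD a (c l : R) : lsup a l -> lsup (fun n => c + a n) (c + l).
Proof.
move=> [hu hl]; split=> [e /hu[m hm]|e m /(hl _ m)[n mn hn]].
  by exists m => n /hm; lra.
by exists n => //; lra.
Qed.

Lemma null_lsup a l : null (fun n => a n - l) -> lsup a l.
Proof.
move=> h; have -> : a = (fun n => l + 0 + (a n - l)) by apply/funext => n; lra.
apply: lsup_null => //; rewrite -{2}[l]addr0; apply: (@lsupD (fun=> 0)).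
split=> [e e0|e m e0]; first by exists 0%N => n _; lra.
by exists m => //; lra.
Qed.

Lemma limn_esup_lsup a l : limn_esup (EFin \o a) = l%:E <-> lsup a l.
Proof.
rewrite /limn_esup limf_esupE; split.
  move=> E; split=> [e e0|e m e0].
    have : (ereal_inf [set ereal_sup ((EFin \o a) @` V) | V in \oo] < (l + e)%:E)%E.
      by rewrite E lte_fin ltrDl.
    move=> /ereal_inf_lt[_ [V [m _ hm] <-] hV]; exists m => n mn.
    rewrite -lee_fin; apply: le_trans (ltW hV); apply: ereal_sup_ubound.
    by exists n => //; exact: hm.
  apply: contrapT => hn.
  have : ((l)%:E <= (l - e)%:E)%E.
    rewrite -E; apply: ereal_inf_le; exists (ereal_sup ((EFin \o a) @` [set n | (m <= n)%N])).
      by exists [set n | (m <= n)%N] => //; exists m.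
    apply: ge_ereal_sup => _ [n mn <-] /=; rewrite lee_fin leNgt; apply/negP => hlt.
    by apply: hn; exists n => //; exact: ltW.
  by rewrite lee_fin; lra.
move=> [hu hl]; apply/eqP; rewrite eq_le; apply/andP; split.
  apply/lee_addgt0Pr => e /hu[m hm].
  apply: ereal_inf_le; exists (ereal_sup ((EFin \o a) @` [set n | (m <= n)%N])).
    by exists [set n | (m <= n)%N] => //; exists m.
  by apply: ge_ereal_sup => _ [n mn <-] /=; rewrite lee_fin; exact: hm.
apply: le_ereal_inf_tmp => _ [V [m _ hm] <-].
apply/lee_subgt0Pr => e /(hl _ m)[n mn hn].
apply: le_trans (_ : (a n)%:E <= _)%E; first by rewrite lee_fin.
by apply: ereal_sup_ubound; exists n => //; exact: hm.
Qed.

Lemma limn_esup_pinfty a : limn_esup (EFin \o a) = +oo%E <->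
  forall (C : R) m, exists2 n, (m <= n)%N & C <= a n.
Proof.
rewrite /limn_esup limf_esupE; split.
  move=> E C m; apply: contrapT => hn.
  have : (+oo <= C%:E)%E; last by rewrite leye_eq.
  rewrite -E; apply: ereal_inf_le; exists (ereal_sup ((EFin \o a) @` [set n | (m <= n)%N])).
    by exists [set n | (m <= n)%N] => //; exists m.
  apply: ge_ereal_sup => _ [n mn <-] /=; rewrite lee_fin leNgt; apply/negP => hlt.
  by apply: hn; exists n => //; exact: ltW.
move=> h; apply/eqP; rewrite -leye_eq.
apply: le_ereal_inf_tmp => _ [V [m _ hm] <-].
rewrite leye_eq; apply/eqP/eqyP => C _; have [n mn hn] := h C m.
apply: le_trans (_ : (a n)%:E <= _)%E; first by rewrite lee_fin.
by apply: ereal_sup_ubound; exists n => //; exact: hm.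
Qed.

Lemma bolzano a (M : R) : (forall n, `|a n| <= M) -> exists2 f : nat -> nat,
  (forall n, (n <= f n)%N) & exists l, null (fun n => a (f n) - l).
Proof.
move=> aM; have bd : bounded_fun a.
  exists M; split; first exact: num_real.
  by move=> x Mx n _ /=; apply: le_trans (aM n) (ltW Mx).
have [f fi /cvg_ex[l hl]] := bolzano_weierstrass bd.
exists f; last first.
  exists l; apply/null_cvg; rewrite -(subrr l); exact: (cvgB hl (cvg_cst _)).
have fs n : (f n < f n.+1)%N by have := fi n.+1 n; rewrite leEnat ltnn ltnNge => ->.
by elim=> // n IH; apply: leq_ltn_trans IH (fs n).
Qed.

End LimSup.

Section Asymptotic.
Variables (R : realType) (k : scalar_kind).
Local Notation K := (scalar_field R k).
Variables (V : lmodType K) (N : V -> R) (X : set V) (p : R).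
Hypothesis p_gt1 : 1 < p.
Hypothesis N0 : forall x, 0 <= N x.
Hypothesis ND : forall x y, X x -> X y -> N (x + y) <= N x + N y.
Hypothesis NB : forall x y, X x -> X y -> N y <= N (x + y) + N x.
Let p0 : 0 < p. Proof. exact: lt_trans p_gt1. Qed.
Let pn : p != 0. Proof. by rewrite gt_eqF. Qed.

Lemma weakly_null_sub (u : nat -> V) (phi : nat -> nat) : (forall n, (n <= phi n)%N) ->
  weakly_null N X u -> weakly_null N X (u \o phi).
Proof.
move=> hp [Xu hu]; split=> [n|f /hu]; first exact: Xu.
move=> /cvgr0Pnorm_le h; apply/cvgr0Pnorm_le => e /h[m _ hm]; exists m => // n /= mn.
by apply: hm; apply: leq_trans mn (hp n).
Qed.

(* Property [(m_p)] without upper limits. *)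
Definition asym_mp := forall (x : V) (u : nat -> V) (M : R), X x ->
  weakly_null N X u -> (forall n, N (u n) <= M) ->
  null (fun n => N (x + u n) `^ p - N x `^ p - N (u n) `^ p).

Let mpE (a b : R) :
  ((a%:E `^ p + b%:E `^ p) `^ p^-1)%E = ((a `^ p + b `^ p) `^ p^-1)%:E.
Proof. by []. Qed.

(** Along a subsequence violating the conclusion, both N(u_n) and N(x + u_n) may be assumed
    convergent; the upper limits in the property are then limits. *)
Lemma mp_asym : property_mp p N X -> asym_mp.
Proof.
move=> mp x u M Xx wu uM; apply: contrapT => /not_null[d d0 [f hf hd]].
have Xu := wu.1.
have aM n : `|N (u (f n))| <= M by rewrite ger0_norm.
have [g hg [c hc]] := bolzano aM.
have bM n : `|N (x + u (f (g n)))| <= N x + M.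
  by rewrite ger0_norm //; apply: le_trans (ND Xx (Xu _)) _; rewrite lerD2l.
have [h hh [l hl]] := bolzano bM.
pose i n := f (g (h n)).
have hi n : (n <= i n)%N by apply: leq_trans (hh n) (leq_trans (hg _) (hf _)).
have {}hc : null (fun n => N (u (i n)) - c) by exact: (null_sub hh hc).
have c0 : 0 <= c.
  by apply: (@le_null_lim _ _ _ (fun n => N (u (i n)) - c)) => // n; rewrite addrC subrK.
have l0 : 0 <= l.
  by apply: (@le_null_lim _ _ _ (fun n => N (x + u (i n)) - l)) => // n; rewrite addrC subrK.
have := mp x _ Xx (weakly_null_sub hi wu).
have /limn_esup_lsup := null_lsup hl; rewrite -/(_ \o _) => -> .
have /limn_esup_lsup := null_lsup hc => ->.
rewrite mpE => -[E].
have lp : l `^ p = N x `^ p + c `^ p by rewrite E powVK // addr_ge0 ?powR_ge0.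
have := nullB (null_pow_sub p0 l0 (fun n => N0 _) hl) (null_pow_sub p0 c0 (fun n => N0 _) hc).
move=> /(_ d d0)[m /(_ m (leqnn m))].
have := hd (g (h m)); rewrite -/(i m) lp => h1.
set A := _ `^ p in h1 *; set B := N (u _) `^ p in h1 *.
have -> : A - (N x `^ p + c `^ p) - (B - c `^ p) = A - N x `^ p - B by ring.
by rewrite leNgt h1.
Qed.

Lemma asym_mp_property : asym_mp -> property_mp p N X.
Proof.
move=> am x u Xx wu; have Xu := wu.1.
case E : (limn_esup (EFin \o (fun n => N (u n)))) => [l| |].
- have /limn_esup_lsup hl := E.
  have l0 : 0 <= l.
    by rewrite -lee_fin -E; apply: limf_esup_ge0 => //= n; rewrite lee_fin.
  (* The sequence is bounded only from some index on, so [asym_mp] is applied to a shift of it. *)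
  have [m hm] := hl.1 1 ltr01.
  have wu' : weakly_null N X (fun n => u (n + m)%N).
    by apply: (weakly_null_sub (phi := fun n => (n + m)%N)) wu => n; exact: leq_addr.
  have nul := am x _ (l + 1) Xx wu' (fun n => hm _ (leq_addl _ _)).
  have {}nul : null (fun n => N (x + u n) `^ p - N x `^ p - N (u n) `^ p).
    move=> e /nul[m' h']; exists (m' + m)%N => n hn.
    have mn : (m <= n)%N by apply: leq_trans hn; exact: leq_addl.
    by have := h' (n - m)%N; rewrite subnK //; apply; rewrite leq_subRL // addnC.
  have h1 := lsup_null (lsupD (N x `^ p) (lsup_pow p0 l0 (fun n => N0 _) hl)) nul.
  have s0 : 0 <= N x `^ p + l `^ p by rewrite addr_ge0 ?powR_ge0.
  have i0 : 0 < p^-1 by rewrite invr_gt0.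
  have e1 : (fun n => N x `^ p + N (u n) `^ p + (N (x + u n) `^ p - N x `^ p - N (u n) `^ p)) =
      (fun n => N (x + u n) `^ p) by apply/funext => n; ring.
  rewrite e1 in h1.
  have /limn_esup_lsup := lsup_pow i0 s0 (fun n => powR_ge0 _ _) h1.
  under eq_fun do rewrite powK //.
  by move=> ->; rewrite mpE.
(* Infinite upper limit: both sides are infinite, by the reverse triangle inequality [NB]. *)
- rewrite poweRyr //.
  have -> : ((N x)%:E `^ p + +oo = +oo)%E by rewrite poweR_EFin.
  rewrite poweRyr ?invr_eq0 //; apply/limn_esup_pinfty => C m.
  have /limn_esup_pinfty/(_ (C + N x) m)[n mn hn] := E; exists n => //.
  have := NB Xx (Xu n); lra.
- have : (0 <= limn_esup (EFin \o (fun n => N (u n))))%E.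
    by apply: limf_esup_ge0 => //= n; rewrite lee_fin.
  by rewrite E.
Qed.

End Asymptotic.

(** * Perturbations of an operator along a singular vector *)

Section Singular.
Variables (R : realType) (k : scalar_kind).
Local Notation K := (scalar_field R k).
Variables (H : completeNormedModType K) (dot : {dot H for @sconj R k}).
Hypothesis Hdot : forall x : H, `|x| ^+ 2 = dot x x.
Local Notation adj := (adjoint dot).
Local Notation bessel := (bessel dot).
Implicit Types (x y : H) (f g z : H -> H).

Variables (p : R) (p_gt1 : 1 < p).
Local Notation cp := (schatten_class dot p).
Local Notation N := (cp_norm dot p).
Let p1 : 1 <= p := ltW p_gt1.
Let p0 : 0 < p. Proof. exact: lt_trans p_gt1. Qed.
Let pn0 : p != 0. Proof. by rewrite gt_eqF. Qed.

Local Notation compl := (@compl R k H).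

Lemma projection_pfam E : projection dot E -> pfam dot (fun b : bool => if b then E else compl E).
Proof.
move=> pE; have [lF sF _] := compl_projection pE; have [lE sE _] := pE.
have h x : \sum_(b : bool) nm ((if b then E else compl E) x) ^+ 2 <= nm x ^+ 2.
  by rewrite big_bool /= -(projection_pyth Hdot x pE).
by case.
Qed.

(** The images of u and of its orthogonal complement under [f] are orthogonal, so [f] is block
    diagonal for the pair of lines u and w = f u / s; pinching and block summation give the two
    inequalities. *)
Lemma singular_split f (u : H) (s : R) : cp f -> nm u = 1 -> 0 < s ->
  (forall y, dot (f u) (f y) = sinj k (s ^+ 2) * dot u y) ->
  nm (f u) = s /\ N f `^ p = s `^ p + N (f \o compl (rank1 dot u u)) `^ p.
Proof.
move=> cf u1 s0 hu; have lf := (cp_bop cf).1.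
have fu : nm (f u) = s.
  apply/eqP; rewrite -(@eqrXn2 _ 2) ?(ltW s0) //; apply/eqP.
  by rewrite (nm_sqr Hdot) hu sreZ -(nm_sqr Hdot) u1 expr1n mulr1.
split=> //; set E := rank1 dot u u.
have pE := line_projection Hdot u1; have pF := compl_projection pE; rewrite -/E in pE pF.
pose w := sinj k s^-1 *: f u.
have w1 : nm w = 1.
  by rewrite /w nmZ smod_sinj fu ger0_norm ?invr_ge0 ?(ltW s0) // mulVf // gt_eqF.
have pG := line_projection Hdot w1; have pG' := compl_projection pG; set G := rank1 dot w w in pG pG'.
have [lG _ _] := pG.
have fE x : (f \o E) x = dot x u *: f u by rewrite /= /E /rank1 (linZ lf).
have fuw : f u = sinj k s *: w.
  by rewrite /w scalerA -rmorphM divff ?gt_eqF // rmorph1 scale1r.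
have Gf : G (f u) = f u.
  by rewrite fuw (linZ lG) /G /rank1 (ipxx Hdot) w1 expr1n rmorph1 scale1r.
have h1 x : (f \o E) x = G ((f \o E) (E x)).
  have [_ _ EE] := pE; by rewrite [in RHS]/= EE -[f (E x)]/((f \o E) x) fE (linZ lG) Gf.
have h2 x : (f \o compl E) x = compl G ((f \o compl E) (compl E x)).
  have [_ _ EE] := pF; rewrite /= EE /compl [f _ in LHS]/=.
  rewrite -[LHS]subr0; congr (_ - _); rewrite /G /rank1 /w ipZr.
  have -> : dot (f (x - E x)) (f u) = 0.
    rewrite -[LHS](@sconjK R k) -ipC hu ipBr [dot u (E x)]ipZr (ipxx Hdot) u1 expr1n rmorph1 mulr1.
    by rewrite -ipC subrr mulr0 rmorph0.
  by rewrite mulr0 scale0r.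
have cE := cp_compr Hdot p_gt1 cf (projection_contraction Hdot pE).
have cF := cp_compr Hdot p_gt1 cf (projection_contraction Hdot pF).
have NE : N (f \o E) = s.
  apply/eqP; rewrite eq_le; apply/andP; split.
    have -> : f \o E = rank1 dot u (f u) by apply/funext => x; rewrite fE.
    by have [_] := cp_rank1 Hdot p_gt1 u (f u); rewrite u1 mul1r fu.
  have := nm_le_cp Hdot p_gt1 u cE.1; rewrite u1 mulr1 fE (ipxx Hdot) u1 expr1n rmorph1 scale1r.
  by rewrite fu.
have pfE := projection_pfam pE; have pfG := projection_pfam pG.
apply/eqP; rewrite eq_le; apply/andP; split.
  have D0 : 0 <= s `^ p + N (f \o compl E) `^ p by rewrite addr_ge0 ?powR_ge0.
  pose g (b : bool) := if b then f \o E else f \o compl E.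
  have cg b : cp (g b) by case: b; [exact: cE.1|exact: cF.1].
  have gE b x : g b x = (if b then G else compl G) (g b ((if b then E else compl E) x)).
    by case: b => /=; [exact: h1|exact: h2].
  have [||_] := @cp_block_sum _ _ _ _ Hdot _ p_gt1 _ _ _ g
    ((s `^ p + N (f \o compl E) `^ p) `^ p^-1) pfG pfE cg gE; rewrite ?powR_ge0 //.
    by rewrite big_bool /= powVK // NE.
  have -> : \sum_b g b = f.
    rewrite big_bool; apply/funext => x; rewrite -[LHS]/(f (E x) + f (x - E x)) (linB lf).
    by rewrite subrKC.
  move=> /(ler_pow (ltW p0) (cp_norm_ge0 _ _ _)); rewrite powVK //.
have := cp_pinch Hdot p_gt1 pfG pfE cf; rewrite big_bool /=.
have -> : G \o f \o E = f \o E.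
  by apply/funext => x; rewrite [in RHS]h1 /=; have [_ _ EE] := pE; rewrite EE.
have -> : compl G \o f \o compl E = f \o compl E.
  by apply/funext => x; rewrite [in RHS]h2 /=; have [_ _ EE] := pF; rewrite EE.
by rewrite NE.
Qed.

Lemma cp_convex a b : cp a -> cp b -> 2 * N a `^ p <= N (a + b) `^ p + N (a - b) `^ p.
Proof.
move=> ca cb; have cs := cpD Hdot p_gt1 ca cb; have cd := cpB Hdot p_gt1 ca cb.
apply: le_trans (pow_mean_ge1 p1 (cp_norm_ge0 _ _ _) (cp_norm_ge0 _ _ _)).
rewrite ler_wpM2l //; apply: ler_pow; rewrite ?cp_norm_ge0 ?(ltW p0) //.
rewrite ler_pdivlMr // mulrC.
have := cp_normD Hdot p_gt1 cs cd.
rewrite addrACA subrr addr0 -mulr2n -(scaler_nat 2 a) (cp_normZ Hdot) //.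
by rewrite -[2%:R](rmorph_nat (sinj k)) smod_sinj ger0_norm.
Qed.

Let sqs (s : R) : 0 <= s -> (s ^+ 2) `^ (p / 2 - 1) = s `^ (p - 2).
Proof. by move=> s0; rewrite -(sqr_pow _ s0); congr (_ `^ _); field. Qed.

Lemma nm_pow_ge2 (x a : H) : 2 <= p -> 0 < nm x ->
  2 * nm x `^ p + p * nm x `^ (p - 2) * nm a ^+ 2 <= nm (x + a) `^ p + nm (x - a) `^ p.
Proof.
move=> p2 x0; rewrite -!(@sqr_pow _ p) // -(sqs (ltW x0)).
have q1 : 1 <= p / 2 by rewrite ler_pdivlMr // mul1r.
apply: le_trans (pow_mean_ge1 q1 (sqr_ge0 _) (sqr_ge0 _)).
rewrite (parallelogram Hdot) [2 * _ / 2]mulrC mulKf //.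
have := pow_tangent q1 (exprn_gt0 2 x0) (addr_ge0 (sqr_ge0 (nm x)) (sqr_ge0 (nm a))).
rewrite addrAC subrr add0r; lra.
Qed.

Lemma nm_pow_le2 (x a : H) : p <= 2 -> 0 < nm x ->
  nm (x + a) `^ p + nm (x - a) `^ p <= 2 * nm x `^ p + p * nm x `^ (p - 2) * nm a ^+ 2.
Proof.
move=> p2 x0; rewrite -!(@sqr_pow _ p) // -(sqs (ltW x0)).
have q0 : 0 < p / 2 by rewrite divr_gt0.
have q1 : p / 2 <= 1 by rewrite ler_pdivrMr // mul1r.
apply: le_trans (pow_mean_le1 q0 q1 (sqr_ge0 _) (sqr_ge0 _)) _.
rewrite (parallelogram Hdot) [2 * _ / 2]mulrC mulKf //.
have := pow_tangent_le q0 q1 (exprn_gt0 2 x0) (addr_ge0 (sqr_ge0 (nm x)) (sqr_ge0 (nm a))).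
rewrite addrAC subrr add0r; lra.
Qed.

(* For [a = t y], the left side grows like [t^2] whereas [(m_p)] makes the
   right side exceed [2 N f ^ p] by at most [O(t^p)], which is smaller if [p > 2]. *)
Lemma two_sided_ge2 f a (u : H) (s : R) : 2 <= p -> cp f -> cp a -> nm u = 1 -> 0 < s ->
  (forall y, dot (f u) (f y) = sinj k (s ^+ 2) * dot u y) ->
  2 * N f `^ p + p * s `^ (p - 2) * nm (a u) ^+ 2 <= N (f + a) `^ p + N (f - a) `^ p.
Proof.
move=> p2 cf ca u1 s0 hu; have [fu ->] := singular_split cf u1 s0 hu.
have pC := projection_contraction Hdot (compl_projection (line_projection Hdot u1)).
have h1 := line_split_ge2 Hdot p_gt1 p2 (cpD Hdot p_gt1 cf ca) u1.
have h2 := line_split_ge2 Hdot p_gt1 p2 (cpB Hdot p_gt1 cf ca) u1.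
apply: le_trans (lerD h1 h2).
have fu0 : 0 < nm (f u) by rewrite fu.
have h3 := nm_pow_ge2 (a u) p2 fu0.
have h4 := cp_convex (cp_compr Hdot p_gt1 cf pC).1 (cp_compr Hdot p_gt1 ca pC).1.
rewrite fu in h3; rewrite addrACA; apply: le_trans (lerD h3 h4).
rewrite mulrDr; set A := 2 * _; set B := 2 * _; rewrite -!addrA lerD2l addrC; exact: lexx.
Qed.

(* For [a = t y] and [L = t M] the last term on the left is of order [t^p], which
   dominates the last term [O(t^2)] on the right if [p < 2]. *)
Lemma two_sided_le2 f a (u : H) (s L : R) : p <= 2 -> cp f -> cp a -> nm u = 1 -> 0 < s ->
  (forall y, dot (f u) (f y) = sinj k (s ^+ 2) * dot u y) -> 0 < L -> N a <= L ->
  N (f + a) `^ p + N (f - a) `^ p + p * L `^ (p - 2) * nm (a u) ^+ 2 <=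
  2 * N f `^ p + 2 * N a `^ p + p * s `^ (p - 2) * nm (a u) ^+ 2.
Proof.
move=> p2 cf ca u1 s0 hu L0 aL; have [fu ->] := singular_split cf u1 s0 hu.
have pC := projection_contraction Hdot (compl_projection (line_projection Hdot u1)).
have h1 := line_split_le2 Hdot p_gt1 p2 (cpD Hdot p_gt1 cf ca) u1.
have h2 := line_split_le2 Hdot p_gt1 p2 (cpB Hdot p_gt1 cf ca) u1.
have fu0 : 0 < nm (f u) by rewrite fu.
have h3 := nm_pow_le2 (a u) p2 fu0; rewrite fu in h3.
have h4 := clarkson_le2 Hdot p_gt1 (cp_compr Hdot p_gt1 cf pC).1 (cp_compr Hdot p_gt1 ca pC).1 p2.
have h5 := line_strict_le2 Hdot p_gt1 p2 ca u1 L0 aL.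
move: h1 h2 h3 h4 h5.
have -> : (f + a) \o compl (rank1 dot u u) =
  (f \o compl (rank1 dot u u)) + (a \o compl (rank1 dot u u)) by [].
have -> : (f - a) \o compl (rank1 dot u u) =
  (f \o compl (rank1 dot u u)) - (a \o compl (rank1 dot u u)) by [].
rewrite -[(f + a) u]/(f u + a u) -[(f - a) u]/(f u - a u).
set c := compl _.
have -> : p * L `^ (p - 2) * nm (a u) ^+ 2 = 2 * (p / 2 * L `^ (p - 2) * nm (a u) ^+ 2) by field.
move: (p / 2 * L `^ (p - 2) * nm (a u) ^+ 2) (p * s `^ (p - 2) * nm (a u) ^+ 2) => Y X.
move: (N (f + a) `^ p) (N (f - a) `^ p) (nm (f u + a u) `^ p) (nm (f u - a u) `^ p)
  (N ((f \o c) + (a \o c)) `^ p) (N ((f \o c) - (a \o c)) `^ p) => A B A1 B1 A2 B2.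
move: (N (f \o c) `^ p) (N (a \o c) `^ p) (s `^ p) (N a `^ p) => F G D Z *; lra.
Qed.

(** For a given tolerance, first t is fixed so that C t^a is small, then n is taken large. In use, a
    is the gap |p - 2| between the two scales. *)
Lemma null_rates (w : nat -> R) (C a : R) : 0 < a -> 0 <= C -> (forall n, 0 <= w n) ->
  (forall t, 0 < t -> exists2 b, null b & forall n, w n <= C * t `^ a + b n) -> null w.
Proof.
move=> a0 C0 w0 h e e0; have an : a != 0 by rewrite gt_eqF.
have C1 : 0 < C + 1 by rewrite ltr_wpDl.
have d0 : 0 < e / 2 / (C + 1) by rewrite !divr_gt0.
have [b nb hb] := h _ (powR_gt0 a^-1 d0).
have e2 : 0 < e / 2 by rewrite divr_gt0.
have [m hm] := nb _ e2; exists m => n /hm h1; rewrite ger0_norm //.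
have {}h1 := le_trans (ler_norm _) h1; have := hb n; rewrite (powVK an (ltW d0)).
have : C * (e / 2 / (C + 1)) <= e / 2.
  by rewrite mulrA ler_pdivrMr // mulrC ler_wpM2l ?lerDl // ltW.
lra.
Qed.

Lemma singular_vanish f (y_ : nat -> H -> H) (u : H) (s M : R) : p <> 2 ->
  cp f -> (forall n, cp (y_ n)) -> 0 < M -> (forall n, N (y_ n) <= M) -> nm u = 1 -> 0 < s ->
  (forall y, dot (f u) (f y) = sinj k (s ^+ 2) * dot u y) ->
  (forall t : R, t != 0 -> null (fun n =>
     N (f + sinj k t *: y_ n) `^ p - N f `^ p - N (sinj k t *: y_ n) `^ p)) ->
  null (fun n => nm (y_ n u)).
Proof.
move=> pn2 cf cy M0 yM u1 s0 hu has; apply: null_sqr.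
(* Adding the relations for t and -t produces the symmetric expression of the two-sided
   estimates. *)
have has2 (t : R) : 0 < t -> null (fun n => N (f + sinj k t *: y_ n) `^ p +
    N (f - sinj k t *: y_ n) `^ p - 2 * N f `^ p - 2 * N (sinj k t *: y_ n) `^ p).
  move=> t0; have tn : t != 0 by rewrite gt_eqF.
  have tn' : - t != 0 by rewrite oppr_eq0.
  apply: null_ext (nullD (has _ tn) (has _ tn')) => n.
  rewrite rmorphN scaleNr (cp_normN Hdot p_gt1 (cpZ Hdot p_gt1 _ (cy n))).
  move: (N (f + sinj k t *: y_ n) `^ p) (N (f - sinj k t *: y_ n) `^ p) (N f `^ p)
    (N (sinj k t *: y_ n) `^ p) => A B C D; ring.
have Nt (t : R) n : 0 < t -> N (sinj k t *: y_ n) <= t * M.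
  by move=> t0; rewrite (cp_normZ Hdot) // smod_sinj gtr0_norm // ler_pM2l.
have ut (t : R) n : 0 < t -> nm ((sinj k t *: y_ n) u) ^+ 2 = t ^+ 2 * nm (y_ n u) ^+ 2.
  by move=> t0; rewrite -[(_ *: _) u]/(sinj k t *: (y_ n u)) nmZ smod_sinj gtr0_norm // exprMn.
have t2 (t : R) : 0 < t -> t `^ p = t ^+ 2 * t `^ (p - 2).
  move=> t0; rewrite -powR_mulrn ?(ltW t0) // -powRD; first by congr (_ `^ _); ring.
  by rewrite (gt_eqF t0) implybT.
have [p2|p2] := leP p 2; last first.
  have K0 : 0 < p * s `^ (p - 2) by rewrite mulr_gt0 // powR_gt0.
  have a0 : 0 < p - 2 by rewrite subr_gt0.
  apply: (@null_rates _ (2 * M `^ p / (p * s `^ (p - 2))) (p - 2)) => // [||t t0].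
  - by rewrite divr_ge0 ?(ltW K0) // mulr_ge0 ?powR_ge0.
  - by move=> n; exact: sqr_ge0.
  eexists; first exact: (nullZ (t ^+ 2 * (p * s `^ (p - 2)))^-1 (has2 t t0)).
  move=> n /=.
  have := two_sided_ge2 (ltW p2) cf (cpZ Hdot p_gt1 (sinj k t) (cy n)) u1 s0 hu; rewrite ut //.
  have := ler_pow (ltW p0) (cp_norm_ge0 _ _ _) (Nt t n t0).
  rewrite powRM ?(ltW t0) ?(ltW M0) // (t2 t) // => g1 g2.
  have tt : 0 < t ^+ 2 by rewrite exprn_gt0.
  rewrite -(ler_pM2l (mulr_gt0 tt K0)) [leRHS]mulrDr mulVKf ?gt_eqF ?(mulr_gt0 tt K0) //.
  have -> : t ^+ 2 * (p * s `^ (p - 2)) * (2 * M `^ p / (p * s `^ (p - 2)) * t `^ (p - 2)) =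
      2 * (t ^+ 2 * t `^ (p - 2) * M `^ p).
    by field; rewrite pn0 /= gt_eqF //; exact: powR_gt0.
  move: g1 g2.
  move: (N (f + sinj k t *: y_ n) `^ p) (N (f - sinj k t *: y_ n) `^ p) (N f `^ p)
    (N (sinj k t *: y_ n) `^ p) (nm (y_ n u) ^+ 2) (p * s `^ (p - 2)) => A B C Z D E.
  set X := _ * M `^ p => g1 g2.
  have -> : t ^+ 2 * E * D = E * (t ^+ 2 * D) by ring.
  by move: g1 g2; move: (E * (t ^+ 2 * D)) X => W X *; lra.
have p2' : p < 2 by rewrite lt_neqAle p2 andbT; apply/eqP.
have K0 : 0 < p * s `^ (p - 2) by rewrite mulr_gt0 // powR_gt0.
have L0 : 0 < p * M `^ (p - 2) by rewrite mulr_gt0 // powR_gt0.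
have a0 : 0 < 2 - p by rewrite subr_gt0.
apply: (@null_rates _ ((p * s `^ (p - 2)) * M ^+ 2 / (p * M `^ (p - 2))) (2 - p)) => // [||t t0].
- by rewrite divr_ge0 ?(ltW L0) // mulr_ge0 ?sqr_ge0 ?(ltW K0).
- by move=> n; exact: sqr_ge0.
have tt : 0 < t ^+ 2 by rewrite exprn_gt0.
have tp : 0 < t `^ (p - 2) by exact: powR_gt0.
eexists; first exact: (nullN (nullZ (t ^+ 2 * (p * M `^ (p - 2)) * t `^ (p - 2))^-1 (has2 t t0))).
move=> n /=.
have tM : 0 < t * M by exact: mulr_gt0.
have := two_sided_le2 p2 cf (cpZ Hdot p_gt1 (sinj k t) (cy n)) u1 s0 hu tM (Nt t n t0).
rewrite ut // powRM ?(ltW t0) ?(ltW M0) // => g2.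
have wM : nm (y_ n u) ^+ 2 <= M ^+ 2.
  rewrite (sqr_le (nm_ge0 _) (ltW M0)); apply: le_trans (nm_le_cp Hdot p_gt1 u (cy n)) _.
  by rewrite u1 mulr1.
have -> : t `^ (2 - p) = (t `^ (p - 2))^-1 by rewrite -powRN opprB.
rewrite -(ler_pM2l (mulr_gt0 (mulr_gt0 tt L0) tp)) [leRHS]mulrBr mulVKf ?gt_eqF ?(mulr_gt0 (mulr_gt0 tt L0) tp) //.
have -> : t ^+ 2 * (p * M `^ (p - 2)) * t `^ (p - 2) *
    (p * s `^ (p - 2) * M ^+ 2 / (p * M `^ (p - 2)) / t `^ (p - 2)) =
    p * s `^ (p - 2) * (t ^+ 2 * M ^+ 2).
  by field; rewrite pn0 /= !gt_eqF //; exact: powR_gt0.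
have : p * s `^ (p - 2) * (t ^+ 2 * nm (y_ n u) ^+ 2) <= p * s `^ (p - 2) * (t ^+ 2 * M ^+ 2).
  by rewrite (ler_pM2l K0) (ler_pM2l tt).
have -> : t ^+ 2 * (p * M `^ (p - 2)) * t `^ (p - 2) * nm (y_ n u) ^+ 2 =
  p * (t `^ (p - 2) * M `^ (p - 2)) * (t ^+ 2 * nm (y_ n u) ^+ 2) by ring.
move: g2; set P := p * s `^ _ * _; set Q := p * s `^ _ * _; set W := p * _ * _.
move: (N (f + sinj k t *: y_ n) `^ p) (N (f - sinj k t *: y_ n) `^ p) (N f `^ p)
  (N (sinj k t *: y_ n) `^ p) P Q W => *; lra.
Qed.
End Singular.

(** * Strong convergence of weakly null sequences and compactness for tau *)

Section Vanish.
Variables (R : realType) (k : scalar_kind).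
Local Notation K := (scalar_field R k).
Variables (H : completeNormedModType K) (dot : {dot H for @sconj R k}).
Hypothesis Hdot : forall x : H, `|x| ^+ 2 = dot x x.
Local Notation adj := (adjoint dot).
Local Notation bessel := (bessel dot).
Implicit Types (x y : H) (f g z : H -> H).

Variables (p : R) (p_gt1 : 1 < p).
Local Notation cp := (schatten_class dot p).
Local Notation N := (cp_norm dot p).
Let p1 : 1 <= p := ltW p_gt1.
Let p0 : 0 < p. Proof. exact: lt_trans p_gt1. Qed.
Let pn0 : p != 0. Proof. by rewrite gt_eqF. Qed.

Hypothesis pn2 : p <> 2.

Lemma null_kernel (y_ : nat -> H -> H) (M : R) : (forall n, linear (y_ n)) -> 0 < M ->
  (forall n x, nm (y_ n x) <= M * nm x) ->
  closed_linear (fun x => null (fun n => nm (y_ n x))).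
Proof.
move=> ly M0 yM; split=> [|a x y hx hy|x hx].
- by under eq_fun do rewrite (lin0 (ly _)) nm0; exact: null0.
- apply: null_squeeze (nullD (nullZ (smod a) hx) hy) => n; rewrite ger0_norm // ly.
  by apply: le_trans (nmD _ _) _; rewrite nmZ.
move=> e e0; have e2 : 0 < e / 2 by rewrite divr_gt0.
have [y hy hxy] := hx _ (divr_gt0 e2 M0).
have [m hm] := hy _ e2; exists m => n /hm; rewrite !ger0_norm // => h1.
apply: le_trans (nm_sub (y_ n y) _) _; rewrite -(linB (ly n)).
have : nm (y_ n (x - y)) <= e / 2.
  by apply: le_trans (yM _ _) _; rewrite mulrC -ler_pdivlMr.
by move: h1; lra.
Qed.

(** The vectors x with y_n x --> 0 form a closed subspace, which contains the right singular vectors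
    of every f in [S] and hence the range of every [adj f]. On its orthogonal complement all members
    of [S] vanish, the y_n included. *)
Lemma asym_sot (S : set (H -> H)) (y_ : nat -> H -> H) (M : R) : S `<=` cp ->
  (forall n, S (y_ n)) -> (forall n, N (y_ n) <= M) ->
  (forall f (t : R), S f -> t != 0 -> null (fun n =>
     N (f + sinj k t *: y_ n) `^ p - N f `^ p - N (sinj k t *: y_ n) `^ p)) ->
  forall x, null (fun n => nm (y_ n x)).
Proof.
move=> Scp Sy yM' has.
have M0 : 0 < M + 1 by rewrite ltr_wpDl // (le_trans _ (yM' 0%N)) ?cp_norm_ge0.
have yM n : N (y_ n) <= M + 1 by apply: le_trans (yM' n) _; rewrite lerDl.
have cy n := Scp _ (Sy n); have ly n : linear (y_ n) := (cp_bop (cy n)).1.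
have cl : closed_linear (fun x => null (fun n => nm (y_ n x))).
  apply: (null_kernel ly M0) => n x.
  by apply: le_trans (nm_le_cp Hdot p_gt1 _ (cy n)) _; rewrite ler_wpM2r.
have rg f w : S f -> null (fun n => nm (y_ n (adj f w))).
  move=> Sf; have cf := Scp _ Sf; have [s [u [hs h1 _]]] := cp_sing Hdot p_gt1 cf.
  have Gu i : null (fun n => nm (y_ n (u i))).
    have := sing_ge0 hs i; rewrite le_eqVlt => /predU1P[s0|s0].
      under eq_fun do rewrite (sing_null hs (esym s0)) (lin0 (ly _)) nm0; exact: null0.
    apply: (singular_vanish Hdot p_gt1 pn2 cf cy M0 yM (sing_unit hs s0) s0 (sing_eq hs i)) => t t0.
    exact: has.
  have [G0 Glin Gcl] := cl; apply: Gcl => e e0.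
  have [m] := sing_range Hdot w (cp_bop cf) hs (cp_sing_null p_gt1 hs h1) (exprn_gt0 2 e0).
  move=> /(_ m (leqnn m)) hm.
  exists (proj dot (fun i : 'I_m => u i) (adj f w)).
    rewrite /proj; elim/big_rec: _ => [|i x _ hx]; first exact: G0.
    exact: Glin.
  have om := sing_orthosys m hs.
  rewrite -(sqr_le (nm_ge0 _) (ltW e0)); apply: le_trans (ler_norm _) (le_trans _ hm).
  rewrite -(proj_sqr Hdot om) (proj_pyth Hdot om (adj f w)).
  by rewrite [_ - nm (proj _ _ _) ^+ 2]addrAC subrr add0r.
move=> x; have [g hg ort] := projection_exists Hdot x cl.
have ker f : S f -> f (x - g) = 0.
  move=> Sf; apply: nm_eq0; suff /eqP : nm (f (x - g)) ^+ 2 = 0 by rewrite expf_eq0 => /eqP.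
  rewrite (nm_sqr Hdot) -(adjP' Hdot (cp_bop (Scp _ Sf))).
  by rewrite (ipC dot) ort ?rmorph0 ?raddf0 //; exact: rg.
apply: null_ext hg => n.
by rewrite -{1}[x](subrK g) (linD (ly n)) ker // add0r.
Qed.

Variable h : nat -> H.
Hypothesis hb : orthobasis dot h.
Local Notation wot_null := (wot_null dot h).

Lemma asym_mp_sot (X : set (H -> H)) (y_ : nat -> H -> H) (M : R) :
  closed_subspace cp N X -> asym_mp N X p ->
  (forall n, X (y_ n)) -> (forall n, N (y_ n) <= M) -> wot_null y_ ->
  forall x, null (fun n => nm (y_ n x)) /\ null (fun n => nm (adj (y_ n) x)).
Proof.
move=> Xc am Xy yM wy; have [Xcp X0 Xl _] := Xc.
have cy n := Xcp _ (Xy n).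
have has f (t : R) : X f -> null (fun n =>
     N (f + sinj k t *: y_ n) `^ p - N f `^ p - N (sinj k t *: y_ n) `^ p).
  move=> Xf; have Xt n : X (sinj k t *: y_ n).
    by have := Xl (sinj k t) _ _ (Xy n) X0; rewrite addr0.
  have tM n : N (sinj k t *: y_ n) <= `|t| * M.
    by rewrite (cp_normZ Hdot) // smod_sinj ler_wpM2l.
  apply: (am _ _ (`|t| * M)) => //.
  apply: (wot_null_weakly_null Hdot p_gt1 hb Xc Xt tM) => i j.
  by apply: null_ext (nullZ `|t| (wy i j)) => n /=; rewrite ipZl smodM smod_sinj.
move=> x; split.
  apply: (@asym_sot X _ M) => // f t Xf _; exact: has.
(* The asymptotic relation passes to adjoints because taking adjoints preserves the norm; it is for
   this use that [asym_sot] allows a mere set. *)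
apply: (@asym_sot [set adj f | f in X] (fun n => adj (y_ n)) M).
- by move=> _ [f Xf <-]; exact: (cp_adj Hdot p_gt1 (Xcp _ Xf)).1.
- by move=> n; exists (y_ n).
- by move=> n; rewrite (cp_adj Hdot p_gt1 (cy n)).2.
move=> _ t [f Xf <-] t0; apply: null_ext (has f t Xf) => n.
have cf := Xcp _ Xf; have cn := cpZ Hdot p_gt1 (sinj k t) (cy n).
rewrite -(cp_adj Hdot p_gt1 cf).2 -(cp_adj Hdot p_gt1 cn).2.
rewrite -(cp_adj Hdot p_gt1 (cpD Hdot p_gt1 cf cn)).2.
have E : adj (sinj k t *: y_ n) = sinj k t *: adj (y_ n).
  have := adj_comb Hdot (sinj k t) (cp_bop (cy n)) (bop0 H).
  rewrite addr0 sconj_sinj => ->.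
  rewrite (_ : adj 0 = 0) ?addr0 //; apply: (adj_uniq Hdot) => u v; by rewrite ip0l ip0r.
have E2 : adj (f + sinj k t *: y_ n) = adj f + sinj k t *: adj (y_ n).
  rewrite addrC [RHS]addrC.
  by have := adj_comb Hdot (sinj k t) (cp_bop (cy n)) (cp_bop cf); rewrite sconj_sinj.
by rewrite E E2.
Qed.

Lemma cvg_tau (F : set_system (H -> H)) f : Filter F ->
  (forall x (e : R), 0 < e -> F [set g | nm (g x - f x) <= e]) ->
  (forall x (e : R), 0 < e -> F [set g | nm (adj g x - adj f x) <= e]) ->
  F --> (f : tau_topology dot).
Proof.
move=> FF h1 h2.
have pt (w : (H -> H) -> H -> H) : (forall x (e : R), 0 < e -> F [set g | nm (w g x - w f x) <= e]) ->
    {ptws, w @ F --> w f}.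
  move=> hw; apply/pointwise_cvgP => x; apply/cvgrPdist_le => e e0.
  have e0' : 0 < sre e by rewrite -(sinj_lt k) rmorph0 -ge0_sinj // ltW.
  change (F [set g | `|w f x - w g x| <= e]).
  apply: filterS (hw x _ e0') => g /= hg.
  by rewrite normH (ge0_sinj (ltW e0)) sinj_le nm_distC.
move=> A /= [_ [[B oB <-] Bf sB]].
have [[P Q] /= [hP hQ] hPQ] : nbhs ((f, adj f) : {ptws H -> H} * {ptws H -> H}) B.
  exact: open_nbhs_nbhs.
have FP : F P := pt id h1 _ hP.
have FQ : F (fun g => Q (adj g)) := pt adj h2 _ hQ.
by apply: filterS (filterI FP FQ) => g [Pg Qg]; apply: sB; apply: hPQ.
Qed.

Lemma filter_lt (T : Type) (F : set_system T) (B : nat -> set T) m : Filter F ->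
  (forall i, F (B i)) -> F [set f | forall i, (i < m)%N -> B i f].
Proof.
move=> FF hB; elim: m => [|m IH]; first by apply: filterS filterT.
by apply: filterS (filterI IH (hB m)) => f [h1 h2] i; rewrite ltnS leq_eqVlt => /predU1P[->|/h1].
Qed.

Lemma basis_nm i : nm (h i) = 1.
Proof. exact: (orthonormal_nm Hdot hb.1). Qed.

(** The cut vectors lie in a bounded set of a finite-dimensional space, so a finite net localises
    the ultrafilter. *)
Lemma ultra_entries (X : set (H -> H)) (w : (H -> H) -> H -> H) (F : set_system (H -> H)) (m : nat) (d : R) :
  UltraFilter F -> F X -> (forall f x, X f -> nm (w f x) <= nm x) -> 0 < d ->
  exists y : nat -> H, F [set f | forall i, (i < m)%N -> nm (head_proj dot h m (w f (h i)) - y i) <= d].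
Proof.
move=> uF FX Xw d0.
have ex i : exists y, F [set f | nm (head_proj dot h m (w f (h i)) - y) <= d].
  have [ys hys] := comb_net h m 1 d0.
  apply: (ultra_seq uF (s := ys)); apply: filterS FX => f Xf /=.
  have [j|y yys hy] := hys (fun j => dot (w f (h i)) (h j)); last by exists y.
  apply: le_trans (cauchy_schwarz Hdot _ _) _.
  by rewrite basis_nm mulr1; apply: le_trans (Xw _ _ Xf) _; rewrite basis_nm.
have [y hy] := choice ex; exists y; exact: filter_lt.
Qed.

Lemma ultra_ptw_cvg (F : set_system (H -> H)) (w : (H -> H) -> H -> H) : UltraFilter F ->
  (forall x (e : R), 0 < e -> exists y, F [set g | nm (w g x - y) <= e]) ->
  exists l : H -> H, forall x (e : R), 0 < e -> F [set g | nm (w g x - l x) <= e].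
Proof.
move=> uF hF.
have ex x : exists l : H, forall e : R, 0 < e -> F [set g | nm (w g x - l) <= e].
  have uF' : ProperFilter ((fun g => w g x) @ F) by exact: fmap_proper_filter.
  have [l hl] := proper_almost_const_cvg uF' (hF x); exists l => e e0.
  have h2 : nbhs l (ball l (sinj k e)).
    by apply: nbhsx_ballx; rewrite -(rmorph0 (sinj k)) sinj_lt.
  have FB : F (fun g => ball l (sinj k e) (w g x)) := hl _ h2.
  apply: filterS FB => g.
  by rewrite -ball_normE /ball_ /= normH sinj_lt nm_distC; exact: ltW.
by have [l hl] := choice ex; exists l.
Qed.

Lemma mp_tau_compact (X : set (H -> H)) : closed_subspace cp N X -> asym_mp N X p ->
  tau_compact dot (closed_unit_ball N X).
Proof.
move=> Xc am; have [Xcp X0 Xl _] := Xc.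
rewrite /tau_compact compact_ultra => F uF FB.
have bd f x : closed_unit_ball N X f -> nm (f x) <= nm x.
  move=> [Xf f1]; apply: le_trans (nm_le_cp Hdot p_gt1 x (Xcp _ Xf)) _.
  by rewrite -[leRHS]mul1r ler_wpM2r.
have XB f g : X f -> X g -> X (f - g).
  by move=> Xf Xg; have := Xl (-1) _ _ Xg Xf; rewrite scaleN1r addrC.
(* The ultrafilter is Cauchy at x. Otherwise pairs with nearly equal leading entries but distant
   values at x have differences contradicting [wn]. Used for w = id and w = adj. *)
have key (w : (H -> H) -> H -> H) x :
    (forall f g, X f -> X g -> w (f - g) x = w f x - w g x) ->
    (forall z_ : nat -> H -> H, (forall n, X (z_ n)) -> (forall n, N (z_ n) <= 2) ->
       wot_null z_ -> null (fun n => nm (w (z_ n) x))) ->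
    forall e : R, 0 < e -> exists y, F [set g | nm (w g x - y) <= e].
  move=> wB wn e e0; apply: contrapT => /forallNP hn.
  have ex (m : nat) : exists z, [/\ X z, N z <= 2, e < nm (w z x) &
      forall i, (i < m)%N -> nm (head_proj dot h m (z (h i))) <= m.+1%:R^-1].
    have d0 : 0 < m.+1%:R^-1 / 2 :> R by rewrite divr_gt0 ?invr_gt0.
    have [y Fy] := @ultra_entries _ id F m _ uF FB bd d0.
    have [f0 [hf0 [Xf0 f01]]] := filter_ex (filterI Fy FB).
    (* No ball of radius e around a point is charged by the ultrafilter, so the complement of the
       one around [w f0 x] is. *)
    have [/hn//|nF] := in_ultra_setVsetC [set g | nm (w g x - w f0 x) <= e] uF.
    have [f1 [[hf1 [Xf1 f11]] hlt]] := filter_ex (filterI (filterI Fy FB) nF).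
    exists (f1 - f0); split; first exact: XB.
    - apply: le_trans (cp_normB Hdot p_gt1 (Xcp _ Xf1) (Xcp _ Xf0)) _; lra.
    - by rewrite wB // ltNge; apply/negP.
    move=> i im; have [lP _ _] := head_proj_projection Hdot hb m.
    rewrite -[(f1 - f0) _]/(f1 (h i) - f0 (h i)) (linB lP).
    apply: le_trans (nm_tri (y i) _ _) _.
    by rewrite [leRHS]splitr; apply: lerD; [exact: hf1|rewrite nm_distC; exact: hf0].
  have [z_ hz] := choice ex.
  have wz : wot_null z_.
    move=> i j; apply: null_le (@null_harmonic R); exists (maxn i j).+1 => n.
    rewrite gtn_max => /andP[ni nj]; rewrite ger0_norm //.
    have [_ _ _ /(_ i ni)] := hz n; apply: le_trans.
    have := proj_dot Hdot (basis_orthosys Hdot hb n) (z_ n (h i)) (Ordinal nj) => /= <-.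
    by apply: le_trans (cauchy_schwarz Hdot _ _) _; rewrite basis_nm mulr1.
  have zn : null (fun n => nm (w (z_ n) x)).
    by apply: wn => // n; have [] := hz n.
  have [m /(_ m (leqnn m))] := zn _ e0.
  by rewrite ger0_norm // leNgt; have [_ _ -> _] := hz m.
have [f hf] : exists f : H -> H, forall x (e : R), 0 < e -> F [set g | nm (g x - f x) <= e].
  apply: (ultra_ptw_cvg (w := id) uF) => x; apply: (key id) => // z_ Xz zM wz.
  exact: (asym_mp_sot Xc am Xz zM wz x).1.
have [f' hf'] : exists f' : H -> H, forall x (e : R), 0 < e -> F [set g | nm (adj g x - f' x) <= e].
  apply: (ultra_ptw_cvg (w := adj) uF) => x; apply: (key adj) => [g1 g2 X1 X2|z_ Xz zM wz]; last first.
    exact: (asym_mp_sot Xc am Xz zM wz x).2.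
  have := adj_comb Hdot (-1) (cp_bop (Xcp _ X2)) (cp_bop (Xcp _ X1)).
  by rewrite scaleN1r addrC rmorphN1 scaleN1r => ->; rewrite addrC.
have lf : linear f.
  move=> a x y; apply/eqP; rewrite -subr_eq0; apply/eqP/nm_eq0.
  apply/eqP; rewrite eq_le nm_ge0 andbT; apply/ler_addgt0Pr => e e0; rewrite add0r.
  have a1 : 0 < smod a + 2 by rewrite ltr_wpDl.
  have d0 := divr_gt0 e0 a1.
  have [g [[[h1 h2] h3] [Xg _]]] := filter_ex (filterI (filterI (filterI (hf x _ d0) (hf y _ d0)) (hf (a *: x + y) _ d0)) FB).
  have lg := (cp_bop (Xcp _ Xg)).1.
  have -> : f (a *: x + y) - (a *: f x + f y) =
    a *: (g x - f x) + (g y - f y) - (g (a *: x + y) - f (a *: x + y)).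
    by rewrite lg scalerBr addrACA -opprD opprB [RHS]addrC addrA subrK.
  apply: le_trans (nmB _ _) _; apply: le_trans (lerD (nmD _ _) (lexx _)) _; rewrite nmZ.
  apply: (@le_trans _ _ (smod a * (e / (smod a + 2)) + e / (smod a + 2) + e / (smod a + 2))).
    by rewrite !lerD // ler_wpM2l.
  by rewrite le_eqVlt; apply/orP; left; apply/eqP; field; rewrite gt_eqF.
have bf : bop f.
  split=> //; exists 1 => x; rewrite mul1r; apply/ler_addgt0Pr => e e0.
  have [g [h1 Bg]] := filter_ex (filterI (hf x _ e0) FB).
  apply: le_trans (nm_sub (g x) _) _; rewrite nm_distC.
  by apply: lerD => //; exact: bd.
have aE x y : dot (f x) y = dot x (f' y).
  apply/eqP; rewrite -subr_eq0 -smod_eq0 eq_le smod_ge0 andbT; apply/ler_addgt0Pr => e e0; rewrite add0r.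
  have a1 : 0 < nm x + nm y + 1 by rewrite ltr_wpDl // addr_ge0.
  have d0 := divr_gt0 e0 a1.
  have [g [[h1 h2] [Xg _]]] := filter_ex (filterI (filterI (hf x _ d0) (hf' y _ d0)) FB).
  have -> : dot (f x) y - dot x (f' y) = dot x (adj g y - f' y) - dot (g x - f x) y.
    by rewrite ipBl ipBr -(adjP Hdot (cp_bop (Xcp _ Xg))) opprB [RHS]addrC subrKA.
  apply: le_trans (smodB _ _) _.
  apply: le_trans (lerD (cauchy_schwarz Hdot _ _) (cauchy_schwarz Hdot _ _)) _.
  apply: (@le_trans _ _ ((nm x + nm y) * (e / (nm x + nm y + 1)))).
    rewrite mulrDl [X in _ + X <= _]mulrC.
    by apply: lerD; [exact: (ler_wpM2l _ h2)|exact: (ler_wpM2l _ h1)].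
  by rewrite mulrA ler_pdivrMr // mulrC ler_wpM2l ?lerDl // ltW.
have f'E : adj f = f' by exact: (adj_uniq Hdot).
have [cf f1] : cp f /\ N f <= 1.
  (* On finitely many vectors f is approximated by elements of the unit ball. *)
  apply: (cp_le Hdot p_gt1 bf ler01); apply: (Qle_approx p1 ler01) => I e g d d0.
  have D0 : 0 < \sum_i nm (g i) + 1 by rewrite ltr_wpDl // sumr_ge0.
  have Fi : F [set z | forall i, nm (z (e i) - f (e i)) <= d / (\sum_i nm (g i) + 1)].
    by apply: filter_forall => i; exact: (hf (e i) _ (divr_gt0 d0 D0)).
  have [x_ [hx [Xx x1]]] := filter_ex (filterI Fi FB).
  exists x_.
    move=> J e1 g1 b1 b2; apply: le_trans (cp_Qle Hdot p_gt1 (Xcp _ Xx) b1 b2) _.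
    by apply: ler_pow; rewrite ?cp_norm_ge0 ?(ltW p0).
  move=> i; rewrite -ipBl; apply: le_trans (cauchy_schwarz Hdot _ _) _.
  apply: le_trans (ler_wpM2r (nm_ge0 _) (hx i)) _.
  rewrite mulrAC ler_pdivrMr // ler_wpM2l ?(ltW d0) //.
  by rewrite (bigD1 i) //= -addrA lerDl addr_ge0 // sumr_ge0.
(* A sequence in the ball agreeing with f ever better on the first m basis vectors has differences
   with vanishing entries. *)
have Xf : X f.
  have ex (m : nat) : exists g, closed_unit_ball N X g /\
      forall i, (i < m)%N -> nm (g (h i) - f (h i)) <= m.+1%:R^-1.
    have m0 : (0 : R) < m.+1%:R^-1 by rewrite invr_gt0.
    by have [g [h1 h2]] := filter_ex (filterI (filter_lt m _ (fun i => hf (h i) _ m0)) FB); exists g.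
  have [x_ hx] := choice ex.
  apply: (wot_closed Hdot p_gt1 hb Xc (x_ := x_) (M := 1)) => //.
  - by move=> n; have [[]] := hx n.
  - by move=> n; have [[]] := hx n.
  move=> i j; apply: null_le (@null_harmonic R); exists i.+1 => n ni; rewrite ger0_norm //.
  apply: le_trans (cauchy_schwarz Hdot _ _) _; rewrite basis_nm mulr1.
  by have [_] := hx n; apply.
exists f; split; first by split.
by apply: cvg_tau => //; rewrite f'E.
Qed.

End Vanish.

(** The sets defining eigenvalue sequences of a matrix and of its extension to [H] may differ at t =
    0, since the extension has a larger kernel; their suprema agree nevertheless. *)
Lemma sup_pos_eq (R : realType) (A B : set R) : (forall t, A t -> 0 <= t) ->
  (forall t, B t -> 0 <= t) -> (forall t : R, 0 < t -> A t <-> B t) -> sup A = sup B.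
Proof.
have half (A' B' : set R) : (forall t, A' t -> 0 <= t) -> (forall t, B' t -> 0 <= t) ->
    (forall t : R, 0 < t -> A' t <-> B' t) -> sup A' <= sup B'.
  move=> A0 B0 AB; have B'0 : 0 <= sup B'.
    have [[[t Bt] ub]|/sup_out ->//] := pselect (has_sup B').
    by apply: le_trans (B0 _ Bt) _; apply: ub_le_sup.
  have [sA|/sup_out ->//] := pselect (has_sup A').
  apply: ge_sup; first exact: sA.1.
  move=> t At; have [t0|/le_trans->//] := ltP 0 t.
  apply: ub_le_sup; last exact/AB.
  have [y hy] := sA.2; exists y => b Bb; have [b0|/le_trans->//] := ltP 0 b; last exact: le_trans (ltW t0) (hy _ At).
  by apply: hy; exact/AB.
move=> A0 B0 AB; apply/eqP; rewrite eq_le half //=; apply: half => // t t0.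
by have [h1 h2] := AB t t0.
Qed.

(** * The space l_p(c_p^n) and almost isometries *)

Section MatrixNorm.
Variables (R : realType) (k : scalar_kind).
Local Notation K := (scalar_field R k).
Variables (H : completeNormedModType K) (dot : {dot H for @sconj R k}).
Hypothesis Hdot : forall x : H, `|x| ^+ 2 = dot x x.
Local Notation adj := (adjoint dot).
Local Notation bessel := (bessel dot).
Implicit Types (x y : H) (f g z : H -> H).

Variables (p : R) (p_gt1 : 1 < p).
Local Notation cp := (schatten_class dot p).
Local Notation N := (cp_norm dot p).
Let p1 : 1 <= p := ltW p_gt1.
Let p0 : 0 < p. Proof. exact: lt_trans p_gt1. Qed.
Let pn0 : p != 0. Proof. by rewrite gt_eqF. Qed.

Variable h : nat -> H.
Hypothesis ho : forall i j, dot (h i) (h j) = (i == j)%:R.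

Definition mx_vec n (c : 'cV[K]_n) : H := \sum_(i < n) c i 0 *: h i.
Definition vec_mx n (x : H) : 'cV[K]_n := \col_i dot x (h i).
(** Extension of [A] by 0 off the first n basis vectors; it carries the norm inequalities for
    operators over to matrices. *)
Definition mx_op n (A : 'M[K]_n) (x : H) : H := mx_vec (A *m vec_mx n x).

Lemma mx_vec_lin n : linear (@mx_vec n).
Proof.
move=> a c d; rewrite /mx_vec scaler_sumr -big_split /=; apply: eq_bigr => i _.
by rewrite !mxE scalerDl scalerA.
Qed.

Lemma vec_mx_lin n : linear (@vec_mx n).
Proof. by move=> a x y; apply/colP => i; rewrite !mxE ipDl ipZl. Qed.

Lemma ip_mx_vec n (c : 'cV[K]_n) x : dot (mx_vec c) x = mx_dot c (vec_mx n x).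
Proof.
by rewrite /mx_vec /mx_dot ip_suml; apply: eq_bigr => i _; rewrite ipZl mxE -ipC.
Qed.

Lemma vec_mxK n (c : 'cV[K]_n) : vec_mx n (mx_vec c) = c.
Proof.
apply/colP => i; rewrite mxE /mx_vec ip_suml (bigD1 i) //= big1 ?addr0.
  by rewrite ipZl ho eqxx mulr1.
by move=> j ji; rewrite ipZl ho val_eqE (negbTE ji) mulr0.
Qed.

Lemma ip_mx_vec2 n (c d : 'cV[K]_n) : dot (mx_vec c) (mx_vec d) = mx_dot c d.
Proof. by rewrite ip_mx_vec vec_mxK. Qed.

Lemma ip_vec_mx n (c : 'cV[K]_n) x : dot x (mx_vec c) = mx_dot (vec_mx n x) c.
Proof.
rewrite /mx_vec /mx_dot ip_sumr; apply: eq_bigr => i _; rewrite ipZr mxE mulrC //.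
Qed.

Lemma mx_dot_ext n (c d : 'cV[K]_n) : (forall u, mx_dot u c = mx_dot u d) -> c = d.
Proof.
move=> hcd; rewrite -(vec_mxK c) -(vec_mxK d); congr vec_mx.
by apply: (ip_extr Hdot) => x; rewrite !ip_vec_mx.
Qed.

Lemma mx_op_lin n (A : 'M[K]_n) : linear (mx_op A).
Proof.
move=> a x y; rewrite /mx_op vec_mx_lin mulmxDr -scalemxAr; exact: mx_vec_lin.
Qed.

Lemma mx_opE n (A : 'M[K]_n) : mx_op A = \sum_i \sum_j A i j *: rank1 dot (h j) (h i).
Proof.
apply/funext => x; rewrite !fct_sumE /mx_op /mx_vec; apply: eq_bigr => i _.
rewrite fct_sumE mxE scaler_suml; apply: eq_bigr => j _.
by rewrite !fctE /rank1 mxE scalerA.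
Qed.

Lemma mx_op_cp n (A : 'M[K]_n) : cp (mx_op A) /\ N (mx_op A) <= \sum_i \sum_j smod (A i j).
Proof.
have hn := orthonormal_nm Hdot ho.
have c1 i j : cp (A i j *: rank1 dot (h j) (h i)) /\
    N (A i j *: rank1 dot (h j) (h i)) <= smod (A i j).
  have [c1 n1] := cp_rank1 Hdot p_gt1 (h j) (h i); split; first exact: cpZ.
  by rewrite (cp_normZ Hdot) // ler_piMr // (le_trans n1) // !hn mulr1.
have c2 i : cp (\sum_j A i j *: rank1 dot (h j) (h i)) /\
    N (\sum_j A i j *: rank1 dot (h j) (h i)) <= \sum_j smod (A i j).
  have [c n1] := @cp_sum _ _ _ _ Hdot _ p_gt1 _ (index_enum 'I_n) xpredT _ (fun j _ => (c1 i j).1).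
  by split=> //; apply: le_trans n1 _; apply: ler_sum => j _; exact: (c1 i j).2.
rewrite mx_opE; have [c n1] := @cp_sum _ _ _ _ Hdot _ p_gt1 _ (index_enum 'I_n) xpredT _ (fun i _ => (c2 i).1).
by split=> //; apply: le_trans n1 _; apply: ler_sum => i _; exact: (c2 i).2.
Qed.

Lemma mx_op_comb n a (A B : 'M[K]_n) : mx_op (a *: A + B) = a *: mx_op A + mx_op B.
Proof.
apply/funext => x; rewrite -[RHS]/(a *: mx_op A x + mx_op B x) /mx_op mulmxDl -scalemxAl; exact: mx_vec_lin.
Qed.

(** Eigenvectors of [T] for nonzero eigenvalues lie in its range, hence come from columns. *)
Lemma eigenvalue_seq_op n (M : 'cV[K]_n -> 'cV[K]_n) (T : H -> H) :
  (forall c, T (mx_vec c) = mx_vec (M c)) -> (forall x, T x = mx_vec (vec_mx n (T x))) ->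
  linear T -> forall m, eigenvalue_seq (@mx_dot R k n) M m = eigenvalue_seq dot T m.
Proof.
move=> TM Tr lT m.
apply: sup_pos_eq => [t []|t []|t t0] //; split=> -[_ [e [oe he]]]; split; rewrite ?(ltW t0) //.
- exists (fun i => mx_vec (e i)); split=> [i j|i]; first by rewrite ip_mx_vec2.
  have [l hl tl] := he i; exists l => //.
  by rewrite TM hl (linZ (@mx_vec_lin n)).
- have ev i : e i = mx_vec (vec_mx n (e i)).
    have [l hl tl] := he i.
    have l0 : l != 0 by apply/eqP => l0; move: tl; rewrite l0 raddf0 leNgt t0.
    have -> : e i = l^-1 *: T (e i) by rewrite hl scalerA mulVf // scale1r.
    by rewrite {1}Tr (linZ (@vec_mx_lin n)) (linZ (@mx_vec_lin n)).
  exists (fun i => vec_mx n (e i)); split=> [i j|i].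
    by rewrite -ip_mx_vec2 -!ev.
  have [l hl tl] := he i; exists l => //.
  rewrite -(linZ (@vec_mx_lin n)) -hl {2}ev TM vec_mxK //.
Qed.

Lemma mx_cp_normE n (A : 'M[K]_n) : mx_cp_norm p A = N (mx_op A).
Proof.
have bA := cp_bop (mx_op_cp A).1.
have ex : forall u v, mx_dot (A *m u) v = mx_dot u (vec_mx n (adj (mx_op A) (mx_vec v))).
  move=> u v; rewrite -ip_mx_vec2 -ip_mx_vec -(adjP Hdot bA).
  by rewrite /mx_op vec_mxK.
have aE v : adjoint (@mx_dot R k n) (mulmx A) v = vec_mx n (adj (mx_op A) (mx_vec v)).
  apply: mx_dot_ext => u; rewrite -ex.
  have := @xgetPex _ (fun=> 0) [set g : 'cV[K]_n -> 'cV[K]_n | forall u v, mx_dot (A *m u) v = mx_dot u (g v)].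
  by move=> /(_ (ex_intro _ _ ex)) /= ->.
rewrite /mx_cp_norm /cp_norm /schatten_norm; congr (fine ('N[_]_(_)[_ \o _])).
apply/funext => m; rewrite /singular_value; congr Num.sqrt.
have rg y : adj (mx_op A) y = mx_vec (vec_mx n (adj (mx_op A) y)).
  apply: (ip_extr Hdot) => z; rewrite ip_vec_mx -ip_mx_vec -!(adjP Hdot bA).
  by rewrite /mx_op vec_mxK.
apply: eigenvalue_seq_op => [c|x|].
- by rewrite /= aE -rg /= /mx_op vec_mxK.
- by rewrite {1}/comp rg.
- by move=> a x y /=; rewrite mx_op_lin (adj_bop Hdot bA).1.
Qed.
End MatrixNorm.

Lemma sum_tailE (R : realType) (s : nat -> R) m n :
  \sum_(i < n) (if (i < m)%N then 0 else s i) = \sum_(i < n) s i - \sum_(i < minn m n) s i.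
Proof.
elim: n => [|n IH]; first by rewrite minn0 !big_ord0 subrr.
rewrite !big_ord_recr /= IH; case: ltnP => mn.
  rewrite addr0 (minn_idPr mn) big_ord_recr /=.
  by rewrite !subrr.
by rewrite (minn_idPl (leqW mn)) addrAC.
Qed.

(** * Asymptotic additivity of the norm in an l_p sum *)

Section TailSplit.
Variables (R : realType) (V : zmodType) (E : set V) (L : V -> R) (p : R).
Variables (tl : nat -> V -> V) (S : nat -> V -> R).
Hypothesis p1 : 1 <= p.
Hypothesis L0 : forall x, 0 <= L x.
Hypothesis ED : forall x y, E x -> E y -> E (x + y) /\ L (x + y) <= L x + L y.
Hypothesis EN : forall x, E x -> E (- x) /\ L (- x) = L x.
Hypothesis tlD : forall m x y, tl m (x + y) = tl m x + tl m y.
Hypothesis Etl : forall m x, E x -> E (tl m x) /\ L x `^ p = S m x + L (tl m x) `^ p.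
Hypothesis S0 : forall m x, 0 <= S m x.
Let p0 : 0 < p. Proof. exact: lt_le_trans ltr01 p1. Qed.

Lemma tail_le m x : E x -> L (tl m x) <= L x.
Proof. by move=> Ex; rewrite -(pow_le p0) // (Etl m Ex).2 lerDr. Qed.

(** Choose m so that the tail of a is small. The heads are asymptotically additive by assumption,
    and the tails of a + u_n and u_n differ by at most the tail of a, which the Lipschitz bound of
    t^p transfers to p-th powers. *)
Lemma tail_asym a (u : nat -> V) (M : R) : E a -> (forall n, E (u n)) ->
  (forall n, L (u n) <= M) -> null (fun m => L (tl m a)) ->
  (forall m, null (fun n => S m (a + u n) - S m a - S m (u n))) ->
  null (fun n => L (a + u n) `^ p - L a `^ p - L (u n) `^ p).
Proof.
move=> la lu uM ta u0.
pose C := L a + `|M|.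
have C0 : 0 <= C by rewrite addr_ge0.
move=> e e0.
pose D := p * C `^ (p - 1) + 1.
have D0 : 0 < D by rewrite /D ltr_wpDl // mulr_ge0 ?powR_ge0 ?(ltW p0).
have tn : null (fun m => L (tl m a) `^ p + D * L (tl m a)).
  exact: nullD (null_pow p0 (fun=> L0 _) ta) (nullZ D ta).
have e2 : 0 < e / 2 by rewrite divr_gt0.
have [m /(_ m (leqnn m)) hm] := tn _ e2.
have [n0 hn] := u0 m _ e2; exists n0 => n /hn {}hn.
have lau := ED la (lu n).
have MC : L (u n) <= `|M| by rewrite (le_trans (uM n)) // ler_norm.
have c1 : L (tl m (a + u n)) <= C.
  by apply: le_trans (tail_le m lau.1) (le_trans lau.2 _); rewrite lerD2l.
have c2 : L (tl m (u n)) <= C.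
  by apply: le_trans (tail_le m (lu n)) (le_trans MC _); rewrite lerDr.
have c3 := pow_lip p1 (L0 _) c1 (L0 _) c2.
have [lta _] := Etl m la; have [ltu _] := Etl m (lu n).
have c4 : `|L (tl m (a + u n)) - L (tl m (u n))| <= L (tl m a).
  have [ltau t1] := ED lta ltu; rewrite -tlD in t1 ltau.
  have [lna nE] := EN lta.
  have [_] := ED lna ltau; rewrite nE tlD addKr -tlD => t2.
  by rewrite ler_norml; apply/andP; split; lra.
have c5 : p * C `^ (p - 1) * `|L (tl m (a + u n)) - L (tl m (u n))| <= D * L (tl m a).
  by apply: ler_pM; rewrite ?mulr_ge0 ?powR_ge0 ?(ltW p0) // /D lerDl.
have c6 := le_trans c3 c5.
have Tp := powR_ge0 (L (tl m a)) p.
have DT : 0 <= D * L (tl m a) by rewrite mulr_ge0 // ltW.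
rewrite (Etl m la).2 (Etl m (lu n)).2 (Etl m lau.1).2.
rewrite ger0_norm ?addr_ge0 // in hm.
move: (D * _) DT c6 hm => DD DT; move: (L (tl m a) `^ p) Tp => TA Tp.
move: (S m (a + u n)) (S m a) (S m (u n)) hn => S1 S2 S3.
move: (L (tl m (a + u n)) `^ p) (L (tl m (u n)) `^ p) => T1 T2.
rewrite !ler_norml => /andP[g1 g2] /andP[g3 g4] g5.
apply/andP; split; lra.
Qed.
End TailSplit.

Section LpNorm.
Variables (R : realType) (k : scalar_kind).
Local Notation K := (scalar_field R k).
Variables (H : completeNormedModType K) (dot : {dot H for @sconj R k}).
Hypothesis Hdot : forall x : H, `|x| ^+ 2 = dot x x.
Local Notation adj := (adjoint dot).
Local Notation bessel := (bessel dot).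
Implicit Types (x y : H) (f g z : H -> H).

Variables (p : R) (p_gt1 : 1 < p).
Local Notation cp := (schatten_class dot p).
Local Notation N := (cp_norm dot p).
Let p1 : 1 <= p := ltW p_gt1.
Let p0 : 0 < p. Proof. exact: lt_trans p_gt1. Qed.
Let pn0 : p != 0. Proof. by rewrite gt_eqF. Qed.

Variable h : nat -> H.
Hypothesis ho : forall i j, dot (h i) (h j) = (i == j)%:R.
Local Notation mN := (@mx_cp_norm R k p _).
Local Notation lp := (@lp_cpn R k p).
Local Notation L := (@lp_cpn_norm R k p).
Local Notation mop := (mx_op dot h).
Let mNE n (A : 'M[K]_n) : mN A = N (mop A) := mx_cp_normE Hdot p_gt1 ho A.
Let mcp n (A : 'M[K]_n) : cp (mop A) := (mx_op_cp Hdot p_gt1 ho A).1.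

Lemma mx_cp_norm_ge0 n (A : 'M[K]_n) : 0 <= mN A.
Proof. by rewrite mNE cp_norm_ge0. Qed.

Lemma mx_cp_norm_comb n a (A B : 'M[K]_n) : mN (a *: A + B) <= smod a * mN A + mN B.
Proof. by rewrite !mNE mx_op_comb; exact: (cp_comb Hdot p_gt1 a (mcp A) (mcp B)).2. Qed.

Lemma mx_cp_norm0 n : mN (0 : 'M[K]_n) = 0.
Proof.
rewrite mNE (_ : mop 0 = 0) ?(cp0 Hdot p_gt1).2 //.
by apply/funext => x; rewrite /mx_op mul0mx (lin0 (@mx_vec_lin _ _ _ h n)).
Qed.

Lemma mx_cp_norm_entry n (A : 'M[K]_n) i j : smod (A i j) <= mN A.
Proof.
have hn := orthonormal_nm Hdot ho.
have := smod_le_cp Hdot p_gt1 (h j) (h i) (mcp A); rewrite !hn !mulr1 -mNE.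
suff -> : dot (mop A (h j)) (h i) = A i j by [].
rewrite /mx_op ip_mx_vec /mx_dot (bigD1 i) //= big1 ?addr0.
  rewrite !mxE ho eqxx rmorph1 mulr1 (bigD1 j) //= big1 ?addr0.
    by rewrite mxE ho eqxx mulr1.
  by move=> l lj; rewrite mxE ho [_ == _](negbTE _) ?mulr0 // eq_sym.
by move=> l li; rewrite !mxE ho [(_ == _ :> nat)](negbTE _) ?rmorph0 ?mulr0 // eq_sym.
Qed.

Lemma mx_cp_norm_sum n (A : 'M[K]_n) : mN A <= \sum_i \sum_j smod (A i j).
Proof. by rewrite mNE; exact: (mx_op_cp Hdot p_gt1 ho A).2. Qed.

Implicit Types (a b : mx_seq R k).
Let m0 a i : 0 <= mN (a i). Proof. exact: mx_cp_norm_ge0. Qed.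

Lemma lp_cpn_norm_ge0 a : 0 <= L a.
Proof. by apply: fine_ge0; exact: Lnorm_ge0. Qed.

Lemma lp_cpn_le a (C : R) : 0 <= C -> (forall n, \sum_(i < n) mN (a i) `^ p <= C `^ p) ->
  lp a /\ L a <= C.
Proof.
move=> C0 hs; have /(Lnorm_leP p0 C0 (m0 a)) hL := hs.
have lpa : lp a by apply: le_lt_trans hL (ltry _).
split=> //; rewrite -lee_fin /lp_cpn_norm fineK // fin_real //.
by rewrite lpa andbT (lt_le_trans _ (Lnorm_ge0 _ _ _)) // ltNyr.
Qed.

Lemma lp_cpn_sum a n : lp a -> \sum_(i < n) mN (a i) `^ p <= L a `^ p.
Proof.
move=> lpa; move: n; apply/(Lnorm_leP p0 (lp_cpn_norm_ge0 a) (m0 a)).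
rewrite /lp_cpn_norm fineK // fin_real //.
by rewrite [(_ < +oo)%E]lpa andbT (lt_le_trans _ (Lnorm_ge0 _ _ _)) // ltNyr.
Qed.

Lemma lp_cpn_lim a : lp a -> null (fun n => L a `^ p - \sum_(i < n) mN (a i) `^ p).
Proof.
move=> lpa; apply: (sum_pow_sup p_gt1 (lp_cpn_norm_ge0 a) (m0 a)).
  by move=> n; exact: lp_cpn_sum.
by move=> C C0 hC; exact: (lp_cpn_le C0 hC).2.
Qed.

Lemma lp_cpn_comb c a b : lp a -> lp b ->
  lp (c *: a + b) /\ L (c *: a + b) <= smod c * L a + L b.
Proof.
move=> la lb; have L0 := lp_cpn_norm_ge0.
apply: lp_cpn_le => [|n]; first by rewrite addr_ge0 ?mulr_ge0.
apply: (@le_trans _ _ (\sum_(i < n) (smod c * mN (a i) + mN (b i)) `^ p)).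
  apply: ler_sum => i _; apply: ler_pow; rewrite ?(ltW p0) ?m0 //.
  exact: mx_cp_norm_comb.
apply: sum_pow_mink => // [i|||]; rewrite ?mulr_ge0 ?L0 //; last exact: lp_cpn_sum.
rewrite powRM // (eq_bigr (fun i : 'I_n => smod c `^ p * mN (a i) `^ p)); last first.
  by move=> i _; rewrite powRM.
by rewrite -mulr_sumr ler_wpM2l ?powR_ge0 //; exact: lp_cpn_sum.
Qed.

Lemma lp_cpn0 : lp 0 /\ L 0 = 0.
Proof.
have [l0 L0] : lp 0 /\ L 0 <= 0.
  apply: lp_cpn_le => // n; rewrite big1 ?powR_ge0 // => i _.
  by rewrite -[(0 : mx_seq R k) i]/0 mx_cp_norm0 powR0.
by split=> //; apply/eqP; rewrite eq_le L0 lp_cpn_norm_ge0.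
Qed.

Lemma lp_cpn_normZ c a : lp a -> L (c *: a) = smod c * L a.
Proof.
have le d b : lp b -> L (d *: b) <= smod d * L b.
  by move=> lb; have [_] := lp_cpn_comb d lb lp_cpn0.1; rewrite lp_cpn0.2 !addr0.
move=> la; have [->|c0] := eqVneq c 0; first by rewrite scale0r lp_cpn0.2 smod0 mul0r.
apply/eqP; rewrite eq_le le //=.
have lc : lp (c *: a) by have [] := lp_cpn_comb c la lp_cpn0.1; rewrite addr0.
have sc : 0 < smod c by rewrite lt_neqAle smod_ge0 eq_sym smod_eq0 c0.
rewrite -ler_pdivlMl //; have := le c^-1 _ lc; rewrite scalerA mulVf // scale1r.
suff -> : smod c^-1 = (smod c)^-1 by [].
by apply: (mulfI (lt0r_neq0 sc)); rewrite -smodM divff // smod1 divff // gt_eqF.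
Qed.

Lemma mx_cp_norm_le_lp a i : lp a -> mN (a i) <= L a.
Proof.
move=> la; have := lp_cpn_sum i.+1 la; rewrite big_ord_recr /= => h1.
rewrite -(pow_le p0) ?m0 ?lp_cpn_norm_ge0 //; apply: le_trans h1.
by rewrite lerDr sumr_ge0 // => j _; exact: powR_ge0.
Qed.

Lemma lp_cpn_eq0 a : lp a -> L a = 0 -> a = 0.
Proof.
move=> la La; apply: functional_extensionality_dep => i.
apply/matrixP => r s; rewrite [RHS]mxE; apply/eqP; rewrite -smod_eq0 eq_le smod_ge0 andbT.
by rewrite -La (le_trans _ (mx_cp_norm_le_lp i la)) // mx_cp_norm_entry.
Qed.

Definition mx_tail m (a : mx_seq R k) : mx_seq R k := fun i => if (i < m)%N then 0 else a i.

Lemma mx_tailD m a b : mx_tail m (a + b) = mx_tail m a + mx_tail m b.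
Proof.
apply: functional_extensionality_dep => i.
rewrite -[RHS]/(mx_tail m a i + mx_tail m b i) /mx_tail.
by case: ifP => // _; rewrite addr0.
Qed.

Lemma lp_tail m a : lp a -> lp (mx_tail m a) /\
  L a `^ p = \sum_(i < m) mN (a i) `^ p + L (mx_tail m a) `^ p.
Proof.
move=> la.
pose Sa n := \sum_(i < n) mN (a i) `^ p.
pose St n := \sum_(i < n) mN (mx_tail m a i) `^ p.
have E n : St n = Sa n - Sa (minn m n).
  apply: etrans (@sum_tailE _ (fun i => mN (a i) `^ p) m n); apply: eq_bigr => i _.
  by rewrite /mx_tail; case: ifP => // _; rewrite mx_cp_norm0 powR0.
have Sa_ge0 n : 0 <= Sa n by apply: sumr_ge0 => i _; exact: powR_ge0.
have Sa_le n : Sa n <= L a `^ p := lp_cpn_sum n la.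
have lt : lp (mx_tail m a).
  have hs n : St n <= L a `^ p.
    by rewrite E; apply: le_trans (Sa_le n); rewrite lerBlDr lerDl.
  exact: (@lp_cpn_le (mx_tail m a) (L a) (lp_cpn_norm_ge0 a) hs).1.
have la_lim : null (fun n => L a `^ p - Sa n) := lp_cpn_lim la.
have lt_lim : null (fun n => L (mx_tail m a) `^ p - St n) := lp_cpn_lim lt.
suff main : L a `^ p = Sa m + L (mx_tail m a) `^ p by [].
apply/eqP; rewrite -subr_eq0; apply/eqP/null_const => e.
move=> /(nullB la_lim lt_lim)[n0 hn]; exists (maxn n0 m) => n; rewrite geq_max => /andP[/hn + mn].
rewrite E (minn_idPl mn).
move: (L a `^ p) (L (mx_tail m a) `^ p) (Sa n) (Sa m) => A B C D.
by have -> : A - C - (B - (C - D)) = A - (D + B) by ring.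
Qed.

Lemma lp_tail_null a : lp a -> null (fun m => L (mx_tail m a)).
Proof.
move=> la; have n1 : null (fun m => L (mx_tail m a) `^ p).
  by apply: null_ext (lp_cpn_lim la) => m; rewrite (lp_tail m la).2 addrAC subrr add0r.
have p0' : 0 < p^-1 by rewrite invr_gt0.
apply: null_ext (null_pow p0' (fun=> powR_ge0 _ _) n1) => m.
by rewrite powK // lp_cpn_norm_ge0.
Qed.

Lemma lp_asym a (u : nat -> mx_seq R k) (M : R) : lp a -> (forall n, lp (u n)) ->
  (forall n, L (u n) <= M) -> (forall i, null (fun n => mN (u n i))) ->
  null (fun n => L (a + u n) `^ p - L a `^ p - L (u n) `^ p).
Proof.
move=> la lu uM u0.
have lD b c : lp b -> lp c -> lp (b + c) /\ L (b + c) <= L b + L c.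
  by move=> lb lc; have := lp_cpn_comb 1 lb lc; rewrite scale1r smod1 mul1r.
have lN b : lp b -> lp (- b) /\ L (- b) = L b.
  move=> lb; rewrite -scaleN1r lp_cpn_normZ // smodN smod1 mul1r; split=> //.
  by have [] := lp_cpn_comb (-1) lb lp_cpn0.1; rewrite addr0.
have S0 m b : 0 <= \sum_(i < m) mN (b i) `^ p by apply: sumr_ge0 => i _; exact: powR_ge0.
apply: (@tail_asym R (mx_seq R k) lp L p mx_tail (fun m b => \sum_(i < m) mN (b i) `^ p)
  p1 lp_cpn_norm_ge0 lD lN mx_tailD lp_tail S0 a u M la lu uM (lp_tail_null la)) => m.
have hd i : null (fun n => mN (a i + u n i) `^ p - mN (a i) `^ p - mN (u n i) `^ p).
  have b1 n : mN (a i + u n i) <= mN (a i) + mN (u n i).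
    by have := mx_cp_norm_comb 1 (a i) (u n i); rewrite scale1r smod1 mul1r.
  have b2 n : mN (a i) <= mN (u n i) + mN (a i + u n i).
    have := mx_cp_norm_comb (-1) (u n i) (a i + u n i); rewrite smodN smod1 mul1r.
    by rewrite scaleN1r addrCA addNr addr0.
  have d1 : null (fun n => mN (a i + u n i) - mN (a i)).
    apply: null_squeeze (u0 i) => n; have := b1 n; have := b2 n.
    by move: (mN (a i + u n i)) (mN (a i)) (mN (u n i)) => A B C *; rewrite ler_norml; apply/andP; split; lra.
  have d2 := null_pow_sub p0 (m0 a i) (fun n => mx_cp_norm_ge0 (a i + u n i)) d1.
  exact: (nullB d2 (null_pow p0 (fun n => m0 (u n) i) (u0 i))).
have hs := @null_sum R _ (index_enum 'I_m) xpredT _ (fun i _ => hd i).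
by apply: null_ext hs => n; rewrite !sumrB.
Qed.

End LpNorm.

(** * Operator norms and transfer along almost isometries *)

Section OperatorNorm.
Variables (R : realType) (k : scalar_kind).
Local Notation K := (scalar_field R k).
Variables (V W : lmodType K) (N : V -> R) (M : W -> R) (X : set V) (T : V -> W).
Hypothesis N0 : forall x, 0 <= N x.
Hypothesis M0 : forall y, 0 <= M y.
Hypothesis Mz : M 0 = 0.
Hypothesis X0 : X 0.
Hypothesis Xlin : forall a x y, X x -> X y -> X (a *: x + y).
Hypothesis NZ : forall (a : K) x, X x -> N (a *: x) = smod a * N x.
Hypothesis MZ : forall (a : K) x, X x -> M (a *: T x) = smod a * M (T x).
Hypothesis Neq0 : forall x, X x -> N x = 0 -> x = 0.
Hypothesis lT : linear_on X T.

Lemma opnorm_le (C : R) : (forall x, X x -> M (T x) <= C * N x) -> 0 <= C ->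
  (operator_norm N M X T <= C%:E)%E.
Proof.
move=> h C0; apply: ge_ereal_sup => _ [x [Xx x1] <-]; rewrite lee_fin.
by apply: le_trans (h x Xx) _; rewrite -[leRHS]mulr1 ler_wpM2l.
Qed.

Lemma opnorm_bound (C : R) : (operator_norm N M X T <= C%:E)%E ->
  forall x, X x -> M (T x) <= C * N x.
Proof.
move=> hC x Xx; have T0 := dual_zero X0 lT.
have [x0|xn0] := eqVneq (N x) 0.
  by rewrite (Neq0 Xx x0) T0 Mz -(Neq0 Xx x0) x0 mulr0.
have xp : 0 < N x by rewrite lt_neqAle eq_sym xn0 N0.
pose c := sinj k (N x)^-1.
have sc : smod c = (N x)^-1 by rewrite smod_sinj ger0_norm // invr_ge0 ltW.
have Xc : X (c *: x) by have := Xlin c Xx X0; rewrite addr0.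
have Tc : T (c *: x) = c *: T x by have := lT c Xx X0; rewrite !addr0 T0 addr0.
have Nc : N (c *: x) <= 1 by rewrite NZ // sc mulVf.
have : ((M (T (c *: x)))%:E <= C%:E)%E.
  by apply: le_trans hC; apply: ereal_sup_ubound; exists (c *: x).
by rewrite lee_fin Tc MZ // sc ler_pdivrMl // mulrC.
Qed.

Lemma opnorm_fin : (operator_norm N M X T < +oo)%E ->
  exists2 C : R, 0 <= C & operator_norm N M X T = C%:E.
Proof.
move=> hf; have T0 := dual_zero X0 lT.
have h0 : (0 <= operator_norm N M X T)%E.
  apply: le_trans (_ : (M (T 0))%:E <= _)%E; first by rewrite lee_fin.
  apply: ereal_sup_ubound; exists 0 => //; split=> //.
  by have := NZ 0 X0; rewrite scale0r smod0 mul0r => ->.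
exists (fine (operator_norm N M X T)); first exact: fine_ge0.
by rewrite fineK // fin_real // hf andbT (lt_le_trans _ h0) // ltNyr.
Qed.
End OperatorNorm.

(** A, B1, B2 stand for p-th powers of the norms of x + u_n, x and u_n, the letters with L for those
    of their images, a and b for p-th powers of the norms of the isomorphism and its inverse. *)
Lemma almost_eq_trans (R : realType) (A B1 B2 LA LB1 LB2 a b d Q e : R) :
  0 <= A -> 0 <= B1 -> 0 <= B2 -> 0 <= b -> 0 <= d -> A <= Q -> B1 <= Q -> B2 <= Q ->
  `|b * (LA - LB1 - LB2)| <= e / 2 -> a * b <= 1 + d -> d * (2 * Q) <= e / 2 ->
  A <= b * LA -> B1 <= b * LB1 -> B2 <= b * LB2 -> LA <= a * A -> LB1 <= a * B1 ->
  LB2 <= a * B2 -> `|A - B1 - B2| <= e.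
Proof.
move=> A0 B10 B20 b0 d0 AQ B1Q B2Q hd ab dQ h1 h2 h3 h4 h5 h6.
have key t l : 0 <= t -> t <= Q -> l <= a * t -> b * l <= t + d * Q.
  move=> t0 tQ lt; apply: le_trans (ler_wpM2l b0 lt) _; rewrite mulrA (mulrC b).
  apply: le_trans (ler_wpM2r t0 ab) _; rewrite mulrDl mul1r lerD2l.
  exact: ler_wpM2l.
have k1 := key _ _ A0 AQ h4; have k2 := key _ _ B10 B1Q h5; have k3 := key _ _ B20 B2Q h6.
have dQ2 : d * (2 * Q) = 2 * (d * Q) by ring.
have dQ0 : 0 <= d * Q by rewrite mulr_ge0 // (le_trans A0).
move: hd; rewrite !mulrBr ler_norml => /andP[g1 g2].
rewrite dQ2 in dQ; rewrite ler_norml.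
move: (d * Q) (b * LA) (b * LB1) (b * LB2) dQ dQ0 k1 k2 k3 g1 g2 h1 h2 h3 => *.
by apply/andP; split; lra.
Qed.

Section Transfer.
Variables (R : realType) (k : scalar_kind).
Local Notation K := (scalar_field R k).
Variables (H : completeNormedModType K) (dot : {dot H for @sconj R k}).
Hypothesis Hdot : forall x : H, `|x| ^+ 2 = dot x x.
Local Notation adj := (adjoint dot).
Local Notation bessel := (bessel dot).

Variables (p : R) (p_gt1 : 1 < p).
Local Notation cp := (schatten_class dot p).
Local Notation N := (cp_norm dot p).
Let p1 : 1 <= p := ltW p_gt1.
Let p0 : 0 < p. Proof. exact: lt_trans p_gt1. Qed.
Let pn0 : p != 0. Proof. by rewrite gt_eqF. Qed.

Variable h : nat -> H.
Hypothesis ho : forall i j, dot (h i) (h j) = (i == j)%:R.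
Local Notation mN := (@mx_cp_norm R k p _).
Local Notation lp := (@lp_cpn R k p).
Local Notation L := (@lp_cpn_norm R k p).

(** Each matrix entry of [T] is a bounded functional on X. *)
Lemma lp_weak_coord (X : set (H -> H)) (T : (H -> H) -> mx_seq R k) (u : nat -> H -> H) (C : R) :
  linear_on X T -> (forall x : H -> H, X x -> lp (T x) /\ L (T x) <= C * N x) -> weakly_null N X u ->
  forall i, null (fun n => mN (T (u n) i)).
Proof.
move=> lT hT [Xu wu] i.
suff ent (r s : 'I_i.+1) : null (fun n => smod (T (u n) i r s)).
  apply: (@null_squeeze _ _ (fun n => \sum_r \sum_s smod (T (u n) i r s))) => [n|].
    by rewrite ger0_norm ?(mx_cp_norm_ge0 Hdot p_gt1 ho) //; exact: (mx_cp_norm_sum Hdot p_gt1 ho).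
  by apply: null_sum => r _; apply: null_sum => s _; exact: ent.
have df : dual_functional N X (fun x => T x i r s : K^o).
  split=> [a x y Xx Xy|]; first by rewrite lT //; transitivity ((a *: T x i + T y i) r s); rewrite ?mxE.
  exists C => x Xx; have [lpT LT] := hT x Xx.
  apply: le_trans LT; apply: le_trans (mx_cp_norm_le_lp Hdot p_gt1 ho i lpT).
  exact: (mx_cp_norm_entry Hdot p_gt1 ho).
have /cvgr0Pnorm_le cv := wu _ df.
move=> e e0; have e0' : 0 < sinj k e by rewrite -(rmorph0 (sinj k)) sinj_lt.
have [m _ hm] := cv _ e0'; exists m => n mn; rewrite ger0_norm //.
by have := hm n mn; rewrite /= normE sinj_le.
Qed.

Lemma iso_asym_mp (X : set (H -> H)) : closed_subspace cp N X ->
  (forall eps : R, 0 < eps -> exists2 X0 : set (mx_seq R k),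
     closed_subspace lp L X0 & (banach_mazur N L X X0 < (1 + eps)%:E)%E) ->
  asym_mp N X p.
Proof.
move=> [Xcp X0 Xl Xc] hiso x u M Xx wu uM e e0; have Xu := wu.1.
have NZ (a : K) y : X y -> N (a *: y) = smod a * N y by move=> /Xcp; exact: cp_normZ.
have N00 y : 0 <= N y by exact: cp_norm_ge0.
have L00 y : 0 <= L y by exact: lp_cpn_norm_ge0.
have Neq0 y : X y -> N y = 0 -> y = 0 by move=> /Xcp; exact: cp_norm_eq0.
pose Q := (N x + `|M|) `^ p; have Q0 : 0 <= Q by exact: powR_ge0.
have Q1 : 0 < 2 * Q + 1 by rewrite ltr_wpDl // mulr_ge0.
(* [Q] bounds the three p-th powers. The distance is taken so close to 1 that its p-th power exceeds
   1 by at most this amount, which keeps the total distortion below e / 2. *)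
have e'0 : 0 < e / 2 / (2 * Q + 1) by rewrite !divr_gt0.
have [d d0 hd] := pow_cont p0 ler01 e'0.
have [X0' [lpX X00 X0l X0c]] := hiso d d0.
move=> /ereal_inf_lt[_ [T [S [[[lT lS] [XT XS] [ST TS] [fT fS]] ->]]]].
have LZ (a : K) y : X0' y -> L (a *: y) = smod a * L y by move=> /lpX; exact: (lp_cpn_normZ Hdot p_gt1 ho).
have L0 : L 0 = 0 := (lp_cpn0 Hdot p_gt1 ho).2.
have Leq0 y : X0' y -> L y = 0 -> y = 0 by move=> /lpX; exact: (lp_cpn_eq0 Hdot p_gt1 ho).
have [al al0 aE] := opnorm_fin L00 X0 NZ lT fT.
have [be be0 bE] := opnorm_fin N00 X00 LZ lS fS.
rewrite aE bE -EFinM lte_fin => ab.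
have LT y (Xy : X y) : L (T y) <= al * N y.
  apply: (opnorm_bound N00 L0 X0 Xl NZ _ Neq0 lT) => //; last by rewrite aE.
  by move=> a z Xz; apply: LZ; exact: XT.
have NS y (Xy : X y) : N y <= be * L (T y).
  rewrite -{1}(ST _ Xy); apply: (opnorm_bound L00 (cp0 Hdot p_gt1).2 X00 X0l LZ _ Leq0 lS) => //.
  - by move=> a z Xz; apply: NZ; exact: XS.
  - by rewrite bE.
  - exact: XT.
have u0 := lp_weak_coord lT (fun y Xy => conj (lpX _ (XT _ Xy)) (LT y Xy)) wu.
have LM n : L (T (u n)) <= al * `|M|.
  by apply: le_trans (LT _ (Xu n)) _; rewrite ler_wpM2l // (le_trans (uM n)) // ler_norm.
have asy := lp_asym Hdot p_gt1 ho (lpX _ (XT _ Xx)) (fun n => lpX _ (XT _ (Xu n))) LM u0.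
have TD n : T (x + u n) = T x + T (u n).
  by have := lT 1 _ _ Xx (Xu n); rewrite !scale1r.
have XD n : X (x + u n) by have := Xl 1 _ _ Xx (Xu n); rewrite scale1r.
have e2 : 0 < e / 2 by rewrite divr_gt0.
have [m hm] := nullZ (be `^ p) asy e2; exists m => n /hm {}hm.
have cx := Xcp _ Xx; have cu := Xcp _ (Xu n).
have kap : (al `^ p) * (be `^ p) <= 1 + e / 2 / (2 * Q + 1).
  rewrite -powRM //; have := (hd _ (mulr_ge0 al0 be0)).1 (ltW ab).
  by rewrite powR1.
have powb (s t c : R) : 0 <= s -> 0 <= t -> 0 <= c -> s <= c * t -> s `^ p <= c `^ p * t `^ p.
  by move=> s0 t0 c0 hs; rewrite -powRM //; apply: ler_pow => //; exact: ltW.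
have b1 := powb _ _ _ (N00 _) (L00 _) be0 (NS _ (XD n)).
have b2 := powb _ _ _ (N00 _) (L00 _) be0 (NS _ Xx).
have b3 := powb _ _ _ (N00 _) (L00 _) be0 (NS _ (Xu n)).
have b4 := powb _ _ _ (L00 _) (N00 _) al0 (LT _ (XD n)).
have b5 := powb _ _ _ (L00 _) (N00 _) al0 (LT _ Xx).
have b6 := powb _ _ _ (L00 _) (N00 _) al0 (LT _ (Xu n)).
have uM' : N (u n) <= `|M| by rewrite (le_trans (uM n)) // ler_norm.
have q1 : N (x + u n) `^ p <= Q.
  apply: ler_pow; rewrite ?(ltW p0) //.
  by apply: le_trans (cp_normD Hdot p_gt1 cx cu) _; rewrite lerD2l.
have q2 : N x `^ p <= Q by apply: ler_pow; rewrite ?(ltW p0) // lerDl.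
have q3 : N (u n) `^ p <= Q.
  by apply: ler_pow; rewrite ?(ltW p0) // (le_trans uM') // lerDr.
rewrite TD in b1 b4.
apply: (almost_eq_trans _ _ _ _ _ q1 q2 q3 hm kap _ b1 b2 b3 b4 b5 b6); rewrite ?powR_ge0 ?(ltW e'0) //.
by rewrite mulrAC ler_pdivrMr // ler_wpM2l ?(ltW e2) // lerDl.
Qed.
End Transfer.

(** * The window embedding *)

Section Masks.
Variables (R : realType) (k : scalar_kind).
Local Notation K := (scalar_field R k).
Variables (H : completeNormedModType K) (dot : {dot H for @sconj R k}).
Hypothesis Hdot : forall x : H, `|x| ^+ 2 = dot x x.
Local Notation adj := (adjoint dot).
Local Notation bessel := (bessel dot).
Implicit Types (x y : H) (f g z : H -> H).

Variables (p : R) (p_gt1 : 1 < p).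
Local Notation cp := (schatten_class dot p).
Local Notation N := (cp_norm dot p).
Let p1 : 1 <= p := ltW p_gt1.
Let p0 : 0 < p. Proof. exact: lt_trans p_gt1. Qed.
Let pn0 : p != 0. Proof. by rewrite gt_eqF. Qed.

Variables (h : nat -> H) (hb : orthobasis dot h).
Implicit Types (S : pred nat).
Let ho i j : dot (h i) (h j) = (i == j)%:R. Proof. exact: hb.1. Qed.

(** Zero vectors replace the omitted coordinates, so that the index type does not depend on [S]. *)
Definition coord_proj n S := proj dot (fun i : 'I_n => if S i then h i else 0).

Lemma coord_proj_orthosys n S : orthosys dot (fun i : 'I_n => if S i then h i else 0).
Proof.
split=> [i j ij|i].
  by case: ifP => _; case: ifP => _; rewrite ?ip0l ?ip0r // ho val_eqE (negbTE ij).
by case: ifP => _; [right; exact: (basis_nm Hdot hb)|left].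
Qed.

Lemma coord_proj_projection n S : projection dot (coord_proj n S).
Proof. exact: (proj_projection Hdot (coord_proj_orthosys n S)). Qed.

Lemma coord_proj_contraction n S : contraction (coord_proj n S).
Proof. exact: (projection_contraction Hdot (coord_proj_projection n S)). Qed.

Lemma coord_projE n S x : coord_proj n S x = \sum_(i < n) dot x (h i) *: h i *+ S i.
Proof.
apply: eq_bigr => i _; case: (S i); rewrite ?mulr1n //.
by rewrite scaler0 mulr0n.
Qed.

Lemma coord_proj_dot n S x i : dot (coord_proj n S x) (h i) = dot x (h i) *+ ((i < n)%N && S i).
Proof.
rewrite coord_projE ip_suml.
transitivity (\sum_(j < n) dot x (h j) *+ ((j == i :> nat) && S j)).
  apply: eq_bigr => j _; case: (S j); rewrite ?mulr0n ?mulr1n ?ip0l ?andbF //.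
  rewrite ipZl ho; case: eqP => _ /=; by rewrite ?mulr1 ?mulr0.
case: ltnP => [ni|ni] /=.
  rewrite (bigD1 (Ordinal ni)) //= eqxx big1 ?addr0 // => j.
  by rewrite -val_eqE /= => /negbTE ->.
rewrite mulr0n big1 // => j _; rewrite (_ : (j == i :> nat) = false) ?mulr0n //.
by apply/negbTE; rewrite neq_ltn (leq_trans (ltn_ord j) ni).
Qed.

Lemma coord_proj_comp n n' S S' x :
  coord_proj n S (coord_proj n' S' x) = coord_proj n (fun i => S i && ((i < n')%N && S' i)) x.
Proof.
rewrite coord_projE [RHS]coord_projE; apply: eq_bigr => i _; rewrite coord_proj_dot.
by case: (S i) => /=; rewrite ?mulr0n // mulr1n scalerMnl.
Qed.

Lemma coord_proj_eq n n' S S' : (forall i, ((i < n)%N && S i) = ((i < n')%N && S' i)) -> coord_proj n S = coord_proj n' S'.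
Proof.
have wid m m' T : (m <= m')%N -> coord_proj m T = coord_proj m' (fun i => (i < m)%N && T i).
  move=> mm; apply/funext => x; rewrite !coord_projE.
  rewrite (big_ord_widen m' (fun i => dot x (h i) *: h i *+ T i) mm) big_mkcond /=.
  by apply: eq_bigr => i _; case: ltnP.
move=> hS; rewrite (wid n (maxn n n')) ?leq_maxl // (wid n' (maxn n n')) ?leq_maxr //.
by congr coord_proj; apply/funext => i; exact: hS.
Qed.

Lemma coord_proj_true n : coord_proj n xpredT = head_proj dot h n.
Proof. by []. Qed.

Lemma coord_proj_pfam (J : finType) n (S : J -> pred nat) :
  (forall j j' i, S j i -> S j' i -> j = j') -> pfam dot (fun j => coord_proj n (S j)).
Proof.
move=> dS j; have [lP sP _] := coord_proj_projection n (S j); split=> // x.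
have E j' : nm (coord_proj n (S j') x) ^+ 2 = \sum_(i < n) smod (dot x (h i)) ^+ 2 *+ S j' i.
  rewrite (proj_sqr Hdot (coord_proj_orthosys n (S j'))); apply: eq_bigr => i _.
  by case: (S j' i); rewrite ?mulr1n // ip0r smod0 expr0n.
under eq_bigr do rewrite E.
rewrite exchange_big /=.
apply: le_trans (orthosys_bessel Hdot (basis_orthosys Hdot hb n) x).
apply: ler_sum => i _; rewrite sumrMnr -mulr_natl -[leRHS]mul1r ler_wpM2r ?sqr_ge0 // -[1]/(1%:R) ler_nat.
have [[j0 Sj0]|hn] := pselect (exists j, S j i); last first.
  by rewrite big1 // => j' _; case Sj: (S j' i) => //; case: hn; exists j'.
rewrite (bigD1 j0) //= big1 ?addn0; first by case: (S j0 i).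
by move=> j' jj; case Sj: (S j' i) => //; move: jj; rewrite (dS _ _ _ Sj Sj0) eqxx.
Qed.

Lemma coord_proj_false n S : (forall i, (i < n)%N -> S i = false) -> coord_proj n S = 0.
Proof.
move=> hS; apply/funext => x; rewrite coord_projE big1 // => i _; by rewrite hS.
Qed.

Lemma block_sum_le M n f (S S' : 'I_M -> pred nat) (C : R) : cp f ->
  (forall j j' i, S j i -> S j' i -> j = j') -> (forall j j' i, S' j i -> S' j' i -> j = j') ->
  0 <= C -> \sum_j N (coord_proj n (S j) \o f \o coord_proj n (S' j)) `^ p <= C `^ p ->
  N (\sum_j (coord_proj n (S j) \o f \o coord_proj n (S' j))) <= C.
Proof.
move=> cf dS dS' C0 hC.
have cj j : cp (coord_proj n (S j) \o f \o coord_proj n (S' j)).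
  exact: (cp_ideal Hdot p_gt1 (coord_proj_contraction n _) cf (coord_proj_contraction n _)).1.
have hE j x : (coord_proj n (S j) \o f \o coord_proj n (S' j)) x =
    coord_proj n (S j) ((coord_proj n (S j) \o f \o coord_proj n (S' j)) (coord_proj n (S' j) x)).
  have [_ _ i1] := coord_proj_projection n (S j); have [_ _ i2] := coord_proj_projection n (S' j).
  by rewrite /= i1 i2.
exact: (cp_block_sum Hdot p_gt1 (coord_proj_pfam n dS) (coord_proj_pfam n dS') cj hE C0 hC).2.
Qed.

(** The (i, l) matrix entry is multiplied by the integer [E i l]: counting identities for pairs of
    indices become decompositions of operators. *)
Definition mask n (E : nat -> nat -> nat) f : H -> H := fun x =>
  \sum_(i < n) \sum_(l < n) (dot (f (h l)) (h i) * dot x (h l)) *: h i *+ E i l.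

Lemma mask_ext n E E' f : (forall i l, (i < n)%N -> (l < n)%N -> E i l = E' i l) ->
  mask n E f = mask n E' f.
Proof.
by move=> hE; apply/funext => x; apply: eq_bigr => i _; apply: eq_bigr => l _; rewrite hE.
Qed.

Lemma maskD n E E' f : mask n (fun i l => E i l + E' i l)%N f = mask n E f + mask n E' f.
Proof.
apply/funext => x; rewrite -[RHS]/(mask n E f x + mask n E' f x) -big_split.
by apply: eq_bigr => i _; rewrite -big_split; apply: eq_bigr => l _; rewrite mulrnDr.
Qed.

Lemma mask0 n f : mask n (fun _ _ => 0%N) f = 0.
Proof. by apply/funext => x; rewrite /mask big1 // => i _; rewrite big1 // => l _; rewrite mulr0n. Qed.

Lemma mask_sum M n (E : nat -> nat -> nat -> nat) f :
  mask n (fun i l => \sum_(j < M) E j i l)%N f = \sum_(j < M) mask n (E j) f.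
Proof.
elim: M => [|M IH].
  rewrite big_ord0 -(mask0 n f); apply: mask_ext => i l _ _; by rewrite big_ord0.
rewrite big_ord_recr /= -IH -maskD; apply: mask_ext => i l _ _; by rewrite big_ord_recr.
Qed.

Lemma mask_rect n S S' f : linear f ->
  mask n (fun i l => (S i && S' l)%N : nat) f = coord_proj n S \o f \o coord_proj n S'.
Proof.
move=> lf; apply/funext => x; rewrite /= [RHS]coord_projE; apply: eq_bigr => i _.
rewrite coord_projE (lin_sum lf) ip_suml scaler_suml -sumrMnl; apply: eq_bigr => l _.
case: (S i); case: (S' l); rewrite ?mulr0n ?mulr1n //=.
- by rewrite (linZ lf) ipZl mulrC.
- by rewrite (lin0 lf) ip0l scale0r.
Qed.

End Masks.

(** * Cut points from compactness of the unit ball *)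

Section Cuts.
Variables (R : realType) (k : scalar_kind).
Local Notation K := (scalar_field R k).
Variables (H : completeNormedModType K) (dot : {dot H for @sconj R k}).
Hypothesis Hdot : forall x : H, `|x| ^+ 2 = dot x x.
Local Notation adj := (adjoint dot).
Local Notation bessel := (bessel dot).
Implicit Types (x y : H) (f g z : H -> H).

Variables (p : R) (p_gt1 : 1 < p).
Local Notation cp := (schatten_class dot p).
Local Notation N := (cp_norm dot p).
Let p1 : 1 <= p := ltW p_gt1.
Let p0 : 0 < p. Proof. exact: lt_trans p_gt1. Qed.
Let pn0 : p != 0. Proof. by rewrite gt_eqF. Qed.

Variables (h : nat -> H) (hb : orthobasis dot h).
Local Notation head_proj := (head_proj dot h).

Lemma tau_nbhs f (v : H) (e : R) : 0 < e ->
  nbhs (f : tau_topology dot) [set g | nm (g v - f v) <= e /\ nm (adj g v - adj f v) <= e].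
Proof.
move=> e0.
have ptn (g : H -> H) : nbhs (g : {ptws H -> H}) [set g' | nm (g' v - g v) <= e].
  have /pointwise_cvgP/(_ v) cv : {ptws, nbhs (g : {ptws H -> H}) --> g} by exact: cvg_id.
  have e1 : (0 : K) < sinj k e by rewrite -(rmorph0 (sinj k)) sinj_lt.
  have nb : nbhs (g v) [set y | nm (y - g v) <= e].
    apply: filterS (nbhsx_ballx (g v) _ e1) => y.
    by rewrite -ball_normE /ball_ /= normH sinj_lt nm_distC; exact: ltW.
  exact: (cv _ nb).
have ini := @initial_continuous _ _ (fun x : H -> H => ((x, adj x) : {ptws H -> H} * {ptws H -> H})).
apply: (ini f [set gg | nm (gg.1 v - f v) <= e /\ nm (gg.2 v - adj f v) <= e]).
exists ([set g' | nm (g' v - f v) <= e], [set g' | nm (g' v - adj f v) <= e]).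
  by split; exact: ptn.
by move=> gg [].
Qed.

Variable X : set (H -> H).
Hypothesis Xc : closed_subspace cp N X.
Hypothesis Xtau : tau_compact dot (closed_unit_ball N X).
Let Xcp : X `<=` cp. Proof. by have [] := Xc. Qed.
Let X0 : X 0. Proof. by have [] := Xc. Qed.
Let Xl (a : K) f g : X f -> X g -> X (a *: f + g).
Proof. by have [_ _ Xl _] := Xc; exact: Xl. Qed.

(** Compactness in the form used below: approximation along arbitrarily late terms, on finitely many
    vectors at once and for adjoints too. *)
Lemma tau_cluster (x_ : nat -> H -> H) : (forall n, closed_unit_ball N X (x_ n)) ->
  exists2 f, closed_unit_ball N X f & forall (I : finType) (v : I -> H) (e : R) n0, 0 < e ->
    exists2 n, (n0 <= n)%N & forall i, nm (x_ n (v i) - f (v i)) <= e /\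
      nm (adj (x_ n) (v i) - adj f (v i)) <= e.
Proof.
move=> Bx; have FB : (x_ @ \oo) (closed_unit_ball N X) by exists 0%N => // n _ /=.
have [f [Bf cf]] := Xtau (fmap_proper_filter x_ eventually_filter) FB.
exists f => // I v e n0 e0.
have nb : nbhs (f : tau_topology dot) [set g | forall i, nm (g (v i) - f (v i)) <= e /\
    nm (adj g (v i) - adj f (v i)) <= e].
  have FF : Filter (nbhs (f : tau_topology dot)) := nbhs_filter (f : tau_topology dot).
  have := @filter_forall (H -> H) I (fun i => [set g | nm (g (v i) - f (v i)) <= e /\
    nm (adj g (v i) - adj f (v i)) <= e]) (nbhs (f : tau_topology dot)) FF.
  by apply; move=> i; exact: tau_nbhs.
have ev : (x_ @ \oo) [set x_ n | n in [set n | (n0 <= n)%N]] by exists n0 => // n /= hn; exists n.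
by have [_ [[n n0n <-] hn]] := cf _ _ ev nb; exists n.
Qed.

Lemma cut_le f m M : cp f ->
  N (head_proj m \o f \o compl (head_proj M)) <= \sum_(i < m) nm (compl (head_proj M) (adj f (h i))).
Proof.
move=> cf; have [_ sM _] := compl_projection (head_proj_projection Hdot hb M).
have -> : head_proj m \o f \o compl (head_proj M) = \sum_(i < m) rank1 dot (compl (head_proj M) (adj f (h i))) (h i).
  apply/funext => x; rewrite fct_sumE; apply: eq_bigr => i _.
  by rewrite /rank1 /= (adjP Hdot (cp_bop cf)) sM.
have c1 i := cp_rank1 Hdot p_gt1 (compl (head_proj M) (adj f (h i))) (h i).
have [_ n1] := @cp_sum _ _ _ _ Hdot _ p_gt1 _ (index_enum 'I_m) xpredT _ (fun i _ => (c1 i).1).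
apply: le_trans n1 _; apply: ler_sum => i _; apply: le_trans (c1 i).2 _.
by rewrite (basis_nm Hdot hb) mulr1.
Qed.

Lemma cut_adj f m M : cp f -> N (compl (head_proj M) \o f \o head_proj m) = N (head_proj m \o adj f \o compl (head_proj M)).
Proof.
move=> cf; have pM := compl_projection (head_proj_projection Hdot hb M); have pm := head_proj_projection Hdot hb m.
have bM := contraction_bop (projection_contraction Hdot pM).
have bm := contraction_bop (projection_contraction Hdot pm).
have cy := (cp_ideal Hdot p_gt1 (projection_contraction Hdot pM) cf (projection_contraction Hdot pm)).1.
rewrite -(cp_adj Hdot p_gt1 cy).2; congr N.
apply: (adj_uniq Hdot) => u v /=.
have [_ sM _] := pM; have [_ sm _] := pm.
by rewrite sM (adjP Hdot (cp_bop cf)) sm.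
Qed.

(** Otherwise elements of the ball exceed [eta] for M arbitrarily large. A cluster point
    approximates one of them and its adjoint on the first m basis vectors, where its own tails are
    negligible. *)
Lemma cut_exists m (eta : R) : 0 < eta -> exists2 M, (m < M)%N & forall f, X f ->
  N (head_proj m \o f \o compl (head_proj M)) <= eta * N f /\ N (compl (head_proj M) \o f \o head_proj m) <= eta * N f.
Proof.
move=> eta0.
suff [M mM hM] : exists2 M, (m < M)%N & forall f, closed_unit_ball N X f ->
    N (head_proj m \o f \o compl (head_proj M)) <= eta /\ N (compl (head_proj M) \o f \o head_proj m) <= eta.
  exists M => // f Xf; have cf := Xcp Xf.
  have [f0|fn0] := eqVneq (N f) 0.
    have [lm _ _] := head_proj_projection Hdot hb m.
    have [lM _ _] := compl_projection (head_proj_projection Hdot hb M).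
    have -> : f = 0 by exact: (cp_norm_eq0 Hdot p_gt1 cf f0).
    have -> : head_proj m \o 0 \o compl (head_proj M) = 0 by apply/funext => x /=; exact: (lin0 lm).
    have -> : compl (head_proj M) \o 0 \o head_proj m = 0 by apply/funext => x /=; exact: (lin0 lM).
    by rewrite (cp0 Hdot p_gt1).2 mulr0.
  have fp : 0 < N f by rewrite lt_neqAle eq_sym fn0 cp_norm_ge0.
  pose c := sinj k (N f)^-1.
  have sc : smod c = (N f)^-1 by rewrite smod_sinj ger0_norm // invr_ge0 ltW.
  have Bf : closed_unit_ball N X (c *: f).
    split; first by have := Xl c Xf X0; rewrite addr0.
    by rewrite (cp_normZ Hdot p_gt1 c cf) sc mulVf.
  have [lm _ _] := head_proj_projection Hdot hb m.
  have [lM _ _] := compl_projection (head_proj_projection Hdot hb M).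
  have [h1 h2] := hM _ Bf.
  have e1 : head_proj m \o (c *: f) \o compl (head_proj M) = c *: (head_proj m \o f \o compl (head_proj M)).
    by apply/funext => x /=; exact: (linZ lm).
  have e2 : compl (head_proj M) \o (c *: f) \o head_proj m = c *: (compl (head_proj M) \o f \o head_proj m).
    by apply/funext => x /=; exact: (linZ lM).
  have cm := projection_contraction Hdot (head_proj_projection Hdot hb m).
  have cM := projection_contraction Hdot (compl_projection (head_proj_projection Hdot hb M)).
  move: h1 h2; rewrite e1 e2 !(cp_normZ Hdot p_gt1 c) ?sc;
    [|exact: (cp_ideal Hdot p_gt1 cM cf cm).1|exact: (cp_ideal Hdot p_gt1 cm cf cM).1].
  by rewrite !ler_pdivrMl // !(mulrC (N f)).
apply: contrapT => hn.
have ex (n : nat) : exists f, closed_unit_ball N X f /\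
    (eta < N (head_proj m \o f \o compl (head_proj (m + n.+1)))  \/ eta < N (compl (head_proj (m + n.+1)) \o f \o head_proj m)).
  apply: contrapT => /forallNP hf; apply: hn; exists (m + n.+1)%N; first by rewrite -ltn_subLR ?subnn // ltn_addr // addnS ltnS leq_addr.
  move=> f Bf; have := hf f; rewrite not_andE => -[//|/not_orP[/negP + /negP]].
  by rewrite -!leNgt.
have [x_ hx] := choice ex.
have [f Bf hf] := tau_cluster (fun n => (hx n).1).
(* At most m terms of size 2 d have to stay below [eta]; m + 1 avoids a division by 0. *)
pose d := eta / 2 / m.+1%:R.
have d0 : 0 < d by rewrite !divr_gt0.
have nl v : null (fun n => nm (compl (head_proj (m + n.+1)) v)).
  by apply: (null_sub (a := fun n => nm (compl (head_proj n) v)) (phi := fun n => (m + n.+1)%N)) (hb.2 v) => n;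
    rewrite (leq_trans (leqnSn n)) // leq_addl.
have [n1 hn1] := finite_null (I := 'I_m) d0 (fun i => nl (f (h i))).
have [n2 hn2] := finite_null (I := 'I_m) d0 (fun i => nl (adj f (h i))).
have [n + hcl] := hf _ (fun i : 'I_m => h i) d (maxn n1 n2) d0.
rewrite geq_max => /andP[nn1 nn2].
have cx := Xcp (hx n).1.1; have cf := Xcp Bf.1.
have key (a b : H) : nm (compl (head_proj (m + n.+1)) b) <= d -> nm (a - b) <= d ->
    nm (compl (head_proj (m + n.+1)) a) <= d + d.
  move=> h1 h2; have pM := compl_projection (head_proj_projection Hdot hb (m + n.+1)).
  have [lM _ _] := pM; have cM := projection_contraction Hdot pM.
  apply: le_trans (nm_sub (compl (head_proj (m + n.+1)) b) _) _.
  rewrite -(linB lM); apply: lerD => //; exact: le_trans (cM.2 _) h2.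
have fin (a : 'I_m -> R) : (forall i, a i <= d + d) -> \sum_i a i <= eta.
  move=> ha; apply: (@le_trans _ _ (\sum_(i < m) (d + d))); first exact: ler_sum.
  rewrite sumr_const card_ord -mulr_natl /d -mulrDl -splitr mulrA ler_pdivrMr //.
  by rewrite mulrC ler_wpM2l ?(ltW eta0) // ler_nat.
have [] := (hx n).2; apply/negP; rewrite -leNgt.
  apply: le_trans (cut_le _ _ cx) (fin _ _) => i.
  apply: (key _ (adj f (h i))); last exact: (hcl i).2.
  by have := hn2 n i nn2; rewrite ger0_norm.
rewrite (cut_adj _ _ cx); have [cx' _] := cp_adj Hdot p_gt1 cx.
apply: le_trans (cut_le _ _ cx') (fin _ _) => i; rewrite (adjK Hdot (cp_bop cx)).
apply: (key _ (f (h i))); last exact: (hcl i).1.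
by have := hn1 n i nn1; rewrite ger0_norm.
Qed.

(** The geometric factor makes the errors of all blocks summable. *)
Lemma cuts_exist (eta : R) : 0 < eta -> exists q : nat -> nat,
  [/\ q 0%N = 0%N, forall j, (q j < q j.+1)%N & forall j f, X f ->
    N (head_proj (q j) \o f \o compl (head_proj (q j.+1))) <= eta / 2 ^+ j.+1 * N f /\
    N (compl (head_proj (q j.+1)) \o f \o head_proj (q j)) <= eta / 2 ^+ j.+1 * N f].
Proof.
move=> e0; have ex (mj : nat * nat) : exists M, (mj.1 < M)%N /\ forall f, X f ->
    N (head_proj mj.1 \o f \o compl (head_proj M)) <= eta / 2 ^+ mj.2.+1 * N f /\
    N (compl (head_proj M) \o f \o head_proj mj.1) <= eta / 2 ^+ mj.2.+1 * N f.
  have d0 : 0 < eta / 2 ^+ mj.2.+1 by rewrite divr_gt0 // exprn_gt0.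
  by have [M h1 h2] := cut_exists mj.1 d0; exists M.
have [nx hnx] := choice ex.
pose q := fix q j : nat := if j is j'.+1 then nx (q j', j') else 0%N.
by exists q; split=> // j; [exact: (hnx (q j, j)).1|exact: (hnx (q j, j)).2].
Qed.
End Cuts.

(** * Blocks between cut points, and the combinatorics of residues *)

Section Blocks.
Variable q : nat -> nat.
Hypothesis q0 : q 0%N = 0%N.
Hypothesis qS : forall j, (q j < q j.+1)%N.

Lemma cut_mono i j : (i <= j)%N -> (q i <= q j)%N.
Proof.
elim: j => [|j IH]; first by rewrite leqn0 => /eqP ->.
rewrite leq_eqVlt => /predU1P[->//|]; rewrite ltnS => /IH h.
exact: leq_trans h (ltnW (qS j)).
Qed.

Lemma cut_ge j : (j <= q j)%N.
Proof. by elim: j => // j IH; exact: leq_ltn_trans IH (qS j). Qed.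

Lemma block_exists : exists beta : nat -> nat, forall i j, (beta i < j)%N = (i < q j)%N.
Proof.
have ex i : exists b, forall j, (b < j)%N = (i < q j)%N.
  have exj : exists j, (i < q j.+1)%N by exists i; exact: cut_ge.
  exists (ex_minn exj); case: ex_minnP => b hb hmin j; apply/idP/idP => [bj|ij].
    exact: leq_trans hb (cut_mono bj).
  by case: j ij => [|j ij]; [rewrite q0|rewrite ltnS; exact: hmin].
by have [beta hbeta] := choice ex; exists beta.
Qed.

End Blocks.

Section Labels.
Local Open Scope nat_scope.
Variables (L r : nat).
Hypothesis rL : (r < L)%N.

(* [label j] is the ceiling of [(j - r) / L] for integers. *)
Definition label j := (j %/ L + (r < j %% L))%N.

(** For a fixed residue r the windows partition the blocks, and the label tells in which window a
    block lies. *)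
Lemma label_window j w : ((j <= w * L + r) && (w * L + r < j + L))%N = (label j == w).
Proof.
rewrite /label; have sL := ltn_pmod j (leq_ltn_trans (leq0n r) rL).
have E : j = (j %/ L * L + j %% L)%N := divn_eq j L.
move: (j %/ L)%N (j %% L)%N E sL => k s -> sL; case: (ltnP r s) => rs /=; apply/idP/eqP.
- by move=> /andP[h1 h2]; apply/eqP; rewrite addn1; nia.
- by move=> <-; nia.
- by move=> /andP[h1 h2]; rewrite addn0; nia.
- by move=> <-; nia.
Qed.

(** Neighbouring blocks fall into different windows exactly at the end of a window. *)
Lemma label_cut j : (label j != label j.+1) = (j %% L == r)%N.
Proof.
have L0 : (0 < L)%N := leq_ltn_trans (leq0n r) rL.
rewrite /label; have sL := ltn_pmod j L0.
have E : j = (j %/ L * L + j %% L)%N := divn_eq j L.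
move: (j %/ L)%N (j %% L)%N E sL => k s -> sL.
case: (ltnP s.+1 L) => h.
  have -> : (k * L + s).+1 = (k * L + s.+1)%N by rewrite addnS.
  rewrite divnMDl // divn_small // modnMDl modn_small // addn0.
  by case: (ltngtP r s) => h1; case: (ltngtP r s.+1) => h2 //=; lia.
have sE : s.+1 = L by apply/eqP; rewrite eqn_leq sL h.
have -> : (k * L + s).+1 = (k.+1 * L + 0)%N by rewrite addn0 mulSn addnC -sE addSn addnC -addSn addnC; lia.
rewrite modnMDl mod0n divnMDl // div0n ltn0 /=.
by case: (ltngtP r s) => h1; lia.
Qed.

Lemma label_le j : (label j <= j)%N.
Proof.
have L0 : (0 < L)%N := leq_ltn_trans (leq0n r) rL.
rewrite /label {3}(divn_eq j L); have := leq_pmulr (j %/ L)%N L0.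
by case: (ltnP r (j %% L)%N) => h; lia.
Qed.

Lemma sum_key M (a : nat) (P : nat -> bool) : (\sum_(j < M) ((a == j :> nat) && P j))%N = ((a < M) && P a)%N.
Proof.
have [aM|Ma] := ltnP a M.
  rewrite (bigD1 (Ordinal aM)) //= eqxx big1 ?addn0 // => j.
  by rewrite -val_eqE /= eq_sym => /negbTE ->.
rewrite big1 // => j _; have /negbTE -> // : a != j.
by rewrite neq_ltn (leq_trans (ltn_ord j) Ma) orbT.
Qed.

(** A pair of blocks either shares a window, or is separated and then adjacent or at distance at
    least 2, above or below the diagonal. Read through [mask], this decomposes a finite corner of an
    operator. *)
Lemma pair_partition M (a b : nat) : (a < M)%N -> (b < M)%N ->
  (1 = \sum_(w < M) (((a <= w * L + r) && (w * L + r < a + L)) &&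
                     ((b <= w * L + r) && (w * L + r < b + L))) +
       \sum_(j < M) (((a == j) && (j %% L == r)) && (b == j.+1)) +
       \sum_(j < M) ((a == j.+1) && ((b == j) && (j %% L == r))) +
       \sum_(j < M) ((a == j) && ((j.+2 <= b) && (label j != label b))) +
       \sum_(j < M) (((j.+2 <= a) && (label j != label a)) && (b == j)))%N.
Proof.
move=> aM bM.
have -> : (\sum_(w < M) (((a <= w * L + r) && (w * L + r < a + L)) &&
                     ((b <= w * L + r) && (w * L + r < b + L))) = (label a == label b))%N.
  under eq_bigr do rewrite !label_window.
  rewrite (sum_key M (label a) (fun w => label b == w)) (leq_ltn_trans (label_le a) aM).
  by rewrite eq_sym.
have -> : (\sum_(j < M) (((a == j) && (j %% L == r)) && (b == j.+1)) =
    ((label a != label b) && (b == a.+1)))%N.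
  under eq_bigr do rewrite -andbA.
  rewrite (sum_key M a (fun j => (j %% L == r) && (b == j.+1))%N) aM -label_cut /=.
  by case: (b =P a.+1) => [->|_]; rewrite ?andbF.
have -> : (\sum_(j < M) ((a == j.+1) && ((b == j) && (j %% L == r))) =
    ((label a != label b) && (a == b.+1)))%N.
  under eq_bigr do rewrite andbCA.
  rewrite (sum_key M b (fun j => (a == j.+1) && (j %% L == r))%N) bM -label_cut /=.
  by case: (a =P b.+1) => [->|_] /=; rewrite ?andbF // andbT eq_sym.
rewrite (sum_key M a (fun j => (j.+2 <= b) && (label j != label b)))%N aM /=.
under [X in (_ + X)%N]eq_bigr do rewrite andbC.
rewrite (sum_key M b (fun j => (j.+2 <= a) && (label j != label a)))%N bM /=.
have [lE|ln] := eqVneq (label a) (label b); first by rewrite /= !andbF.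
rewrite !andbT /=; have ab : a <> b by move=> ab; rewrite ab eqxx in ln.
by case: (ltngtP a b) => h //; lia.
Qed.
End Labels.

(** * The window map is a contraction *)

Section Windows.
Variables (R : realType) (k : scalar_kind).
Local Notation K := (scalar_field R k).
Variables (H : completeNormedModType K) (dot : {dot H for @sconj R k}).
Hypothesis Hdot : forall x : H, `|x| ^+ 2 = dot x x.
Local Notation adj := (adjoint dot).
Local Notation bessel := (bessel dot).
Implicit Types (x y : H) (f g z : H -> H).

Variables (p : R) (p_gt1 : 1 < p).
Local Notation cp := (schatten_class dot p).
Local Notation N := (cp_norm dot p).
Let p1 : 1 <= p := ltW p_gt1.
Let p0 : 0 < p. Proof. exact: lt_trans p_gt1. Qed.
Let pn0 : p != 0. Proof. by rewrite gt_eqF. Qed.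

Variables (h : nat -> H) (hb : orthobasis dot h).
Local Notation head_proj := (head_proj dot h).
Local Notation coord_proj := (coord_proj dot h).
Local Notation mN := (@mx_cp_norm R k p _).
Local Notation lp := (@lp_cpn R k p).
Local Notation LN := (@lp_cpn_norm R k p).
Let ho i j : dot (h i) (h j) = (i == j)%:R. Proof. exact: hb.1. Qed.

Variables (q beta : nat -> nat) (L : nat).
Hypothesis q0 : q 0%N = 0%N.
Hypothesis qS : forall j, (q j < q j.+1)%N.
Hypothesis betaE : forall i j, (beta i < j)%N = (i < q j)%N.
Hypothesis L0 : (0 < L)%N.

(* [beta i] is the index of the block containing [i]; window [m] is made of the blocks [m - L + 1, ..., m]. *)
Definition window m i := (beta i <= m)%N && (m < beta i + L)%N.
(** Nonempty only if n is the last coordinate of its block; different windows therefore occupy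
    different components. *)
Definition window_at n i := (n.+1 == q (beta n).+1)%N && window (beta n) i.
Let c : R := L%:R `^ (- p^-1).

Let LR : 0 < L%:R :> R. Proof. by rewrite ltr0n. Qed.
Let c0 : 0 < c. Proof. exact: powR_gt0. Qed.
Let cp_pow : c `^ p = L%:R^-1.
Proof. by rewrite /c -powRrM mulNr mulVf // powRN powRr1 // ltW. Qed.

(* Window [m] is stored as the matrix of size [q m.+1], the least one
   containing all its coordinates; the remaining components are zero. *)
Definition window_map f : mx_seq R k := fun n =>
  \matrix_(a, b) ((sinj k c * dot (f (h b)) (h a)) *+ (window_at n a && window_at n b)).

Lemma window_lt m i : window m i -> (i < q m.+1)%N.
Proof. by move=> /andP[h1 _]; rewrite -betaE ltnS. Qed.

Lemma window_at_lt n i : window_at n i -> (i < n.+1)%N.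
Proof. by move=> /andP[/eqP -> hw]; exact: window_lt. Qed.

Lemma window_map_op f n : linear f ->
  mx_op dot h (window_map f n) = sinj k c *: (coord_proj n.+1 (window_at n) \o f \o coord_proj n.+1 (window_at n)).
Proof.
move=> lf; rewrite -mask_rect //; apply/funext => x.
rewrite -[RHS]/(sinj k c *: mask dot h n.+1 _ f x) /mx_op /mx_vec /mask scaler_sumr.
apply: eq_bigr => i _; rewrite mxE scaler_suml scaler_sumr; apply: eq_bigr => l _.
rewrite !mxE; case: (_ && _); rewrite ?mulr1n ?mulr0n ?mul0r ?scale0r ?scaler0 //.
by rewrite scalerA mulrA.
Qed.

Lemma window_map_norm f n : cp f ->
  mN (window_map f n) = c * N (coord_proj n.+1 (window_at n) \o f \o coord_proj n.+1 (window_at n)).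
Proof.
move=> cf; rewrite (mx_cp_normE Hdot p_gt1 ho) window_map_op; last exact: (cp_bop cf).1.
rewrite (cp_normZ Hdot) // ?smod_sinj ?ger0_norm ?(ltW c0) //.
exact: (cp_ideal Hdot p_gt1 (coord_proj_contraction Hdot hb _ _) cf (coord_proj_contraction Hdot hb _ _)).1.
Qed.

Lemma beta_last m : beta (q m.+1).-1 = m.
Proof.
have qp : (0 < q m.+1)%N by exact: leq_ltn_trans (qS m).
apply/eqP; rewrite eqn_leq -ltnS betaE prednK // leqnn /= leqNgt betaE -leqNgt.
by rewrite -ltnS prednK.
Qed.

Lemma window_at_last m i : window_at (q m.+1).-1 i = window m i.
Proof.
rewrite /window_at beta_last prednK ?eqxx //; exact: leq_ltn_trans (qS m).
Qed.

(** Overlapping windows have end blocks at distance less than L, so congruence forces equality; the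
    end block determines the component. *)
Lemma window_disjoint n n' i : (beta n %% L = beta n' %% L)%N ->
  window_at n i -> window_at n' i -> n = n'.
Proof.
move=> hr /andP[/eqP e1 /andP[h1 h2]] /andP[/eqP e2 /andP[h3 h4]].
suff bb : beta n = beta n' by apply/eqP; rewrite -eqSS e1 e2 bb.
have a1 : (beta n < beta n' + L)%N by apply: leq_trans h2 _; rewrite leq_add2r.
have a2 : (beta n' < beta n + L)%N by apply: leq_trans h4 _; rewrite leq_add2r.
have key a b : (a %% L = b %% L)%N -> (a <= b)%N -> (b < a + L)%N -> a = b.
  move=> hab ab ba; have : (b - a)%N = 0%N; last by lia.
  have : (L %| b - a)%N by rewrite -eqn_mod_dvd //; apply/eqP.
  by move=> dv; apply/eqP; rewrite -leqn0 leqNgt; apply/negP => bp; have := dvdn_leq bp dv; lia.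
by case: (leqP (beta n) (beta n')) => hle; [exact: key|apply/esym/key => //; exact: ltnW].
Qed.

Lemma window_map_upper f : cp f -> forall n0, \sum_(n < n0) mN (window_map f n) `^ p <= N f `^ p.
Proof.
move=> cf n0.
pose W (r n : nat) := coord_proj n0 (fun i => window_at n i && (beta n %% L == r)%N).
have pr (r : nat) : \sum_(n < n0) N (W r n \o f \o W r n) `^ p <= N f `^ p.
  have pf : pfam dot (fun n : 'I_n0 => W r n).
    apply: (coord_proj_pfam Hdot hb) => n n' i /andP[w1 /eqP r1] /andP[w2 /eqP r2].
    by apply: val_inj; apply: window_disjoint w1 w2; rewrite r1 r2.
  exact: (cp_pinch Hdot p_gt1 pf pf cf).
(* Component n contributes to one residue only. The factor 1 / L turns the sum over residues of the
   pinching bounds [pr] into their mean. *)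
have E (n : 'I_n0) : mN (window_map f n) `^ p = L%:R^-1 * \sum_(r < L) N (W r n \o f \o W r n) `^ p.
  rewrite window_map_norm // powRM ?(ltW c0) ?cp_norm_ge0 // cp_pow; congr (_ * _).
  have bL : (beta n %% L < L)%N by exact: ltn_pmod.
  rewrite (bigD1 (Ordinal bL)) //= big1 ?addr0; last first.
    move=> r; rewrite -val_eqE /= => /negbTE rb.
    have -> : W r n = 0.
      by apply: coord_proj_false => i _; rewrite [(_ == nat_of_ord r)]eq_sym rb andbF.
    have -> : 0 \o f \o 0 = 0 :> (H -> H) by [].
    by rewrite (cp0 Hdot p_gt1).2 powR0.
  have -> : W (beta n %% L)%N n = coord_proj n.+1 (window_at n) => [|//].
  apply: coord_proj_eq => i; rewrite eqxx andbT.
  case w: (window_at n i); rewrite ?andbF // !andbT.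
  by rewrite (window_at_lt w) (leq_trans (window_at_lt w)).
rewrite (eq_bigr _ (fun n _ => E n)) -mulr_sumr exchange_big /= ler_pdivrMl //.
apply: (@le_trans _ _ (\sum_(r < L) N f `^ p)); first exact: ler_sum.
by rewrite sumr_const card_ord mulr_natl.
Qed.

End Windows.

Lemma sum_half_pow (R : realType) M (e : R) : 0 <= e -> \sum_(j < M) e / 2 ^+ j.+2 <= e.
Proof.
move=> e0; suff -> : \sum_(j < M) e / 2 ^+ j.+2 = e / 2 - e / 2 ^+ M.+1.
  have : 0 <= e / 2 ^+ M.+1 by rewrite divr_ge0 ?exprn_ge0.
  lra.
elim: M => [|M IH]; first by rewrite big_ord0 expr1 subrr.
rewrite big_ord_recr /= IH [2 ^+ M.+2]exprS; set u := 2 ^+ M.+1.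
have u0 : u != 0 by rewrite expf_neq0.
by field.
Qed.

(** * Lower estimate for one residue *)

Section WindowsLower.
Variables (R : realType) (k : scalar_kind).
Local Notation K := (scalar_field R k).
Variables (H : completeNormedModType K) (dot : {dot H for @sconj R k}).
Hypothesis Hdot : forall x : H, `|x| ^+ 2 = dot x x.
Local Notation adj := (adjoint dot).
Local Notation bessel := (bessel dot).
Implicit Types (x y : H) (f g z : H -> H).

Variables (p : R) (p_gt1 : 1 < p).
Local Notation cp := (schatten_class dot p).
Local Notation N := (cp_norm dot p).
Let p1 : 1 <= p := ltW p_gt1.
Let p0 : 0 < p. Proof. exact: lt_trans p_gt1. Qed.
Let pn0 : p != 0. Proof. by rewrite gt_eqF. Qed.

Variables (h : nat -> H) (hb : orthobasis dot h).
Local Notation head_proj := (head_proj dot h).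
Local Notation coord_proj := (coord_proj dot h).
Local Notation mN := (@mx_cp_norm R k p _).
Local Notation lp := (@lp_cpn R k p).
Local Notation LN := (@lp_cpn_norm R k p).
Let ho i j : dot (h i) (h j) = (i == j)%:R. Proof. exact: hb.1. Qed.

Variables (q beta : nat -> nat) (L : nat).
Hypothesis q0 : q 0%N = 0%N.
Hypothesis qS : forall j, (q j < q j.+1)%N.
Hypothesis betaE : forall i j, (beta i < j)%N = (i < q j)%N.
Hypothesis L0 : (0 < L)%N.
Local Notation window := (window beta L).
Local Notation window_map := (window_map dot p h q beta L).

Variables (f : H -> H) (eta : R).
Hypothesis cf : cp f.
Hypothesis eta0 : 0 <= eta.
Hypothesis far : forall j, N (head_proj (q j) \o f \o compl (head_proj (q j.+1))) <= eta / 2 ^+ j.+1 * N f /\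
  N (compl (head_proj (q j.+1)) \o f \o head_proj (q j)) <= eta / 2 ^+ j.+1 * N f.

Let blk n S S' := coord_proj n S \o f \o coord_proj n S'.

Let blk_cp n S S' : cp (blk n S S') /\ N (blk n S S') <= N f.
Proof. exact: (cp_ideal Hdot p_gt1 (coord_proj_contraction Hdot hb _ _) cf (coord_proj_contraction Hdot hb _ _)). Qed.

(** Block j lies below the cut point with index j + 1 and [S] beyond the next one, so the cut
    estimate applies with j + 1 in place of j. *)
Lemma far_block n j (S : pred nat) : (forall i, S i -> (j.+2 <= beta i)%N) ->
  N (blk n (fun i => beta i == j) S) <= eta / 2 ^+ j.+2 * N f /\
  N (blk n S (fun i => beta i == j)) <= eta / 2 ^+ j.+2 * N f.
Proof.
move=> hS.
have near i : beta i == j -> (i < q j.+1)%N by move=> /eqP e; rewrite -betaE e.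
have cC := head_proj_compl_contraction Hdot hb (q j.+2); have cP := head_proj_contraction Hdot hb (q j.+1).
have pB := coord_proj_projection Hdot hb n (fun i => beta i == j); have pS := coord_proj_projection Hdot hb n S.
have e1 x : coord_proj n (fun i => beta i == j) (head_proj (q j.+1) x) = coord_proj n (fun i => beta i == j) x.
  rewrite -(coord_proj_true dot h) (coord_proj_comp hb); congr (_ x); apply: coord_proj_eq => i.
  by case b: (beta i == j); rewrite ?andbF // (near i) ?b // ?andbT.
have e1' x : head_proj (q j.+1) (coord_proj n (fun i => beta i == j) x) = coord_proj n (fun i => beta i == j) x.
  rewrite -(coord_proj_true dot h) (coord_proj_comp hb); congr (_ x); apply: coord_proj_eq => i /=.
  by case b: (beta i == j); rewrite ?andbF // (near i) ?b // ?andbT.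
have e2 x : compl (head_proj (q j.+2)) (coord_proj n S x) = coord_proj n S x.
  rewrite /compl -(coord_proj_true dot h) (coord_proj_comp hb).
  rewrite [X in _ - X](_ : _ = 0) ?subr0 // (coord_proj_false dot h) // => i iq /=.
  by case s: (S i); rewrite ?andbF //; have := hS i s; rewrite leqNgt betaE iq.
have e2' x : coord_proj n S (compl (head_proj (q j.+2)) x) = coord_proj n S x.
  have [lS _ _] := pS; rewrite /compl (linB lS) -(coord_proj_true dot h) (coord_proj_comp hb).
  rewrite [X in _ - X](_ : _ = 0) ?subr0 // (coord_proj_false dot h) // => i iq.
  case s: (S i) => //=; rewrite andbT; have := hS i s; rewrite leqNgt betaE.
  by case: (i < _)%N.
have cB := coord_proj_contraction Hdot hb n (fun i => beta i == j); have cS := coord_proj_contraction Hdot hb n S.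
have [f1 f2] := far j.+1.
split.
  have c1 := (cp_ideal Hdot p_gt1 cP cf cC).1.
  have [_ n1] := cp_ideal Hdot p_gt1 cB c1 cS.
  apply: le_trans f1; apply: le_trans n1; rewrite le_eqVlt; apply/orP; left; apply/eqP.
  by congr N; apply/funext => x; rewrite /blk /= e1 e2.
have c1 := (cp_ideal Hdot p_gt1 cC cf cP).1.
have [_ n1] := cp_ideal Hdot p_gt1 cS c1 cB.
apply: le_trans f2; apply: le_trans n1; rewrite le_eqVlt; apply/orP; left; apply/eqP.
by congr N; apply/funext => x; rewrite /blk /= e1' e2'.
Qed.

Let root (s : R) := s `^ p^-1.
Let rootK s : 0 <= s -> root s `^ p = s. Proof. by move=> s0; rewrite /root powVK. Qed.

Definition win_sum M r := \sum_(w < M) N (blk (q M) (window (w * L + r)%N) (window (w * L + r)%N)) `^ p.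
Definition upper_sum M r := \sum_(j < M)
  N (blk (q M) (fun i => (beta i == j) && (j %% L == r)%N) (fun i => beta i == j.+1)) `^ p.
Definition lower_sum M r := \sum_(j < M)
  N (blk (q M) (fun i => beta i == j.+1) (fun i => (beta i == j) && (j %% L == r)%N)) `^ p.

Let mask_blocks M n (S S' : nat -> pred nat) :
  mask dot h n (fun i l => \sum_(j < M) (S j i && S' j l))%N f = \sum_(j < M) blk n (S j) (S' j).
Proof.
rewrite (mask_sum dot h M n (fun j i l => nat_of_bool (S j i && S' j l))).
by apply: eq_bigr => j _; exact: (mask_rect dot h n (S j) (S' j) (cp_bop cf).1).
Qed.

(** The five parts of [pair_partition]: windows and adjacent blocks are block diagonal up to a shift
    and add in the l_p sense, while the far parts are summed by the triangle inequality and the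
    geometric series. *)
Lemma residue_bound M r : (r < L)%N ->
  N (head_proj (q M) \o f \o head_proj (q M)) <=
  root (win_sum M r) + root (upper_sum M r) + root (lower_sum M r) + 2 * eta * N f.
Proof.
move=> rL; set n := q M; have lf := (cp_bop cf).1.
pose X1 := \sum_(w < M) blk n (window (w * L + r)%N) (window (w * L + r)%N).
pose X2 := \sum_(j < M) blk n (fun i => (beta i == j) && (j %% L == r)%N) (fun i => beta i == j.+1).
pose X3 := \sum_(j < M) blk n (fun i => beta i == j.+1) (fun i => (beta i == j) && (j %% L == r)%N).
pose X4 := \sum_(j < M) blk n (fun i => beta i == j) (fun i => (j.+2 <= beta i)%N && (label L r j != label L r (beta i))).
pose X5 := \sum_(j < M) blk n (fun i => (j.+2 <= beta i)%N && (label L r j != label L r (beta i))) (fun i => beta i == j).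
have E : head_proj n \o f \o head_proj n = X1 + X2 + X3 + X4 + X5.
  rewrite -(coord_proj_true dot h) -(mask_rect dot h) //.
  rewrite (mask_ext dot h (E' := fun i l => (\sum_(w < M) ((window (w * L + r) i) && (window (w * L + r) l)) +
       \sum_(j < M) (((beta i == j) && (j %% L == r)) && (beta l == j.+1)) +
       \sum_(j < M) ((beta i == j.+1) && ((beta l == j) && (j %% L == r))) +
       \sum_(j < M) ((beta i == j) && ((j.+2 <= beta l) && (label L r j != label L r (beta l)))) +
       \sum_(j < M) (((j.+2 <= beta i) && (label L r j != label L r (beta i))) && (beta l == j)))%N)); last first.
    move=> i l iq lq; rewrite /= -betaE in iq lq; rewrite /= -betaE in lq.
    exact: (pair_partition rL iq lq).
  rewrite !maskD.
  rewrite (mask_blocks M n (fun w => window (w * L + r)%N) (fun w => window (w * L + r)%N)).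
  rewrite (mask_blocks M n (fun j i => (beta i == j) && (j %% L == r)%N) (fun j i => beta i == j.+1)).
  rewrite (mask_blocks M n (fun j i => beta i == j.+1) (fun j i => (beta i == j) && (j %% L == r)%N)).
  rewrite (mask_blocks M n (fun j i => beta i == j)
    (fun j i => (j.+2 <= beta i)%N && (label L r j != label L r (beta i)))).
  by rewrite (mask_blocks M n (fun j i => (j.+2 <= beta i)%N && (label L r j != label L r (beta i)))
    (fun j i => beta i == j)).
have csum (S S' : 'I_M -> pred nat) : cp (\sum_j blk n (S j) (S' j)) /\
    N (\sum_j blk n (S j) (S' j)) <= \sum_j N (blk n (S j) (S' j)).
  by apply: (cp_sum Hdot p_gt1) => j _; exact: (blk_cp n _ _).1.
have c1 : cp X1 by exact: (csum _ _).1.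
have c2 : cp X2 by exact: (csum _ _).1.
have c3 : cp X3 by exact: (csum _ _).1.
have c4 : cp X4 by exact: (csum _ _).1.
have c5 : cp X5 by exact: (csum _ _).1.
have s0 (S S' : 'I_M -> pred nat) : 0 <= \sum_j N (blk n (S j) (S' j)) `^ p.
  by apply: sumr_ge0 => j _; exact: powR_ge0.
have n1 : N X1 <= root (win_sum M r).
  have dw (w w' : 'I_M) i : window (w * L + r) i -> window (w' * L + r) i -> w = w'.
    by rewrite /window !(label_window rL) => /eqP e /eqP e'; apply: val_inj; rewrite /= -e -e'.
  apply: (block_sum_le Hdot p_gt1 hb cf dw dw (powR_ge0 _ _)).
  by rewrite rootK // (s0 (fun w : 'I_M => window (w * L + r)%N) (fun w : 'I_M => window (w * L + r)%N)).
have d1 (j j' : 'I_M) i : (beta i == j) && (j %% L == r)%N -> (beta i == j') && (j' %% L == r)%N -> j = j'.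
  by move=> /andP[/eqP e _] /andP[/eqP e' _]; apply: val_inj; rewrite /= -e -e'.
have d2 (j j' : 'I_M) i : (beta i == j.+1) -> (beta i == j'.+1) -> j = j'.
  by move=> /eqP e /eqP e'; apply: val_inj => /=; rewrite e in e'; case: e'.
have n2 : N X2 <= root (upper_sum M r).
  apply: (block_sum_le Hdot p_gt1 hb cf d1 d2 (powR_ge0 _ _)).
  by rewrite rootK // sumr_ge0 // => j _; exact: powR_ge0.
have n3 : N X3 <= root (lower_sum M r).
  apply: (block_sum_le Hdot p_gt1 hb cf d2 d1 (powR_ge0 _ _)).
  by rewrite rootK // sumr_ge0 // => j _; exact: powR_ge0.
have geo : \sum_(j < M) eta / 2 ^+ j.+2 * N f <= eta * N f.
  by rewrite -mulr_suml ler_wpM2r ?cp_norm_ge0 // sum_half_pow.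
have n4 : N X4 <= eta * N f.
  apply: le_trans geo; apply: le_trans (csum _ _).2 _; apply: ler_sum => j _.
  by apply: (far_block n _).1 => i /andP[].
have n5 : N X5 <= eta * N f.
  apply: le_trans geo; apply: le_trans (csum _ _).2 _; apply: ler_sum => j _.
  by apply: (far_block n _).2 => i /andP[].
have D := fun g g' cg cg' => @cp_normD _ _ _ _ Hdot _ p_gt1 g g' cg cg'.
have C := fun g g' cg cg' => @cpD _ _ _ _ Hdot _ p_gt1 g g' cg cg'.
have m1 := D _ _ c1 c2; have m2 := D _ _ (C _ _ c1 c2) c3.
have m3 := D _ _ (C _ _ (C _ _ c1 c2) c3) c4.
have m4 := D _ _ (C _ _ (C _ _ (C _ _ c1 c2) c3) c4) c5.
have -> : 2 * eta * N f = eta * N f + eta * N f by ring.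
rewrite E [leRHS]addrA; apply: le_trans m4 (lerD (le_trans m3 (lerD _ n4)) n5).
exact: le_trans m2 (lerD (le_trans m1 (lerD n1 n2)) n3).
Qed.
End WindowsLower.

(** * Summation over the residues *)

Section WindowsTotal.
Variables (R : realType) (k : scalar_kind).
Local Notation K := (scalar_field R k).
Variables (H : completeNormedModType K) (dot : {dot H for @sconj R k}).
Hypothesis Hdot : forall x : H, `|x| ^+ 2 = dot x x.
Local Notation adj := (adjoint dot).
Local Notation bessel := (bessel dot).
Implicit Types (x y : H) (f g z : H -> H).

Variables (p : R) (p_gt1 : 1 < p).
Local Notation cp := (schatten_class dot p).
Local Notation N := (cp_norm dot p).
Let p1 : 1 <= p := ltW p_gt1.
Let p0 : 0 < p. Proof. exact: lt_trans p_gt1. Qed.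
Let pn0 : p != 0. Proof. by rewrite gt_eqF. Qed.

Variables (h : nat -> H) (hb : orthobasis dot h).
Local Notation head_proj := (head_proj dot h).
Local Notation coord_proj := (coord_proj dot h).
Local Notation mN := (@mx_cp_norm R k p _).
Local Notation lp := (@lp_cpn R k p).
Local Notation LN := (@lp_cpn_norm R k p).
Let ho i j : dot (h i) (h j) = (i == j)%:R. Proof. exact: hb.1. Qed.

Variables (q beta : nat -> nat) (L : nat).
Hypothesis q0 : q 0%N = 0%N.
Hypothesis qS : forall j, (q j < q j.+1)%N.
Hypothesis betaE : forall i j, (beta i < j)%N = (i < q j)%N.
Hypothesis L0 : (0 < L)%N.
Local Notation window := (window beta L).
Local Notation window_map := (window_map dot p h q beta L).

Variables (f : H -> H) (eta : R).
Hypothesis cf : cp f.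
Hypothesis eta0 : 0 <= eta.
Hypothesis far : forall j, N (head_proj (q j) \o f \o compl (head_proj (q j.+1))) <= eta / 2 ^+ j.+1 * N f /\
  N (compl (head_proj (q j.+1)) \o f \o head_proj (q j)) <= eta / 2 ^+ j.+1 * N f.

Let blk n S S' := coord_proj n S \o f \o coord_proj n S'.
Let blk_cp n S S' : cp (blk n S S') /\ N (blk n S S') <= N f.
Proof. exact: (cp_ideal Hdot p_gt1 (coord_proj_contraction Hdot hb _ _) cf (coord_proj_contraction Hdot hb _ _)). Qed.
Let LR : 0 < L%:R :> R. Proof. by rewrite ltr0n. Qed.
Let c : R := L%:R `^ (- p^-1).
Let C : R := L%:R `^ p^-1.
Let C0 : 0 < C. Proof. exact: powR_gt0. Qed.
Let CE : C `^ p = L%:R. Proof. by rewrite /C powVK // ltW. Qed.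
Let cC : c = C^-1. Proof. by rewrite /c powRN. Qed.

Local Notation win_sum := (win_sum dot p h q beta L f).
Local Notation upper_sum := (upper_sum dot p h q beta L f).
Local Notation lower_sum := (lower_sum dot p h q beta L f).
Let nu m := (q m.+1).-1.

(** The cut at q_M may truncate the window, which does not increase the norm; the factor L undoes
    the normalisation of [window_map]. *)
Lemma window_block M m : N (blk (q M) (window m) (window m)) `^ p <=
  L%:R * mN (window_map f (nu m)) `^ p.
Proof.
have qp : (0 < q m.+1)%N by exact: leq_ltn_trans (qS m).
rewrite (window_map_norm Hdot p_gt1 hb q beta L0 _ cf) powRM ?cp_norm_ge0 ?powR_ge0 //.
rewrite -powRrM mulNr mulVf // powRN powRr1 ?(ltW LR) // mulrA divff ?gt_eqF // mul1r.
have -> : coord_proj (nu m).+1 (window_at q beta L (nu m)) = coord_proj (q m.+1) (window m).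
  by apply: coord_proj_eq => i; rewrite (window_at_last L qS betaE) /nu prednK.
apply: ler_pow; rewrite ?cp_norm_ge0 ?(ltW p0) //.
have cP := head_proj_contraction Hdot hb (q M); have cm := blk_cp (q m.+1) (window m) (window m).
have [_] := cp_ideal Hdot p_gt1 cP cm.1 cP; apply: le_trans.
rewrite le_eqVlt; apply/orP; left; apply/eqP; congr N; apply/funext => x.
have e1 y : head_proj (q M) (coord_proj (q m.+1) (window m) y) = coord_proj (q M) (window m) y.
  rewrite -(coord_proj_true dot h) (coord_proj_comp hb); congr (_ y); apply: coord_proj_eq => i /=.
  by case w: (window m i); rewrite ?andbF // (window_lt betaE w) !andbT.
have e2 y : coord_proj (q m.+1) (window m) (head_proj (q M) y) = coord_proj (q M) (window m) y.
  rewrite -(coord_proj_true dot h) (coord_proj_comp hb); congr (_ y); apply: coord_proj_eq => i /=.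
  by case w: (window m i); rewrite ?andbF // (window_lt betaE w) !andbT.
by rewrite /blk /= e1 e2.
Qed.

Lemma sum_residues (g : nat -> R) M :
  \sum_(r < L) \sum_(w < M) g (w * L + r)%N = \sum_(m < M * L) g m.
Proof.
rewrite exchange_big /=; elim: M => [|M IH]; first by rewrite !big_ord0.
by rewrite big_ord_recr /= IH mulSn addnC big_split_ord.
Qed.

Lemma win_total M : lp (window_map f) ->
  \sum_(r < L) win_sum M r <= L%:R * LN (window_map f) `^ p.
Proof.
move=> lf; pose F n := mN (window_map f n) `^ p.
have F0 n : 0 <= F n by exact: powR_ge0.
apply: (@le_trans _ _ (\sum_(r < L) \sum_(w < M) L%:R * F (nu (w * L + r)%N))).
  by apply: ler_sum => r _; apply: ler_sum => w _; exact: window_block.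
rewrite (sum_residues (fun m => L%:R * F (nu m))) -mulr_sumr ler_pM2l //.
apply: le_trans (lp_cpn_sum Hdot p_gt1 ho (q (M * L)%N) lf).
apply: (sum_inj_le (F := F) (nu := nu)) => // [m m' e|m hm].
  by rewrite -(beta_last qS betaE m) -(beta_last qS betaE m') -/(nu m) e.
have qp : (0 < q m.+1)%N by exact: leq_ltn_trans (qS m).
by rewrite /nu -ltnS prednK // ltnS; exact: cut_mono.
Qed.

(** The gain of the averaging: every j is active for one residue only, so the total over all
    residues is a single pinching, independent of L. *)
Lemma keyed_total (M n : nat) (S S' : nat -> pred nat) :
  (forall j j' i, S j i -> S j' i -> j = j') -> (forall j j' i, S' j i -> S' j' i -> j = j') ->
  \sum_(r < L) \sum_(j < M) (if (j %% L == r)%N then N (blk n (S j) (S' j)) `^ p else 0) <= N f `^ p.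
Proof.
move=> dS dS'; rewrite exchange_big /=.
have pf : pfam dot (fun j : 'I_M => coord_proj n (S j)).
  by apply: (coord_proj_pfam Hdot hb) => j j' i h1 h2; apply: val_inj; exact: dS h1 h2.
have pf' : pfam dot (fun j : 'I_M => coord_proj n (S' j)).
  by apply: (coord_proj_pfam Hdot hb) => j j' i h1 h2; apply: val_inj; exact: dS' h1 h2.
apply: le_trans (cp_pinch Hdot p_gt1 pf pf' cf); apply: ler_sum => j _.
have bL : (j %% L < L)%N by exact: ltn_pmod.
rewrite (bigD1 (Ordinal bL)) //= eqxx big1 ?addr0 // => r.
by rewrite -val_eqE /= eq_sym => /negbTE ->.
Qed.

Let blk0 n S : N (blk n (fun=> false) S) = 0 /\ N (blk n S (fun=> false)) = 0.
Proof.
have z : coord_proj n (fun=> false) = 0 by exact: coord_proj_false.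
have [lS _ _] := coord_proj_projection Hdot hb n S; have lf := (cp_bop cf).1.
have e1 : blk n (fun=> false) S = 0 by rewrite /blk z.
have e2 : blk n S (fun=> false) = 0.
  by rewrite /blk z; apply/funext => x /=; rewrite (lin0 lf) (lin0 lS).
by rewrite e1 e2 (cp0 Hdot p_gt1).2.
Qed.

Lemma upper_total M : \sum_(r < L) upper_sum M r <= N f `^ p.
Proof.
apply: le_trans (_ : \sum_(r < L) \sum_(j < M) (if (j %% L == r)%N then
    N (blk (q M) (fun i => beta i == j) (fun i => beta i == j.+1)) `^ p else 0) <= _).
  apply: ler_sum => r _; apply: ler_sum => j _; case: ifP => _.
    by under [X in coord_proj _ X]eq_fun do rewrite andbT.
  under [X in coord_proj _ X \o _ \o _]eq_fun do rewrite andbF.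
  by rewrite (blk0 _ _).1 powR0.
apply: (keyed_total M (q M) (S := fun j i => beta i == j) (S' := fun j i => beta i == j.+1)).
  by move=> j j' i /eqP <- /eqP <-.
by move=> j j' i /eqP e /eqP e'; rewrite e in e'; case: e'.
Qed.

Lemma lower_total M : \sum_(r < L) lower_sum M r <= N f `^ p.
Proof.
apply: le_trans (_ : \sum_(r < L) \sum_(j < M) (if (j %% L == r)%N then
    N (blk (q M) (fun i => beta i == j.+1) (fun i => beta i == j)) `^ p else 0) <= _).
  apply: ler_sum => r _; apply: ler_sum => j _; case: ifP => _.
    by under [X in _ \o coord_proj _ X]eq_fun do rewrite andbT.
  under [X in _ \o coord_proj _ X]eq_fun do rewrite andbF.
  by rewrite (blk0 _ _).2 powR0.
apply: (keyed_total M (q M) (S := fun j i => beta i == j.+1) (S' := fun j i => beta i == j)).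
  by move=> j j' i /eqP e /eqP e'; rewrite e in e'; case: e'.
by move=> j j' i /eqP <- /eqP <-.
Qed.

(** Minkowski's inequality in l_p over the L residues. After division by L^(1/p) the neighbour terms
    retain the factor c = L^(-1/p), while the far terms keep their size. *)
Lemma window_map_lower : lp (window_map f) ->
  N f <= LN (window_map f) + (2 * c + 2 * eta) * N f.
Proof.
move=> lf; have Lf0 : 0 <= LN (window_map f) by exact: lp_cpn_norm_ge0.
have rootp (s : R) : 0 <= s -> (s `^ p^-1) `^ p = s by move=> s0; rewrite powVK.
have cut M : N (head_proj (q M) \o f \o head_proj (q M)) <= LN (window_map f) + (2 * c + 2 * eta) * N f.
  set NP := N _; have NP0 : 0 <= NP by exact: cp_norm_ge0.
  pose d := 2 * eta * N f; have d0 : 0 <= d by rewrite !mulr_ge0 ?cp_norm_ge0.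
  have w0 (r : 'I_L) : 0 <= win_sum M r by apply: sumr_ge0 => i _; exact: powR_ge0.
  have u0 (r : 'I_L) : 0 <= upper_sum M r by apply: sumr_ge0 => i _; exact: powR_ge0.
  have l0 (r : 'I_L) : 0 <= lower_sum M r by apply: sumr_ge0 => i _; exact: powR_ge0.
  have sA : \sum_(r < L) (win_sum M r `^ p^-1) `^ p <= (C * LN (window_map f)) `^ p.
    rewrite powRM ?(ltW C0) // CE; by rewrite (eq_bigr _ (fun r _ => rootp _ (w0 r))); exact: win_total.
  have sB : \sum_(r < L) (upper_sum M r `^ p^-1) `^ p <= N f `^ p.
    by rewrite (eq_bigr _ (fun r _ => rootp _ (u0 r))); exact: upper_total.
  have sC : \sum_(r < L) (lower_sum M r `^ p^-1) `^ p <= N f `^ p.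
    by rewrite (eq_bigr _ (fun r _ => rootp _ (l0 r))); exact: lower_total.
  have sD : \sum_(r < L) d `^ p <= (C * d) `^ p.
    by rewrite powRM ?(ltW C0) // CE sumr_const card_ord mulr_natl.
  have CL0 : 0 <= C * LN (window_map f) by rewrite mulr_ge0 // ltW.
  have Cd0 : 0 <= C * d by rewrite mulr_ge0 // ltW.
  have Nf0 : 0 <= N f by exact: cp_norm_ge0.
  have s1 := sum_pow_mink p1 (fun r => powR_ge0 _ _) (fun r => powR_ge0 _ _) CL0 Nf0 sA sB.
  have s2 := sum_pow_mink p1 (fun r => addr_ge0 (powR_ge0 _ _) (powR_ge0 _ _)) (fun r => powR_ge0 _ _)
    (addr_ge0 CL0 Nf0) Nf0 s1 sC.
  have s3 := sum_pow_mink p1 (fun r => addr_ge0 (addr_ge0 (powR_ge0 _ _) (powR_ge0 _ _)) (powR_ge0 _ _))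
    (fun r => d0) (addr_ge0 (addr_ge0 CL0 Nf0) Nf0) Cd0 s2 sD.
  have fin : C * NP <= C * LN (window_map f) + N f + N f + C * d.
    rewrite -(pow_le p0) ?addr_ge0 ?(mulr_ge0 (ltW C0)) //.
    apply: le_trans s3; rewrite powRM ?(ltW C0) // CE mulr_natl -[L in leLHS]card_ord -sumr_const.
    apply: ler_sum => r _; apply: ler_pow; rewrite ?(ltW p0) //.
    exact: (residue_bound Hdot p_gt1 hb betaE cf eta0 far M (ltn_ord r)).
  rewrite -(ler_pM2l C0); apply: le_trans fin _; rewrite cC /d le_eqVlt; apply/orP; left; apply/eqP.
  by field; rewrite gt_eqF.
have n0 := null_sub (cut_ge qS) (cp_cut_null Hdot p_gt1 hb cf).
apply: (le_null_lim n0) => M /=.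
have cc := (cp_ideal Hdot p_gt1 (head_proj_contraction Hdot hb (q M)) cf (head_proj_contraction Hdot hb (q M))).1.
by apply: le_trans (cp_norm_sub Hdot p_gt1 cf cc) _; rewrite lerD2r.
Qed.
End WindowsTotal.

(** * Completeness of X, choice of parameters and the image of X *)

Section Embedding.
Variables (R : realType) (k : scalar_kind).
Local Notation K := (scalar_field R k).
Variables (H : completeNormedModType K) (dot : {dot H for @sconj R k}).
Hypothesis Hdot : forall x : H, `|x| ^+ 2 = dot x x.
Local Notation adj := (adjoint dot).
Local Notation bessel := (bessel dot).
Implicit Types (f g : H -> H).

Variables (p : R) (p_gt1 : 1 < p).
Local Notation cp := (schatten_class dot p).
Local Notation N := (cp_norm dot p).
Let p1 : 1 <= p := ltW p_gt1.
Let p0 : 0 < p. Proof. exact: lt_trans p_gt1. Qed.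
Let pn0 : p != 0. Proof. by rewrite gt_eqF. Qed.

Variables (h : nat -> H) (hb : orthobasis dot h).
Local Notation lp := (@lp_cpn R k p).
Local Notation LN := (@lp_cpn_norm R k p).
Let ho i j : dot (h i) (h j) = (i == j)%:R. Proof. exact: hb.1. Qed.

Lemma window_map_linear q beta L (a : K) f g : window_map dot p h q beta L (a *: f + g) =
  a *: window_map dot p h q beta L f + window_map dot p h q beta L g.
Proof.
apply: functional_extensionality_dep => n; apply/matrixP => i j.
set T := window_map _ _ _ _ _ _.
transitivity ((a *: T f n + T g n) i j) => //; rewrite !mxE.
rewrite -[(a *: f + g) _]/(a *: f (h j) + g (h j)) ipDl ipZl.
by case: (_ && _); rewrite ?mulr0n ?mulr0 ?addr0 // !mulr1n mulrDr mulrCA.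
Qed.

Variable X : set (H -> H).
Hypothesis Xc : closed_subspace cp N X.
Hypothesis Xtau : tau_compact dot (closed_unit_ball N X).
Let Xcp : X `<=` cp. Proof. by have [] := Xc. Qed.
Let X0 : X 0. Proof. by have [] := Xc. Qed.
Let Xl (a : K) f g : X f -> X g -> X (a *: f + g).
Proof. by have [_ _ Xl _] := Xc; exact: Xl. Qed.
Let XB f g : X f -> X g -> X (f - g).
Proof. by move=> Xf Xg; have := Xl (-1) Xg Xf; rewrite scaleN1r addrC. Qed.

(** The limit is produced by compactness of the unit ball: a cluster point of the rescaled sequence
    is a norm limit, because the variational bound of differences passes to weak limits. *)
Lemma tau_complete (x_ : nat -> H -> H) : (forall n, X (x_ n)) ->
  (forall e : R, 0 < e -> exists n0, forall n m, (n0 <= n)%N -> (n0 <= m)%N -> N (x_ n - x_ m) <= e) ->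
  exists2 f, X f & null (fun n => N (x_ n - f)).
Proof.
move=> Xx hC; have [n0 hn0] := hC 1 ltr01.
pose B := N (x_ n0) + 1; have B0 : 0 < B by rewrite ltr_wpDl ?cp_norm_ge0.
pose b := sinj k B^-1; have sb : smod b = B^-1 by rewrite smod_sinj ger0_norm // invr_ge0 ltW.
pose y_ n := b *: x_ (n + n0)%N.
have By n : closed_unit_ball N X (y_ n).
  split; first by have := Xl b (Xx (n + n0)%N) X0; rewrite addr0.
  rewrite (cp_normZ Hdot p_gt1 _ (Xcp (Xx _))) sb ler_pdivrMl // mulr1.
  apply: le_trans (cp_norm_sub Hdot p_gt1 (Xcp (Xx _)) (Xcp (Xx n0))) _.
  by rewrite lerD2l; apply: hn0; rewrite ?leq_addl.
have [g [Xg _] hg] := tau_cluster Xtau By.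
pose f := sinj k B *: g; have Xf : X f by have := Xl (sinj k B) Xg X0; rewrite addr0.
exists f => // e e0; have [n1 hn1] := hC e e0; exists n1 => n hn; rewrite ger0_norm ?cp_norm_ge0 //.
apply: (cp_norm_le Hdot p_gt1 (Xcp (XB (Xx n) Xf)) (ltW e0)).
apply: (Qle_approx p1 (ltW e0)) => I u v d d0.
have D0 : 0 < B * (\sum_i nm (v i) + 1) by rewrite mulr_gt0 // ltr_wpDl // sumr_ge0.
have [m mn hm] := hg I u _ n1 (divr_gt0 d0 D0).
have n1m : (n1 <= m + n0)%N by apply: leq_trans mn (leq_addr _ _).
exists (x_ n - x_ (m + n0)%N).
  move=> J u' v' bu bv; apply: le_trans (cp_Qle Hdot p_gt1 (Xcp (XB (Xx n) (Xx _))) bu bv) _.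
  by apply: ler_pow; rewrite ?cp_norm_ge0 ?(ltW p0) //; exact: hn1.
move=> i.
have xE : x_ (m + n0)%N (u i) = sinj k B *: y_ m (u i).
  by rewrite /y_ -[(b *: _) _]/(b *: x_ (m + n0)%N (u i)) scalerA -rmorphM divff ?gt_eqF // rmorph1 scale1r.
rewrite -ipBl -[(x_ n - x_ _) _]/(x_ n (u i) - x_ (m + n0)%N (u i)) -[(x_ n - f) _]/(x_ n (u i) - f (u i)).
rewrite opprB addrC subrKA xE -scalerBr ipZl smodM smod_sinj gtr0_norm //.
rewrite -ler_pdivlMl //; apply: le_trans (cauchy_schwarz Hdot _ _) _.
rewrite nm_distC; apply: le_trans (ler_wpM2r (nm_ge0 _) (hm i).1) _.
have S0 : 0 < \sum_i nm (v i) + 1 by rewrite ltr_wpDl // sumr_ge0.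
rewrite invfM mulrA [d / B]mulrC mulrAC ler_pdivrMr // ler_wpM2l ?mulr_ge0 ?invr_ge0 ?(ltW d0) ?(ltW B0) //.
by rewrite (bigD1 i) //= -addrA lerDl addr_ge0 // sumr_ge0.
Qed.

Lemma window_embedding (d : R) : 0 < d -> d < 1 -> exists T : (H -> H) -> mx_seq R k,
  (forall a f g, T (a *: f + g) = a *: T f + T g) /\
  (forall f, X f -> [/\ lp (T f), LN (T f) <= N f & (1 - d) * N f <= LN (T f)]).
Proof.
move=> d0 d1; have d4 : 0 < d / 4 by rewrite divr_gt0.
have [q [q0 qS hq]] := cuts_exist Hdot p_gt1 hb Xc Xtau d4.
have [beta betaE] := block_exists q0 qS.
(* Makes L^(-1/p) at most d / 4; with cuts of precision d / 4 the relative loss 2 c + 2 (d / 4) is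
   at most d. *)
pose L := (Num.truncn ((4 / d) `^ p)).+1.
have L0 : (0 < L)%N by [].
exists (window_map dot p h q beta L); split=> [a f g|f Xf]; first exact: window_map_linear.
have cf := Xcp Xf.
have [lT LT] := lp_cpn_le Hdot p_gt1 ho (cp_norm_ge0 dot p f)
  (window_map_upper Hdot p_gt1 hb q0 betaE L0 cf).
split=> //; have := window_map_lower Hdot p_gt1 hb qS betaE L0 cf (ltW d4) (fun j => hq j f Xf) lT.
have cd : L%:R `^ (- p^-1) <= d / 4.
  rewrite powRN -[d / 4]invrK lef_pV2 ?posrE ?invr_gt0 ?powR_gt0 ?ltr0n //.
  have v0 : 0 <= (d / 4)^-1 by rewrite invr_ge0 ltW.
  rewrite -(powK pn0 v0); apply: ler_pow; rewrite ?invr_ge0 ?(ltW p0) ?powR_ge0 //.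
  by rewrite invf_div; exact: ltW (truncnS_gt _).
have Nf := cp_norm_ge0 dot p f; move: (L%:R `^ _) cd => c cd h1.
have h2 : (2 * c + 2 * (d / 4)) * N f <= d * N f by rewrite ler_wpM2r //; lra.
rewrite mulrBl mul1r; move: h1 h2; move: ((2 * c + 2 * (d / 4)) * N f) (d * N f) => A B *; lra.
Qed.

Lemma tau_compact_iso (eps : R) : 0 < eps -> exists2 X0 : set (mx_seq R k),
  closed_subspace lp LN X0 & (banach_mazur N LN X X0 < (1 + eps)%:E)%E.
Proof.
move=> eps0; have e1 : 0 < 1 + eps by rewrite addr_gt0.
(* Chosen so that (1 - d) (1 + eps) = 1 + eps / 2, which gives the strict inequality for the
   distance. *)
pose d := eps / (2 * (1 + eps)).
have d0 : 0 < d by rewrite divr_gt0 // mulr_gt0.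
have dE : (1 - d) * (1 + eps) = 1 + eps / 2 by rewrite /d; field; rewrite gt_eqF.
have d1 : d < 1 by rewrite ltr_pdivrMr ?mulr_gt0 // mul1r; lra.
have d1' : 0 < 1 - d by rewrite subr_gt0.
have [T [lT hT]] := window_embedding d0 d1.
have L00 y : 0 <= LN y by exact: lp_cpn_norm_ge0.
have [lp0 LN0] := lp_cpn0 Hdot p_gt1 ho.
have T0 : T 0 = 0 by have := lin0 lT.
have TB f g : T (f - g) = T f - T g.
  by have := lT (-1) g f; rewrite !scaleN1r addrC [RHS]addrC.
have lpB a b : lp a -> lp b -> lp (a - b) /\ LN (a - b) <= LN a + LN b.
  move=> la lb; have := lp_cpn_comb Hdot p_gt1 ho (-1) lb la.
  by rewrite scaleN1r smodN smod1 mul1r addrC [LN b + _]addrC.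
have inj f g : X f -> X g -> T f = T g -> f = g.
  move=> Xf Xg e; have [_ _] := hT _ (XB Xf Xg); rewrite TB e subrr LN0 pmulr_rle0 // => n0.
  apply/eqP; rewrite -subr_eq0; apply/eqP/(cp_norm_eq0 Hdot p_gt1 (Xcp (XB Xf Xg))).
  by apply/eqP; rewrite eq_le n0 cp_norm_ge0.
pose S y := xget 0 [set f | X f /\ T f = y].
have hS y : [set T f | f in X] y -> X (S y) /\ T (S y) = y.
  by move=> [f Xf <-]; exact: (@xgetPex _ 0 [set g | X g /\ T g = T f] (ex_intro _ f (conj Xf erefl))).
have Nge f : X f -> N f <= (1 - d)^-1 * LN (T f).
  by move=> Xf; rewrite ler_pdivlMl //; have [] := hT _ Xf.
have X00 : [set T f | f in X] 0 by exists 0.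
have Xc' : closed_subspace lp LN [set T f | f in X].
  split=> [_ [f Xf <-]|//|a _ _ [f Xf <-] [g Xg <-]|u y Xu lpy].
  - by have [] := hT _ Xf.
  - by exists (a *: f + g); [exact: Xl|rewrite lT].
  move=> /null_cvg cu.
  have lu n : lp (u n) by have [f Xf <-] := Xu n; have [] := hT _ Xf.
  (* The image is closed: by the lower estimate the preimages of a convergent sequence are Cauchy,
     hence converge in X. *)
  have [f Xf fl] : exists2 f, X f & null (fun n => N (S (u n) - f)).
    apply: (tau_complete (x_ := fun n => S (u n))) => [n|e e0]; first exact: (hS _ (Xu n)).1.
    have [n0 hn0] := cu ((1 - d) * (e / 2)) ltac:(by rewrite mulr_gt0 // divr_gt0).
    exists n0 => n m /hn0 hn /hn0 hm; rewrite !ger0_norm // in hn hm.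
    have [Xn En] := hS _ (Xu n); have [Xm Em] := hS _ (Xu m).
    apply: le_trans (Nge _ (XB Xn Xm)) _; rewrite ler_pdivrMl // TB En Em.
    have -> : u n - u m = (u n - y) - (u m - y) by rewrite opprB addrA subrK.
    have [l1 _] := lpB _ _ (lu n) lpy; have [l2 _] := lpB _ _ (lu m) lpy.
    by apply: le_trans (lpB _ _ l1 l2).2 _; apply: le_trans (lerD hn hm) _; rewrite -mulrDr -splitr.
  exists f => //.
  have lf : lp (T f) by have [] := hT _ Xf.
  apply/eqP; rewrite -subr_eq0; apply/eqP/(lp_cpn_eq0 Hdot p_gt1 ho (lpB _ _ lf lpy).1).
  apply: null_const; apply: null_squeeze (nullD fl cu) => n; rewrite ger0_norm //.
  have [Xn En] := hS _ (Xu n).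
  have -> : T f - y = (u n - y) - T (S (u n) - f) by rewrite TB En opprB [RHS]addrC addrA subrK.
  have [l1 _] := lpB _ _ (lu n) lpy; have [l2 h2 _] := hT _ (XB Xn Xf).
  by apply: le_trans (lpB _ _ l1 l2).2 _; rewrite addrC lerD2r.
exists [set T f | f in X] => //.
have lTX : linear_on X T by move=> a f g _ _; exact: lT.
have lSX : linear_on [set T f | f in X] S.
  move=> a y z Xy Xz; have [Xy' Ey] := hS _ Xy; have [Xz' Ez] := hS _ Xz.
  have Xyz : [set T f | f in X] (a *: y + z) by have [_ _ hl _] := Xc'; exact: hl.
  have [Xs Es] := hS _ Xyz.
  by apply: inj => //; [exact: Xl|rewrite Es lT Ey Ez].
have nT : (operator_norm N LN X T <= 1%:E)%E.
  by apply: opnorm_le => // f Xf; rewrite mul1r; have [] := hT _ Xf.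
have nS : (operator_norm LN N [set T f | f in X] S <= ((1 - d)^-1)%:E)%E.
  apply: opnorm_le; last by rewrite invr_ge0 ltW.
  by move=> y Xy; have [Xs Es] := hS _ Xy; have := Nge _ Xs; rewrite Es.
have fT : (operator_norm N LN X T < +oo)%E by apply: le_lt_trans nT _; exact: ltry.
have fS : (operator_norm LN N [set T f | f in X] S < +oo)%E by apply: le_lt_trans nS _; exact: ltry.
have NZ (a : K) f : X f -> N (a *: f) = smod a * N f by move=> /Xcp; exact: cp_normZ.
have LZ (a : K) y : [set T f | f in X] y -> LN (a *: y) = smod a * LN y.
  by move=> [f Xf <-]; have [l1 _ _] := hT _ Xf; exact: (lp_cpn_normZ Hdot p_gt1 ho).
have [al al0 aE] := opnorm_fin L00 X0 NZ lTX fT.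
have [be be0 bE] := opnorm_fin (fun f => cp_norm_ge0 dot p f) X00 LZ lSX fS.
apply: (@le_lt_trans _ _ (al * be)%:E).
  apply: ereal_inf_lbound; exists T, S; split; last by rewrite aE bE EFinM.
  split; [by split|split|split|by split].
  - by move=> f Xf; exists f.
  - by move=> y /hS[].
  - by move=> f Xf; have [Xs Es] := hS (T f) (ex_intro2 _ _ f Xf erefl); exact: inj.
  - by move=> y /hS[].
rewrite lte_fin; rewrite aE lee_fin in nT; rewrite bE lee_fin in nS.
apply: (@le_lt_trans _ _ (1 - d)^-1).
  by apply: le_trans (ler_wpM2r be0 nT) _; rewrite mul1r.
rewrite -[X in X < _]mul1r ltr_pdivrMr // mulrC dE ltrDl divr_gt0 //.
Qed.
End Embedding.

Theorem theorem6p2 (R : realType) (k : scalar_kind)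
    (H : completeNormedModType (scalar_field R k))
    (dot : {dot H for @sconj R k})
    (Hdot : forall x : H, `|x| ^+ 2 = dot x x)
    (Hsep : exists2 D : set H, countable D & dense D)
    (Hinf : infinite_dimensional [set: H])
    (p : R) (p_gt1 : 1 < p) (p_neq2 : p <> 2)
    (X : set (H -> H))
    (Xsub : closed_subspace (schatten_class dot p) (cp_norm dot p) X)
    (Xinf : infinite_dimensional X) :
  (tau_compact dot (closed_unit_ball (cp_norm dot p) X) <->
   property_mp p (cp_norm dot p) X) /\
  (property_mp p (cp_norm dot p) X <->
   forall eps : R, 0 < eps ->
     exists2 X0 : set (mx_seq R k),
       closed_subspace (lp_cpn p) (lp_cpn_norm p) X0 &
       (banach_mazur (cp_norm dot p) (lp_cpn_norm p) X X0
          < (1 + eps)%:E)%E).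
Proof.
have [h hb] := basis_exists Hdot Hsep Hinf.
have Xcp : X `<=` schatten_class dot p by have [] := Xsub.
have N0 f : 0 <= cp_norm dot p f by exact: cp_norm_ge0.
have ND f g : X f -> X g -> cp_norm dot p (f + g) <= cp_norm dot p f + cp_norm dot p g.
  by move=> /Xcp cf /Xcp cg; exact: cp_normD.
have NB f g : X f -> X g -> cp_norm dot p g <= cp_norm dot p (f + g) + cp_norm dot p f.
  move=> /Xcp cf /Xcp cg; have := cp_norm_sub Hdot p_gt1 cg (cpD Hdot p_gt1 cf cg).
  by rewrite opprD addrCA subrr addr0 (cp_normN Hdot).
have mp_iso_asym := @iso_asym_mp R k H dot Hdot p p_gt1 h hb.1 X Xsub.
have to_mp := asym_mp_property p_gt1 N0 NB.
have of_mp := mp_asym p_gt1 N0 ND.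
have to_tau am := mp_tau_compact Hdot p_gt1 p_neq2 hb Xsub am.
have to_iso tc := tau_compact_iso Hdot p_gt1 hb Xsub tc.
split; split=> [tc|mp].
- by apply: to_mp; apply: mp_iso_asym; exact: to_iso.
- exact: to_tau (of_mp mp).
- exact: to_iso (to_tau (of_mp tc)).
- exact: to_mp (mp_iso_asym mp).
Qed.
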